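(* Let $Z_1,\dots,Z_H$ be the independent integrated Brownian motion processes (with parameters $N_1\in\mathbb N$ and $N_2,\dots,N_H\in\mathbb N^*$) defined in the context, let $K_2,\dots,K_H>0$ be the bounds on the derivatives, and let $Z_{c,1},\dots,Z_{c,H}$ be the corresponding constrained processes. Let $\beta>0$ be fixed with $\beta\le N_1+1/2$ and $\beta\le N_h$ for $h=2,\dots,H$. (1) Density estimation. Let $p_0$ be a strictly positive probability density on $[-1,1]$ that belongs to $\mathcal F^\beta([-1,1],\mathbb R)$, and let $X_1,\dots,X_n$ be i.i.d. with density $p_0$. Then the fixed constants $K_2,\dots,K_H$ can be chosen large enough so that, for some constant $C_{\sup}$ that does not depend on $n$ and with $\varepsilon_{c,n}=C_{\sup}\,n^{-\beta/(2N_1+2)}$, the posterior distribution for the prior $p_{Z_{c,H}\circ\cdots\circ Z_{c,1}}$ satisfies $$\mathbb P\left(h(p_{Z_{c,H}\circ\cdots\circ Z_{c,1}},p_0)>M_n\varepsilon_{c,n}\,\middle|\,X_1,\dots,X_n\right)\to0$$ in probability as $n\to\infty$, for any sequence $M_n\to\infty$. (2) Classification. Let $\Psi:\mathbb R\to(0,1)$ have a bounded derivative with $\Psi'/(\Psi(1-\Psi))$ bounded on $\mathbb R$, and write $f_z=\Psi\circ z$. Let $(U_1,V_1),\dots,(U_n,V_n)$ be i.i.d. copies of $(U,V)$ with $U\in[-1,1]$, $V\in\{0,1\}$, $\mathbb P(V=1\mid U)=f_0(U)$, where $f_0=f_{g_0}$ with $g_0\in\mathcal F^\beta([-1,1],\mathbb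 R)$. Then the fixed constants $K_2,\dots,K_H$ can be chosen large enough so that, for some constant $C_{\sup}$ that does not depend on $n$ and with $\varepsilon_{c,n}=C_{\sup}\,n^{-\beta/(2N_1+2)}$, the posterior distribution for the prior $f_{Z_{c,H}\circ\cdots\circ Z_{c,1}}$ satisfies $$\mathbb P\left(\|f_{Z_{c,H}\circ\cdots\circ Z_{c,1}}-f_0\|_{2,U}>M_n\varepsilon_{c,n}\,\middle|\,(U_1,V_1),\dots,(U_n,V_n)\right)\to0$$ in probability as $n\to\infty$, for any sequence $M_n\to\infty$, where $\|\cdot\|_{2,U}$ is the $L^2$ norm with respect to the law of $U$.
   Context: $H\ge2$ is a fixed integer; $\mathbb N$ includes $0$ and $\mathbb N^*=\mathbb N\setminus\{0\}$. $\|\cdot\|_\infty$ is the sup norm on $[-1,1]$. Hölder space: for $x\in\mathbb R$, $\lfloor x\rfloor$ denotes the largest integer strictly smaller than $x$. For $\beta>0$, $\mathcal F^\beta([-1,1],\mathbb R)$ is the set of functions $[-1,1]\to\mathbb R$ that have derivatives up to order $\lfloor\beta\rfloor$ and whose derivative of order $\lfloor\beta\rfloor$ is $(\beta-\lfloor\beta\rfloor)$-Hölder. Processes: for continuous $g:[0,\infty)\to\mathbb R$, $I^0g=g$ and $(I^\ell g)(t)=\int_0^t(I^{\ell-1}g)(s)ds$ for $\ell\in\mathbb N^*$. For $h=1,\dots,H$ and $t\ge-1$, $$Z_h(t)=(I^{N_h}B_h)(t+1)+\sum_{\ell=0}^{N_h}X_{h,\ell}\frac{(t+1)^\ell}{\ell!},$$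 where $B_h$ is a standard Brownian motion on $[0,\infty)$ and $X_{h,0},\dots,X_{h,N_h}$ are independent standard Gaussian variables independent of $B_h$; $Z_1,\dots,Z_H$ are independent. (Only the restrictions to $[-1,1]$ matter.) $Z_h$ is continuously differentiable for $h\ge2$. Constrained processes: $Z_{c,1},\dots,Z_{c,H}$ are independent processes on $[-1,1]$; the law of $Z_{c,1}$ is that of $Z_1$ conditioned on $\|Z_1\|_\infty\le1$; for $2\le h\le H-1$ the law of $Z_{c,h}$ is that of $Z_h$ conditioned on $\|Z_h\|_\infty\le1$ and $\|Z_h'\|_\infty\le K_h$; the law of $Z_{c,H}$ is that of $Z_H$ conditioned on $\|Z_H'\|_\infty\le K_H$. Densities: $p_z(t)=e^{z(t)}/\int_{-1}^1e^{z(s)}ds$ for continuous $z:[-1,1]\to\mathbb R$. Hellinger distance: $h(f,g)=(\int_{-1}^1(\sqrt{f(t)}-\sqrt{g(t)})^2dt)^{1/2}$. Posteriors are given by Bayes' rule: with $\Pi$ the law of the random density (resp. random function $f$), the posterior mass of a set $A$ is $\int_AL_n\,d\Pi/\int L_n\,d\Pi$ with likelihood $L_n(p)=\prod_{k=1}^np(X_k)$ (resp. $L_n(f)=\prod_{k=1}^nf(U_k)^{V_k}(1-f(U_k))^{1-V_k}$). *)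

(* Defs.v *)
From HB Require Import structures.
From mathcomp Require Import all_boot all_order all_algebra finmap.
From mathcomp Require Import all_classical all_reals all_analysis.

Set Implicit Arguments.
Unset Strict Implicit.
Unset Printing Implicit Defensive.

Import Order.TTheory GRing.Theory Num.Theory.
Import numFieldNormedType.Exports.

Local Open Scope classical_set_scope.
Local Open Scope ring_scope.

Section analysis.
Context {R : realType}.
Implicit Types (f g z : R -> R) (t beta : R).

Definition unit_ball : set R := `[-1, 1].

Definition sup_norm f : \bar R :=
  ereal_sup [set `|f t|%:E | t in unit_ball].

(* Functions on [-1, 1] are represented by total functions on R of which only
   the values on [-1, 1] are used, so difference quotients are restricted to
   [-1, 1] and derivatives at the endpoints are one-sided. *)
Definition diff_quot f t : R -> R := fun s => (f s - f t) / (s - t).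

Definition has_deriv f :=
  forall t, unit_ball t -> cvg (diff_quot f t @ within unit_ball t^').

Definition deriv_on f : R -> R :=
  fun t => lim (diff_quot f t @ within unit_ball t^').

Definition hoelder_on (a : R) f := exists L : R,
  forall s t, unit_ball s -> unit_ball t -> `|f s - f t| <= L * `|s - t| `^ a.

(* k is the largest integer strictly smaller than beta, so that the Hoelder
   exponent beta - k lies in ]0, 1]. *)
Definition hoelder_space beta f := exists k : nat,
  [/\ k%:R < beta, beta <= k.+1%:R,
      forall j, (j < k)%N -> has_deriv (iter j deriv_on f) &
      hoelder_on (beta - k%:R) (iter k deriv_on f)].

Fixpoint iter_int (l : nat) g : R -> R :=
  if l is l'.+1 then fun t => \int[lebesgue_measure]_(s in `[0, t]) iter_int l' g s
  else g.

(* One path, for t >= -1, of the N-fold integrated Brownian motion released at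
   -1, given the Brownian path b and the values x of the Gaussian variables. *)
Definition ibm_path (N : nat) (b : R -> R) (x : nat -> R) : R -> R :=
  fun t => iter_int N b (t + 1) + \sum_(l < N.+1) x l * ((t + 1) ^+ l / l`!%:R).

(* compose z n = z n \o ... \o z 1 *)
Fixpoint compose (z : nat -> R -> R) (n : nat) : R -> R :=
  if n is m.+1 then z m.+1 \o compose z m else id.

Definition exp_density z : R -> R :=
  fun t => expR (z t) / \int[lebesgue_measure]_(s in unit_ball) expR (z s).

Definition hellinger f g : R :=
  Num.sqrt (\int[lebesgue_measure]_(t in unit_ball)
    (Num.sqrt (f t) - Num.sqrt (g t)) ^+ 2).

Definition positive_density f :=
  (forall t, unit_ball t -> 0 < f t) /\
  (\int[lebesgue_measure]_(t in unit_ball) (f t)%:E = 1)%E.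

Definition link_function (Psi : R -> R) :=
  [/\ forall x, 0 < Psi x < 1,
      forall x, derivable Psi x 1,
      exists c : R, forall x, `|Psi^`()%classic x| <= c &
      exists c : R, forall x, `|Psi^`()%classic x / (Psi x * (1 - Psi x))| <= c].

Definition likelihood_density f (n : nat) (x : nat -> R) : R :=
  \prod_(k < n) f (x k).

Definition likelihood_classif f (n : nat) (u : nat -> R) (v : nat -> bool) : R :=
  \prod_(k < n) (f (u k) ^+ v k * (1 - f (u k)) ^+ (~~ v k)).

(* The sigma-algebra on functions R -> R generated by the evaluations at the
   points of S. *)
Definition cylinder (S : set R) : set (set (R -> R)) :=
  <<s \bigcup_(t in S) preimage_set_system setT (fun z : R -> R => z t) measurable >>.

Definition constraint (H : nat) (K : nat -> R) (h : nat) : set (R -> R) :=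
  if h == 1%N then [set z | (sup_norm z <= 1)%E]
  else if (h < H)%N
  then [set z | (sup_norm z <= 1)%E /\ (sup_norm (deriv_on z) <= (K h)%:E)%E]
  else [set z | (sup_norm (deriv_on z) <= (K h)%:E)%E].

End analysis.

Section probability.
Context {R : realType} {d : measure_display} {T : measurableType d}.
Variable P : probability T R.

(* Mutual independence of the sigma-algebras F i for i in D. *)
Definition independent (I : choiceType) (D : set I) (F : I -> set (set T)) :=
  forall J : {fset I}, [set` J] `<=` D ->
  forall A : I -> set T, (forall i, i \in J -> F i (A i)) ->
  P (\bigcap_(i in [set` J]) A i) = (\prod_(i <- J) P (A i))%E.

Definition independent2 (F G : set (set T)) :=
  forall A B, F A -> G B -> P (A `&` B) = (P A * P B)%E.

Definition sigma_of d' (U : measurableType d') (X : T -> U) : set (set T) :=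
  preimage_set_system setT X measurable.

Definition sigma_path (S : set R) (Z : T -> R -> R) : set (set T) :=
  preimage_set_system setT Z (cylinder S).

Definition has_law d' (U : measurableType d') (X : T -> U)
    (nu : set U -> \bar R) :=
  measurable_fun setT X /\ forall A, measurable A -> P (X @^-1` A) = nu A.

Definition brownian (B : T -> R -> R) :=
  [/\ forall t, 0 <= t -> measurable_fun setT (B ^~ t),
      forall w, {within `[0, +oo[, continuous (B w)},
      {ae P, forall w, B w 0 = 0},
      forall s t, 0 <= s < t ->
        has_law (U := R) (fun w => B w t - B w s) (normal_prob 0 (Num.sqrt (t - s))) &
      forall (n : nat) (t : nat -> R), 0 <= t 0%N ->
        (forall i, (i < n)%N -> t i < t i.+1) ->
        independent [set i | (i < n)%N]
          (fun i => sigma_of (fun w => B w (t i.+1) - B w (t i)))].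

Definition ibm (N : nat -> nat) (B : nat -> T -> R -> R) (G : nat -> nat -> T -> R)
    (h : nat) : T -> R -> R :=
  fun w => ibm_path (N h) (B h w) (fun l => G h l w).

Definition ibm_family (H : nat) (N : nat -> nat) (B : nat -> T -> R -> R)
    (G : nat -> nat -> T -> R) :=
  (forall h, (1 <= h <= H)%N ->
    [/\ brownian (B h),
        forall l, (l <= N h)%N -> has_law (U := R) (G h l) (normal_prob 0 1),
        independent [set l | (l <= N h)%N] (fun l => sigma_of (G h l)) &
        independent2
          <<s \bigcup_(l in [set l | (l <= N h)%N]) sigma_of (G h l) >>
          (sigma_path `[0, +oo[ (B h))]) /\
  independent [set h | (1 <= h <= H)%N]
    (fun h => sigma_path `[-1, +oo[ (ibm N B G h)).

(* The posterior mass of A when the random parameter is carried by (T, P) and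
   has likelihood L : integrals with respect to the law of the parameter are
   written as integrals over T. *)
Definition posterior (L : T -> R) (A : set T) : R :=
  (\int[P]_(w in A) L w) / (\int[P]_w L w).

Definition cvg_in_probability (Y : nat -> T -> R) (l : R) :=
  forall delta : R, 0 < delta ->
  P [set w | delta < `|Y n w - l|] @[n --> \oo] --> 0%E.

Definition iid_density (p : R -> R) (X : nat -> T -> R) :=
  [/\ forall k w, unit_ball (X k w),
      forall k, has_law (U := R) (X k)
        (fun A => (\int[lebesgue_measure]_(t in A `&` unit_ball) (p t)%:E)%E) &
      independent setT (fun k => sigma_of (X k))].

(* (U, V) is a pair with P(V = 1 | U) = f(U), i.e. f(U) is a version of the
   conditional probability, and the (Us k, Vs k) are i.i.d. copies of (U, V). *)
Definition iid_classif (f : R -> R) (U : T -> R) (V : T -> bool)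
    (Us : nat -> T -> R) (Vs : nat -> T -> bool) :=
  [/\ (forall w, unit_ball (U w)) /\ forall k w, unit_ball (Us k w),
      measurable_fun setT U /\ measurable_fun setT V,
      forall A : set R, measurable A ->
        P (U @^-1` A `&` [set w | V w]) = (\int[P]_(w in U @^-1` A) (f (U w))%:E)%E,
      forall k, has_law (fun w => (Us k w, Vs k w))
        (fun A => P ((fun w => (U w, V w)) @^-1` A)) &
      independent setT (fun k => sigma_of (fun w => (Us k w, Vs k w)))].

Definition norm2 (U : T -> R) (g : R -> R) : R :=
  Num.sqrt (\int[P]_w (g (U w)) ^+ 2).

End probability.

(* Z_c has, on the probability space (S, Q), the joint law of independent
   processes on [-1, 1] distributed as the Z h conditioned on the constraints.
   Laws on paths are compared on the cylinder sigma-algebra.  The paths Z_c h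
   with h < H are required to map [-1, 1] to itself surely, and not only
   Q-almost surely, for the composition to make sense everywhere. *)
Definition constrained_family {R : realType} (H : nat) (K : nat -> R)
    {d : measure_display} {T : measurableType d} (P : probability T R)
    (Z : nat -> T -> R -> R)
    {e : measure_display} {S : measurableType e} (Q : probability S R)
    (Zc : nat -> S -> R -> R) :=
  [/\ forall h, (1 <= h <= H)%N ->
        (forall t, unit_ball t -> measurable_fun setT (Zc h ^~ t)) /\
        (forall w, {within unit_ball, continuous (Zc h w)}),
      forall h, (1 <= h < H)%N ->
        forall w t, unit_ball t -> unit_ball (Zc h w t),
      independent Q [set h | (1 <= h <= H)%N]
        (fun h => sigma_path unit_ball (Zc h)) &
      forall h, (1 <= h <= H)%N -> forall A, cylinder unit_ball A ->
        Q (Zc h @^-1` A) =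
          (fine (P (Z h @^-1` (A `&` constraint H K h))) /
           fine (P (Z h @^-1` constraint H K h)))%:E].

Definition rate {R : realType} (C beta : R) (N1 n : nat) : R :=
  C * n%:R `^ (- (beta / (2 * N1%:R + 2))).

(* Main.v *)
(* Contraction follows from three facts at the scale eps = m^-beta with m of order
   n^(1/(2 N_1 + 2)), where n eps^2 is of order A = m^(2 N_1 + 2 - 2 beta) >= m: the prior gives mass
   at least e^(-cA) to an eps-neighbourhood of the truth, all but a set of prior mass e^(-c'A) is
   covered by e^(c''A) cells of diameter O(eps), and the likelihood ratios are stable under uniform
   perturbation of the path.  Cells far from the truth are eliminated by the square roots of their
   likelihood ratios, which decay like e^(-n h^2 / 4) at Hellinger distance h.

   No Gaussian process theory is used for the first two facts.  For the prior mass, let e be the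
   difference between an N-fold integrated Brownian motion and a smooth target: y = (1 + del D)^N e,
   with del = 1/m, is driven by the Brownian motion itself, and forcing the sign of each of O(A)
   consecutive Brownian increments to be opposite to that of y costs a constant factor per step and
   keeps y, hence e, of the right size.  For the cover, [0, 2] is cut into 2m cells, the i-th one
   into q_i subintervals on which the Brownian motion oscillates at most like sqrt del; since the
   numbers q_i have independent exponential tails, their sum is O(A) outside a set of probability
   e^(-c'A), and on each subinterval finitely many boxes for the derivatives suffice.

   Composition is handled by the Lipschitz bounds K_h.  The truth is itself a composition of smooth
   functions that stay away from the constraints: the first layer is an affine image of p_0 (or g_0),
   smoothed at scale del by gluing its Taylor polynomials, the middle layers are contractions
   x -> kappa x, and the last layer undoes the scaling and, for densities, takes the logarithm. *)
Require Import Defs.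
From HB Require Import structures.
From mathcomp Require Import all_boot all_order all_algebra finmap.
From mathcomp Require Import all_classical all_reals all_analysis.
From mathcomp Require Import measurable_realfun ring lra zify.

Set Implicit Arguments.
Unset Strict Implicit.
Unset Printing Implicit Defensive.

Import Order.TTheory GRing.Theory Num.Theory.
Import numFieldNormedType.Exports.

Local Open Scope classical_set_scope.
Local Open Scope ring_scope.

(** * Gaussian and Brownian estimates *)

(** The first layer dictates the exponent of the cost A. Smoothing at scale 1/m leaves a derivative
    of order N_1 with Lipschitz constant Lam of order m^(N_1 + 1 - beta), and a Brownian path
    follows such a drift only in steps of length tau with Lam sqrt(tau) bounded: about Lam^2 = A
    steps. The resulting error m^(-N_1) sqrt(tau) is O(m^(-beta)) when beta <= N_1 + 1/2. Later
    layers have fixed smooth targets, so beta <= N_h suffices there. Steering is adaptive: the sign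
    to be opposed depends on the past, so its probability rests on the independence of past and
    future increments, with the Gaussian coefficients joined to the past. The conditioned laws are
    known on cylinder sets only, so uniform distances and bounds on derivatives are expressed
    through countably many evaluations. Conditioning divides by a fixed positive probability: it
    costs a constant in upper bounds and nothing in lower bounds for events that imply the
    constraints. All neighbourhoods being uniform, likelihood ratios are controlled pointwise, and
    the evidence is bounded below through reciprocal likelihoods rather than divergences. *)

Section gaussian.
Context {R : realType}.
Implicit Types s a u v : R.

(** Half of the Gaussian exponent stays as a weight and the other half is again a normal density, so
    a tail is bounded by its largest weight without any tail integral. *)
Lemma normal_pdf_sqrt2 s x : 0 < s ->
  normal_pdf 0 s x =
  Num.sqrt 2 * expR (- x ^+ 2 / (4 * s ^+ 2)) * normal_pdf 0 (Num.sqrt 2 * s) x.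
Proof.
move=> s0; have s20 : 0 < Num.sqrt 2 * s by rewrite mulr_gt0 ?sqrtr_gt0.
rewrite !normal_pdfE ?gt_eqF//= /normal_fun /normal_peak !subr0 exprMn sqr_sqrtr//.
have -> : Num.sqrt (2 * s ^+ 2 * pi *+ 2) = Num.sqrt 2 * Num.sqrt (s ^+ 2 * pi *+ 2).
  by rewrite -sqrtrM//; congr Num.sqrt; ring.
have w0 : Num.sqrt 2 != 0 :> R by rewrite gt_eqF// sqrtr_gt0.
rewrite [(Num.sqrt 2 * _)^-1]invfM.
rewrite [RHS](_ : _ = (Num.sqrt (s ^+ 2 * pi *+ 2))^-1 *
  (expR (- x ^+ 2 / (4 * s ^+ 2)) * expR (- x ^+ 2 / (2 * s ^+ 2 *+ 2)))); last first.
  by move: (Num.sqrt (s ^+ 2 * pi *+ 2))^-1 (expR _) (expR _) => y e1 e2; field.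
congr (_ * _); rewrite -expRD; congr expR.
by field; rewrite gt_eqF.
Qed.

Lemma normal_prob_tail s a : 0 < s -> 0 <= a ->
  (normal_prob 0 s [set x | (a * s < `|x|)%R] <= (2 * expR (- (a ^+ 2 / 4)))%:E)%E.
Proof.
move=> s0 a0; set A := [set x | _].
have s20 : 0 < Num.sqrt 2 * s by rewrite mulr_gt0 ?sqrtr_gt0.
have mA : measurable A.
  rewrite (_ : A = (fun x : R => `|x|) @^-1` `]a * s, +oo[).
    by rewrite -[_ @^-1` _]setTI; apply: (_ : measurable_fun setT (@Num.norm R R)).
  by apply/seteqP; split => x; rewrite /A/= in_itv/= andbT.
rewrite /normal_prob.
have h2 : Num.sqrt 2 <= 2 :> R by rewrite -[leRHS]ger0_norm// -sqrtr_sqr ler_sqrt//; lra.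
apply: (@le_trans _ _ (\int[lebesgue_measure]_(x in A)
    ((2 * expR (- (a ^+ 2 / 4)))%:E * (normal_pdf 0 (Num.sqrt 2 * s) x)%:E))%E).
  apply: ge0_le_integral => //.
  - by move=> x _; rewrite lee_fin normal_pdf_ge0.
  - apply: measurable_funTS; apply/measurable_EFinP; exact: measurable_normal_pdf.
  - apply: measurable_funTS; apply/measurable_EFinP; apply: measurable_funM => //.
    exact: measurable_normal_pdf.
  move=> x; rewrite /A/= => ax; rewrite -EFinM lee_fin normal_pdf_sqrt2//.
  rewrite ler_wpM2r ?normal_pdf_ge0// ler_pM ?sqrtr_ge0 ?expR_ge0//.
  rewrite ler_expR mulNr lerN2 ler_pdivlMr ?mulr_gt0 ?exprn_gt0//.
  have : (a * s) ^+ 2 <= `|x| ^+ 2 by rewrite ler_sqr ?nnegrE// ?(ltW ax)// mulr_ge0// ltW.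
  rewrite real_normK ?num_real// exprMn => h.
  by rewrite (_ : a ^+ 2 / 4 * (4 * s ^+ 2) = a ^+ 2 * s ^+ 2)//; field.
rewrite ge0_integralZl//=; first last.
- by move=> x _; rewrite lee_fin normal_pdf_ge0.
- apply: measurable_funTS; apply/measurable_EFinP; exact: measurable_normal_pdf.
rewrite -[leRHS]mule1 lee_wpmul2l ?lee_fin ?mulr_ge0 ?expR_ge0//.
exact: (@probability_le1 _ _ _ (normal_prob 0 (Num.sqrt 2 * s))).
Qed.

Lemma normal_prob_itv_ge s c u v : 0 < s -> u <= v ->
  (forall x, u <= x <= v -> `|x| <= c * s) ->
  (((v - u) / s * (expR (- (c ^+ 2 / 2)) / Num.sqrt (2 * pi)))%:E
   <= normal_prob 0 s `[u, v])%E.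
Proof.
move=> s0 uv h; rewrite /normal_prob.
pose k := expR (- (c ^+ 2 / 2)) / Num.sqrt (2 * pi) / s.
have k0 : 0 <= k by rewrite /k !divr_ge0 ?expR_ge0 ?sqrtr_ge0// ltW.
apply: (@le_trans _ _ (\int[lebesgue_measure]_(x in `[u, v]) (cst k%:E x))%E).
  rewrite integral_cst//= lebesgue_measure_itv/= lte_fin.
  case: ltP => [_|vu]; last first.
    have -> : v = u by apply/le_anti; rewrite uv vu.
    by rewrite subrr !mul0r mule0.
  rewrite -EFinB -EFinM lee_fin /k le_eqVlt; apply/orP; left; apply/eqP.
  by ring.
apply: ge0_le_integral => //.
  apply/measurable_EFinP; apply: measurable_funTS; exact: measurable_normal_pdf.
move=> x /=; rewrite in_itv/= => /h xc; rewrite lee_fin normal_pdfE ?gt_eqF//=.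
rewrite /normal_peak /normal_fun subr0 /k.
rewrite (_ : Num.sqrt (s ^+ 2 * pi *+ 2) = Num.sqrt (2 * pi) * s); last first.
  rewrite -[in RHS](ger0_norm (ltW s0)) -sqrtr_sqr -sqrtrM ?mulr_ge0 ?pi_ge0//.
  by congr Num.sqrt; ring.
rewrite invfM mulrC mulrA [leLHS]mulrC [leRHS]mulrC.
rewrite [X in _ <= _ * X]mulrC [X in X <= _]mulrCA [leLHS]mulrA [X in _ <= X](_ : _ = s^-1 * (Num.sqrt (2 * pi))^-1 * expR (- x ^+ 2 / (s ^+ 2 *+ 2))); last by ring.
rewrite -mulrA [leLHS](_ : _ = s^-1 * (Num.sqrt (2 * pi))^-1 * expR (- (c ^+ 2 / 2))); last by ring.
rewrite ler_wpM2l ?mulr_ge0 ?invr_ge0 ?sqrtr_ge0 ?(ltW s0)//.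
rewrite ler_expR mulNr lerN2 ler_pdivrMr ?pmulrn_lgt0 ?exprn_gt0//.
have : `|x| ^+ 2 <= (c * s) ^+ 2.
  by rewrite ler_sqr ?nnegrE// (le_trans _ xc).
rewrite real_normK ?num_real// exprMn => hx; apply: (le_trans hx).
rewrite le_eqVlt; apply/orP; left; apply/eqP.
by field.
Qed.

End gaussian.

(** * Independence of sigma-algebras *)

Section pi_lambda.
Context {R : realType} {d : measure_display} {T : measurableType d}.
Variable P : probability T R.
Implicit Types (A B : set T) (G : set (set T)).

Lemma gen_measurable G : G `<=` measurable -> <<s G>> `<=` measurable.
Proof.
by move=> Gm; apply: smallest_sub => //; exact: sigma_algebra_measurable.
Qed.

Lemma indep_setC A B : measurable A -> measurable B ->
  P (A `&` B) = (P A * P B)%E -> P (~` A `&` B) = (P (~` A) * P B)%E.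
Proof.
move=> mA mB h; rewrite probability_setC//.
have e : P (B `\` A) = (P B - P (B `&` A))%E.
  by apply: measureD => //; rewrite ltey_eq fin_num_measure.
rewrite setIC -setDE e setIC h.
rewrite -(fineK (fin_num_measure P _ mA)) -(fineK (fin_num_measure P _ mB)).
by rewrite -EFinM -!EFinB -EFinM; congr EFin; ring.
Qed.

Lemma indep_gen_l G B : setI_closed G -> G `<=` measurable -> measurable B ->
  (forall A, G A -> P (A `&` B) = (P A * P B)%E) ->
  forall A, <<s G>> A -> P (A `&` B) = (P A * P B)%E.
Proof.
move=> GI Gm mB h A GA.
have sub := gen_measurable Gm.
suff : measurable A /\ P (A `&` B) = (P A * P B)%E by case.
pose Q (X : set T) := measurable X /\ P (X `&` B) = (P X * P B)%E.
apply: (@dynkin_induction _ (g_sigma_algebraType G) G Q _ GI) GA => //; rewrite /Q.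
- by split=> //; rewrite setTI probability_setT mul1e.
- by move=> X GX; split; [exact: Gm|exact: h].
- by move=> X _ [mX hX]; split; [exact: measurableC|exact: indep_setC].
- move=> F mF tF hF; split; first by apply: bigcup_measurable => k _; have [] := hF k.
  rewrite setI_bigcupl measure_bigcup//; last 2 first.
  + by move=> k _; apply: measurableI => //; have [] := hF k.
  + exact: trivIset_setIr.
  rewrite measure_bigcup//; last by move=> k _; have [] := hF k.
  rewrite muleC -(fineK (fin_num_measure P _ mB)) -nneseriesZl; last first.
    by move=> *; exact: measure_ge0.
  apply: eq_eseriesr => k _; rewrite fineK ?fin_num_measure// muleC.
  by have [] := hF k.
Qed.

(** Dynkin's pi-lambda argument, applied to one side at a time. *)
Lemma indep_gen G1 G2 : setI_closed G1 -> setI_closed G2 ->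
  G1 `<=` measurable -> G2 `<=` measurable ->
  independent2 P G1 G2 -> independent2 P <<s G1>> <<s G2>>.
Proof.
move=> I1 I2 m1 m2 h A B sA sB.
have mA := gen_measurable m1 sA.
rewrite setIC muleC; apply: (indep_gen_l I2 m2 mA) sB => {}B GB.
rewrite setIC muleC; apply: (indep_gen_l I1 m1 _ _) sA; first exact: m2.
by move=> A' GA; exact: h.
Qed.

Lemma measurable_fun_gen G d' (U : measurableType d') (f : T -> U) :
  (forall A : set U, measurable A -> <<s G>> (f @^-1` A)) ->
  @measurable_fun _ _ (g_sigma_algebraType G) U setT f.
Proof. by move=> h _ A mA; rewrite setTI; exact: h. Qed.

Lemma gen_measurable_fun G d' (U : measurableType d') (f : T -> U) :
  @measurable_fun _ _ (g_sigma_algebraType G) U setT f ->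
  forall A : set U, measurable A -> <<s G>> (f @^-1` A).
Proof. by move=> h A mA; have := h measurableT _ mA; rewrite setTI. Qed.

Lemma measurable_fun_genS G G' d' (U : measurableType d') (f : T -> U) :
  <<s G>> `<=` <<s G'>> ->
  @measurable_fun _ _ (g_sigma_algebraType G) U setT f ->
  @measurable_fun _ _ (g_sigma_algebraType G') U setT f.
Proof.
by move=> s h; apply: measurable_fun_gen => A mA; apply: s; exact: gen_measurable_fun.
Qed.

(** An increasing union of sigma-algebras is stable under intersection, and any two of its members
    lie in a common level, where independence is known. *)
Lemma indep_bigcup (F1 F2 : nat -> set (set T)) :
  (forall r, F1 r `<=` measurable) -> (forall r, F2 r `<=` measurable) ->
  (forall r, <<s F1 r>> `<=` <<s F1 r.+1>>) ->
  (forall r, <<s F2 r>> `<=` <<s F2 r.+1>>) ->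
  (forall r, independent2 P <<s F1 r>> <<s F2 r>>) ->
  independent2 P <<s \bigcup_r <<s F1 r>> >> <<s \bigcup_r <<s F2 r>> >>.
Proof.
have dir (F : nat -> set (set T)) : (forall r, <<s F r>> `<=` <<s F r.+1>>) ->
    forall r s, (r <= s)%N -> <<s F r>> `<=` <<s F s>>.
  move=> h r s; elim: s => [|s ih]; first by rewrite leqn0 => /eqP ->.
  rewrite leq_eqVlt => /predU1P[->//|]; rewrite ltnS => /ih rs.
  exact: (subset_trans rs).
have setI_U (F : nat -> set (set T)) : (forall r, <<s F r>> `<=` <<s F r.+1>>) ->
    setI_closed (\bigcup_r <<s F r>>).
  move=> h A B [r _ rA] [s _ sB]; exists (maxn r s) => //.
  have := @sigma_algebra_measurable _ (g_sigma_algebraType (F (maxn r s))).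
  move=> _; apply: (@measurableI _ (g_sigma_algebraType (F (maxn r s)))).
    by apply: dir rA => //; rewrite leq_maxl.
  by apply: dir sB => //; rewrite leq_maxr.
move=> m1 m2 s1 s2 h; apply: indep_gen.
- exact: setI_U.
- exact: setI_U.
- by apply: bigcup_sub => r _; exact: gen_measurable.
- by apply: bigcup_sub => r _; exact: gen_measurable.
- move=> A B [r _ rA] [s _ sB]; apply: (h (maxn r s)).
    by apply: dir rA => //; rewrite leq_maxl.
  by apply: dir sB => //; rewrite leq_maxr.
Qed.

(** This lets the Gaussian coefficients ([G0]) join the past ([F1]) without losing independence from
    the future ([F2]): P(g a b) = P(g) P(a b) = P(g) P(a) P(b) = P(g a) P(b) on a generating
    pi-system. *)
Lemma indep_adjoin (G0 F1 F2 F : set (set T)) :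
  F `<=` measurable -> G0 `<=` measurable -> F1 `<=` measurable -> F2 `<=` measurable ->
  <<s F1>> `<=` <<s F>> -> <<s F2>> `<=` <<s F>> ->
  independent2 P <<s G0>> <<s F>> -> independent2 P <<s F1>> <<s F2>> ->
  independent2 P
    <<s [set A | exists g a, [/\ <<s G0>> g, <<s F1>> a & A = g `&` a]] >> <<s F2>>.
Proof.
move=> mF m0 m1 m2 s1 s2 h0 h12 A B sA sB.
have mB := gen_measurable m2 sB.
apply: indep_gen_l sA => //.
- move=> _ _ [g [a [gg aa ->]]] [g' [a' [gg' aa' ->]]].
  exists (g `&` g'), (a `&` a'); split; last by rewrite setIACA.
    exact: (@measurableI _ (g_sigma_algebraType G0)).
  exact: (@measurableI _ (g_sigma_algebraType F1)).
- move=> _ [g [a [gg aa ->]]].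
  by apply: measurableI; [exact: gen_measurable gg|exact: gen_measurable aa].
- move=> _ [g [a [gg aa ->]]].
  rewrite -setIA h0//; last first.
    by apply: (@measurableI _ (g_sigma_algebraType F)); [exact: s1|exact: s2].
  by rewrite h12// h0 ?muleA//; exact: s1.
Qed.

Section family.
Context {I : choiceType}.
Implicit Types (D : set I) (F : I -> set (set T)).

Definition finite_rect D F : set (set T) :=
  [set X | exists (J : {fset I}) (A : I -> set T), [/\ [set` J] `<=` D,
     forall i, F i (A i) & X = \bigcap_(i in [set` J]) A i]].

(** Finite intersections are the pi-system behind a grouped family; two of them over disjoint index
    sets merge into a single one, to which mutual independence applies. *)
Lemma independent_rect D D1 D2 F :
  (forall i, F i setT) ->
  (forall i A B, F i A -> F i B -> F i (A `&` B)) ->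
  (forall i, D i -> F i `<=` measurable) ->
  D1 `<=` D -> D2 `<=` D -> (forall i, D1 i -> D2 i -> False) ->
  independent P D F ->
  [/\ setI_closed (finite_rect D1 F), finite_rect D1 F `<=` measurable &
      independent2 P (finite_rect D1 F) (finite_rect D2 F)].
Proof.
move=> FT FI Fm s1 s2 dis ind; split.
- move=> _ _ [J [A [JD FA ->]]] [J' [A' [JD' FA' ->]]].
  exists (J `|` J')%fset, (fun i => (if i \in J then A i else setT) `&`
     (if i \in J' then A' i else setT)); split.
  + by move=> i /=; rewrite inE => /orP[/JD|/JD'].
  + by move=> i; apply: FI; case: ifP.
  + apply/seteqP; split => [x [h h'] i /=|x h].
      by move=> _; split; case: ifPn => // iJ; [exact: h|exact: h'].
    split => i /= iJ.
      by have [] := h i; [rewrite /= inE iJ|rewrite iJ].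
    by have [] := h i; [rewrite /= inE iJ orbT|rewrite iJ].
- move=> _ [J [A [JD FA ->]]]; rewrite bigcap_fset.
  rewrite big_seq; apply: big_ind => //; first by move=> ? ? ? ?; exact: measurableI.
  by move=> i iJ; apply: (Fm i) => //; exact/s1/JD.
- move=> _ _ [J [A [JD FA ->]]] [J' [A' [JD' FA' ->]]].
  pose A'' i := if i \in J then A i else A' i.
  have JJ' i : i \in J -> i \in J' -> False by move=> /JD h /JD' h'; exact: dis h h'.
  have -> : \bigcap_(i in [set` J]) A i `&` \bigcap_(i in [set` J']) A' i =
            \bigcap_(i in [set` (J `|` J')%fset]) A'' i.
    apply/seteqP; split => [x [h h'] i /=|x h].
      rewrite inE /A'' => /orP[iJ|iJ']; first by rewrite iJ; exact: h.
      by case: ifPn => iJ; [exact: h|exact: h'].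
    split => i /= iJ.
      by have := h i; rewrite /A'' /= inE iJ; apply.
    have := h i; rewrite /A'' /= inE iJ orbT; case: ifPn => [iJ2|_]; last exact.
    by have := JJ' _ iJ2 iJ.
  rewrite ind; first last.
  + by move=> i _; rewrite /A''; case: ifP.
  + by move=> i /=; rewrite inE => /orP[/JD/s1|/JD'/s2].
  rewrite ind//; last by move=> i /JD/s1.
  rewrite ind//; last by move=> i /JD'/s2.
  rewrite (perm_big (enum_fset J ++ enum_fset J')) /=; last first.
    apply: uniq_perm; first exact: fset_uniq.
      rewrite cat_uniq !fset_uniq /= andbT; apply/hasPn => i iJ'; apply/negP => iJ.
      exact: JJ' iJ iJ'.
    by move=> i; rewrite inE mem_cat.
  rewrite big_cat/=; congr (_ * _)%E.
    by rewrite big_seq [RHS]big_seq; apply: eq_bigr => i iJ; rewrite /A'' iJ.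
  rewrite big_seq [RHS]big_seq; apply: eq_bigr => i iJ; rewrite /A''.
  by case: ifPn => // iJ2; have := JJ' _ iJ2 iJ.
Qed.

Lemma independent_split D D1 D2 F :
  (forall i, F i setT) ->
  (forall i A B, F i A -> F i B -> F i (A `&` B)) ->
  (forall i, D i -> F i `<=` measurable) ->
  D1 `<=` D -> D2 `<=` D -> (forall i, D1 i -> D2 i -> False) ->
  independent P D F ->
  independent2 P <<s \bigcup_(i in D1) F i>> <<s \bigcup_(i in D2) F i>>.
Proof.
move=> FT FI Fm s1 s2 dis ind.
have sub E : <<s \bigcup_(i in E) F i>> `<=` <<s finite_rect E F>>.
  apply: smallest_sub; first exact: smallest_sigma_algebra.
  move=> X [i Ei FX]; apply: sub_sigma_algebra.
  exists [fset i]%fset, (fun j => if j == i then X else setT); split.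
  - by move=> j /=; rewrite inE => /eqP ->.
  - by move=> j; case: eqP => [->|].
  - apply/seteqP; split => [x Xx j /=|x /(_ i)]; last by rewrite /= inE eqxx; apply.
    by rewrite inE => ->.
have [I1 m1 h] := independent_rect FT FI Fm s1 s2 dis ind.
have [I2 m2 _] := independent_rect FT FI Fm s2 s1 (fun i a b => dis i b a) ind.
by move=> A B /sub sA /sub sB; exact: (indep_gen I1 I2 m1 m2 h).
Qed.

End family.

(** Independence concerns finite subfamilies, and a finite set of indices is bounded. *)
Lemma independent_nat (F : nat -> set (set T)) :
  (forall n, independent P [set i | (i < n)%N] F) -> independent P setT F.
Proof.
move=> h J _ A FA; apply: (h (\max_(i <- J) i).+1) => // i /= iJ.
by rewrite ltnS; exact: leq_bigmax_seq.
Qed.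

End pi_lambda.

(** * Dyadic grids and the splitting of Brownian motion at a fixed time *)

Section dyadic.
Context {R : realType}.
Implicit Types h s t : R.

Lemma continuous_within_comp (A : set R) (f c : R -> R) :
  {within A, continuous f} -> continuous c -> (forall x, A (c x)) ->
  continuous (f \o c).
Proof.
move=> /subspace_continuousP fA cc Ac x.
apply: (@cvg_comp _ _ _ c f (nbhs x) (within A (nbhs (c x)))); last exact: fA.
move=> U hU; have h2 : \forall y \near x, A (c y) -> U (c y) := cc x _ hU.
by apply: (@filterS _ (nbhs x) _ _ _ _ h2) => y; apply; exact: Ac.
Qed.

Definition dyad h (r k : nat) : R := h * k%:R / 2 ^+ r.

Lemma dyadS h r k : dyad h r.+1 k.*2 = dyad h r k.
Proof.
rewrite /dyad -muln2 natrM exprS; field.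
by rewrite expf_neq0//.
Qed.

Definition dyad_floor h s r := Num.truncn (s / h * 2 ^+ r).

Lemma dyad_floor_itv h s r : 0 < h -> 0 <= s ->
  dyad h r (dyad_floor h s r) <= s < dyad h r (dyad_floor h s r) + h / 2 ^+ r.
Proof.
move=> h0 s0; have p0 : 0 < 2 ^+ r :> R by rewrite exprn_gt0.
have x0 : 0 <= s / h * 2 ^+ r by rewrite mulr_ge0 ?divr_ge0 ?(ltW h0) ?(ltW p0).
have /andP[] := truncn_itv x0; rewrite -/(dyad_floor h s r) => le1 lt2; apply/andP; split.
  by rewrite /dyad ler_pdivrMr// mulrC -ler_pdivlMr// mulrAC.
rewrite /dyad -mulrDl ltr_pdivlMr// -[X in _ + X]mulr1 -mulrDr -ltr_pdivrMl//.
by rewrite natr1 mulrA [_^-1 * _]mulrC.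
Qed.

Lemma dyad_cvg h s : 0 < h -> 0 <= s ->
  dyad h r (dyad_floor h s r) @[r --> \oo] --> s.
Proof.
move=> h0 s0; apply: (@squeeze_cvgr _ _ _ _ (fun r => s - h / 2 ^+ r) (fun=> s)).
- near=> r; have /andP[a b] := dyad_floor_itv r h0 s0.
  by rewrite a andbT lerBlDr ltW.
- rewrite -[X in _ --> X]subr0; apply: cvgB; first exact: cvg_cst.
  rewrite [X in X @ _](_ : _ = geometric h (2^-1)).
    by apply: cvg_geometric; rewrite ger0_norm//; lra.
  by apply/funext => r; rewrite /geometric/= exprVn.
- exact: cvg_cst.
Unshelve. all: by end_near. Qed.

End dyadic.

Section brownian_split.
Context {R : realType} {d : measure_display} {T : measurableType d}.
Variables (P : probability T R) (B : T -> R -> R).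
Hypothesis Bm : brownian P B.

Lemma brownian_measurable t : 0 <= t -> measurable_fun setT (B ^~ t).
Proof. by case: Bm => h *; exact: h. Qed.

(** Continuity is given within [[0, +oo[]; the retraction [Num.max 0] turns it into continuity on
    the line. *)
Lemma brownian_continuous w : continuous (fun t : R => B w (Num.max 0 t)).
Proof.
case: Bm => _ h _ _ _; apply: (@continuous_within_comp _ _ (B w) (Num.max 0) (h w)).
  by move=> x; apply: continuous_max; [exact: cvg_cst|exact: cvg_id].
by move=> x; rewrite /= in_itv/= andbT le_max lexx.
Qed.

Lemma brownian_cvg w (u : nat -> R) t : (forall r, 0 <= u r) ->
  u @ \oo --> t -> B w (u r) @[r --> \oo] --> B w t.
Proof.
move=> u0 ut; have t0 : 0 <= t.
  rewrite -(cvg_lim _ ut)//; apply: limr_ge; first by apply: cvgP ut.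
  exact: nearW.
have := cvg_comp _ _ ut (@brownian_continuous w t).
have -> : (fun t : R => B w (Num.max 0 t)) \o u = fun r => B w (u r).
  by apply/funext => r /=; rewrite max_r.
by rewrite max_r.
Qed.

Definition inc h r k (w : T) := B w (dyad h r k.+1) - B w (dyad h r k).

Lemma dyad_ge0 (h : R) r k : 0 <= h -> 0 <= dyad h r k.
Proof. by move=> h0; rewrite /dyad divr_ge0 ?mulr_ge0. Qed.

Lemma measurable_inc h r k : 0 <= h -> measurable_fun setT (inc h r k).
Proof.
by move=> h0; apply: measurable_funB; apply: brownian_measurable; exact: dyad_ge0.
Qed.

Lemma sigma_of_measurable d' (U : measurableType d') (X : T -> U) :
  measurable_fun setT X -> sigma_of X `<=` measurable.
Proof. by move=> mX _ [A mA <-]; exact: mX. Qed.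

Lemma inc_independent h r : 0 < h ->
  independent P setT (fun k => sigma_of (inc h r k)).
Proof.
move=> h0; apply: independent_nat => n; case: Bm => _ _ _ _ ind.
apply: (ind n (dyad h r)); first exact/dyad_ge0/ltW.
by move=> i _; rewrite /dyad ltr_pM2r ?invr_gt0 ?exprn_gt0// ltr_pM2l// ltr_nat.
Qed.

Lemma sigma_ofT d' (U : measurableType d') (X : T -> U) : sigma_of X setT.
Proof. by exists setT => //; rewrite setTI preimage_setT. Qed.

Lemma sigma_ofI d' (U : measurableType d') (X : T -> U) A A' :
  sigma_of X A -> sigma_of X A' -> sigma_of X (A `&` A').
Proof.
move=> [C mC <-] [C' mC' <-]; exists (C `&` C'); first exact: measurableI.
by rewrite !setTI preimage_setI.
Qed.

Definition gen_inc h r (D : set nat) := \bigcup_(k in D) sigma_of (inc h r k).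

Lemma gen_inc_measurable h r D : 0 <= h -> gen_inc h r D `<=` measurable.
Proof.
move=> h0; apply: bigcup_sub => k _.
by apply: sigma_of_measurable; exact: measurable_inc.
Qed.

Lemma measurable_fun_inc h r D k : D k ->
  @measurable_fun _ _ (g_sigma_algebraType (gen_inc h r D)) R setT (inc h r k).
Proof.
move=> Dk; apply: measurable_fun_gen => A mA.
by apply: sub_sigma_algebra; exists k => //; exists A => //; rewrite setTI.
Qed.

Lemma gen_inc_sub h r (D D' : set nat) :
  (forall k, D k -> D' k.*2 /\ D' k.*2.+1) ->
  <<s gen_inc h r D>> `<=` <<s gen_inc h r.+1 D'>>.
Proof.
move=> DD'; apply: smallest_sub; first exact: smallest_sigma_algebra.
move=> _ [k Dk [A mA <-]]; rewrite setTI.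
have [Dk1 Dk2] := DD' _ Dk.
apply: (@gen_measurable_fun _ _ (gen_inc h r.+1 D')) => //.
rewrite (_ : inc h r k = fun w => inc h r.+1 k.*2.+1 w + inc h r.+1 k.*2 w).
  by apply: measurable_funD; exact: measurable_fun_inc.
by apply/funext => w; rewrite /inc -doubleS !dyadS; ring.
Qed.

(* The dyadic increments of levels [r] determine, by continuity, the increments
   between arbitrary times. *)
Lemma measurable_fun_dyadic_limit (h s : R) (j : nat) (D : nat -> set nat) :
  0 < h -> h * j%:R <= s ->
  (forall r k, (j * 2 ^ r <= k < dyad_floor h s r)%N -> D r k) ->
  @measurable_fun _ _ (g_sigma_algebraType (\bigcup_r <<s gen_inc h r (D r)>>)) R
    setT (fun w => B w s - B w (h * j%:R)).
Proof.
move=> h0 js Dk; have j0 : 0 <= h * j%:R by rewrite mulr_ge0// ltW.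
have s0 := le_trans j0 js.
pose u r := dyad h r (dyad_floor h s r).
have jE r : h * j%:R = dyad h r (j * 2 ^ r).
  rewrite /dyad natrM natrX mulrA mulfK// expf_neq0//.
have jle r : (j * 2 ^ r <= dyad_floor h s r)%N.
  rewrite /dyad_floor truncn_ge_nat ?mulr_ge0 ?divr_ge0 ?invr_ge0 ?(ltW h0)//.
  rewrite natrM natrX ler_pM2r ?exprn_gt0// ler_pdivlMr// mulrC//.
apply: (@measurable_fun_cvg _ (g_sigma_algebraType _) R setT
  (fun r w => B w (u r) - B w (h * j%:R))) => //.
  move=> r; have -> : (fun w => B w (u r) - B w (h * j%:R)) =
      fun w => \sum_(j * 2 ^ r <= k < dyad_floor h s r) inc h r k w.
    apply/funext => w; rewrite /u (jE r).
    by rewrite -(telescope_sumr (fun k => B w (dyad h r k)) (jle r)).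
  rewrite (_ : (fun w => _) = fun w => \sum_(j * 2 ^ r <= k < dyad_floor h s r)
      (if (j * 2 ^ r <= k < dyad_floor h s r)%N then inc h r k w else 0)); last first.
    by apply/funext => w; apply: eq_big_nat => k ->.
  apply: (@measurable_sum _ (g_sigma_algebraType _)) => k.
  case: (boolP (j * 2 ^ r <= k < dyad_floor h s r)%N) => [/Dk Drk|_]; last exact: measurable_cst.
  refine (measurable_fun_genS (f := inc h r k) _ (measurable_fun_inc (h := h) Drk)) => A GA.
  by apply: sub_sigma_algebra; exists r.
move=> w _; apply: cvgB; last exact: cvg_cst.
by apply: brownian_cvg; [move=> r; exact/dyad_ge0/ltW|exact: dyad_cvg].
Qed.

Lemma sigma_path_sigma_algebra (S : set R) (Z : T -> R -> R) :
  sigma_algebra setT (sigma_path S Z).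
Proof. exact/sigma_algebra_preimage/smallest_sigma_algebra. Qed.

Lemma cylinder_eval (S : set R) t : S t ->
  @measurable_fun _ _ (g_sigma_algebraType (\bigcup_(t in S)
    preimage_set_system setT (fun z : R -> R => z t) measurable)) R setT
    (fun z : R -> R => z t).
Proof.
move=> St _ A mA; rewrite setTI; apply: sub_sigma_algebra.
by exists t => //; exists A => //; rewrite setTI.
Qed.

Lemma sigma_path_measurable (S : set R) (Z : T -> R -> R) :
  (forall t, S t -> measurable_fun setT (Z ^~ t)) -> sigma_path S Z `<=` measurable.
Proof.
move=> mZ _ [C cC <-].
suff : cylinder S `<=` image_set_system setT Z measurable by apply.
apply: smallest_sub.
  exact/sigma_algebra_image/sigma_algebra_measurable.
move=> _ [t St [A mA <-]]; rewrite /image_set_system/= !setTI.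
by rewrite -[X in measurable X]setTI; exact: mZ.
Qed.

Lemma sigma_path_inc h r k : 0 <= h ->
  sigma_of (inc h r k) `<=` sigma_path `[0, +oo[ B.
Proof.
move=> h0 _ [A mA <-]; rewrite setTI.
have t0 k' : `[0, +oo[%classic (dyad h r k') by rewrite /= in_itv/= andbT dyad_ge0.
exists ((fun z : R -> R => z (dyad h r k.+1) - z (dyad h r k)) @^-1` A); last first.
  by rewrite setTI.
have := measurable_funB (cylinder_eval (t0 k.+1)) (cylinder_eval (t0 k)).
by move=> /(_ measurableT _ mA); rewrite setTI.
Qed.

(** Weak Markov property in the form in which it is used: [G0] joins the past, and past and future
    are described by increments from 0 and from [t]. Dyadic increments suffice because the paths are
    continuous. *)
Lemma brownian_split (G0 : set (set T)) t : 0 <= t -> G0 `<=` measurable ->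
  independent2 P <<s G0>> (sigma_path `[0, +oo[ B) ->
  exists F1 F2 : set (set T),
  [/\ F1 `<=` measurable /\ F2 `<=` measurable, independent2 P <<s F1>> <<s F2>>,
    <<s G0>> `<=` <<s F1>>,
    forall s, 0 <= s <= t -> @measurable_fun _ _ (g_sigma_algebraType F1) R setT
      (fun w => B w s - B w 0) &
    forall s, t <= s -> @measurable_fun _ _ (g_sigma_algebraType F2) R setT
      (fun w => B w s - B w t)].
Proof.
move=> t0 mG0 ind0.
(* With [t = h * j%:R], the time [t] is a grid point of every level, so each dyadic increment lies
   entirely before or entirely after it. *)
have [h [j [h0 tE]]] : exists h (j : nat), 0 < h /\ t = h * j%:R.
  move: t0; rewrite le_eqVlt => /predU1P[<-|t0]; last by exists t, 1%N; rewrite mulr1.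
  by exists 1, 0%N; rewrite mulr0.
pose D1 r := [set k | (k < j * 2 ^ r)%N].
pose D2 r := [set k | (j * 2 ^ r <= k)%N].
pose F1 := \bigcup_r <<s gen_inc h r (D1 r)>>.
pose F2 := \bigcup_r <<s gen_inc h r (D2 r)>>.
have h0' := ltW h0.
have mF D r : <<s gen_inc h r D>> `<=` measurable.
  exact/gen_measurable/gen_inc_measurable.
have mF1 : F1 `<=` measurable by apply: bigcup_sub => r _; exact: mF.
have mF2 : F2 `<=` measurable by apply: bigcup_sub => r _; exact: mF.
have ind : independent2 P <<s F1>> <<s F2>>.
  apply: indep_bigcup.
  - by move=> r; exact: gen_inc_measurable.
  - by move=> r; exact: gen_inc_measurable.
  - move=> r; apply: gen_inc_sub => k; rewrite /D1/= expnS.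
    move: (2 ^ r)%N => p; nia.
  - move=> r; apply: gen_inc_sub => k; rewrite /D2/= expnS.
    move: (2 ^ r)%N => p; nia.
  - move=> r; apply: (@independent_split _ _ _ P _ setT) => //.
    + by move=> i; exact: sigma_ofT.
    + by move=> i; exact: sigma_ofI.
    + by move=> i _; apply: sigma_of_measurable; exact: measurable_inc.
    + by move=> i; rewrite /D1 /D2/= => a b; have := leq_ltn_trans b a; rewrite ltnn.
    + exact: inc_independent.
have spm : sigma_path `[0, +oo[ B `<=` measurable.
  apply: sigma_path_measurable => s; rewrite /= in_itv/= andbT.
  exact: brownian_measurable.
have Fsub D r : <<s gen_inc h r D>> `<=` sigma_path `[0, +oo[ B.
  apply: smallest_sub; first exact: sigma_path_sigma_algebra.
  by apply: bigcup_sub => k _; exact: sigma_path_inc.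
have F1sub : <<s F1>> `<=` <<s sigma_path `[0, +oo[ B>>.
  by apply: sub_smallest2r => //; apply: bigcup_sub => r _; exact: Fsub.
have F2sub : <<s F2>> `<=` <<s sigma_path `[0, +oo[ B>>.
  by apply: sub_smallest2r => //; apply: bigcup_sub => r _; exact: Fsub.
have F1T : <<s F1>> setT by exact: (@measurableT _ (g_sigma_algebraType F1)).
exists [set A | exists g a, [/\ <<s G0>> g, <<s F1>> a & A = g `&` a]], F2; split.
- split=> // _ [g [a [gg aa ->]]].
  by apply: measurableI; [exact: gen_measurable gg|exact: gen_measurable aa].
- apply: (@indep_adjoin _ _ _ P G0 F1 F2 _ spm) => //.
  by rewrite (sigma_algebra_id (sigma_path_sigma_algebra _ _)).
- by move=> A GA; apply: sub_sigma_algebra; exists A, setT; split => //; rewrite setIT.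
- move=> s /andP[s0 st].
  have := @measurable_fun_dyadic_limit h s 0 D1 h0.
  rewrite mulr0 => /(_ s0) H.
  apply: measurable_fun_genS (H _).
    apply: sub_smallest2r => // A FA; exists setT, A; split => //.
    - exact: (@measurableT _ (g_sigma_algebraType G0)).
    - exact: sub_sigma_algebra.
    - by rewrite setTI.
  move=> r k /andP[_ kf]; rewrite /D1/= (leq_trans kf)// /dyad_floor.
  rewrite -ltnS truncn_lt_nat ?mulr_ge0 ?divr_ge0 ?invr_ge0//.
  rewrite -[X in _ < X]natr1 natrM natrX ltr_pwDr// ler_pM2r ?exprn_gt0// ler_pdivrMr//.
  by rewrite mulrC -tE.
- move=> s ts; rewrite {1}tE; apply: measurable_fun_dyadic_limit => //.
    by rewrite -tE.
  by move=> r k /andP[].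
Qed.

End brownian_split.

Section measurable_levels.
Context {R : realType} {d : measure_display} {T : measurableType d}.
Implicit Types (f : T -> R) (c : R).

Lemma measurable_set_gt f c : measurable_fun setT f -> measurable [set w | c < f w].
Proof.
move=> mf; rewrite (_ : [set _ | _] = f @^-1` `]c, +oo[).
  by rewrite -[X in measurable X]setTI; exact: mf.
by apply/seteqP; split => w; rewrite /= in_itv/= andbT.
Qed.

Lemma measurable_set_ge f c : measurable_fun setT f -> measurable [set w | c <= f w].
Proof.
move=> mf; rewrite (_ : [set _ | _] = f @^-1` `[c, +oo[).
  by rewrite -[X in measurable X]setTI; exact: mf.
by apply/seteqP; split => w; rewrite /= in_itv/= andbT.
Qed.

Lemma measurable_set_le f c : measurable_fun setT f -> measurable [set w | f w <= c].
Proof.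
move=> mf; rewrite (_ : [set _ | _] = f @^-1` `]-oo, c]).
  by rewrite -[X in measurable X]setTI; exact: mf.
by apply/seteqP; split => w; rewrite /= in_itv.
Qed.

Lemma measurable_fun_norm f : measurable_fun setT f ->
  measurable_fun setT (fun w => `|f w|).
Proof. by move=> mf; apply: measurableT_comp. Qed.

Lemma bernoulli (x : R) n : 0 <= x -> 1 + n%:R * x <= (1 + x) ^+ n.
Proof.
move=> x0; elim: n => [|n ih]; first by rewrite mul0r addr0.
rewrite exprS -[n.+1%:R]natr1.
have n0 : 0 <= n%:R :> R by [].
move: ih n0; move: (_ ^+ n) (n%:R) => y m ih m0; nra.
Qed.

Lemma sum_geometric34 n : \sum_(i < n) (3 / 4 : R) ^+ i <= 4.
Proof.
suff -> : \sum_(i < n) (3 / 4 : R) ^+ i = 4 - 4 * (3 / 4) ^+ n.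
  by rewrite gerBl mulr_ge0 ?exprn_ge0.
elim: n => [|n ih]; first by rewrite big_ord0; lra.
by rewrite big_ord_recr/= ih exprS; lra.
Qed.

End measurable_levels.

(** * Oscillation of Brownian motion by dyadic chaining *)

Section oscillation.
Context {R : realType} {d : measure_display} {T : measurableType d}.
Variables (P : probability T R) (B : T -> R -> R).
Hypothesis Bm : brownian P B.
Implicit Types t tau x a : R.

Definition osc t tau x : set T :=
  [set w | exists2 s, t <= s <= t + tau & x < `|B w s - B w t|].

Definition osc_at t tau x j k : set T :=
  [set w | x < `|B w (t + dyad tau j k) - B w t|].

Lemma dyad_le tau j k : 0 <= tau -> (k <= 2 ^ j)%N -> dyad tau j k <= tau.
Proof.
move=> t0 kj; rewrite /dyad ler_pdivrMr ?exprn_gt0// ler_wpM2l//.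
by rewrite -natrX ler_nat.
Qed.

(** The strict inequality is inherited by nearby dyadic times, so an excursion somewhere in an
    interval becomes a countable union. *)
Lemma osc_dyadic t tau x : 0 <= t -> 0 < tau ->
  osc t tau x = \bigcup_j \bigcup_(k in [set k | (k <= 2 ^ j)%N]) osc_at t tau x j k.
Proof.
move=> t0 tau0; apply/seteqP; split => [w [s /andP[ts st] xs]|w [j _ [k /= kj xk]]].
  have st0 : 0 <= s - t by rewrite subr_ge0.
  have := @brownian_cvg _ _ _ _ _ Bm w (fun r => t + dyad tau r (dyad_floor tau (s - t) r)) s.
  have u0 r : 0 <= t + dyad tau r (dyad_floor tau (s - t) r).
    by rewrite addr_ge0 ?dyad_ge0// ltW.
  move=> /(_ u0).
  have uc : (fun r => t + dyad tau r (dyad_floor tau (s - t) r)) @ \oo --> s.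
    rewrite -[X in _ --> X](subrKC t); apply: cvgD; first exact: cvg_cst.
    exact: dyad_cvg.
  move=> /(_ uc) Bc.
  have : `|B w (t + dyad tau r (dyad_floor tau (s - t) r)) - B w t| @[r --> \oo]
      --> `|B w s - B w t|.
    by apply: cvg_norm; apply: cvgB => //; exact: cvg_cst.
  move=> /cvgr_gt/(_ _ xs)[r _ /(_ r (leqnn r))/= xr].
  exists r => //; exists (dyad_floor tau (s - t) r) => //=.
  rewrite /dyad_floor truncn_le_nat -[X in _ < X]natr1 natrX.
  rewrite (@le_lt_trans _ _ (2 ^+ r))// ?ltrDl// ler_piMl ?exprn_ge0//.
  by rewrite ler_pdivrMr// mul1r lerBlDl.
exists (t + dyad tau j k) => //.
by rewrite lerDl lerD2l dyad_ge0 ?dyad_le// ltW.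
Qed.

Lemma measurable_osc t tau x (F : set (set T)) : 0 <= t -> 0 < tau ->
  (forall s, t <= s <= t + tau ->
    @measurable_fun _ _ (g_sigma_algebraType F) R setT (fun w => B w s - B w t)) ->
  <<s F>> (osc t tau x).
Proof.
move=> t0 tau0 mB; rewrite osc_dyadic//.
apply: (@bigcupT_measurable _ (g_sigma_algebraType F)) => j.
apply: (@bigcup_measurable _ (g_sigma_algebraType F)) => k /= kj.
have ms : t <= t + dyad tau j k <= t + tau.
  by rewrite lerDl lerD2l dyad_ge0 ?dyad_le// ltW.
have mn : @measurable_fun _ _ (g_sigma_algebraType F) R setT
    (fun w => `|B w (t + dyad tau j k) - B w t|).
  by apply: measurableT_comp => //; exact: mB.
have -> : osc_at t tau x j k =
    (fun w => `|B w (t + dyad tau j k) - B w t|) @^-1` `]x, +oo[.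
  by apply/seteqP; split => w; rewrite /osc_at/= in_itv/= andbT.
exact: (gen_measurable_fun mn).
Qed.

Lemma measurable_osc_total t tau x : 0 <= t -> 0 < tau -> measurable (osc t tau x).
Proof.
move=> t0 tau0; rewrite -[measurable]/(@measurable _ T).
rewrite -(sigma_algebra_id (@sigma_algebra_measurable _ T)).
apply: measurable_osc => // s /andP[ts _]; apply: measurable_fun_gen => A mA.
apply: sub_sigma_algebra; rewrite -[X in measurable X]setTI.
have := measurable_funB (brownian_measurable Bm (le_trans t0 ts))
  (brownian_measurable Bm t0).
exact.
Qed.

Lemma increment_tail s t a : 0 <= s < t -> 0 <= a ->
  (P [set w | (a * Num.sqrt (t - s) < `|B w t - B w s|)%R]
   <= (2 * expR (- (a ^+ 2 / 4)))%:E)%E.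
Proof.
move=> st a0; case: Bm => _ _ _ /(_ _ _ st)[_ law] _.
have s0 : 0 < Num.sqrt (t - s) by case/andP: st => _ h; rewrite sqrtr_gt0 subr_gt0.
apply: le_trans (normal_prob_tail s0 a0).
have := law [set x | (a * Num.sqrt (t - s) < `|x|)%R].
rewrite /preimage/= => <- //.
rewrite (_ : [set _ | _] = (fun x : R => `|x|) @^-1` `]a * Num.sqrt (t - s), +oo[).
  by rewrite -[_ @^-1` _]setTI; apply: (_ : measurable_fun setT (@Num.norm R R)).
by apply/seteqP; split => x; rewrite /=/= in_itv/= andbT.
Qed.

(** Chaining with allowance [(3 / 4) ^+ j] at level [j]: the ratio 3/4 is below 1, so the allowances
    sum to at most 4, and above 1 / sqrt 2, so measured in standard deviations they grow like
    (9/8)^(j/2), which defeats the 2^j increments of that level. *)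
Let bad1 t tau a j k : set T := [set w | a * (3 / 4) ^+ j * Num.sqrt tau <
     `|B w (t + dyad tau j k.+1) - B w (t + dyad tau j k)|].

Let bad t tau a j : set T := \big[setU/set0]_(k < 2 ^ j) bad1 t tau a j k.

Let bad1_measurable t tau a j k : 0 <= t -> 0 < tau -> measurable (bad1 t tau a j k).
Proof.
move=> t0 tau0; apply: measurable_set_gt; apply: measurable_fun_norm.
by apply: measurable_funB; apply: (brownian_measurable Bm);
  rewrite addr_ge0 ?dyad_ge0// ltW.
Qed.

Let bad_bound t tau a w : 0 <= t -> 0 < tau -> 0 <= a ->
  (forall j, ~ bad t tau a j w) ->
  forall j k, (k <= 2 ^ j)%N ->
  `|B w (t + dyad tau j k) - B w t| <=
    a * Num.sqrt tau * (\sum_(i < j.+1) (3 / 4) ^+ i).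
Proof.
move=> t0 tau0 a0 nb.
have nb' j k : (k < 2 ^ j)%N ->
    `|B w (t + dyad tau j k.+1) - B w (t + dyad tau j k)| <=
    a * (3 / 4) ^+ j * Num.sqrt tau.
  move=> kj; rewrite leNgt; apply/negP => h; apply: (nb j); rewrite /bad -bigcup_mkord.
  by exists k.
have s0 : 0 <= a * Num.sqrt tau by rewrite mulr_ge0 ?sqrtr_ge0.
elim=> [|j ih] k kj.
  rewrite big_ord1 expr0 mulr1.
  case: k kj => [|[|//]] _.
    by rewrite /dyad mulr0 mul0r addr0 subrr normr0.
  by have := nb' 0%N 0%N isT; rewrite /dyad mulr0 mul0r addr0 expr0 mulr1 divr1 mulr1.
rewrite big_ord_recr/= mulrDr.
(* A grid point of even index already belongs to the coarser level; one of odd index is a single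
   increment away from such a point. *)
have [ko|ke] := boolP (odd k); last first.
  have kE : k = (k./2).*2 by rewrite -[LHS]odd_double_half (negbTE ke).
  rewrite kE dyadS (le_trans (ih _ _))//; last by rewrite lerDl mulr_ge0// exprn_ge0.
  by rewrite -leq_double -kE -mul2n -expnS.
have kE : k = (k./2).*2.+1 by rewrite -[LHS]odd_double_half ko.
have k2 : (k./2 <= 2 ^ j)%N.
  by move: kj; rewrite expnS [in X in X -> _]kE; lia.
rewrite [in X in X <= _]kE.
have -> : B w (t + dyad tau j.+1 (k./2).*2.+1) - B w t =
  (B w (t + dyad tau j k./2) - B w t) +
  (B w (t + dyad tau j.+1 (k./2).*2.+1) - B w (t + dyad tau j.+1 (k./2).*2)).
  by rewrite dyadS; ring.
rewrite (le_trans (ler_normD _ _))// lerD ?ih//.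
rewrite (le_trans (nb' _ _ _)) -?kE// ?[X in (X <= _)%N]kE//.
by rewrite mulrAC.
Qed.

Let bad_prob t tau a j : 0 <= t -> 0 < tau -> 8 <= a ->
  (P (bad t tau a j) <= (4 * expR (- (a ^+ 2 / 4)) / 2 ^+ j.+1)%:E)%E.
Proof.
move=> t0 tau0 a8; have a0 : 0 <= a by lra.
have mk k : measurable (bad1 t tau a j k) by exact: bad1_measurable.
apply: (@le_trans _ _ (\sum_(k < 2 ^ j) (2 * expR (- (a ^+ 2 / 4)) * (4^-1) ^+ j)%:E)%E).
  have := Boole_inequality P (A := bad1 t tau a j) (n := (2 ^ j)%N) (fun i _ => mk i).
  move=> /le_trans; apply; apply: lee_sum => k _.
  pose aj := a * (3 / 4) ^+ j * Num.sqrt (2 ^+ j).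
  have d0 : 0 <= t + dyad tau j k < t + dyad tau j k.+1.
    by rewrite addr_ge0 ?dyad_ge0 ?(ltW tau0)//= ltrD2l /dyad ltr_pM2r ?invr_gt0 ?exprn_gt0// ltr_pM2l// ltr_nat.
  have aj0 : 0 <= aj by rewrite /aj !mulr_ge0 ?sqrtr_ge0 ?exprn_ge0.
  have := increment_tail d0 aj0.
  have -> : aj * Num.sqrt (t + dyad tau j k.+1 - (t + dyad tau j k)) =
            a * (3 / 4) ^+ j * Num.sqrt tau.
    rewrite /aj -mulrA -sqrtrM ?exprn_ge0//; congr (_ * Num.sqrt _).
    rewrite /dyad -natr1; field; rewrite expf_neq0//.
  move=> /le_trans; apply; rewrite lee_fin -mulrA ler_pM2l//.
  have -> : aj ^+ 2 / 4 = a ^+ 2 / 4 * (9 / 8) ^+ j.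
    have -> : 9 / 8 = (3 / 4) ^+ 2 * 2 :> R by field.
    rewrite /aj 2!exprMn sqr_sqrtr ?exprn_ge0// [in RHS]exprMn -[in RHS]exprM mulnC.
    by rewrite [in RHS]exprM; move: ((3 / 4) ^+ j) (2 ^+ j) => x y; ring.
  (* By Bernoulli's inequality and [8 <= a], the exponent [a ^+ 2 / 4 * (9 / 8) ^+ j] exceeds
     [a ^+ 2 / 4] by at least 2j, and e^(-2j) is at most 4^(-j). *)
  have bern : 1 + j%:R / 8 <= (9 / 8) ^+ j :> R.
    have /(@bernoulli R _ j) : 0 <= 1 / 8 :> R by lra.
    by rewrite [1 + 1 / 8](_ : _ = 9 / 8) ?mul1r//; lra.
  have h1 : 16 * (j%:R / 8) <= a ^+ 2 / 4 * (j%:R / 8).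
    rewrite ler_wpM2r ?divr_ge0//; nra.
  have h2 : expR (- (a ^+ 2 / 4 * (9 / 8) ^+ j)) <= expR (- (a ^+ 2 / 4)) * expR (- (j%:R * 2)).
    rewrite -expRD ler_expR.
    have : a ^+ 2 / 4 * (1 + j%:R / 8) <= a ^+ 2 / 4 * (9 / 8) ^+ j.
      by rewrite ler_wpM2l// divr_ge0// sqr_ge0.
    rewrite mulrDr mulr1; lra.
  apply: (le_trans h2); rewrite ler_wpM2l ?expR_ge0//.
  rewrite -mulrN mulrC expRM_natr lerXn2r ?nnegrE ?expR_ge0//.
  rewrite expRN lef_pV2 ?posrE ?expR_gt0//.
  have : 2 <= expR 1 :> R by rewrite (le_trans _ (expR_ge1Dx 1))//; lra.
  have -> : 2 = 1 + 1 :> R by lra.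
  rewrite expRD; nra.
rewrite sumEFin lee_fin sumr_const card_ord -[leLHS]mulr_natr natrX.
have -> : (4^-1 : R) ^+ j = (2^-1) ^+ j * (2^-1) ^+ j by rewrite -exprMn; congr (_ ^+ _); field.
have -> : 4 * expR (- (a ^+ 2 / 4)) / 2 ^+ j.+1 = 2 * expR (- (a ^+ 2 / 4)) * (2^-1) ^+ j.
  have : 2 ^+ j != 0 :> R by rewrite expf_neq0.
  by rewrite [2 ^+ j.+1]exprS exprVn; move: (2 ^+ j) (expR _) => y e y0; field.
have : 2 ^+ j != 0 :> R by rewrite expf_neq0.
rewrite exprVn; move: (2 ^+ j) (expR _) => y e y0.
by rewrite le_eqVlt; apply/orP; left; apply/eqP; field.
Qed.

Lemma osc_prob t tau a : 0 <= t -> 0 < tau -> 8 <= a ->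
  (P (osc t tau (4 * a * Num.sqrt tau)) <= (4 * expR (- (a ^+ 2 / 4)))%:E)%E.
Proof.
move=> t0 tau0 a8; have a0 : 0 <= a by lra.
have mb j : measurable (bad t tau a j).
  by apply: bigsetU_measurable => k _; exact: bad1_measurable.
apply: (@le_trans _ _ (P (\bigcup_j bad t tau a j))).
  apply: le_measure; rewrite ?inE; [exact: measurable_osc_total|exact: bigcupT_measurable|].
  rewrite osc_dyadic// => w [j _ [k /= kj]]; rewrite /osc_at/= => xk.
  apply: contrapT => nb; have nb' i : ~ bad t tau a i w by move=> h; apply: nb; exists i.
  have := bad_bound t0 tau0 a0 nb' kj; rewrite leNgt => /negP; apply.
  apply: le_lt_trans xk; rewrite [leRHS](_ : _ = a * Num.sqrt tau * 4); last by ring.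
  by rewrite ler_wpM2l ?mulr_ge0 ?sqrtr_ge0// sum_geometric34.
apply: (le_trans (generalized_Boole_inequality P mb (bigcupT_measurable _ mb))).
apply: le_trans (epsilon_trick0 xpredT _); last by rewrite mulr_ge0 ?expR_ge0.
apply: lee_nneseries => j *; first exact: measure_ge0.
by rewrite natrX; exact: bad_prob.
Qed.

(** One controlled increment: [sgn] true means downwards, the size is comparable to the standard
    deviation, and the path does not stray in between. *)
Definition kick t tau (L : R) (sgn : bool) : set T :=
  [set w | Num.sqrt tau <= (-1) ^+ sgn * (B w (t + tau) - B w t) <= 3 * Num.sqrt tau]
  `&` ~` osc t tau (L * Num.sqrt tau).

Lemma measurable_kick t tau L sgn (F : set (set T)) : 0 <= t -> 0 < tau ->
  (forall s, t <= s <= t + tau ->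
    @measurable_fun _ _ (g_sigma_algebraType F) R setT (fun w => B w s - B w t)) ->
  <<s F>> (kick t tau L sgn).
Proof.
move=> t0 tau0 mB; apply: (@measurableI _ (g_sigma_algebraType F)); last first.
  by apply: (@measurableC _ (g_sigma_algebraType F)); exact: measurable_osc.
have mD : @measurable_fun _ _ (g_sigma_algebraType F) R setT
    (fun w => (-1) ^+ sgn * (B w (t + tau) - B w t)).
  apply: measurable_funM; first exact: measurable_cst.
  by apply: mB; rewrite lexx andbT lerDl ltW.
rewrite (_ : [set _ | _] = [set w | Num.sqrt tau <= (-1) ^+ sgn * (B w (t + tau) - B w t)]
  `&` [set w | (-1) ^+ sgn * (B w (t + tau) - B w t) <= 3 * Num.sqrt tau]).
  apply: (@measurableI _ (g_sigma_algebraType F)).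
    exact: (@measurable_set_ge _ _ (g_sigma_algebraType F)).
  exact: (@measurable_set_le _ _ (g_sigma_algebraType F)).
by apply/seteqP; split => w /=; [move=> /andP|move=> [-> ->]].
Qed.

Lemma kick_prob (a : R) t tau sgn : 0 <= t -> 0 < tau -> 8 <= a ->
  ((2 * (expR (- (9 / 2)) / Num.sqrt (2 * pi)) - 4 * expR (- (a ^+ 2 / 4)))%:E
   <= P (kick t tau (4 * a) sgn))%E.
Proof.
move=> t0 tau0 a8; pose st := Num.sqrt tau.
have st0 : 0 < st by rewrite sqrtr_gt0.
pose I := if sgn then `[- (3 * st), - st] else `[st, 3 * st].
pose X w := B w (t + tau) - B w t.
have lawX : has_law (U := R) P X (normal_prob 0 st).
  have tt : 0 <= t < t + tau by rewrite t0 ltrDl.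
  have tE : t + tau - t = tau by ring.
  by case: Bm => _ _ _ /(_ _ _ tt) + _; rewrite tE.
have mI : measurable [set` I] by rewrite /I; case: (sgn).
have mX := lawX.1.
have mXI : measurable (X @^-1` [set` I]) by rewrite -[X in measurable X]setTI; exact: mX.
have mO := measurable_osc_total (4 * a * st) t0 tau0.
have -> : kick t tau (4 * a) sgn = X @^-1` [set` I] `\` osc t tau (4 * a * st).
  apply/seteqP; split => w; rewrite /kick /I/=; case: (sgn); rewrite in_itv/= -/(X w) -/st;
    move=> [h1 h2]; split => //; move: h1; rewrite ?expr1 ?expr0 => /andP[? ?];
    by apply/andP; split; lra.
have fO : P (osc t tau (4 * a * st)) \is a fin_num by exact: fin_num_measure.
have fX : P (X @^-1` [set` I]) \is a fin_num by exact: fin_num_measure.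
have h1 : ((2 * (expR (- (9 / 2)) / Num.sqrt (2 * pi)))%:E <= P (X @^-1` [set` I]))%E.
  rewrite lawX.2// /I; case: (sgn).
    have := @normal_prob_itv_ge R st 3 (- (3 * st)) (- st) st0.
    have -> : (- st - - (3 * st)) / st = 2 by field; rewrite gt_eqF.
    rewrite (_ : 3 ^+ 2 = 9 :> R); last by ring.
    apply; first lra.
    by move=> x /andP[? ?]; rewrite ler_norml; apply/andP; split; lra.
  have := @normal_prob_itv_ge R st 3 st (3 * st) st0.
  have -> : (3 * st - st) / st = 2 by field; rewrite gt_eqF.
  rewrite (_ : 3 ^+ 2 = 9 :> R); last by ring.
  apply; first lra.
  by move=> x /andP[? ?]; rewrite ler_norml; apply/andP; split; lra.
have h2 := osc_prob t0 tau0 a8; rewrite -/st in h2.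
have e : P (X @^-1` [set` I] `\` osc t tau (4 * a * st)) =
    (P (X @^-1` [set` I]) - P (X @^-1` [set` I] `&` osc t tau (4 * a * st)))%E.
  by apply: measureD => //; rewrite ltey_eq fX.
rewrite e EFinB; apply: leeB => //; apply: le_trans h2.
by apply: le_measure; rewrite ?inE//; exact: measurableI.
Qed.

End oscillation.

Lemma kick_prob_gt0 (R : realType) : exists L p : R, [/\ 0 < L, 0 < p &
  forall (d : measure_display) (T : measurableType d) (P : probability T R)
    (B : T -> R -> R), brownian P B ->
  forall t tau sgn, 0 <= t -> 0 < tau -> (p%:E <= P (kick B t tau L sgn))%E].
Proof.
pose q : R := 2 * (expR (- (9 / 2)) / Num.sqrt (2 * pi)).
have q0 : 0 < q.
  by rewrite mulr_gt0// divr_gt0 ?expR_gt0// sqrtr_gt0 mulr_gt0// pi_gt0.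
(* The first 8 is required by [osc_prob]; the term [8 / q] brings the oscillation probability down
   to at most half of [q]. *)
pose a := 8 + 8 / q; have q8 : 0 < 8 / q by rewrite divr_gt0.
exists (4 * a), (q / 2); split; [rewrite /a; lra|lra|].
move=> d T P B Bm t tau sgn t0 tau0.
have a8 : 8 <= a by rewrite /a; lra.
apply: le_trans (kick_prob Bm sgn t0 tau0 a8); rewrite lee_fin -/q.
suff : expR (- (a ^+ 2 / 4)) <= q / 8 by lra.
rewrite expRN invf_ple ?posrE ?expR_gt0 ?divr_gt0// invf_div.
apply: le_trans (expR_ge1Dx _); have : 8 * a <= a ^+ 2 by rewrite expr2 ler_wpM2r//; lra.
rewrite /a; lra.
Qed.

Section clamp.
Context {R : realType}.
Implicit Types a b x : R.

(** Composing with this retraction extends a function that is continuous within a segment to a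
    continuous function on the line. *)
Definition clamp a b x := Num.max a (Num.min b x).

Lemma clamp_itv a b x : a <= b -> `[a, b]%classic (clamp a b x).
Proof.
by move=> ab; rewrite /= in_itv/= /clamp le_max lexx ge_max ab ge_min lexx.
Qed.

Lemma clamp_id a b x : a <= x <= b -> clamp a b x = x.
Proof. by move=> /andP[ax xb]; rewrite /clamp min_r// max_r. Qed.

Lemma continuous_clamp a b : continuous (clamp a b).
Proof.
move=> x; apply: continuous_max; first exact: cvg_cst.
by apply: continuous_min; [exact: cvg_cst|exact: cvg_id].
Qed.

Lemma continuous_clamp_comp a b (f : R -> R) : a <= b ->
  {within `[a, b], continuous f} -> continuous (f \o clamp a b).
Proof.
move=> ab cf; apply: continuous_within_comp cf _ _; first exact: continuous_clamp.
by move=> x; exact: clamp_itv.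
Qed.

End clamp.

(** * Joint measurability and parametric integrals *)

Section joint_measurability.
Context {R : realType} {d : measure_display} {X : measurableType d}.

(** Rounding the time down to multiples of 2^(-r) leaves countably many values, each with a
    measurable section; continuity in time passes to the limit. *)
Lemma measurable_caratheodory_fun (g : X -> R -> R) :
  (forall s, measurable_fun setT (g ^~ s)) -> (forall w, continuous (g w)) ->
  measurable_fun setT (fun p : X * R => g p.1 p.2).
Proof.
move=> mg cg.
pose u (r : nat) (s : R) : R := (Num.floor (s * 2 ^+ r))%:~R / 2 ^+ r.
have uP r s : u r s <= s < u r s + 2^-1 ^+ r.
  have p0 : 0 < 2 ^+ r :> R by rewrite exprn_gt0.
  have /andP[f1 f2] := floor_itv (s * 2 ^+ r).
  rewrite /u ler_pdivrMr// f1/= exprVn -[X in _ + X]mul1r -mulrDl ltr_pdivlMr//.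
  by rewrite (lt_le_trans f2)// intrD.
apply: (@measurable_fun_cvg _ _ _ setT (fun r (p : X * R) => g p.1 (u r p.2))); last first.
  move=> [w s] _ /=; apply: (@cvg_comp _ _ _ (u ^~ s) (g w) \oo (nbhs s)); last exact: cg.
  apply: (@squeeze_cvgr _ _ _ _ (fun r => s - 2^-1 ^+ r) (fun=> s)).
  - near=> r; have /andP[a b] := uP r s.
    by rewrite a andbT lerBlDr ltW.
  - rewrite -[X in _ --> X]subr0; apply: cvgB; first exact: cvg_cst.
    by apply: cvg_expr; rewrite ger0_norm//; lra.
  - exact: cvg_cst.
move=> r _ A mA; rewrite setTI.
rewrite (_ : _ @^-1` A = \bigcup_(q : rat)
   ((g ^~ (ratr q)) @^-1` A `*` [set s | u r s = ratr q])).
  apply: bigcupT_measurable_rat => q; apply: measurableX.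
    by rewrite -[X in measurable X]setTI; exact: mg.
  have mf : measurable_fun setT (fun s : R => (Num.floor s)%:~R : R).
    apply: nondecreasing_measurable => // x y xy.
    rewrite ler_int floor_ge_int; apply: le_trans xy.
    by have /andP[] := floor_itv x.
  have mur : measurable_fun setT (u r).
    rewrite /u; apply: measurable_funM; last exact: measurable_cst.
    by apply: (measurableT_comp mf); exact: measurable_funM.
  by have := mur measurableT [set ratr q] (measurable_set1 _); rewrite setTI.
apply/seteqP; split => [[w s] /= Ag|[w s] [q _ [/= Ag us]]].
  exists ((Num.floor (s * 2 ^+ r))%:~R / 2 ^+ r) => //=.
  by rewrite fmorph_div/= ratr_int rmorphXn/= ratr_nat.
by rewrite /= us.
Unshelve. all: by end_near. Qed.

Context {e : measure_display} {Y : measurableType e}.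
Variable mu : {sigma_finite_measure set Y -> \bar R}.

(** Positive and negative parts are handled separately by Tonelli, and [fine] of their difference is
    the real integral. *)
Lemma measurable_param_integral (D : set Y) (f : X -> Y -> R) : measurable D ->
  measurable_fun setT (fun p : X * Y => f p.1 p.2) ->
  measurable_fun setT (fun x => \int[mu]_(y in D) f x y).
Proof.
move=> mD mf.
have m1 : measurable_fun setT (fun p : X * Y => (f p.1 p.2 * \1_D p.2)%:E).
  apply/measurable_EFinP; apply: measurable_funM => //.
  by apply: measurableT_comp => //; exact: measurable_indic.
pose F (x : X) := (\int[mu]_y (f x y * \1_D y)%:E)%E.
suff mF : measurable_fun setT F.
  rewrite (_ : (fun x => _) = fine \o F).
    by apply: measurableT_comp => //; exact: fine_measurable.
  apply/funext => x /=; rewrite /Rintegral /F; congr fine.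
  rewrite [LHS]integral_mkcond; apply: eq_integral => y _.
  by rewrite patchE indicE; case: (y \in D); rewrite ?mulr1 ?mulr0.
pose fp (p : X * Y) := (f p.1 p.2 * \1_D p.2)%:E.
have -> : F = fun x => (fubini_F mu (fp^\+) x - fubini_F mu (fp^\-) x)%E.
  apply/funext => x; rewrite /F integralE /fubini_F /=.
  by congr (_ - _)%E; apply: eq_integral => y _; rewrite ?funeposE ?funenegE.
apply: emeasurable_funB.
  apply: measurable_fun_fubini_tonelli_F; first exact: measurable_funepos.
  by move=> z; exact: funepos_ge0.
apply: measurable_fun_fubini_tonelli_F; first exact: measurable_funeneg.
by move=> z; exact: funeneg_ge0.
Qed.

End joint_measurability.

(** * Regularity and measurability of iterated integrals *)

Section iterated_integral.
Context {R : realType}.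
Implicit Types (f : R -> R) (M : R).
Local Notation mu := (@lebesgue_measure R).

Lemma within_integrable f M t : {within `[0, M], continuous f} -> t <= M ->
  mu.-integrable `[0, t] (EFin \o f).
Proof.
move=> cf tM; apply: continuous_compact_integrable; first exact: segment_compact.
apply: continuous_subspaceW cf => x /=; rewrite !in_itv/= => /andP[-> xt].
exact: le_trans tM.
Qed.

Lemma iter_int_regular f M : 0 < M -> {within `[0, M], continuous f} -> forall l,
  {within `[0, M], continuous iter_int l f} /\
  forall t, 0 < t < M -> is_derive t 1 (iter_int l.+1 f) (iter_int l f t).
Proof.
move=> M0 cf.
have step g : {within `[0, M], continuous g} -> forall t, 0 < t < M ->
    is_derive t 1 (fun t => \int[mu]_(s in `[0, t]) g s) (g t).
  move=> cg t /andP[t0 tM].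
  have ct : {for t, continuous g}.
    have /(continuous_within_itvP _ M0)[+ _ _] := cg; apply.
    by rewrite in_itv/= t0.
  have := @continuous_FTC1 R g (BLeft 0) t M tM (within_integrable cg (lexx _)).
  by move=> /(_ t0 ct)[h1 <-]; rewrite derive1E; exact: DeriveDef.
elim=> [|l [ih1 ih2]]; first by split => //=; exact: step.
have c1 : {within `[0, M], continuous (iter_int l.+1 f)}.
  apply: parameterized_integral_continuous => //; first exact: ltW.
  exact: within_integrable ih1 (lexx _).
by split => //; exact: step c1.
Qed.

Lemma measurable_iter_int {d} {T : measurableType d} (f : T -> R -> R) M :
  0 < M -> (forall t, 0 <= t <= M -> measurable_fun setT (f ^~ t)) ->
  (forall w, {within `[0, M], continuous (f w)}) ->
  forall l t, 0 <= t <= M -> measurable_fun setT (fun w => iter_int l (f w) t).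
Proof.
move=> M0 mf cf; elim=> [|l ih] t t0; first exact: mf.
have M0' := ltW M0.
pose g (w : T) (s : R) := iter_int l (f w) (clamp 0 M s).
have mg : measurable_fun setT (fun p : T * R => g p.1 p.2).
  apply: measurable_caratheodory_fun => [s|w].
    by apply: ih; have := clamp_itv s M0'; rewrite /= in_itv.
  by apply: continuous_clamp_comp => //; have [] := iter_int_regular M0 (cf w) l.
have := @measurable_param_integral R _ T _ _ (@lebesgue_measure R) `[0, t] g (measurable_itv _) mg.
congr (measurable_fun _ _); apply/funext => w; apply: eq_Rintegral => s.
rewrite inE/= in_itv/= => /andP[s0 st]; rewrite /g clamp_id// s0/=.
by rewrite (le_trans st)//; case/andP: t0.
Qed.

End iterated_integral.

(** * Small balls by steering *)

Section real_derivatives.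
Context {R : realType}.
Implicit Types (f g : R -> R) (x a b c : R).

Lemma deriv_cst c x : is_derive x 1 (fun=> c) 0.
Proof. exact: is_derive_cst. Qed.

Lemma deriv_id x : is_derive x 1 (fun y : R => y) 1.
Proof. exact: is_derive_id. Qed.

Lemma deriv_add f g x a b : is_derive x 1 f a -> is_derive x 1 g b ->
  is_derive x 1 (fun y => f y + g y) (a + b).
Proof. by move=> ? ?; exact: is_deriveD. Qed.

Lemma deriv_sub f g x a b : is_derive x 1 f a -> is_derive x 1 g b ->
  is_derive x 1 (fun y => f y - g y) (a - b).
Proof. by move=> ? ?; exact: is_deriveB. Qed.

Lemma deriv_mul f g x a b : is_derive x 1 f a -> is_derive x 1 g b ->
  is_derive x 1 (fun y => f y * g y) (a * g x + f x * b).
Proof.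
move=> ha hb; have h := is_deriveM ha hb.
by apply: (is_derive_eq h); rewrite /GRing.scale/= addrC [g x * a]mulrC.
Qed.

Lemma deriv_scale c f x a : is_derive x 1 f a -> is_derive x 1 (fun y => c * f y) (c * a).
Proof.
move=> ha; have h := deriv_mul (deriv_cst c x) ha.
by apply: (is_derive_eq h); rewrite mul0r add0r.
Qed.

Lemma deriv_compose f g x a b : is_derive (g x) 1 f a -> is_derive x 1 g b ->
  is_derive x 1 (fun y => f (g y)) (a * b).
Proof. by move=> ha hb; exact: is_derive1_comp. Qed.

Lemma deriv_exp f x a : is_derive x 1 f a ->
  is_derive x 1 (fun y => expR (f y)) (expR (f x) * a).
Proof. by move=> ha; apply: deriv_compose => //; exact: is_derive_expR. Qed.

Lemma deriv_pow n x : is_derive x 1 (fun y => y ^+ n.+1) (n.+1%:R * x ^+ n).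
Proof.
elim: n => [|n ih].
  by rewrite expr0 mulr1; exact: deriv_id.
have h := deriv_mul (deriv_id x) ih.
rewrite (_ : (fun y => y ^+ n.+2) = fun y => y * y ^+ n.+1); last first.
  by apply/funext => y; rewrite exprS.
apply: (is_derive_eq h); rewrite mul1r mulrCA -exprS -[n.+2%:R]natr1; ring.
Qed.

End real_derivatives.

(** * Deterministic steering of a relaxation chain *)

Section sliding_mode.
Context {R : realType}.
Implicit Types (S del t s : R) (e : nat -> R -> R) (N l : nat).

(* e is the output of the relaxation equation del e' + e = f, so (F - e) exp(t / del) is
   nondecreasing. *)
Lemma relax_bound_above S del (F : R) (e f : R -> R) : 0 < del ->
  (forall t, 0 < t < S -> is_derive t 1 e ((f t - e t) / del)) ->
  {within `[0, S], continuous e} ->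
  (forall t, 0 <= t <= S -> f t <= F) -> e 0 <= F ->
  forall t, 0 <= t <= S -> e t <= F.
Proof.
move=> del0 de ce fF e0 t /andP[t0 tS].
pose g u := (F - e u) * expR (u / del).
pose dg u := (F - f u) / del * expR (u / del).
have [||c] := @MVT_segment R g dg 0 t t0.
- move=> u; rewrite in_itv/= => /andP[u0 ut].
  have uS : 0 < u < S by rewrite u0 (lt_le_trans ut).
  have := de u uS => deu.
  have h := deriv_mul (deriv_sub (deriv_cst F u) deu)
    (deriv_exp (deriv_mul (deriv_id u) (deriv_cst del^-1 u))).
  by apply: (is_derive_eq h); rewrite /dg; field; rewrite gt_eqF.
- have ct : {within `[0, t], continuous e}.
    apply: continuous_subspaceW ce => x /=; rewrite !in_itv/= => /andP[-> xt].
    exact: le_trans tS.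
  move=> x; apply: cvgM.
    by apply: cvgB; [exact: cvg_cst|exact: ct].
  apply: continuous_subspaceT => y.
  apply: (@cvg_comp _ _ _ (fun u => u / del) expR _ (nbhs (y / del))).
    by apply: cvgMl; exact: cvg_id.
  exact: continuous_expR.
- rewrite in_itv/= => /andP[c0 ct]; rewrite subr0 => gE.
  have dg0 : 0 <= dg c.
    rewrite /dg mulr_ge0 ?expR_ge0// divr_ge0 ?(ltW del0)// subr_ge0 fF//.
    by rewrite c0 (le_trans ct).
  have : 0 <= g t.
    have -> : g t = g 0 + dg c * t by rewrite -gE addrC subrK.
    by rewrite addr_ge0 ?(mulr_ge0 dg0)// /g mulr_ge0 ?expR_ge0// subr_ge0.
  by rewrite /g pmulr_lge0 ?expR_gt0// subr_ge0.
Qed.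

Lemma relax_bound S del (F : R) (e f : R -> R) : 0 < del ->
  (forall t, 0 < t < S -> is_derive t 1 e ((f t - e t) / del)) ->
  {within `[0, S], continuous e} ->
  (forall t, 0 <= t <= S -> `|f t| <= F) -> `|e 0| <= F ->
  forall t, 0 <= t <= S -> `|e t| <= F.
Proof.
move=> del0 de ce fF e0 t tS; rewrite ler_norml; apply/andP; split.
  rewrite lerNl; apply: (@relax_bound_above S del F (\- e) (\- f)) => //.
  - move=> u uS; have deu := de u uS.
    have h := deriv_sub (deriv_cst 0 u) deu.
    rewrite (_ : \- e = fun y => 0 - e y); last by apply/funext => y; rewrite sub0r.
    by apply: (is_derive_eq h); rewrite /=; field; rewrite gt_eqF.
  - by move=> x; apply: cvgN; exact: ce.
  - by move=> u uS /=; have := fF u uS; rewrite ler_norml lerNl => /andP[].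
  - by move: e0; rewrite ler_norml /= lerNl => /andP[].
apply: (@relax_bound_above S del F e f) => //.
- by move=> u uS /=; have := fF u uS; rewrite ler_norml => /andP[].
- by move: e0; rewrite ler_norml => /andP[].
Qed.

(* [comb N e] is the jet of [(1 + D)^N e_0] when [e] is the sequence of the
   successive derivatives of [e_0]. *)
Fixpoint comb N e : R -> R :=
  if N is N'.+1 then comb N' (fun l t => e l t + e l.+1 t) else e 0%N.

Lemma comb_bound N e t (b : R) : (forall l, (l <= N)%N -> `|e l t| <= b) ->
  `|comb N e t| <= 2 ^+ N * b.
Proof.
elim: N e b => [|N ih] e b h /=; first by rewrite expr0 mul1r; exact: h.
rewrite exprSr -mulrA; apply: ih => l lN.
by rewrite (le_trans (ler_normD _ _))// mulr_natl mulr2n lerD// h// leqW.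
Qed.

(** The coefficients of [comb] are binomial: that of [e N] is 1, and the others add up to 2^N -
    1. *)
Lemma comb_increment N e s t (k : R) :
  (forall l, (l < N)%N -> `|e l t - e l s| <= k) ->
  `|(comb N e t - comb N e s) - (e N t - e N s)| <= (2 ^+ N - 1) * k.
Proof.
elim: N e k => [|N ih] e k h /=.
  by rewrite subrr normr0 expr0 subrr mul0r.
have h2 l : (l < N)%N -> `|(e l t + e l.+1 t) - (e l s + e l.+1 s)| <= 2 * k.
  move=> lN; have -> : e l t + e l.+1 t - (e l s + e l.+1 s) =
    (e l t - e l s) + (e l.+1 t - e l.+1 s) by ring.
  by rewrite (le_trans (ler_normD _ _))// mulr_natl mulr2n lerD// h// ltnW.
have := ih (fun l u => e l u + e l.+1 u) _ h2; set A := comb N _ t - comb N _ s => hA.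
have := h N (ltnSn N) => hN.
have -> : A - (e N.+1 t - e N.+1 s) =
   (A - (e N t + e N.+1 t - (e N s + e N.+1 s))) + (e N t - e N s) by ring.
rewrite (le_trans (ler_normD _ _))// exprS; move: hA hN; lra.
Qed.

(** The sequence f_l = e_l + e_(l+1) is again such a chain, one order shorter and with the same
    [comb]. Since del e_0' = f_0 - e_0, the relaxation bound controls e_0, and e_(l+1) = f_l - e_l
    at most doubles the bound from one order to the next. *)
Lemma chain_bound del S N e (Y : R) : 0 < del ->
  (forall l, (l < N)%N -> forall t, 0 < t < S -> is_derive t 1 (e l) (e l.+1 t / del)) ->
  (forall l, (l <= N)%N -> {within `[0, S], continuous e l}) ->
  (forall l, (l <= N)%N -> `|e l 0| * 2 ^+ N <= Y) ->
  (forall t, 0 <= t <= S -> `|comb N e t| <= Y) ->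
  forall l, (l <= N)%N -> forall t, 0 <= t <= S -> `|e l t| <= 2 ^+ l * Y.
Proof.
move=> del0; elim: N e => [|N ih] e de ce e0 cY l.
  by rewrite leqn0 => /eqP -> t tS; rewrite expr0 mul1r; exact: cY.
pose f l t := e l t + e l.+1 t.
have fb : forall l, (l <= N)%N -> forall t, 0 <= t <= S -> `|f l t| <= 2 ^+ l * Y.
  apply: ih => //.
  - move=> k kN t tS; have d1 := de k (leqW kN) t tS.
    have d2 := de k.+1 kN t tS.
    apply: (is_derive_eq (deriv_add d1 d2)); rewrite /f; field; rewrite gt_eqF//.
  - by move=> k kN x; apply: cvgD; apply: ce => //; exact: leqW.
  - move=> k kN; have := e0 k (leqW kN); have := e0 k.+1 kN.
    rewrite exprS => h1 h2; have h3 := ler_normD (e k 0) (e k.+1 0).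
    have p0 : 0 < 2 ^+ N :> R by rewrite exprn_gt0.
    apply: (@le_trans _ _ ((`|e k 0| + `|e k.+1 0|) * 2 ^+ N)).
      by rewrite ler_pM2r.
    move: h1 h2; rewrite mulrDl; lra.
elim: l => [_|l ihl lN] t tS.
  rewrite expr0 mul1r; apply: (@relax_bound S del Y (e 0%N) (f 0%N)) => //.
  - move=> u uS; have du := de 0%N isT u uS.
    by rewrite /f addrAC subrr add0r.
  - exact: ce.
  - by move=> u uS; have := fb 0%N isT u uS; rewrite expr0 mul1r.
  - apply: le_trans (e0 0%N isT); rewrite ler_peMr// exprn_ege1//; lra.
have h1 := fb l lN t tS; have h2 := ihl (ltnW lN) t tS.
have -> : e l.+1 t = f l t - e l t by rewrite /f; ring.
by rewrite (le_trans (ler_normB _ _))// exprS; move: h1 h2; lra.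
Qed.

(** Put D = del^N sqrt(tau). On each step the combination y = [comb N e] follows del^N b up to D. A
    push of size between D and 3D against the sign of y, blurred by D, maps [-4D, 4D] into itself;
    inside a step y moves by at most (L + 1) D, so it stays below (5 + L) D throughout. *)
Lemma steering del (tau L Lam : R) (J : nat) N e (b r : R -> R) :
  0 < del -> 0 < tau -> 0 <= L -> 0 <= Lam ->
  let S := J%:R * tau in let sig := Num.sqrt tau in
  (forall l, (l < N)%N -> forall t, 0 < t < S -> is_derive t 1 (e l) (e l.+1 t / del)) ->
  (forall l, (l <= N)%N -> {within `[0, S], continuous e l}) ->
  (forall t, e N t = del ^+ N * b t - r t) ->
  (forall s t, 0 <= s <= S -> 0 <= t <= S -> `|r t - r s| <= Lam * `|t - s|) ->
  4 ^+ N * (4 * (5 + L)) * tau <= del -> Lam * sig <= del ^+ N / 2 ->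
  (forall l, (l <= N)%N -> `|e l 0| * 2 ^+ N <= 4 * (del ^+ N * sig)) ->
  (forall j, (j < J)%N ->
    (forall s, j%:R * tau <= s <= j.+1%:R * tau -> `|b s - b (j%:R * tau)| <= L * sig) /\
    sig <= (-1) ^+ (0 < comb N e (j%:R * tau))%R *
             (b (j.+1%:R * tau) - b (j%:R * tau)) <= 3 * sig) ->
  forall l t, (l <= N)%N -> 0 <= t <= S -> `|e l t| <= 2 ^+ N * ((5 + L) * (del ^+ N * sig)).
Proof.
move=> del0 tau0 L0 Lam0 S sig de ce eN rL c1 c2 e0 hb.
pose D := del ^+ N * sig.
have sig0 : 0 < sig by rewrite sqrtr_gt0.
have dN0 : 0 < del ^+ N by rewrite exprn_gt0.
have D0 : 0 < D by rewrite mulr_gt0.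
have sig2 : sig * sig = tau by rewrite -expr2 sqr_sqrtr// ltW.
pose Y := (5 + L) * D.
have YD : 4 * D <= Y by rewrite /Y ler_pM2r//; lra.
have Y0 : 0 < Y by rewrite (lt_le_trans _ YD)// mulr_gt0.
have p2 : 1 <= 2 ^+ N :> R by rewrite exprn_ege1//; lra.
have p20 : 0 < 2 ^+ N :> R by rewrite exprn_gt0.
have p4 : 4 ^+ N = 2 ^+ N * 2 ^+ N :> R by rewrite -exprMn; congr (_ ^+ _); ring.
(* The comparison of [tau] with [del] makes the orders below [N] nearly constant during a step:
   their contribution to the change of [comb N e] is at most D / 2. The other D / 2 is left for the
   drift [r]. *)
have ratio : 2 ^+ N * (tau / del * (2 * (2 ^+ N * Y))) <= D / 2.
  have -> : 2 ^+ N * (tau / del * (2 * (2 ^+ N * Y))) =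
     (4 ^+ N * (4 * (5 + L)) * tau / del) * (D / 2).
    by rewrite p4 /Y; field; rewrite gt_eqF.
  by rewrite ler_piMl ?divr_ge0 ?(ltW D0)// ler_pdivrMr// mul1r.
have q0 : 0 <= tau / del * (2 * (2 ^+ N * Y)).
  by apply: mulr_ge0; [by rewrite divr_ge0 ?(ltW tau0) ?(ltW del0)|apply: mulr_ge0 => //; apply: mulr_ge0; exact: ltW].
have rat2 : tau / del * (2 * (2 ^+ N * Y)) <= D / 2.
  by apply: le_trans ratio; rewrite ler_peMl.
have e0' l : (l <= N)%N -> `|e l 0| * 2 ^+ N <= Y.
  by move=> lN; rewrite (le_trans (e0 l lN)).
suff H : forall j, (j <= J)%N ->
    (forall t, 0 <= t <= j%:R * tau -> `|comb N e t| <= Y) /\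
    `|comb N e (j%:R * tau)| <= 4 * D.
  move=> l t lN tS; apply: (@le_trans _ _ (2 ^+ l * Y)).
    by apply: (chain_bound del0 de ce e0' (H J (leqnn _)).1).
  by rewrite ler_pM2r// ler_weXn2l//; lra.
elim=> [_|j ih jJ].
  rewrite mul0r; have h0 : `|comb N e 0| <= 4 * D.
    apply: (le_trans (comb_bound (b := 4 * D / 2 ^+ N) _)).
      by move=> l lN; rewrite ler_pdivlMr//; exact: e0.
    by rewrite mulrC divfK// gt_eqF.
  split=> // t /andP[t0 t0']; have -> : t = 0 by apply/le_anti; rewrite t0' t0.
  exact: le_trans YD.
have [ih1 ih2] := ih (ltnW jJ).
set t0 := j%:R * tau in ih1 ih2 *.
have t00 : 0 <= t0 by rewrite mulr_ge0// ltW.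
have t1E : j.+1%:R * tau = t0 + tau by rewrite -natr1 mulrDl mul1r.
have t1S : t0 + tau <= S by rewrite -t1E ler_pM2r// ler_nat.
have t0S : t0 <= S by rewrite (le_trans _ t1S)// lerDl ltW.
have [ob kb] := hb j jJ; rewrite -/t0 t1E in ob kb *.
have etop l : (l <= N)%N -> `|e l t0| <= 2 ^+ N * Y.
  move=> lN; apply: (@le_trans _ _ (2 ^+ l * Y)).
    apply: (@chain_bound del t0 N e Y) => //.
    - by move=> k kN t /andP[h1 h2]; apply: de => //; rewrite h1 (lt_le_trans h2).
    - move=> k kN; apply: continuous_subspaceW (ce k kN) => x /=.
      by rewrite !in_itv/= => /andP[-> xt]; exact: le_trans t0S.
    - by rewrite t00 lexx.
  by rewrite ler_pM2r// ler_weXn2l//; lra.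
have dN s : t0 <= s <= t0 + tau -> `|(e N s - e N t0) - del ^+ N * (b s - b t0)| <= D / 2.
  move=> /andP[s1 s2]; rewrite !eN.
  have -> : del ^+ N * b s - r s - (del ^+ N * b t0 - r t0) - del ^+ N * (b s - b t0) =
    - (r s - r t0) by ring.
  rewrite normrN; apply: (@le_trans _ _ (Lam * `|s - t0|)).
    by apply: rL; [rewrite t00|rewrite (le_trans t00)//= (le_trans s2)].
  apply: (@le_trans _ _ (Lam * tau)).
    by rewrite ler_wpM2l// ger0_norm ?subr_ge0// lerBlDl.
  by rewrite -sig2 mulrA (le_trans (ler_wpM2r (ltW sig0) c2))// /D mulrAC.
(* From the top order downwards: over a step of length [tau], order l changes by at most [tau / del]
   times a bound on order l + 1, so the bound known at [t0] at most doubles. *)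
have eb i : (i <= N)%N -> forall s, t0 <= s <= t0 + tau ->
    `|e (N - i)%N s| <= 2 * (2 ^+ N * Y).
  elim: i => [_|i ihi iN] s ss.
    rewrite subn0.
    have -> : e N s = e N t0 + (((e N s - e N t0) - del ^+ N * (b s - b t0)) +
       del ^+ N * (b s - b t0)) by ring.
    rewrite (le_trans (ler_normD _ _))// mulrDl mul1r lerD ?etop//.
    apply: (@le_trans _ _ Y); last by rewrite ler_peMl// ltW.
    rewrite (le_trans (ler_normD _ _))//.
    have h2 : `|del ^+ N * (b s - b t0)| <= L * D.
      rewrite normrM gtr0_norm// /D mulrCA ler_pM2l//; exact: ob.
    by have h1 := dN s ss; rewrite /Y; move: h1 h2 D0; lra.
  have Ni : (N - i)%N = (N - i.+1).+1 by rewrite subnSK.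
  have lN : (N - i.+1 < N)%N by rewrite ltn_subrL/= (leq_trans _ iN).
  have [s1 s2] := andP ss.
  have [||c] := @MVT_segment R (e (N - i.+1)%N) (fun t => e (N - i)%N t / del) t0 s s1.
  - move=> x; rewrite in_itv/= => /andP[x1 x2]; rewrite Ni; apply: de => //.
    by rewrite (le_lt_trans t00)//= (lt_le_trans x2)// (le_trans s2).
  - apply: continuous_subspaceW (ce _ (ltnW lN)) => x /=.
    rewrite !in_itv/= => /andP[x1 x2].
    by rewrite (le_trans t00)//= (le_trans x2)// (le_trans s2).
  rewrite in_itv/= => /andP[c1' c2'] Ec.
  have -> : e (N - i.+1)%N s = e (N - i.+1)%N t0 + e (N - i)%N c / del * (s - t0).
    by rewrite -Ec addrC subrK.
  rewrite (le_trans (ler_normD _ _))// mulrDl mul1r lerD ?etop ?leq_subr//.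
  have hc := ihi (ltnW iN) c; rewrite c1' (le_trans c2' s2) in hc.
  have {}hc := hc isT.
  apply: (@le_trans _ _ (tau / del * (2 * (2 ^+ N * Y)))).
    rewrite !normrM (gtr0_norm (x := del^-1)) ?invr_gt0// (ger0_norm (x := s - t0)) ?subr_ge0//.
    rewrite [X in X <= _](_ : _ = (s - t0) * `|e (N - i)%N c| / del); last by ring.
    rewrite [X in _ <= X](_ : _ = tau * (2 * (2 ^+ N * Y)) / del); last by ring.
    by rewrite ler_pM2r ?invr_gt0// ler_pM ?subr_ge0// lerBlDl.
  apply: (le_trans rat2); rewrite (@le_trans _ _ Y)//; last by rewrite ler_peMl// ltW.
  by move: YD D0; lra.
have inc s l : t0 <= s <= t0 + tau -> (l < N)%N ->
    `|e l s - e l t0| <= tau / del * (2 * (2 ^+ N * Y)).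
  move=> ss lN; have [s1 s2] := andP ss.
  have [||c] := @MVT_segment R (e l) (fun t => e l.+1 t / del) t0 s s1.
  - move=> x; rewrite in_itv/= => /andP[x1 x2]; apply: de => //.
    by rewrite (le_lt_trans t00)//= (lt_le_trans x2)// (le_trans s2).
  - apply: continuous_subspaceW (ce _ (ltnW lN)) => x /=.
    rewrite !in_itv/= => /andP[x1 x2].
    by rewrite (le_trans t00)//= (le_trans x2)// (le_trans s2).
  rewrite in_itv/= => /andP[c1' c2'] ->.
  have hc : `|e l.+1 c| <= 2 * (2 ^+ N * Y).
    have := @eb (N - l.+1)%N (leq_subr _ _) c; rewrite subKn//; apply.
    by rewrite c1' (le_trans c2').
  rewrite !normrM (gtr0_norm (x := del^-1)) ?invr_gt0// (ger0_norm (x := s - t0)) ?subr_ge0//.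
  rewrite [X in X <= _](_ : _ = (s - t0) * `|e l.+1 c| / del); last by ring.
  rewrite [X in _ <= X](_ : _ = tau * (2 * (2 ^+ N * Y)) / del); last by ring.
  by rewrite ler_pM2r ?invr_gt0// ler_pM ?subr_ge0// lerBlDl.
have dcomb s : t0 <= s <= t0 + tau ->
    `|(comb N e s - comb N e t0) - del ^+ N * (b s - b t0)| <= D.
  move=> ss; have h1 := dN s ss.
  have h2 := comb_increment (fun l lN => inc s l ss lN).
  have h3 : (2 ^+ N - 1) * (tau / del * (2 * (2 ^+ N * Y))) <= D / 2.
    by apply: le_trans ratio; rewrite ler_wpM2r ?gerBl.
  have -> : (comb N e s - comb N e t0) - del ^+ N * (b s - b t0) =
     ((comb N e s - comb N e t0) - (e N s - e N t0)) +
     ((e N s - e N t0) - del ^+ N * (b s - b t0)) by ring.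
  by rewrite (le_trans (ler_normD _ _))//; move: h1 h2 h3; lra.
have bD s : t0 <= s <= t0 + tau -> `|del ^+ N * (b s - b t0)| <= L * D.
  by move=> ss; rewrite normrM gtr0_norm// /D mulrCA ler_pM2l//; exact: ob.
split.
  move=> t /andP[tge0 tt]; have [tt0|tt0] := leP t t0; first by apply: ih1; rewrite tge0.
  have ss : t0 <= t <= t0 + tau by rewrite (ltW tt0).
  have := dcomb t ss; have := bD t ss; move: ih2.
  rewrite !ler_norml /Y => /andP[? ?] /andP[? ?] /andP[? ?].
  by apply/andP; split; lra.
have ss : t0 <= t0 + tau <= t0 + tau by rewrite lexx andbT lerDl ltW.
have := dcomb _ ss; move: ih2 kb; set y0 := comb N e t0; set y1 := comb N e _.
set db := b _ - b _.
have hd : forall x : bool, sig <= (-1) ^+ x * db <= 3 * sig ->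
    D <= (-1) ^+ x * (del ^+ N * db) <= 3 * D.
  move=> x /andP[h1 h2]; rewrite mulrCA /D; apply/andP; split.
    by rewrite ler_pM2l.
  by rewrite [leRHS]mulrCA ler_pM2l.
(* A value in ]0, 4D] changes by an amount in [-4D, 0], and one in [-4D, 0] by an amount in
   [0, 4D]. *)
move=> + /hd; case: ltP => y0s; rewrite ?expr1 ?expr0 !ler_norml;
  move=> /andP[? ?] /andP[? ?] /andP[? ?]; apply/andP; split; lra.
Qed.

End sliding_mode.

(** * Derivatives of integrated Brownian paths *)

Section jets.
Context {R : realType}.
Implicit Types (b : R -> R) (x : nat -> R) (N l : nat) (t : R).

(** Derivative of order [l] of the released path, for [l <= N], with time starting at 0 instead of
    -1; at the top order it is the Brownian path plus a constant. *)
Definition jet N b x l t : R :=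
  iter_int (N - l) b t + \sum_(i < (N - l).+1) x (l + i)%N * (t ^+ i / i`!%:R).

Lemma ibm_path_jet N b x t : ibm_path N b x t = jet N b x 0 (t + 1).
Proof. by rewrite /ibm_path /jet subn0. Qed.

Lemma jet_top N b x t : jet N b x N t = b t + x N.
Proof. by rewrite /jet subnn /= big_ord1 addn0 expr0 fact0 divr1 mulr1. Qed.

Lemma jet0 N b x l : (l <= N)%N -> b 0 = 0 -> jet N b x l 0 = x l.
Proof.
move=> lN b0; rewrite /jet big_ord_recl /= addn0 expr0 fact0 divr1 mulr1.
rewrite big1 ?addr0; last by move=> i _; rewrite expr0n/= mul0r mulr0.
case: (N - l)%N => [|k] /=; first by rewrite b0 add0r.
by rewrite set_itv1 Rintegral_set1 add0r.
Qed.

Lemma taylor_sum_derive (c : nat -> R) n t :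
  is_derive t 1 (fun t : R => \sum_(i < n.+1) c i * (t ^+ i / i`!%:R))
    (\sum_(i < n) c i.+1 * (t ^+ i / i`!%:R)).
Proof.
elim: n => [|n ih].
  rewrite big_ord0; under eq_fun do rewrite big_ord1 expr0.
  exact: is_derive_cst.
under eq_fun do rewrite big_ord_recr/=.
rewrite big_ord_recr/=; apply: deriv_add => //; apply: deriv_scale.
have h := deriv_mul (deriv_pow n t) (deriv_cst (n.+1`!%:R^-1) t).
apply: (is_derive_eq h); rewrite mulr0 addr0 factS natrM.
have f0 : (n`!)%:R != 0 :> R by rewrite pnatr_eq0 -lt0n fact_gt0.
have n0 : 1 + n%:R != 0 :> R by rewrite addrC natr1 pnatr_eq0.
by rewrite -[n.+1%:R]natr1; field; rewrite f0 addrC n0.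
Qed.

Lemma jet_regular N b x M : 0 < M -> {within `[0, M], continuous b} ->
  (forall l, {within `[0, M], continuous jet N b x l}) /\
  (forall l t, (l < N)%N -> 0 < t < M ->
     is_derive t 1 (jet N b x l) (jet N b x l.+1 t)).
Proof.
move=> M0 cb; split => [l|l t lN tM].
  have [c1 _] := iter_int_regular M0 cb (N - l)%N.
  have c2 : continuous (fun t : R => \sum_(i < (N - l).+1) x (l + i)%N * (t ^+ i / i`!%:R)).
    move=> t; apply: differentiable_continuous; apply/derivable1_diffP.
    by have [] := taylor_sum_derive (fun i => x (l + i)%N) (N - l)%N t.
  by move=> t; apply: cvgD; [exact: c1|exact: continuous_subspaceT].
have NlE : (N - l)%N = (N - l.+1).+1 by rewrite subnSK.
have [_ d1] := iter_int_regular M0 cb (N - l.+1)%N.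
rewrite /jet NlE; apply: deriv_add; first exact: d1.
have := taylor_sum_derive (fun i => x (l + i)%N) (N - l.+1).+1 t.
by move=> h; apply: (is_derive_eq h); apply: eq_bigr => i _; rewrite addnS addSn.
Qed.

Lemma measurable_jet {d} {T : measurableType d} N (f : T -> R -> R) (x : T -> nat -> R) l t :
  0 <= t -> (l <= N)%N ->
  (forall s, 0 <= s <= t -> measurable_fun setT (f ^~ s)) ->
  (forall w, {within `[0, +oo[, continuous (f w)}) ->
  (forall l, (l <= N)%N -> measurable_fun setT (x ^~ l)) ->
  measurable_fun setT (fun w => jet N (f w) (x w) l t).
Proof.
move=> t0 lN mf cf mx; apply: measurable_funD.
  move: t0; rewrite le_eqVlt => /predU1P[t0|t0].
    case: (N - l)%N => [|k]; first by apply: mf; rewrite -t0 lexx.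
    rewrite (_ : (fun _ => _) = fun=> 0); first exact: measurable_cst.
    by apply/funext => w /=; rewrite -t0 set_itv1 Rintegral_set1.
  apply: (measurable_iter_int t0 mf); last by rewrite ltW//=.
  move=> w; apply: continuous_subspaceW (cf w) => s /=.
  by rewrite !in_itv/= andbT => /andP[].
apply: measurable_sum => i; apply: measurable_funM => //.
by apply: mx; have := ltn_ord i; lia.
Qed.

Lemma measurable_comb {d} {T : measurableType d} N (e : T -> nat -> R -> R) t :
  (forall l, (l <= N)%N -> measurable_fun setT (fun w => e w l t)) ->
  measurable_fun setT (fun w => comb N (e w) t).
Proof.
elim: N e => [|N ih] e me /=; first exact: me.
apply: (ih (fun w l t => e w l t + e w l.+1 t)) => l lN.
by apply: measurable_funD; apply: me => //; exact: leqW.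
Qed.

End jets.

Lemma prode_ge_expr {R : realType} (I : eqType) (s : seq I) (k : R) (F : I -> \bar R) :
  0 <= k -> (forall i, i \in s -> (k%:E <= F i)%E) ->
  ((k ^+ size s)%:E <= \prod_(i <- s) F i)%E.
Proof.
move=> k0; elim: s => [|i s ih] h; first by rewrite big_nil expr0.
rewrite big_cons /= exprS EFinM; apply: lee_pmul; rewrite ?lee_fin ?exprn_ge0//.
  by apply: h; rewrite mem_head.
by apply: ih => j js; apply: h; rewrite inE js orbT.
Qed.

(** * Probability of a steered path *)

Section steering_probability.
Context {R : realType} {d : measure_display} {T : measurableType d}.
Variables (P : probability T R) (B : T -> R -> R) (X : nat -> T -> R) (N : nat).
Hypothesis Bm : brownian P B.
Hypothesis lawX : forall l, (l <= N)%N -> has_law (U := R) P (X l) (normal_prob 0 1).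
Hypothesis indX : independent P [set l | (l <= N)%N] (fun l => sigma_of (X l)).
Hypothesis indXB : independent2 P
  <<s \bigcup_(l in [set l | (l <= N)%N]) sigma_of (X l)>> (sigma_path `[0, +oo[ B).

(** The Brownian path starts from 0 only almost surely; subtracting its initial value makes the jets
    start exactly at [X] and involves nothing but increments. *)
Let B0 (w : T) (t : R) := B w t - B w 0.
Let G0 := \bigcup_(l in [set l | (l <= N)%N]) sigma_of (X l).

Let mG0 : G0 `<=` measurable.
Proof.
by apply: bigcup_sub => l lN; apply: sigma_of_measurable; have [] := lawX lN.
Qed.

Let mX_gen l : (l <= N)%N -> @measurable_fun _ _ (g_sigma_algebraType G0) R setT (X l).
Proof.
move=> lN; apply: measurable_fun_gen => A mA; apply: sub_sigma_algebra.
by exists l => //; exists A => //; rewrite setTI.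
Qed.

Let B0c w : {within `[0, +oo[, continuous (B0 w)}.
Proof.
case: Bm => _ h _ _ _; move=> t; apply: cvgB; first exact: h.
exact: cvg_cst.
Qed.

Variables (a : nat -> R -> R) (del tau eta L p : R).
Hypotheses (del0 : 0 < del) (tau0 : 0 < tau) (L0 : 0 < L) (p0 : 0 < p).
Hypothesis kickp : forall t sgn, 0 <= t -> (p%:E <= P (kick B t tau L sgn))%E.

(** The factor [del ^+ l] turns successive derivatives into a chain with e_l' = e_(l+1) / del. *)
Definition scaled_error (w : T) l t :=
  del ^+ l * (jet N (B0 w) (fun l => X l w) l t - a l t).

Definition above j : set T := [set w | 0 < comb N (scaled_error w) (j%:R * tau)].

Definition start : set T :=
  \bigcap_(l in [set l | (l <= N)%N]) [set w | `|X l w - a l 0| <= eta].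

Fixpoint steered j : set T :=
  if j is i.+1 then steered i `&`
    ((above i `&` kick B (i%:R * tau) tau L true) `|`
     (~` above i `&` kick B (i%:R * tau) tau L false))
  else start.

Let step_ge0 j : 0 <= j%:R * tau. Proof. by rewrite mulr_ge0// ltW. Qed.

Let above_measurable (F : set (set T)) j :
  <<s G0>> `<=` <<s F>> ->
  (forall s, 0 <= s <= j%:R * tau ->
    @measurable_fun _ _ (g_sigma_algebraType F) R setT (B0 ^~ s)) ->
  <<s F>> (above j).
Proof.
move=> sub mB; apply: (@measurable_set_gt _ _ (g_sigma_algebraType F)).
apply: (@measurable_comb _ _ (g_sigma_algebraType F)) => l lN.
apply: measurable_funM; first exact: measurable_cst.
apply: measurable_funB; last exact: measurable_cst.
apply: (@measurable_jet _ _ (g_sigma_algebraType F) N B0 (fun w l => X l w)) => //.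
by move=> k kN; apply: measurable_fun_genS sub (mX_gen kN).
Qed.

Let start_measurable : <<s G0>> start.
Proof.
apply: (@bigcap_measurable _ (g_sigma_algebraType G0)); first by exists 0%N.
move=> l lN; apply: (@measurable_set_le _ _ (g_sigma_algebraType G0)).
apply: (@measurable_fun_norm _ _ (g_sigma_algebraType G0)).
by apply: measurable_funB; [exact: mX_gen|exact: measurable_cst].
Qed.

Let steered_measurable (F : set (set T)) j :
  <<s G0>> `<=` <<s F>> ->
  (forall s, 0 <= s <= j%:R * tau ->
    @measurable_fun _ _ (g_sigma_algebraType F) R setT (B0 ^~ s)) ->
  <<s F>> (steered j).
Proof.
move=> sub; elim: j => [_|j ih mB /=]; first exact: (sub _ start_measurable).
have tj : j%:R * tau <= j.+1%:R * tau by rewrite ler_pM2r// ler_nat.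
have mB' s : 0 <= s <= j%:R * tau ->
    @measurable_fun _ _ (g_sigma_algebraType F) R setT (B0 ^~ s).
  by move=> /andP[s0 sj]; apply: mB; rewrite s0 (le_trans sj).
have mA := above_measurable sub mB'.
have mK sgn : <<s F>> (kick B (j%:R * tau) tau L sgn).
  apply: (measurable_kick Bm) => // s /andP[s1 s2].
  rewrite (_ : (fun w => B w s - B w _) = fun w => B0 w s - B0 w (j%:R * tau)).
    apply: measurable_funB; apply: mB.
      by rewrite (le_trans _ s1)//= (le_trans s2)// -natr1 mulrDl mul1r.
    by rewrite step_ge0.
  by apply/funext => w; rewrite /B0; ring.
apply: (@measurableI _ (g_sigma_algebraType F)); first exact: ih.
apply: (@measurableU _ (g_sigma_algebraType F)).
  exact: (@measurableI _ (g_sigma_algebraType F) _ _ mA (mK true)).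
apply: (@measurableI _ (g_sigma_algebraType F) _ _ _ (mK false)).
exact: (@measurableC _ (g_sigma_algebraType F) _ mA).
Qed.

(** The sign to be opposed is a function of the coefficients and of the path up to time
    [j%:R * tau], while the kick depends on later increments. On each of the two events for the
    sign, the kick has conditional probability at least [p]. *)
Lemma steered_prob j : (p%:E * P (steered j) <= P (steered j.+1))%E.
Proof.
have [F1 [F2 [[m1 m2] ind sub mB1 mB2]]] := brownian_split Bm (step_ge0 j) mG0 indXB.
set t := j%:R * tau in mB1 mB2.
have mS := steered_measurable sub mB1.
have mA := above_measurable sub mB1.
have t0 : 0 <= t by exact: step_ge0.
have mK sgn : <<s F2>> (kick B t tau L sgn).
  by apply: (measurable_kick Bm) => // s /andP[s1 _]; exact: mB2.
have mSA : <<s F1>> (steered j `&` above j).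
  exact: (@measurableI _ (g_sigma_algebraType F1)).
have mSA' : <<s F1>> (steered j `&` ~` above j).
  apply: (@measurableI _ (g_sigma_algebraType F1)) => //.
  exact: (@measurableC _ (g_sigma_algebraType F1)).
have M1 := gen_measurable m1; have M2 := gen_measurable m2.
have e1 : P (steered j.+1) =
    (P (steered j `&` above j `&` kick B t tau L true) +
     P (steered j `&` ~` above j `&` kick B t tau L false))%E.
  have -> : steered j.+1 = (steered j `&` above j `&` kick B t tau L true) `|`
      (steered j `&` ~` above j `&` kick B t tau L false).
    by rewrite -!setIA -setIUr.
  rewrite measureU//.
  - by apply: measurableI; [exact: M1|exact: M2].
  - by apply: measurableI; [exact: M1|exact: M2].
  - by rewrite -subset0 => w [[[_ h] _] [[_ h'] _]].
have e2 : P (steered j) =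
    (P (steered j `&` above j) + P (steered j `&` ~` above j))%E.
  rewrite -measureU//; [|exact: M1|exact: M1|].
    by rewrite -setIUr setUCr setIT.
  by rewrite -subset0 => w [[_ h] [_ h']].
rewrite e1 (ind _ _ mSA (mK _)) (ind _ _ mSA' (mK _)) e2.
rewrite ge0_muleDr//; apply: leeD; rewrite muleC lee_wpmul2l//; exact: kickp.
Qed.

Lemma measurable_steered j : measurable (steered j).
Proof.
have [F1 [F2 [[m1 m2] ind sub mB1 mB2]]] := brownian_split Bm (step_ge0 j) mG0 indXB.
by apply: (gen_measurable m1); exact: steered_measurable.
Qed.

Lemma steered_prob_ge j : (((p ^+ j)%:E * P start) <= P (steered j))%E.
Proof.
elim: j => [|j ih]; first by rewrite expr0 mul1e.
apply: le_trans (steered_prob j); rewrite exprS EFinM -muleA lee_wpmul2l//.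
by rewrite lee_fin ltW.
Qed.

Lemma start_prob (A0 : R) : 0 <= eta <= 1 -> (forall l, (l <= N)%N -> `|a l 0| <= A0) ->
  (((2 * eta * (expR (- ((A0 + 1) ^+ 2 / 2)) / Num.sqrt (2 * pi))) ^+ N.+1)%:E
   <= P start)%E.
Proof.
move=> /andP[eta0 eta1] aA.
pose I l := `[a l 0 - eta, a l 0 + eta]%classic : set R.
pose J := seq_fset tt (iota 0 N.+1).
have JE l : (l \in J) = (l <= N)%N by rewrite seq_fsetE mem_iota add0n ltnS.
have -> : start = \bigcap_(l in [set` J])
    (if (l <= N)%N then X l @^-1` I l else setT).
  apply/seteqP; split => w h l /=.
    rewrite JE => lN; rewrite lN /I/= in_itv/=.
    have := h l lN; rewrite /= ler_norml => /andP[h1 h2].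
    by apply/andP; split; lra.
  move=> lN; have := h l; rewrite /= JE lN /I/= in_itv/= => /(_ isT) /andP[h1 h2].
  by rewrite ler_norml; apply/andP; split; lra.
rewrite indX; first last.
- move=> l _; case: ifP => _; last exact: sigma_ofT.
  by exists (I l); [exact: measurable_itv|rewrite setTI].
- by move=> l /=; rewrite JE.
set k := 2 * eta * _.
have k0 : 0 <= k by rewrite !mulr_ge0// divr_ge0 ?expR_ge0 ?sqrtr_ge0.
have -> : N.+1 = size J by rewrite size_seq_fset undup_id ?iota_uniq// size_iota.
apply: prode_ge_expr => // l; rewrite JE => lN; rewrite lN.
have [_ ->] := lawX lN; last exact: measurable_itv.
apply: le_trans (@normal_prob_itv_ge R 1 (A0 + 1) (a l 0 - eta) (a l 0 + eta) ltr01 _ _).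
- rewrite lee_fin /k divr1 ler_wpM2r//; last by lra.
- lra.
- move=> x /andP[x1 x2]; rewrite mulr1; have := aA l lN; rewrite !ler_norml => /andP[? ?].
  by apply/andP; split; lra.
Qed.

Lemma steered_error (Lam : R) (J : nat) : del <= 1 ->
  let S := J%:R * tau in let sig := Num.sqrt tau in
  0 < S -> 0 <= Lam ->
  (forall l, (l < N)%N -> forall t, 0 < t < S -> is_derive t 1 (a l) (a l.+1 t)) ->
  (forall l, (l <= N)%N -> {within `[0, S], continuous a l}) ->
  (forall s t, 0 <= s <= S -> 0 <= t <= S -> `|a N t - a N s| <= Lam * `|t - s|) ->
  4 ^+ N * (4 * (5 + L)) * tau <= del -> Lam * sig <= 1 / 2 ->
  eta * 2 ^+ N <= 4 * (del ^+ N * sig) ->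
  forall w, steered J w -> B w 0 = 0 ->
  forall l t, (l <= N)%N -> 0 <= t <= S ->
  `|jet N (B w) (fun l => X l w) l t - a l t| <= 2 ^+ N * (5 + L) * sig * del ^+ (N - l).
Proof.
move=> del1 S sig S0 Lam0 da ca aL c1 c2 c3 w sw Bw0 l t lN tS.
have B0E : B0 w = B w by apply/funext => s; rewrite /B0 Bw0 subr0.
have cB : {within `[0, S], continuous B0 w}.
  by apply: continuous_subspaceW (@B0c w) => s /=; rewrite !in_itv/= andbT => /andP[].
have [jc jd] := jet_regular N (fun l => X l w) S0 cB.
have sw' j : (j <= J)%N -> steered j w.
  elim: J sw {S S0 da ca aL tS cB jc jd} => [|J ih] sw; first by rewrite leqn0 => /eqP ->.
  by rewrite leq_eqVlt => /predU1P[->//|]; rewrite ltnS; apply: ih; case: sw.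
have dN0 : 0 < del ^+ N by rewrite exprn_gt0.
(* At the top order the error is the Brownian path minus a drift, both rescaled by [del ^+ N]; the
   drift gathers the derivative of order [N] of the target and the constant [X N]. *)
have := @steering R del tau L (del ^+ N * Lam) J N (scaled_error w) (B0 w)
  (fun t => del ^+ N * (a N t - X N w)) del0 tau0 (ltW L0).
rewrite -/S -/sig => /(_ _ _ _ _ _ c1 _ _ _ l t lN tS) H.
have {}H : `|scaled_error w l t| <= 2 ^+ N * ((5 + L) * (del ^+ N * sig)).
  apply: H.
  - by rewrite mulr_ge0// ltW.
  - move=> k kN u uS; rewrite /scaled_error.
    have h := deriv_scale (del ^+ k) (deriv_sub (jd k u kN uS) (da k kN u uS)).
    by apply: (is_derive_eq h); rewrite exprS; field; rewrite gt_eqF.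
  - move=> k kN u; apply: cvgM; first exact: cvg_cst.
    by apply: cvgB; [exact: jc|exact: ca].
  - by move=> u; rewrite /scaled_error jet_top; ring.
  - move=> u v uS vS; rewrite -mulrBr normrM gtr0_norm// -mulrA ler_pM2l//.
    by rewrite (_ : _ - _ = a N v - a N u) ?aL//; ring.
  - by rewrite -mulrA ler_pM2l//; move: c2; lra.
  - move=> k kN; rewrite /scaled_error jet0//; last by rewrite /B0 subrr.
    rewrite normrM normrX gtr0_norm//.
    have := sw' 0%N isT; rewrite /= => /(_ k kN) /= hk.
    apply: le_trans c3; rewrite ler_pM2r ?exprn_gt0//.
    apply: (@le_trans _ _ `|X k w - a k 0|) => //.
    by rewrite ler_piMl// exprn_ile1// ltW.
  - move=> j jJ; have := sw' j.+1 jJ => -[_].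
    have tE : j%:R * tau + tau = j.+1%:R * tau by rewrite -natr1 mulrDl mul1r.
    have bE u v : B0 w u - B0 w v = B w u - B w v by rewrite /B0; ring.
    have osc_bound : ~ osc B (j%:R * tau) tau (L * sig) w ->
        forall s, j%:R * tau <= s <= j.+1%:R * tau ->
        `|B0 w s - B0 w (j%:R * tau)| <= L * sig.
      move=> no s ss; rewrite bE leNgt; apply/negP => h; apply: no.
      by exists s => //; rewrite tE.
    move=> [[ab [/= + no]]|[nab [/= + no]]]; rewrite tE => kb; split;
      try exact: osc_bound; rewrite bE.
      by move: ab; rewrite /above/= => ->.
    by move: nab; rewrite /above/= => /negP/negbTE ->.
have dl0 : 0 < del ^+ l by rewrite exprn_gt0.
move: H; rewrite /scaled_error B0E normrM (gtr0_norm dl0) => H.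
rewrite -(ler_pM2l dl0); apply: (le_trans H).
have -> : del ^+ N = del ^+ l * del ^+ (N - l) by rewrite -exprD subnKC.
by rewrite le_eqVlt; apply/orP; left; apply/eqP; ring.
Qed.

End steering_probability.

(** * Sieves *)

Section covers.
Context {T : Type}.
Implicit Types (E A : set T) (Q : set T -> Prop).

(** Covers are sequences with a length, so that they are refined and merged by arithmetic on
    indices. *)
Definition pieces E (n : nat) Q := exists F : nat -> set T,
  E `<=` \bigcup_(j in [set j | (j < n)%N]) F j /\ forall j, (j < n)%N -> Q (F j).

Lemma pieces_refine E n m Q Q' : pieces E n Q -> (forall A, Q A -> pieces A m Q') ->
  pieces E (n * m) Q'.
Proof.
move=> [F [EF QF]] h.
have h' j : exists G : nat -> set T, (j < n)%N ->
    F j `<=` \bigcup_(k in [set k | (k < m)%N]) G k /\ forall k, (k < m)%N -> Q' (G k).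
  have [jn|jn] := boolP (j < n)%N; last by exists (fun=> set0).
  by have [G hG] := h _ (QF j jn); exists G.
have [G hG] := choice h'.
exists (fun i : nat => G (i %/ m)%N (i %% m)%N); split.
  move=> w /EF[j /= jn Fw]; have [/(_ _ Fw)[k /= km Gw] _] := hG j jn.
  exists (j * m + k)%N => /=.
    by rewrite (leq_trans (n := (j.+1 * m)%N)) ?leq_mul2r ?jn ?orbT// mulSn addnC ltn_add2r.
  rewrite divnMDl ?(leq_ltn_trans _ km)// divn_small// addn0 modnMDl modn_small//.
move=> i im; have m0 : (0 < m)%N by case: (m) im => //; rewrite muln0.
have in' : (i %/ m < n)%N by rewrite ltn_divLR.
by apply: (hG _ in').2; rewrite ltn_mod.
Qed.

Lemma pieces_weaken E E' n n' Q Q' : E' `<=` E -> (n <= n')%N ->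
  (forall A, Q A -> Q' A) -> Q' set0 -> pieces E n Q -> pieces E' n' Q'.
Proof.
move=> EE nn QQ Q0 [F [EF QF]]; exists (fun j => if (j < n)%N then F j else set0); split.
  move=> w /EE/EF[j /= jn Fw]; exists j => /=; first exact: leq_trans nn.
  by rewrite jn.
by move=> j _; case: ifPn => // jn; exact/QQ/QF.
Qed.

Lemma pieces_sub E E' n Q : E' `<=` E -> pieces E n Q -> pieces E' n Q.
Proof. by move=> EE [F [EF QF]]; exists F; split => //; exact: subset_trans EF. Qed.

Lemma piecesU E1 E2 n1 n2 Q : pieces E1 n1 Q -> pieces E2 n2 Q ->
  pieces (E1 `|` E2) (n1 + n2) Q.
Proof.
move=> [F1 [EF1 QF1]] [F2 [EF2 QF2]].
exists (fun j => if (j < n1)%N then F1 j else F2 (j - n1)%N); split.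
  move=> w [/EF1|/EF2] [j /= jn Fw]; first by exists j; rewrite /= ?jn// ltn_addr.
  by exists (n1 + j)%N; rewrite /= ?ltn_add2l// -ltn_subRL subnn ltn0 addKn.
move=> j jn; case: ifPn => [|]; first exact: QF1.
by rewrite -leqNgt => n1j; apply: QF2; rewrite ltn_subLR.
Qed.

Lemma pieces_bigcup (E : nat -> set T) (n : nat -> nat) r Q :
  (forall q, (q < r)%N -> pieces (E q) (n q) Q) ->
  pieces (\bigcup_(q in [set q | (q < r)%N]) E q) (\sum_(q < r) n q) Q.
Proof.
elim: r => [|r ih] h.
  by exists (fun=> set0); split => [w [q]|j] //; rewrite big_ord0.
rewrite big_ord_recr/=.
apply: pieces_sub (piecesU (ih (fun q qr => h q (leqW qr))) (h r (ltnSn r))).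
move=> w [q /=]; rewrite ltnS leq_eqVlt => /predU1P[->|qr] Ew; first by right.
by left; exists q.
Qed.

(** The cells are the level sets of the integer part of (u - u w0) / D + c, which ranges over
    [0, 2c]. *)
Lemma pieces_split (R : realType) A (u : T -> R) (D : R) (c : nat) : 0 < D ->
  (forall w w', A w -> A w' -> `|u w - u w'| <= c%:R * D) ->
  pieces A (c.*2.+1) (fun A' => A' `<=` A /\ forall w w', A' w -> A' w' -> `|u w - u w'| <= D).
Proof.
move=> D0 h; have [->|/set0P[w0 Aw0]] := eqVneq A set0.
  by exists (fun=> set0); split => // j _; split => // ? ? [].
pose k w := Num.truncn ((u w - u w0) / D + c%:R).
have kP w : A w -> (k w)%:R <= (u w - u w0) / D + c%:R < (k w)%:R + 1.
  move=> Aw; rewrite natr1; apply: truncn_itv.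
  have := h w w0 Aw Aw0; rewrite ler_norml => /andP[h1 _].
  by rewrite -lerBlDr sub0r ler_pdivlMr// mulNr.
exists (fun j => [set w | A w /\ k w = j]); split => [w Aw|j _].
  exists (k w) => //=; rewrite -(ltr_nat R) -addnn -natr1 natrD.
  have /andP[k1 _] := kP w Aw.
  have := h w w0 Aw Aw0; rewrite ler_norml => /andP[_ h1].
  have : (u w - u w0) / D <= c%:R by rewrite ler_pdivrMr.
  by move: k1; lra.
split=> [w []//|w w' [Aw kw] [Aw' kw']].
have := kP w Aw; have := kP w' Aw'; rewrite kw kw' => /andP[a1 a2] /andP[b1 b2].
have h1 : (u w - u w0) / D - (u w' - u w0) / D <= 1 by lra.
have h2 : -1 <= (u w - u w0) / D - (u w' - u w0) / D by lra.
move: h1 h2; rewrite -mulrBl (_ : u w - u w0 - (u w' - u w0) = u w - u w'); last by ring.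
by rewrite ler_pdivrMr// ler_pdivlMr// ler_norml mul1r mulN1r => -> ->.
Qed.

Lemma pieces_split_many (R : realType) A (u : nat -> T -> R) (D : R) (c n : nat) : 0 < D ->
  (forall l w w', (l < n)%N -> A w -> A w' -> `|u l w - u l w'| <= c%:R * D) ->
  pieces A (c.*2.+1 ^ n) (fun A' => A' `<=` A /\
    forall l w w', (l < n)%N -> A' w -> A' w' -> `|u l w - u l w'| <= D).
Proof.
move=> D0; elim: n => [|n ih] h.
  exists (fun=> A); split; first by move=> w Aw; exists 0%N.
  by move=> j _; split.
have := ih (fun l w w' ln => h l w w' (leqW ln)).
rewrite expnSr => /pieces_refine; apply => A' [A'A hA'].
have := @pieces_split R A' (u n) D c D0 (fun w w' a a' => h n w w' (ltnSn n) (A'A _ a) (A'A _ a')).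
apply: (pieces_weaken (fun _ x => x) (leqnn _)) => [A'' [s hs]|]; last first.
  by split=> [w []|l w w' _ []].
split; first exact: subset_trans A'A.
move=> l w w'; rewrite ltnS leq_eqVlt => /predU1P[->|ln] a a'; first exact: hs.
by apply: hA' => //; exact: s.
Qed.

End covers.

(** * Propagation of closeness over one subinterval *)

Section sieve_path.
Context {R : realType}.

(** By descent on the order, in units of [D]: at the top order the two oscillations add 2 rho to the
    initial distance 1, and each integration over a length at most [del] adds one more initial
    distance. *)
Lemma jet_stability (N : nat) (del s h rho : R) (b b' : R -> R) (x x' : nat -> R) M :
  let D := del ^+ N * Num.sqrt del in
  0 < del -> 0 <= s -> 0 < h <= del -> s + h <= M -> 0 < M ->
  {within `[0, M], continuous b} -> {within `[0, M], continuous b'} ->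
  (forall t, s <= t <= s + h -> `|b t - b s| <= rho * Num.sqrt del) ->
  (forall t, s <= t <= s + h -> `|b' t - b' s| <= rho * Num.sqrt del) ->
  (forall l, (l <= N)%N ->
     `|del ^+ l * (jet N b x l s) - del ^+ l * (jet N b' x' l s)| <= D) ->
  forall l t, (l <= N)%N -> s <= t <= s + h ->
     `|del ^+ l * (jet N b x l t) - del ^+ l * (jet N b' x' l t)| <=
     ((2 * rho + 1) + N%:R) * D.
Proof.
move=> D del0 s0 /andP[h0 hd] shM M0 cb cb' ob ob' cl.
have D0 : 0 < D by rewrite mulr_gt0 ?exprn_gt0 ?sqrtr_gt0.
have [jc jd] := jet_regular N x M0 cb; have [jc' jd'] := jet_regular N x' M0 cb'.
pose e l t := del ^+ l * (jet N b x l t) - del ^+ l * (jet N b' x' l t).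
have H i : (i <= N)%N -> forall t, s <= t <= s + h ->
    `|e (N - i)%N t| <= ((2 * rho + 1) + i%:R) * D.
  elim: i => [_|i ih iN] t ts.
    rewrite subn0 addr0.
    have -> : e N t = e N s + (del ^+ N * (b t - b s) - del ^+ N * (b' t - b' s)).
      by rewrite /e !jet_top; ring.
    have h1 : `|del ^+ N * (b t - b s)| <= rho * D.
      rewrite normrM gtr0_norm ?exprn_gt0// /D mulrCA ler_pM2l ?exprn_gt0//; exact: ob.
    have h2 : `|del ^+ N * (b' t - b' s)| <= rho * D.
      rewrite normrM gtr0_norm ?exprn_gt0// /D mulrCA ler_pM2l ?exprn_gt0//; exact: ob'.
    rewrite (le_trans (ler_normD _ _))//.
    have := cl N (leqnn N); rewrite -/(e N s) => h3.
    have := ler_normB (del ^+ N * (b t - b s)) (del ^+ N * (b' t - b' s)).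
    by move: h1 h2 h3; rewrite !mulrDl; lra.
  have Ni : (N - i)%N = (N - i.+1).+1 by rewrite subnSK.
  have lN : (N - i.+1 < N)%N by rewrite ltn_subrL/= (leq_trans _ iN).
  have [s1 s2] := andP ts.
  have [||c] := @MVT_segment R (e (N - i.+1)%N) (fun t => e (N - i)%N t / del) s t s1.
  - move=> u; rewrite in_itv/= => /andP[u1 u2].
    have uM : 0 < u < M by rewrite (le_lt_trans s0)//= (lt_le_trans u2)// (le_trans s2).
    have d1 := deriv_scale (del ^+ (N - i.+1)) (jd _ _ lN uM).
    have d2 := deriv_scale (del ^+ (N - i.+1)) (jd' _ _ lN uM).
    apply: (is_derive_eq (deriv_sub d1 d2)); rewrite /e Ni exprS.
    by field; rewrite gt_eqF.
  - have sub : `[s, t] `<=` `[0, M].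
      move=> u /=; rewrite !in_itv/= => /andP[u1 u2].
      by rewrite (le_trans s0)//= (le_trans u2)// (le_trans s2).
    apply: (continuous_subspaceW sub) => u.
    by apply: cvgB; apply: cvgM; try exact: cvg_cst; [exact: jc|exact: jc'].
  rewrite in_itv/= => /andP[c1 c2] Ec.
  have -> : e (N - i.+1)%N t = e (N - i.+1)%N s + e (N - i)%N c / del * (t - s).
    by rewrite -Ec addrC subrK.
  have hc : `|e (N - i)%N c| <= ((2 * rho + 1) + i%:R) * D.
    by apply: ih; [exact: ltnW|rewrite c1 (le_trans c2)].
  have h1 := cl _ (ltnW lN); rewrite -/(e (N - i.+1)%N s) in h1.
  have h2 : `|e (N - i)%N c / del * (t - s)| <= `|e (N - i)%N c|.
    rewrite -mulrA normrM ler_piMr// normrM (gtr0_norm (x := del^-1)) ?invr_gt0//.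
    by rewrite ger0_norm ?subr_ge0// mulrC ler_pdivrMr// mul1r lerBlDl (le_trans s2)// lerD2l.
  rewrite (le_trans (ler_normD _ _))// -[i.+1%:R]natr1.
  by move: h1 h2 hc; rewrite !mulrDl; lra.
move=> l t lN ts; have := H (N - l)%N (leq_subr _ _) t ts; rewrite subKn// => /le_trans; apply.
by rewrite ler_pM2r// lerD2l ler_nat leq_subr.
Qed.

End sieve_path.

(** * Random partitions and the entropy of typical paths *)

Section sieve_probability.
Context {R : realType} {d : measure_display} {T : measurableType d}.
Variables (P : probability T R) (B : T -> R -> R) (X : nat -> T -> R) (N : nat).
Hypothesis Bm : brownian P B.
Hypothesis lawX : forall l, (l <= N)%N -> has_law (U := R) P (X l) (normal_prob 0 1).
Hypothesis indXB : independent2 P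
  <<s \bigcup_(l in [set l | (l <= N)%N]) sigma_of (X l)>> (sigma_path `[0, +oo[ B).
Variable del : R.
Hypothesis del0 : 0 < del.

Let B0 (w : T) (t : R) := B w t - B w 0.

Let mG0 : \bigcup_(l in [set l | (l <= N)%N]) sigma_of (X l) `<=` measurable.
Proof.
by apply: bigcup_sub => l lN; apply: sigma_of_measurable; have [] := lawX lN.
Qed.

(** The threshold stays at the scale of the whole cell while the parts shrink, so that the failure
    probability decreases exponentially in [q]. *)
Definition calm i q : set T :=
  \bigcap_(k in [set k | (k < q)%N])
    ~` osc B (i%:R * del + k%:R * (del / q%:R)) (del / q%:R) (32 * Num.sqrt del).

Let sub_time i q k : (0 < q)%N -> (k < q)%N ->
  [/\ 0 <= i%:R * del, i%:R * del <= i%:R * del + k%:R * (del / q%:R), 0 < del / q%:R &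
   i%:R * del + k%:R * (del / q%:R) + del / q%:R <= i.+1%:R * del].
Proof.
move=> q0 kq; have q0' : 0 < q%:R :> R by rewrite ltr0n.
have h0 : 0 < del / q%:R by rewrite divr_gt0.
split=> //; first by rewrite mulr_ge0// ltW.
  by rewrite lerDl mulr_ge0// ltW.
rewrite -addrA -[X in _ + (_ + X)]mul1r -mulrDl natr1 -[i.+1%:R]natr1 [leRHS]mulrDl lerD2l mul1r.
rewrite mulrA ler_pdivrMr// mulrC ler_pM2l// ler_nat//.
Qed.

Lemma measurable_calm i q (F : set (set T)) : (0 < q)%N ->
  (forall s t, i%:R * del <= s <= i.+1%:R * del -> i%:R * del <= t <= i.+1%:R * del ->
    @measurable_fun _ _ (g_sigma_algebraType F) R setT (fun w => B w s - B w t)) ->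
  <<s F>> (calm i q).
Proof.
move=> q0 mB; apply: (@bigcap_measurable _ (g_sigma_algebraType F)); first by exists 0%N.
move=> k /= kq; apply: (@measurableC _ (g_sigma_algebraType F)).
have [t0 t1 h0 t2] := sub_time i q0 kq.
apply: (measurable_osc Bm) => //; first exact: le_trans t1.
move=> s /andP[s1 s2]; apply: mB; rewrite ?t1 ?(le_trans t1 s1)/=.
  exact: le_trans t2.
by apply: le_trans t2; rewrite lerDl ltW.
Qed.

Lemma calm_prob i q : (0 < q)%N -> (P (~` calm i q) <= ((4^-1) ^+ q)%:E)%E.
Proof.
move=> q0; have q0' : 0 < q%:R :> R by rewrite ltr0n.
have q1 : 1 <= q%:R :> R by rewrite ler1n.
rewrite setC_bigcap bigcup_mkord.
pose A k := ~` ~` osc B (i%:R * del + k%:R * (del / q%:R)) (del / q%:R) (32 * Num.sqrt del).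
have mA k : (k < q)%N -> measurable (A k).
  move=> kq; have [t0 t1 h0 t2] := sub_time i q0 kq.
  by rewrite /A setCK; apply: (measurable_osc_total Bm) => //; exact: le_trans t1.
have h := Boole_inequality P (A := A) (n := q) mA.
apply: (le_trans h); apply: (@le_trans _ _ (\sum_(k < q) (4 * expR (- (16 * q%:R)))%:E)%E).
  apply: lee_sum => k _; have [t0 t1 h0 t2] := sub_time i q0 (ltn_ord k).
  (* With this value for [a], the threshold of [osc_prob] on a part of length [del / q%:R] is
     exactly [32 * Num.sqrt del], and each part fails with probability at most 4 e^(-16 q). *)
  have a8 : 8 <= 8 * Num.sqrt q%:R :> R.
    by rewrite ler_peMr// -[leLHS]sqrtr1 ler_sqrt.
  have := osc_prob Bm (le_trans t0 t1) h0 a8; rewrite /A setCK.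
  rewrite (_ : 4 * (8 * Num.sqrt q%:R) * Num.sqrt (del / q%:R) = 32 * Num.sqrt del).
    rewrite exprMn sqr_sqrtr ?ler0n// (_ : 8 ^+ 2 * q%:R / 4 = 16 * q%:R)//.
    by field.
  have -> : Num.sqrt del = Num.sqrt q%:R * Num.sqrt (del / q%:R).
    by rewrite -sqrtrM ?ler0n//; congr Num.sqrt; field; rewrite gt_eqF.
  by ring.
rewrite sumEFin lee_fin sumr_const card_ord -[leLHS]mulr_natr exprVn.
have E1 : expR (- (16 * q%:R)) = (expR 8 ^+ q)^-1 * (expR 8 ^+ q)^-1 :> R.
  by rewrite -expRM_natr -!expRN -expRD; congr expR; lra.
rewrite E1.
have e8 : 9 <= expR 8 :> R by have := @expR_ge1Dx R 8; lra.
have p1 : 4 ^+ q <= expR 8 ^+ q :> R by rewrite lerXn2r ?nnegrE ?expR_ge0//; lra.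
have p2 : 4 * q%:R <= expR 8 ^+ q :> R.
  rewrite -expRM_natr; have := @expR_ge1Dx R (8 * q%:R); lra.
have y0 : 0 < expR 8 ^+ q :> R by rewrite exprn_gt0// expR_gt0.
have z0 : 0 < 4 ^+ q :> R by rewrite exprn_gt0.
rewrite mulrC mulrA [q%:R * 4]mulrC.
move: p1 p2 y0 z0; move: (expR 8 ^+ q) (4 ^+ q) => y z p1 p2 y0 z0.
apply: (@le_trans _ _ y^-1); last by rewrite lef_pV2.
by rewrite mulrA ler_pdivrMr// mulVf ?gt_eqF// ler_pdivrMr// mul1r.
Qed.

(** There are positive numbers q_0, ..., q_(i-1) of sum at most [r] for which each of the first [i]
    cells is calm. Recursion on the last cell is what makes the independence of successive cells
    usable. *)
Fixpoint tame i r : set T :=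
  if i is i'.+1 then
    \bigcup_(q in [set q | (q < r)%N]) (tame i' (r - q.+1)%N `&` calm i' q.+1)
  else setT.

Let measurable_tame_gen (F : set (set T)) i r :
  (forall s t, 0 <= s <= i%:R * del -> 0 <= t <= i%:R * del ->
    @measurable_fun _ _ (g_sigma_algebraType F) R setT (fun w => B w s - B w t)) ->
  <<s F>> (tame i r).
Proof.
elim: i r => [|i ih] r mB /=; first exact: (@measurableT _ (g_sigma_algebraType F)).
have ii : i%:R * del <= i.+1%:R * del by rewrite ler_pM2r// ler_nat.
have i0 : 0 <= i%:R * del by rewrite mulr_ge0// ltW.
apply: (@bigcup_measurable _ (g_sigma_algebraType F)) => q _.
apply: (@measurableI _ (g_sigma_algebraType F)).
  apply: ih => s t /andP[s0 s1] /andP[t0 t1].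
  by apply: mB; rewrite ?s0 ?t0 (le_trans _ ii).
apply: measurable_calm => // s t /andP[s0 s1] /andP[t0 t1].
by apply: mB; rewrite ?s1 ?t1 andbT (le_trans i0).
Qed.

Let split_at i : exists F1 F2 : set (set T),
  [/\ F1 `<=` measurable /\ F2 `<=` measurable, independent2 P <<s F1>> <<s F2>>,
   forall r, <<s F1>> (tame i r) & forall q, (0 < q)%N -> <<s F2>> (calm i q)].
Proof.
have i0 : 0 <= i%:R * del by rewrite mulr_ge0// ltW.
have [F1 [F2 [m12 ind sub mB1 mB2]]] := brownian_split Bm i0 mG0 indXB.
exists F1, F2; split=> // [r|q q0].
  apply: measurable_tame_gen => s t s0 t0.
  rewrite (_ : (fun w => B w s - B w t) = fun w => (B w s - B w 0) - (B w t - B w 0)).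
    by apply: measurable_funB; exact: mB1.
  by apply/funext => w; ring.
apply: measurable_calm => // s t /andP[s0 _] /andP[t0 _].
rewrite (_ : (fun w => B w s - B w t) =
  fun w => (B w s - B w (i%:R * del)) - (B w t - B w (i%:R * del))).
  by apply: measurable_funB; exact: mB2.
by apply/funext => w; ring.
Qed.

Lemma measurable_tame i r : measurable (tame i r).
Proof. by have [F1 [F2 [[m1 _] _ h _]]] := split_at i; exact: (gen_measurable m1). Qed.

Let sum_bound (k : R) r : 0 <= k ->
  \sum_(q < r) ((4^-1) ^+ q * (k * (2^-1) ^+ (r - q.+1))) <= 4 * k * (2^-1) ^+ r.
Proof.
move=> k0; have -> : \sum_(q < r) ((4^-1) ^+ q * (k * (2^-1) ^+ (r - q.+1))) =
    2 * k * (2^-1) ^+ r * \sum_(q < r) (2^-1) ^+ q.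
  rewrite mulr_sumr; apply: eq_bigr => q _.
  have -> : (2^-1) ^+ r = (2^-1) ^+ (r - q.+1) * (2^-1 * (2^-1) ^+ q) :> R.
    by rewrite -exprS -exprD subnK.
  have -> : (4^-1 : R) ^+ q = (2^-1) ^+ q * (2^-1) ^+ q.
    by rewrite -exprMn; congr (_ ^+ _); field.
  by field.
have -> : 4 * k * (2^-1) ^+ r = 2 * k * (2^-1) ^+ r * 2 by ring.
rewrite ler_wpM2l ?mulr_ge0 ?exprn_ge0//.
suff -> : \sum_(q < r) (2^-1) ^+ q = 2 - 2 * (2^-1) ^+ r :> R.
  by rewrite gerBl mulr_ge0// exprn_ge0.
elim: (r) => [|n ih]; first by rewrite big_ord0; ring.
by rewrite big_ord_recr/= ih exprS; field.
Qed.

(** When tameness fails, take the least q < r for which the last cell is calm with q + 1 parts: it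
    is not calm with q parts (if q > 0), and the earlier cells exceed the remaining budget r - q -
    1. These two events are independent, and summing 4^(-q) 2^(-(r - q - 1)) costs a factor 4. If
    there is no such q, the term 4^(-r) raises the factor to 5. *)
Lemma tame_prob i r : (P (~` tame i r) <= (5 ^+ i * (2^-1) ^+ r)%:E)%E.
Proof.
elim: i r => [|i ih] r.
  by rewrite /= setCT measure0 lee_fin mulr_ge0// exprn_ge0.
have [F1 [F2 [[m1 m2] ind mt mc]]] := split_at i.
(* [C 0] is the whole space: no trial precedes the one with a single part. *)
pose C q := if q is 0%N then setT else ~` calm i q.
have FC q : <<s F2>> (C q).
  case: q => [|q]; first exact: (@measurableT _ (g_sigma_algebraType F2)).
  by apply: (@measurableC _ (g_sigma_algebraType F2)); exact: mc.
have FT q : <<s F1>> (~` tame i q) by exact: (@measurableC _ (g_sigma_algebraType F1) _ (mt q)).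
have PC q : (P (C q) <= ((4^-1) ^+ q)%:E)%E.
  by case: q => [|q]; [rewrite probability_setT expr0|exact: calm_prob].
have mCq q : measurable (C q) by exact: (gen_measurable m2).
have mTq q : measurable (~` tame i q) by exact: (gen_measurable m1).
pose A q := if (q < r)%N then ~` tame i (r - q.+1)%N `&` C q else C q.
have mA q : measurable (A q).
  by rewrite /A; case: ifP => _ //; exact: measurableI.
have sub : ~` tame i.+1 r `<=` \big[setU/set0]_(q < r.+1) A q.
  move=> w nw; suff H k : (k <= r)%N ->
      (exists2 q, (q < k)%N & (~` tame i (r - q.+1)%N `&` C q) w) \/ C k w.
    rewrite -bigcup_mkord; have [[q qr Aq]|Cr] := H r (leqnn r).
      by exists q => /=; [exact: leqW|rewrite /A qr].
    by exists r => //=; rewrite /A ltnn.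
  elim: k => [_|k ihk kr]; first by right.
  have [[q qk Aq]|Ck] := ihk (ltnW kr); first by left; exists q => //; exact: leqW.
  have [ck|nck] := pselect (calm i k.+1 w); last by right.
  by left; exists k => //; split=> // tk; apply: nw; exists k.
have mU : measurable (\big[setU/set0]_(q < r.+1) A q).
  by apply: bigsetU_measurable => q _.
apply: (@le_trans _ _ (P (\big[setU/set0]_(q < r.+1) A q))).
  by apply: le_measure; rewrite ?inE//; apply: measurableC; exact: measurable_tame.
apply: (le_trans (Boole_inequality P (fun q _ => mA q))).
rewrite big_ord_recr/=.
apply: (@le_trans _ _ (\sum_(q < r) ((4^-1) ^+ q * (5 ^+ i * (2^-1) ^+ (r - q.+1)))%:E
    + ((4^-1) ^+ r)%:E)%E).
  apply: leeD; last by rewrite /A ltnn.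
  apply: lee_sum => q _; rewrite /A ltn_ord (ind _ _ (FT _) (FC _)) muleC EFinM.
  by apply: lee_pmul => //; exact: ih.
rewrite sumEFin -EFinD lee_fin.
have k0 : 0 <= 5 ^+ i :> R by rewrite exprn_ge0.
have := sum_bound r k0.
have h4 : (4^-1) ^+ r <= 5 ^+ i * (2^-1) ^+ r :> R.
  apply: (@le_trans _ _ ((2^-1) ^+ r)).
    by rewrite lerXn2r ?nnegrE//; lra.
  by rewrite ler_peMl ?exprn_ge0// exprn_ege1//; lra.
by rewrite exprS; move: h4; lra.
Qed.

Definition wjet (w : T) l t := jet N (B0 w) (fun l => X l w) l t.

Let D := del ^+ N * Num.sqrt del.
(** The constant of [jet_stability] for rho = 32, namely 2 * 32 + 1 + N. *)
Let c := (65 + N)%N.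

(** The past paths are close up to the constant [c], but the current derivatives agree up to [D]
    itself. Splitting restores this constant 1 after each subinterval, which prevents the constants
    from growing. *)
Definition small t (A : set T) := forall w w', A w -> A w' ->
  (forall s, 0 <= s <= t -> `|wjet w 0 s - wjet w' 0 s| <= c%:R * D) /\
  (forall l, (l <= N)%N -> `|del ^+ l * wjet w l t - del ^+ l * wjet w' l t| <= D).

Definition branching := (c.*2.+1 ^ N.+1)%N.

Let D0 : 0 < D. Proof. by rewrite mulr_gt0 ?exprn_gt0 ?sqrtr_gt0. Qed.

Let B0c w M : {within `[0, M], continuous (B0 w)}.
Proof.
apply: (@continuous_subspaceW _ _ `[0, M] `[0, +oo[).
  by move=> x /=; rewrite !in_itv/= andbT => /andP[].
case: Bm => _ h _ _ _; move=> t; apply: cvgB; first exact: h.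
exact: cvg_cst.
Qed.

Let small_step s h A : 0 <= s -> 0 < h <= del -> small s A ->
  A `<=` ~` osc B s h (32 * Num.sqrt del) ->
  pieces A branching (fun A' => A' `<=` A /\ small (s + h) A').
Proof.
move=> s0 /andP[h0 hd] sA nA.
have M0 : 0 < s + h by rewrite ltr_wpDl.
have ob w : A w -> forall t, s <= t <= s + h -> `|B0 w t - B0 w s| <= 32 * Num.sqrt del.
  move=> Aw t ts; rewrite (_ : B0 w t - B0 w s = B w t - B w s); last by rewrite /B0; ring.
  by rewrite leNgt; apply/negP => hh; apply: (nA _ Aw); exists t.
have cE : c%:R = 2 * 32 + 1 + N%:R :> R by rewrite /c natrD; ring.
have key w w' : A w -> A w' -> forall l t, (l <= N)%N -> s <= t <= s + h ->
    `|del ^+ l * wjet w l t - del ^+ l * wjet w' l t| <= c%:R * D.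
  move=> Aw Aw' l t lN ts; rewrite cE.
  have hh : 0 < h <= del by rewrite h0.
  apply: (jet_stability del0 s0 hh (lexx _) M0 (@B0c w _) (@B0c w' _) (ob w Aw) (ob w' Aw') _ lN ts).
  exact: (sA w w' Aw Aw').2.
have := @pieces_split_many T R A (fun l w => del ^+ l * wjet w l (s + h)) D c N.+1 D0.
have ss : s <= s + h <= s + h by rewrite lexx andbT lerDl ltW.
move=> /(_ (fun l w w' lN Aw Aw' => key w w' Aw Aw' l _ lN ss)).
apply: pieces_weaken => // [A' [sub hA']|]; last by split=> // ? ? [].
split=> // w w' Aw Aw'; split=> [t /andP[t0 tsh]|l lN]; last exact: hA'.
have [ts|st] := leP t s.
  by apply: (sA w w' (sub _ Aw) (sub _ Aw')).1; rewrite t0.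
have := key w w' (sub _ Aw) (sub _ Aw') 0%N t isT; rewrite expr0 !mul1r; apply.
by rewrite (ltW st).
Qed.

Let calm_pieces i q A : (0 < q)%N -> small (i%:R * del) A -> A `<=` calm i q ->
  pieces A (branching ^ q)%N (small (i.+1%:R * del)).
Proof.
move=> q0 sA cA.
have q0' : 0 < q%:R :> R by rewrite ltr0n.
suff H k : (k <= q)%N -> pieces A (branching ^ k)%N
    (fun A' => A' `<=` A /\ small (i%:R * del + k%:R * (del / q%:R)) A').
  have := H q (leqnn q); apply: pieces_weaken => // A' [_].
  by rewrite [q%:R * _]mulrC divfK ?gt_eqF// -[i.+1%:R]natr1 mulrDl mul1r.
elim: k => [_|k ih kq].
  exists (fun=> A); split; first by move=> w Aw; exists 0%N.
  by move=> j _; split => //; rewrite mul0r addr0.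
have := ih (ltnW kq); rewrite expnSr => /pieces_refine; apply => A' [sub sA'].
have [t0 t1 h0 t2] := sub_time i q0 kq.
have hd : 0 < del / q%:R <= del by rewrite h0 ler_pdivrMr// ler_peMr ?(ltW del0)// ler1n.
have nA : A' `<=` ~` osc B (i%:R * del + k%:R * (del / q%:R)) (del / q%:R) (32 * Num.sqrt del).
  by move=> w /sub /cA; apply.
have := small_step (le_trans t0 t1) hd sA' nA.
apply: pieces_weaken => // [A'' [sub' s'']|]; last by split=> // ? ? [].
split; first exact: subset_trans sub.
by move: s''; rewrite -addrA -[X in _ + (_ + X)]mul1r -mulrDl natr1.
Qed.

(** Each subinterval multiplies the number of pieces by [branching]; the extra factor 2^r pays for
    the unknown numbers of parts, through the sum of 2^(r - q - 1) over q < r. *)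
Lemma tame_pieces i r A : small 0 A ->
  pieces (A `&` tame i r) (branching.*2 ^ r)%N (small (i%:R * del)).
Proof.
move=> sA; elim: i r => [|i ih] r.
  rewrite mul0r; exists (fun=> A); split; last by [].
  by move=> w [Aw _]; exists 0%N => //=; rewrite expn_gt0 double_gt0 expn_gt0.
have smallI t A1 A2 : small t A1 -> small t (A1 `&` A2).
  by move=> h w w' [a _] [a' _]; exact: h.
apply: (@pieces_weaken _ (\bigcup_(q in [set q | (q < r)%N])
    (A `&` tame i (r - q.+1)%N `&` calm i q.+1)) _
    (\sum_(q < r) (branching.*2 ^ (r - q.+1) * branching ^ q.+1))%N _
    (small (i.+1%:R * del))).
- by move=> w [Aw [q qr [tq cq]]]; exists q.
- have -> : (\sum_(q < r) branching.*2 ^ (r - q.+1) * branching ^ q.+1 =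
      branching ^ r * \sum_(q < r) 2 ^ (r - q.+1))%N.
    rewrite big_distrr/=; apply: eq_bigr => q _.
    by rewrite -mul2n expnMn -mulnA -expnD subnK// mulnC.
  rewrite -mul2n expnMn mulnC leq_mul2r; apply/orP; right.
  have -> : (\sum_(q < r) 2 ^ (r - q.+1) = \sum_(q < r) 2 ^ q)%N.
    rewrite (reindex_inj rev_ord_inj) /=; apply: eq_bigr => q _.
    by rewrite subnSK// subKn// ltnW.
  suff : (\sum_(q < r) 2 ^ q).+1 = (2 ^ r)%N by move=> <-.
  elim: (r) => [|n ihn]; first by rewrite big_ord0.
  by rewrite big_ord_recr/= -addSn ihn expnS mul2n addnn.
- by [].
- by move=> ? ? [].
apply: (@pieces_bigcup _ (fun q => A `&` tame i (r - q.+1)%N `&` calm i q.+1)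
  (fun q => branching.*2 ^ (r - q.+1) * branching ^ q.+1)%N) => q qr.
have [F [EF QF]] := ih (r - q.+1)%N.
apply: (@pieces_refine _ _ _ _ (fun A' => small (i%:R * del) A' /\ A' `<=` calm i q.+1)).
  exists (fun j => F j `&` calm i q.+1); split.
    by move=> w [/EF[j jn Fw] cw]; exists j.
  by move=> j jn; split; [apply: smallI; exact: QF|exact: subIsetr].
by move=> A' [sA' cA']; exact: calm_pieces.
Qed.

Definition bounded_start (H0 : R) : set T :=
  \bigcap_(l in [set l | (l < N.+1)%N]) [set w | `|X l w| <= H0].

Lemma bounded_start_small H0 (c0 : nat) : del <= 1 -> 2 * H0 <= c0%:R * D ->
  pieces (bounded_start H0) (c0.*2.+1 ^ N.+1)%N (small 0).
Proof.
move=> del1 hH.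
have := @pieces_split_many T R (bounded_start H0) (fun l w => del ^+ l * wjet w l 0) D c0 N.+1 D0.
have j0 w l : (l <= N)%N -> wjet w l 0 = X l w.
  by move=> lN; rewrite /wjet jet0// /B0 subrr.
have dl l : del ^+ l <= 1 by rewrite exprn_ile1// ltW.
have dl0 l : 0 <= del ^+ l by rewrite exprn_ge0// ltW.
have h1 : forall l w w', (l < N.+1)%N -> bounded_start H0 w -> bounded_start H0 w' ->
    `|del ^+ l * wjet w l 0 - del ^+ l * wjet w' l 0| <= c0%:R * D.
  move=> l w w' lN bw bw'; rewrite !j0// -mulrBr normrM ger0_norm//.
  apply: le_trans hH; apply: (@le_trans _ _ `|X l w - X l w'|); first by rewrite ler_piMl.
  rewrite (le_trans (ler_normB _ _))//.
  by have := bw l lN; have := bw' l lN => /=; lra.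
move=> /(_ h1); apply: pieces_weaken => // A' [sub hA].
move=> w w' Aw Aw'; split=> [s /andP[s0 s0']|l lN]; last exact: hA.
have -> : s = 0 by apply/le_anti; rewrite s0 s0'.
have := hA 0%N w w' isT Aw Aw'; rewrite expr0 !mul1r => /le_trans; apply.
by rewrite ler_peMl ?(ltW D0)// ler1n.
Qed.

Lemma measurable_bounded_start H0 : measurable (bounded_start H0).
Proof.
apply: bigcap_measurable; first by exists 0%N.
move=> l /= lN; apply: measurable_set_le; apply: measurable_fun_norm.
by have [] := lawX lN.
Qed.

Lemma bounded_start_prob H0 : 0 <= H0 ->
  (P (~` bounded_start H0) <= (N.+1%:R * (2 * expR (- (H0 ^+ 2 / 4))))%:E)%E.
Proof.
move=> H00; rewrite setC_bigcap bigcup_mkord.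
pose A l := ~` [set w | `|X l w| <= H0].
have mA l : (l < N.+1)%N -> measurable (A l).
  move=> lN; apply: measurableC; apply: measurable_set_le; apply: measurable_fun_norm.
  by have [] := lawX lN.
apply: (le_trans (Boole_inequality P mA)).
apply: (@le_trans _ _ (\sum_(l < N.+1) (2 * expR (- (H0 ^+ 2 / 4)))%:E)%E).
  apply: lee_sum => l _; have [mX lX] := lawX (ltn_ord l : (l <= N)%N).
  have -> : A l = X l @^-1` [set x | H0 * 1 < `|x|].
    apply/seteqP; split => w; rewrite /A /= mulr1 => h.
      by rewrite ltNge; apply/negP.
    by apply/negP; rewrite -ltNge.
  apply: le_trans (normal_prob_tail ltr01 H00); rewrite -lX//.
  by apply: measurable_set_gt; exact: measurable_fun_norm.
by rewrite sumEFin sumr_const card_ord -[_ *+ _]mulr_natl.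
Qed.

End sieve_probability.

(** * Posterior contraction *)

Section independent_expectation.
Context {R : realType} {d : measure_display} {T : measurableType d}.
Variable P : probability T R.
Local Open Scope ereal_scope.

Lemma indep_integralM (Y Z : T -> R) :
  measurable_fun setT Y -> measurable_fun setT Z ->
  (forall w, 0 <= Y w)%R -> (forall w, 0 <= Z w)%R ->
  (forall A B : set R, measurable A -> measurable B ->
    P (Y @^-1` A `&` Z @^-1` B) = P (Y @^-1` A) * P (Z @^-1` B)) ->
  \int[P]_w (Y w * Z w)%:E = (\int[P]_w (Y w)%:E) * (\int[P]_w (Z w)%:E).
Proof.
move=> mY mZ Y0 Z0 ind.
have mW : measurable_fun setT (fun w => (Y w, Z w)) by apply/measurable_fun_pairP.
pose nY : probability R R := distribution P (mfun_Sub (mem_set mY : Y \in mfun)).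
pose nZ : probability R R := distribution P (mfun_Sub (mem_set mZ : Z \in mfun)).
(* The variables are nonnegative pointwise, but Tonelli is applied on the plane, where the integrand
   has to be nonnegative everywhere. *)
pose f (p : R * R) : \bar R := (Num.max 0 p.1 * Num.max 0 p.2)%:E.
have mf : measurable_fun setT f.
  apply/measurable_EFinP; apply: measurable_funM; apply: measurable_maxr => //.
have f0 p : 0 <= f p by rewrite lee_fin mulr_ge0// le_max lexx.
have eW : \int[P]_w (Y w * Z w)%:E =
    \int[distribution P (mfun_Sub (mem_set mW : (fun w => (Y w, Z w)) \in mfun))]_p f p.
  rewrite ge0_integral_pushforward// preimage_setT; apply: eq_integral => w _ /=.
  by rewrite /f/= !max_r.
rewrite eW.
rewrite (eq_measure_integral (nY \x nZ)%E); last first.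
  move=> A mA _; apply/esym; apply: product_measure_unique mA => A1 A2 mA1 mA2; exact: (ind A1 A2 mA1 mA2).
rewrite fubini_tonelli1//.
under eq_integral do rewrite /fubini_F/f/=.
have mm : measurable_fun setT (fun x : R => (Num.max 0 x)%:E).
  by apply/measurable_EFinP; exact: measurable_maxr.
have m0 (x : R) : 0 <= (Num.max 0 x)%:E by rewrite lee_fin le_max lexx.
under eq_integral do (under eq_integral do rewrite EFinM; rewrite ge0_integralZl//).
rewrite ge0_integralZr//; last exact: integral_ge0.
rewrite !ge0_integral_pushforward// !preimage_setT.
by congr (_ * _); apply: eq_integral => w _ /=; rewrite max_r.
Qed.

End independent_expectation.

(** * Expectations of likelihood products *)

Section iid_likelihood.
Context {R : realType} {d d' du : measure_display}.
Context {T : measurableType d} {U : measurableType du} {S : measurableType d'}.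
Variables (P : probability T R) (X : nat -> T -> U).
Hypothesis mX : forall k, measurable_fun setT (X k).
Hypothesis indX : independent P setT (fun k => sigma_of (X k)).
Hypothesis lawX : forall k A, measurable A -> P (X k @^-1` A) = P (X 0%N @^-1` A).
Local Open Scope ereal_scope.

Lemma iid_integral (f : U -> R) k : measurable_fun setT f -> (forall x, 0 <= f x)%R ->
  \int[P]_w (f (X k w))%:E = \int[P]_w (f (X 0%N w))%:E.
Proof.
move=> mf f0.
have mE : measurable_fun setT (EFin \o f) by apply/measurable_EFinP.
have e i : \int[P]_w (f (X i w))%:E =
    \int[distribution P (mfun_Sub (mem_set (mX i) : X i \in mfun))]_x (f x)%:E.
  by rewrite ge0_integral_pushforward// => x _; rewrite lee_fin.
rewrite !e; apply: eq_measure_integral => A mA _.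
exact: lawX.
Qed.

Lemma iid_prod_integral (f : U -> R) (c : R) n :
  measurable_fun setT f -> (forall x, 0 <= f x)%R -> (0 <= c)%R ->
  \int[P]_w (f (X 0%N w))%:E <= c%:E ->
  \int[P]_w (\prod_(k < n) f (X k w))%:E <= (c ^+ n)%:E.
Proof.
move=> mf f0 c0 fc; elim: n => [|n IH].
  under eq_integral do rewrite big_ord0.
  by rewrite integral_cst// mul1e expr0; exact: probability_le1.
have mfX k : measurable_fun setT (f \o X k) by exact: measurableT_comp.
have mpr : measurable_fun setT (fun w => \prod_(k < n) f (X k w))%R.
  by apply: measurable_prod => k _; exact: mfX.
have pr0 w : (0 <= \prod_(k < n) f (X k w))%R by apply: prodr_ge0 => k _.
under eq_integral do rewrite big_ord_recr/=.
rewrite (indep_integralM (P := P) mpr (mfX n) pr0 (fun w => f0 _)); last first.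
  move=> A A' mA mA'.
  have sm : forall i, setT i -> sigma_of (X i) `<=` measurable.
    by move=> i _; apply: sigma_of_measurable.
  have dis i : [set i | (i < n)%N] i -> [set n] i -> False.
    by move=> /= lin iN; move: lin; rewrite iN ltnn.
  have sp := (independent_split (fun i => sigma_ofT (X i)) (fun i A A' => @sigma_ofI _ _ _ _ (X i) A A') sm
     (@subsetT _ [set i | (i < n)%N]) (@subsetT _ [set n]) dis indX).
  refine (sp _ _ _ _).
  - apply: gen_measurable_fun mA.
    apply: measurable_prod => k _.
    apply: measurable_fun_gen => A1 mA1; apply: sub_sigma_algebra.
    exists (k : nat); first by rewrite /= ltn_ord.
    exists (f @^-1` A1) => //; last by rewrite setTI.
    by rewrite -[X in measurable X]setTI; exact: mf.
  - apply: sub_sigma_algebra; exists n => //.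
    exists (f @^-1` A') => //; last by rewrite setTI.
    by rewrite -[X in measurable X]setTI; exact: mf.
rewrite exprSr EFinM; apply: lee_pmul => //.
- by apply: integral_ge0 => w _; rewrite lee_fin.
- by apply: integral_ge0 => w _; rewrite lee_fin; exact: f0.
- by rewrite iid_integral.
Qed.

Variable Q : probability S R.
Variable g : S -> U -> R.
Hypothesis mg : measurable_fun setT (fun p : S * U => g p.1 p.2).
Hypothesis g0 : forall s x, (0 <= g s x)%R.

Definition lik_prod n s w := (\prod_(k < n) g s (X k w))%R.

Lemma lik_prod_ge0 n s w : (0 <= lik_prod n s w)%R.
Proof. by apply: prodr_ge0 => k _. Qed.

Lemma measurable_lik_prod n : measurable_fun setT (fun p : T * S => lik_prod n p.2 p.1).
Proof.
apply: measurable_prod => k _.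
apply: (measurableT_comp (f := fun p : S * U => g p.1 p.2)
  (g := fun p : T * S => (p.2, X k p.1)) mg).
apply/measurable_fun_pairP; split; first exact: measurable_snd.
exact: (measurableT_comp (mX k) measurable_fst).
Qed.

Lemma measurable_lik_prod1 n w : measurable_fun setT (fun s => lik_prod n s w).
Proof. exact: (measurableT_comp (measurable_lik_prod n) (measurable_pair1 w)). Qed.

Definition lik_mass n (A : set S) w := \int[Q]_(s in A) (lik_prod n s w)%:E.

Lemma lik_massE n A w : measurable A ->
  lik_mass n A w = \int[Q]_s (lik_prod n s w * \1_A s)%:E.
Proof.
move=> mA; rewrite /lik_mass integral_mkcond; apply: eq_integral => s _.
by rewrite restrict_EFin /= patch_indic.
Qed.

Let measurable_lik_ind n A : measurable A ->
  measurable_fun setT (fun p : T * S => (lik_prod n p.2 p.1 * \1_A p.2)%:E).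
Proof.
move=> mA; apply/measurable_EFinP; apply: measurable_funM.
  exact: measurable_lik_prod.
by apply: measurableT_comp => //; exact: measurable_indic.
Qed.

Let lik_ind_ge0 n A (p : T * S) : 0 <= (lik_prod n p.2 p.1 * \1_A p.2)%:E.
Proof. by rewrite lee_fin mulr_ge0// lik_prod_ge0. Qed.

Lemma measurable_lik_mass n A : measurable A -> measurable_fun setT (lik_mass n A).
Proof.
move=> mA; rewrite (_ : lik_mass n A = fun w => \int[Q]_s (lik_prod n s w * \1_A s)%:E).
  exact: (measurable_fun_fubini_tonelli_F (m2 := Q) _ (measurable_lik_ind n mA) (lik_ind_ge0 n A)).
by apply/funext => w; rewrite lik_massE.
Qed.

Lemma lik_mass_integral n A (c : R) : measurable A -> (0 <= c)%R ->
  (forall s, A s -> \int[P]_w (g s (X 0%N w))%:E <= c%:E) ->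
  \int[P]_w lik_mass n A w <= (c ^+ n)%:E * Q A.
Proof.
move=> mA c0 hc; under eq_integral do rewrite lik_massE//.
rewrite (@fubini_tonelli _ _ _ _ _ P Q (fun p : T * S => (lik_prod n p.2 p.1 * \1_A p.2)%:E)
  (measurable_lik_ind n mA) (lik_ind_ge0 n A)).
rewrite -[X in _ * Q X](setIT A) -integral_indic// -ge0_integralZl//; last 2 first.
- by apply/measurable_EFinP; exact: measurable_indic.
- by rewrite lee_fin exprn_ge0.
have m1 : measurable_fun setT (fun s => \int[P]_w (lik_prod n s w * \1_A s)%:E).
  exact: (measurable_fun_fubini_tonelli_G (m1 := P) _ (measurable_lik_ind n mA) (lik_ind_ge0 n A)).
apply: ge0_le_integral => //.
- by move=> s _; apply: integral_ge0 => w _; rewrite lee_fin mulr_ge0// lik_prod_ge0.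
- apply: measurable_funeM; apply/measurable_EFinP; exact: measurable_indic.
move=> s _ /=; rewrite indicE; have [/set_mem As|_] := boolP (s \in A).
  rewrite mule1; under eq_integral do rewrite mulr1.
  apply: iid_prod_integral => //; last exact: hc.
  exact: (measurableT_comp mg (measurable_pair1 s)).
rewrite mule0; under eq_integral do rewrite mulr0.
by rewrite integral0.
Qed.

(** Markov's inequality after exchanging prior and sample. The weight [g] is kept general: besides
    the likelihood ratio it will be a square root of it, a quotient by this root, and a
    reciprocal. *)
Lemma lik_mass_markov n A (c t : R) : measurable A -> (0 <= c)%R -> (0 < t)%R ->
  (forall s, A s -> \int[P]_w (g s (X 0%N w))%:E <= c%:E) ->
  P [set w | t%:E <= lik_mass n A w] <= (c ^+ n / t)%:E * Q A.
Proof.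
move=> mA c0 t0 hc; rewrite (mulrC (c ^+ n)%R) EFinM -muleA.
have l0 w : 0 <= lik_mass n A w.
  by apply: integral_ge0 => s _; rewrite lee_fin lik_prod_ge0.
rewrite [leLHS](_ : _ = t^-1%:E * (t%:E * P (setT `&` [set w | t%:E <= `|lik_mass n A w|]))); last first.
  rewrite muleA -EFinM mulVf ?gt_eqF// mul1e setTI; congr (P _).
  by apply/seteqP; split => w /=; rewrite gee0_abs.
apply: lee_wpmul2l; first by rewrite lee_fin invr_ge0 ltW.
apply: le_trans (lik_mass_integral n mA c0 hc).
apply: le_trans (le_integral_abse _ _ _ _) _ => //; first exact: measurable_lik_mass.
by under eq_integral do rewrite gee0_abs//.
Qed.

End iid_likelihood.

Lemma measurable_funV_ge0 {R : realType} {d} {T : measurableType d} (f : T -> R) :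
  (forall x, 0 <= f x) -> measurable_fun setT f -> measurable_fun setT (fun x => (f x)^-1).
Proof.
move=> f0 mf; rewrite (_ : (fun x => _) = fun x => f x `^ (-1)).
  exact: (measurableT_comp (measurable_powR (-1)) mf).
by apply/funext => x; rewrite powR_inv1.
Qed.

(** * Evidence, cells and posterior mass *)

Section posterior_bound.
Context {R : realType} {d d' du : measure_display}.
Context {T : measurableType d} {U : measurableType du} {S : measurableType d'}.
Variables (P : probability T R) (X : nat -> T -> U) (Q : probability S R).
Hypothesis mX : forall k, measurable_fun setT (X k).
Hypothesis indX : independent P setT (fun k => sigma_of (X k)).
Hypothesis lawX : forall k A, measurable A -> P (X k @^-1` A) = P (X 0%N @^-1` A).
Variable r : S -> U -> R.
Hypothesis mr : measurable_fun setT (fun p : S * U => r p.1 p.2).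
Hypothesis r_gt0 : forall s x, 0 < r s x.
Hypothesis r_density : forall s, (\int[P]_w (r s (X 0%N w))%:E = 1)%E.

(** Squared Hellinger distance between the model [s] and the truth, [r s] being the density of the
    former relative to the latter. *)
Definition hell2 s := \int[P]_w (Num.sqrt (r s (X 0%N w)) - 1) ^+ 2.

Let measurable_r s : measurable_fun setT (r s).
Proof. exact: (measurableT_comp mr (measurable_pair1 s)). Qed.

Let mrX s : measurable_fun setT (fun w => r s (X 0%N w)).
Proof. exact: (measurableT_comp (measurable_r s) (mX 0)). Qed.

Let r_integrable s : P.-integrable setT (EFin \o (fun w => r s (X 0%N w))).
Proof.
apply/integrableP; split; first by apply/measurable_EFinP; exact: mrX.
under eq_integral => w _ do rewrite /= ger0_norm ?(ltW (r_gt0 _ _))//.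
by rewrite r_density ltry.
Qed.

Let hell_integrable s :
  P.-integrable setT (EFin \o (fun w => (Num.sqrt (r s (X 0%N w)) - 1) ^+ 2)).
Proof.
apply: (@le_integrable _ _ _ P setT _ _ (EFin \o (fun w => r s (X 0%N w) + 1))) => //.
- apply/measurable_EFinP; apply: measurable_funX; apply: measurable_funB => //.
  by apply: (measurableT_comp (continuous_measurable_fun (@sqrt_continuous R)) (mrX s)).
- move=> w _ /=; rewrite lee_fin !ger0_norm ?sqr_ge0 ?addr_ge0 ?(ltW (r_gt0 _ _))//.
  have := sqr_sqrtr (ltW (r_gt0 s (X 0 w))).
  have := sqrtr_ge0 (r s (X 0 w)).
  move: (Num.sqrt _) => y y0 <-; nra.
- have i1 : P.-integrable setT (EFin \o (fun _ : T => 1 : R)).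
    exact: finite_measure_integrable_cst.
  exact: (integrableD measurableT (r_integrable s) i1).
Qed.

Let rintegral_r s : \int[P]_w r s (X 0%N w) = 1.
Proof. by rewrite /Rintegral r_density. Qed.

(** Transfers a pointwise inequality to expectations, by E r = 1 and the definition of [hell2]; the
    coefficients are adapted to each use. *)
Let affine_integral s s' (a b c e : R) (f : T -> R) : measurable_fun setT f ->
  (forall w, 0 <= f w) ->
  (forall w, f w <= a * r s (X 0%N w) + b * r s' (X 0%N w) +
    c * (Num.sqrt (r s' (X 0%N w)) - 1) ^+ 2 + e) ->
  (\int[P]_w (f w)%:E <= (a + b + c * hell2 s' + e)%:E)%E.
Proof.
move=> mf f0 fle.
pose F w := a * r s (X 0%N w) + b * r s' (X 0%N w) +
    c * (Num.sqrt (r s' (X 0%N w)) - 1) ^+ 2 + e.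
have i1 : P.-integrable setT (EFin \o (fun w => a * r s (X 0%N w))).
  by apply: (integrableZl measurableT a (r_integrable s)).
have i2 : P.-integrable setT (EFin \o (fun w => b * r s' (X 0%N w))).
  by apply: (integrableZl measurableT b (r_integrable s')).
have i3 : P.-integrable setT (EFin \o (fun w => c * (Num.sqrt (r s' (X 0%N w)) - 1) ^+ 2)).
  by apply: (integrableZl measurableT c (hell_integrable s')).
have i4 : P.-integrable setT (EFin \o (fun _ : T => e)) by exact: finite_measure_integrable_cst.
have i12 := integrableD measurableT i1 i2.
have i123 := integrableD measurableT i12 i3.
have iF : P.-integrable setT (EFin \o F) := integrableD measurableT i123 i4.
have -> : a + b + c * hell2 s' + e = \int[P]_w F w.
  rewrite RintegralD// RintegralD// RintegralD//.
  rewrite (RintegralZl _ measurableT (r_integrable s)) (RintegralZl _ measurableT (r_integrable s')).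
  rewrite (RintegralZl _ measurableT (hell_integrable s')) !rintegral_r !mulr1; congr (_ + _).
  rewrite Rintegral_cst//; have /(congr1 fine) /= h1 := @probability_setT _ _ _ P.
  by transitivity (e * 1); [rewrite mulr1 | congr (_ * _); rewrite -h1].
rewrite /Rintegral fineK; last exact: integrable_fin_num.
apply: ge0_le_integral => //.
- by move=> w _; rewrite lee_fin f0.
- by apply/measurable_EFinP.
- exact: measurable_int iF.
- by move=> w _; rewrite lee_fin fle.
Qed.

(** With v the square root of the ratio at the centre [s0], write r s = v (r s / v). The product of
    the v is at least 1 with probability at most e^(-n h^2 / 2), because E v = 1 - hell2 / 2.
    Otherwise the likelihood of a member of the cell is at most the product of the r s / v, whose
    expectation is still below (1 - h^2 / 4)^n. *)
Lemma cell_prob n (A : set S) s0 (eta h t : R) : measurable A -> A s0 ->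
  0 < t -> 16 * eta ^+ 2 <= h ^+ 2 ->
  (forall s x, A s -> `|r s x - r s0 x| <= eta * r s0 x) ->
  h ^+ 2 <= hell2 s0 ->
  (P [set w | t%:E <= lik_mass X Q r n A w] <=
   (expR (- (n%:R * h ^+ 2 / 2)) + expR (- (n%:R * h ^+ 2 / 4)) / t)%:E)%E.
Proof.
move=> mA As0 t0 eh hr hh.
pose v x := Num.sqrt (r s0 x).
have v0 x : 0 < v x by rewrite sqrtr_gt0.
have vv x : v x ^+ 2 = r s0 x by rewrite sqr_sqrtr// ltW.
have mv : measurable_fun setT v.
  by apply: (measurableT_comp (continuous_measurable_fun (@sqrt_continuous R)) (measurable_r s0)).
pose g1 (s : S) x := v x.
pose g2 (s : S) x := r s x / v x.
have mg1 : measurable_fun setT (fun p : S * U => g1 p.1 p.2).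
  exact: (measurableT_comp mv measurable_snd).
have mg2 : measurable_fun setT (fun p : S * U => g2 p.1 p.2).
  apply: measurable_funM => //.
  by apply: measurable_funV_ge0 => [p|]; [exact: ltW|exact: (measurableT_comp mv measurable_snd)].
have g10 (s : S) x : 0 <= g1 s x by exact: ltW.
have g20 s x : 0 <= g2 s x by rewrite divr_ge0 ?ltW// r_gt0.
have h2 := sqr_ge0 h.
have c1 s : A s -> (\int[P]_w (g1 s (X 0%N w))%:E <= (1 - h ^+ 2 / 2)%:E)%E.
  move=> As; apply: (@le_trans _ _ (0 + 2^-1 + (- 2^-1) * hell2 s0 + 2^-1)%:E).
    apply: (@affine_integral s0 s0) => //; first exact: (measurableT_comp mv (mX 0)).
    by move=> w; rewrite /g1 -/(v _) -vv; move: (v _) => y; nra.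
  by rewrite lee_fin; nra.
have c2 s : A s -> (\int[P]_w (g2 s (X 0%N w))%:E <= (1 - h ^+ 2 / 4)%:E)%E.
  (* With y the value of v and r s = y^2 (1 + del), the pointwise bound is a completed square in del
     y - (1 - y) / 4. This spends an eighth of [hell2 s0], and [16 * eta ^+ 2 <= h ^+ 2] makes the
     error 2 eta^2 at most another eighth of h^2. *)
  move=> As; apply: (@le_trans _ _ (1 + (- 2^-1 + 2 * eta ^+ 2) + (- (3 / 8)) * hell2 s0 + 2^-1)%:E).
    apply: (@affine_integral s s0) => //.
      apply: (measurableT_comp (f := fun x => g2 s x)) => //.
      exact: (measurableT_comp mg2 (measurable_pair1 s)).
    move=> w; rewrite -/(v _) /g2; have := hr s (X 0%N w) As.
    have := r_gt0 s (X 0%N w); rewrite -vv; have := v0 (X 0%N w).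
    move: (v _) (r s _) => y x y0 x0.
    rewrite ler_norml => /andP[l1 l2].
    pose del := x / y ^+ 2 - 1.
    have xE : x = y ^+ 2 * (1 + del).
      by rewrite /del addrCA subrr addr0 mulrCA divff ?mulr1// expf_neq0// gt_eqF.
    have xy : x / y = y * (1 + del).
      rewrite [in LHS]xE; move: (1 + del) => z; field.
      by rewrite gt_eqF.
    have y2 : 0 < y ^+ 2 by rewrite exprn_gt0.
    have de : del ^+ 2 <= eta ^+ 2.
      have d1 : del <= eta by rewrite /del lerBlDr ler_pdivrMr//; lra.
      have d2 : - eta <= del by rewrite /del lerBrDr ler_pdivlMr//; lra.
      nra.
    rewrite xy xE.
    have : 0 <= (eta ^+ 2 - del ^+ 2) * y ^+ 2 by rewrite mulr_ge0 ?sqr_ge0// subr_ge0.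
    have := sqr_ge0 (del * y - (1 - y) / 4).
    lra.
  by rewrite lee_fin; nra.
have ec (k : R) : 0 < k -> (1 - h ^+ 2 / k <= expR (- (h ^+ 2 / k)))%R.
  by move=> k0; exact: expR_ge1Dx.
have eX (k : R) : expR (- (h ^+ 2 / k)) ^+ n = expR (- (n%:R * h ^+ 2 / k)).
  by rewrite -expRM_natl mulrN mulrA.
have mE1 := measurable_lik_mass mX Q mg1 g10 n measurableT.
have mE2 := measurable_lik_mass mX Q mg2 g20 n mA.
have P1 := lik_mass_markov mX indX lawX Q mg1 g10 n measurableT (expR_ge0 _) ltr01
  (fun s _ => le_trans (c1 s0 As0) (_ : _ <= (expR (- (h ^+ 2 / 2)))%:E)%E).
have P2 := lik_mass_markov mX indX lawX Q mg2 g20 n mA (expR_ge0 _) t0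
  (fun s As => le_trans (c2 s As) (_ : _ <= (expR (- (h ^+ 2 / 4)))%:E)%E).
have m1 : measurable [set w | (1%:E <= lik_mass X Q g1 n setT w)%E].
  by rewrite -[X in measurable X]setTI; apply: emeasurable_fun_c_infty.
have m2 : measurable [set w | (t%:E <= lik_mass X Q g2 n A w)%E].
  by rewrite -[X in measurable X]setTI; apply: emeasurable_fun_c_infty.
have m0 : measurable [set w | (t%:E <= lik_mass X Q r n A w)%E].
  rewrite -[X in measurable X]setTI; apply: emeasurable_fun_c_infty => //.
  by apply: (measurable_lik_mass mX) => // s x; exact: ltW.
apply: le_trans (_ : _ <= P ([set w | (1%:E <= lik_mass X Q g1 n setT w)%E] `|`
    [set w | (t%:E <= lik_mass X Q g2 n A w)%E]))%E _.
  apply: le_measure; rewrite ?inE//; first exact: measurableU.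
  move=> w /= hw; have [l1|g1w] := ltP (\prod_(k < n) v (X k w)) 1; last first.
    left; rewrite /lik_mass /lik_prod /=.
    rewrite (@integral_cst _ _ _ Q _ measurableT (\prod_(k < n) v (X k w))%:E).
    have h1 := @probability_setT _ _ _ Q.
    suff -> : ((\prod_(k < n) v (X k w))%:E * Q [set: S] = (\prod_(k < n) v (X k w))%:E)%E.
      by rewrite lee_fin.
    by transitivity ((\prod_(k < n) v (X k w))%:E * 1)%E; [congr (_ * _)%E | rewrite mule1].
  right; apply: le_trans hw _; apply: ge0_le_integral => //.
  - by move=> s _; rewrite lee_fin; apply: lik_prod_ge0 => s' x; exact: ltW.
  - apply/measurable_EFinP; apply: measurable_funTS.
    exact: (measurable_lik_prod1 mX mr).
  - apply/measurable_EFinP; apply: measurable_funTS.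
    exact: (measurable_lik_prod1 mX mg2).
  - move=> s As; rewrite lee_fin /lik_prod.
    rewrite (_ : \prod_(k < n) r s (X k w) = \prod_(k < n) g2 s (X k w) * \prod_(k < n) v (X k w)).
      apply: (ler_piMr _ (ltW l1)); apply: prodr_ge0 => k _; exact: g20.
    rewrite -big_split/=; apply: eq_bigr => k _.
    by rewrite /g2 divfK// gt_eqF.
apply: le_trans (measureU2 _ _ _) _ => //.
rewrite EFinD; apply: leeD.
  apply: le_trans (P1 _) _; first by move=> *; rewrite lee_fin ec.
  rewrite divr1 eX -[leRHS]mule1; apply: lee_wpmul2l; first by rewrite lee_fin expR_ge0.
  exact: probability_le1.
apply: le_trans (P2 _) _; first by move=> *; rewrite lee_fin ec.
rewrite eX -[leRHS]mule1; apply: lee_wpmul2l; last exact: probability_le1.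
by rewrite lee_fin divr_ge0 ?expR_ge0// ltW.
Qed.

(** Since E r = 1 and |r - 1| <= eps on [A], one has E (1 / r) <= e^(2 eps^2). By Markov the
    reciprocal likelihood integrates over [A] to at most e^(3 n eps^2) Q(A), outside an event of
    probability e^(-n eps^2); by the inequality between means the likelihood then integrates to at
    least e^(-3 n eps^2) Q(A). *)
Lemma evidence_prob n (A : set S) (eps q : R) : measurable A -> 0 <= eps <= 1 / 2 ->
  0 < q -> (q%:E <= Q A)%E ->
  (forall s x, A s -> `|r s x - 1| <= eps) ->
  (P [set w | lik_mass X Q r n setT w < (q * expR (- (3 * (n%:R * eps ^+ 2))))%:E] <=
   (expR (- (n%:R * eps ^+ 2)))%:E)%E.
Proof.
move=> mA /andP[e0 e1] q0 qA hr.
pose g s x := (r s x)^-1.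
have mg : measurable_fun setT (fun p : S * U => g p.1 p.2).
  by apply: measurable_funV_ge0 => // p; exact: ltW.
have g0 s x : 0 <= g s x by rewrite invr_ge0 ltW.
have r0 s x : 0 <= r s x by exact: ltW.
pose p := fine (Q A).
have pE : Q A = p%:E by rewrite fineK// fin_num_measure.
have qp : q <= p by rewrite -lee_fin -pE.
have p0 : 0 < p by exact: lt_le_trans qp.
pose la := expR (- (3 * (n%:R * eps ^+ 2))) : R.
have la0 : 0 < la by exact: expR_gt0.
have c1 s : A s -> (\int[P]_w (g s (X 0%N w))%:E <= (expR (2 * eps ^+ 2))%:E)%E.
  (* For y >= 1/2 one has 1 / y <= 2 - y + 2 (y - 1)^2. The linear term has expectation -1, so no
     first-order term in [eps] remains. *)
  move=> As; apply: (@le_trans _ _ (0 + (- 1) + 0 * hell2 s + (2 + 2 * eps ^+ 2))%:E).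
    apply: (@affine_integral s s) => //.
      exact: (measurableT_comp (measurableT_comp mg (measurable_pair1 s)) (mX 0)).
    move=> w; rewrite /g !mul0r addr0 add0r; have := hr s (X 0%N w) As.
    have := r_gt0 s (X 0%N w); move: (r s _) => y y0; rewrite ler_norml => /andP[l1 l2].
    rewrite -[leLHS]mul1r ler_pdivrMr//.
    have : (y - 1) ^+ 2 <= eps ^+ 2 by nra.
    have : 1 / 2 <= y by lra.
    nra.
  rewrite lee_fin mul0r addr0; apply: le_trans (expR_ge1Dx _); lra.
have mD := measurable_lik_mass mX Q mr r0 n measurableT.
have mW := measurable_lik_mass mX Q mg g0 n mA.
have t0 : 0 < p / la by rewrite divr_gt0.
have := lik_mass_markov mX indX lawX Q mg g0 n mA (expR_ge0 _) t0 c1.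
rewrite pE -EFinM [X in (_ <= X%:E)%E](_ : _ = expR (- (n%:R * eps ^+ 2))); last first.
  rewrite -expRM_natl invf_div -mulrA divfK ?gt_eqF// /la -expRD; congr expR; ring.
apply: le_trans; apply: le_measure; rewrite ?inE.
- rewrite -[X in measurable X]setTI; exact: emeasurable_fun_infty_o.
- rewrite -[X in measurable X]setTI; exact: emeasurable_fun_c_infty.
move=> w /= hD; rewrite leNgt; apply/negP => hW.
have hD' : (lik_mass X Q r n setT w < (p * la)%:E)%E.
  by apply: lt_le_trans hD _; rewrite lee_fin ler_wpM2r// ltW.
have L0 s : 0 < lik_prod X r n s w by apply: prodr_gt0 => k _.
have gE s : lik_prod X g n s w = (lik_prod X r n s w)^-1 by rewrite /lik_prod prodfV.
have mLr : measurable_fun A (fun s => (lik_prod X r n s w)%:E).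
  by apply/measurable_EFinP; apply: measurable_funTS; exact: (measurable_lik_prod1 mX mr).
have mLg : measurable_fun A (fun s => (lik_prod X g n s w)%:E).
  by apply/measurable_EFinP; apply: measurable_funTS; exact: (measurable_lik_prod1 mX mg).
(* The pointwise inequality 1 <= y / (2 la) + la / (2 y), with y the likelihood, stands for the
   Cauchy-Schwarz inequality. *)
have key : (p%:E <= (2 * la)^-1%:E * lik_mass X Q r n A w + (la / 2)%:E * lik_mass X Q g n A w)%E.
  have k1 : 0 <= (2 * la)^-1 by rewrite invr_ge0 mulr_ge0// ltW.
  have k2 : 0 <= la / 2 by rewrite divr_ge0// ltW.
  rewrite -pE -[Q A]mul1e -integral_cst// /lik_mass -ge0_integralZl//; last first.
    by move=> s _; rewrite lee_fin ltW.
  rewrite -ge0_integralZl//; last by move=> s _; rewrite lee_fin gE invr_ge0 ltW.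
  rewrite -ge0_integralD//.
  - apply: ge0_le_integral => //.
      by apply: emeasurable_funD; apply: measurable_funeM.
    move=> s As; rewrite -!EFinM -EFinD lee_fin gE.
    have := L0 s; move: (lik_prod _ _ _ _ _) => y y0.
    rewrite -subr_ge0 (_ : _ - 1 = (y - la) ^+ 2 / (2 * la * y)).
      by rewrite divr_ge0 ?sqr_ge0// mulr_ge0 ?mulr_ge0// ltW.
    by field; rewrite !gt_eqF.
  - by move=> s _; rewrite -EFinM lee_fin mulr_ge0// ltW.
  - exact: measurable_funeM.
  - by move=> s _; rewrite -EFinM lee_fin mulr_ge0// gE invr_ge0 ltW.
  - exact: measurable_funeM.
have hA : (lik_mass X Q r n A w <= lik_mass X Q r n setT w)%E.
  apply: ge0_subset_integral => //.
    by apply/measurable_EFinP; exact: (measurable_lik_prod1 mX mr).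
  by move=> s _; rewrite lee_fin ltW.
have a0 : (0 <= lik_mass X Q r n A w)%E.
  by apply: integral_ge0 => s _; rewrite lee_fin ltW.
have b0 : (0 <= lik_mass X Q g n A w)%E.
  by apply: integral_ge0 => s _; rewrite lee_fin gE invr_ge0 ltW.
have hA' := le_lt_trans hA hD'.
move: key a0 b0 hA' hW {hA}.
case: (lik_mass X Q r n A w) => [x| |]//; case: (lik_mass X Q g n A w) => [y| |]//.
rewrite -!EFinM -EFinD !lee_fin !lte_fin => key x0 y0 xp yp.
have : (2 * la)^-1 * x < p / 2.
  by rewrite mulrC ltr_pdivrMr ?mulr_gt0//; lra.
have : la / 2 * y < p / 2.
  by move: yp; rewrite ltr_pdivlMr//; lra.
lra.
Qed.

Let lik_massU n A A' w : measurable A -> measurable A' ->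
  (lik_mass X Q r n (A `|` A') w <= lik_mass X Q r n A w + lik_mass X Q r n A' w)%E.
Proof.
move=> mA mA'; have mAA := measurableU _ _ mA mA'.
have r0 s x : 0 <= r s x by exact: ltW.
have m1 B : measurable B -> measurable_fun setT (fun s => (lik_prod X r n s w * \1_B s)%:E).
  move=> mB; apply/measurable_EFinP; apply: measurable_funM.
    exact: (measurable_lik_prod1 mX mr).
  exact: measurable_indic.
have p0 B s : (0 <= (lik_prod X r n s w * \1_B s)%:E)%E.
  by rewrite lee_fin mulr_ge0// lik_prod_ge0.
rewrite !lik_massE// -ge0_integralD//; try exact: m1.
apply: ge0_le_integral => //; first exact: m1.
  by apply: emeasurable_funD; exact: m1.
move=> s _; rewrite -EFinD lee_fin -mulrDr ler_wpM2l ?lik_prod_ge0//.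
rewrite !indicE in_setU; case: (s \in A); case: (s \in A') => //=; lra.
Qed.

(** Off the exceptional events the evidence is at least a = q e^(-3 n eps^2). Half of delta a is
    granted to [E] and the other half is shared by the cells; dividing by [J.+1] also covers the
    case of no cell. *)
Lemma posterior_prob n (Bad A E : set S) (F : nat -> set S) J (eps q phi eta h delta : R) :
  let u := delta * (q * expR (- (3 * (n%:R * eps ^+ 2)))) / 2 in
  let t := u / J.+1%:R in
  measurable Bad -> measurable A -> measurable E -> (forall j, measurable (F j)) ->
  Bad `<=` E `|` \big[setU/set0]_(j < J) F j ->
  0 <= eps <= 1 / 2 -> 0 < q -> (q%:E <= Q A)%E ->
  (forall s x, A s -> `|r s x - 1| <= eps) ->
  (Q E <= phi%:E)%E -> 0 < delta -> 16 * eta ^+ 2 <= h ^+ 2 ->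
  (forall j s s' x, F j s -> F j s' -> `|r s x - r s' x| <= eta * r s' x) ->
  (forall s, Bad s -> h ^+ 2 <= hell2 s) ->
  (P [set w | (delta < `|posterior Q (fun s => lik_prod X r n s w) Bad - 0|)%R] <=
   (expR (- (n%:R * eps ^+ 2)) + phi / u +
    J%:R * (expR (- (n%:R * h ^+ 2 / 2)) + expR (- (n%:R * h ^+ 2 / 4)) / t))%:E)%E.
Proof.
move=> u t mB mA mE mF cov e01 q0 qA hA QE d0 eh hF hB.
have r0 s x : 0 <= r s x by exact: ltW.
pose a := q * expR (- (3 * (n%:R * eps ^+ 2))).
have a0 : 0 < a by rewrite mulr_gt0 ?expR_gt0.
have u0 : 0 < u by rewrite /u !mulr_gt0 ?expR_gt0// invr_gt0.
have t0 : 0 < t by rewrite /t divr_gt0.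
have mm B : measurable B -> measurable_fun setT (lik_mass X Q r n B).
  exact: measurable_lik_mass.
pose D0 := [set w | (lik_mass X Q r n setT w < a%:E)%E].
pose D1 := [set w | (u%:E <= lik_mass X Q r n E w)%E].
pose D2 j := [set w | (t%:E <= lik_mass X Q r n (F j `&` Bad) w)%E].
have mFB j : measurable (F j `&` Bad) by exact: measurableI.
have mD0 : measurable D0.
  by rewrite -[X in measurable X]setTI; apply: emeasurable_fun_infty_o => //; exact: mm.
have mD1 : measurable D1.
  by rewrite -[X in measurable X]setTI; apply: emeasurable_fun_c_infty => //; exact: mm.
have mD2 j : measurable (D2 j).
  by rewrite -[X in measurable X]setTI; apply: emeasurable_fun_c_infty => //; exact: mm.
have mU : measurable (\big[setU/set0]_(j < J) D2 j) by exact: bigsetU_measurable.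
have l0 B w : (0 <= lik_mass X Q r n B w)%E.
  by apply: integral_ge0 => s _; rewrite lee_fin lik_prod_ge0.
have postE w : posterior Q (fun s => lik_prod X r n s w) Bad =
    fine (lik_mass X Q r n Bad w) / fine (lik_mass X Q r n setT w) by [].
apply: (@le_trans _ _ (P (D0 `|` D1 `|` \big[setU/set0]_(j < J) D2 j))).
  apply: le_measure; rewrite ?inE; last 2 first.
  - by apply: measurableU => //; exact: measurableU.
  - move=> w /=; rewrite subr0 => dp.
    apply: contrapT => /not_orP[/not_orP[nD0 nD1] nD2].
    have {}nD0 : (a%:E <= lik_mass X Q r n setT w)%E by rewrite leNgt; exact/negP.
    have {}nD1 : (lik_mass X Q r n E w < u%:E)%E by rewrite ltNge; exact/negP.
    have {}nD2 j : (j < J)%N -> (lik_mass X Q r n (F j `&` Bad) w < t%:E)%E.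
      move=> jJ; rewrite ltNge; apply/negP => h1; apply: nD2.
      by apply: (bigsetU_sup (i := j)) h1.
    have mUF k : measurable (\big[setU/set0]_(j < k) (F j `&` Bad)) by exact: bigsetU_measurable.
    have sumE k : (k <= J)%N ->
        (lik_mass X Q r n (E `|` \big[setU/set0]_(j < k) (F j `&` Bad)) w < (u + k%:R * t)%:E)%E.
      elim: k => [|k IH] kJ; first by rewrite big_ord0 setU0 mul0r addr0.
      rewrite big_ord_recr /= setUA.
      apply: le_lt_trans (lik_massU _ _ (measurableU _ _ mE (mUF k)) (mFB k)) _.
      have -> : u + k.+1%:R * t = u + k%:R * t + t by rewrite -[in LHS]natr1 mulrDl mul1r addrA.
      by rewrite [ltRHS]EFinD; apply: lteD; [apply: IH; exact: ltnW | exact: nD2].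
    have NB : (lik_mass X Q r n Bad w < (delta * a)%:E)%E.
      apply: le_lt_trans (lt_le_trans (sumE J _) (_ : _ <= _)%E) => //; last first.
        rewrite lee_fin (_ : delta * a = u + J.+1%:R * t).
          by rewrite lerD2l ler_wpM2r ?ler_nat// ltW.
        by rewrite [X in _ + X]mulrC /t divfK// /u -splitr.
      apply: ge0_subset_integral => //; first exact: measurableU.
      + by apply/measurable_EFinP; apply: measurable_funTS; exact: (measurable_lik_prod1 mX mr).
      + by move=> s _; rewrite lee_fin lik_prod_ge0.
      + move=> s Bs; have [Es|] := cov s Bs; first by left.
        by rewrite -bigcup_mkord => -[j jJ Fs]; right; apply: (bigsetU_sup (i := j) (F := fun j => F j `&` Bad)).
    move: dp; rewrite postE.
    move: nD0 NB (l0 Bad w) (l0 setT w).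
    (* An infinite evidence is sent to 0 by [fine]; the posterior is then 0 and does not exceed
       [delta]. *)
    case: (lik_mass _ _ _ _ setT w) => [y| |]//; last by rewrite /= invr0 mulr0 normr0; lra.
    case: (lik_mass _ _ _ _ Bad w) => [x| |]//=.
    rewrite !lee_fin !lte_fin => ay xa x0 y0.
    rewrite ger0_norm ?divr_ge0// ltr_pdivlMr ?(lt_le_trans a0)// => dx.
    have : delta * a <= delta * y by rewrite ler_wpM2l// ltW.
    lra.
  - have mp : measurable_fun setT (fun w => `|posterior Q (fun s => lik_prod X r n s w) Bad - 0|).
      apply: measurable_fun_norm; apply: measurable_funB => //.
      rewrite (_ : (fun w => _) = fun w => fine (lik_mass X Q r n Bad w) *
        (fine (lik_mass X Q r n setT w))^-1)//.
      apply: measurable_funM.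
        exact: (measurableT_comp _ (mm _ mB)).
      apply: measurable_funV_ge0 => [w|]; first exact: fine_ge0.
      exact: (measurableT_comp _ (mm _ measurableT)).
    exact: measurable_set_gt.
apply: le_trans (measureU2 _ _ _) _ => //; first exact: measurableU.
rewrite [leRHS]EFinD; apply: leeD.
  apply: le_trans (measureU2 _ _ _) _ => //.
  rewrite [leRHS]EFinD; apply: leeD; first exact: (evidence_prob _ mA).
  apply: le_trans (lik_mass_markov mX indX lawX Q mr r0 n mE ler01 u0 _) _.
    by move=> s _; rewrite r_density.
  rewrite expr1n.
  have -> : ((phi / u)%:E = (1 / u)%:E * phi%:E)%E by rewrite -EFinM mul1r mulrC.
  by apply: lee_wpmul2l => //; rewrite lee_fin divr_ge0// ltW.
apply: le_trans (Boole_inequality P _) _ => //.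
rewrite -[J in (J%:R)]card_ord -sum1_card natr_sum big_distrl/= -sumEFin.
apply: lee_sum => j _; rewrite mul1r.
rewrite /D2; have [->|/set0P[s0 [Fs0 Bs0]]] := eqVneq (F j `&` Bad) set0.
  rewrite (_ : [set w | _] = set0) ?measure0; last first.
    by rewrite -subset0 => w /=; rewrite /lik_mass integral_set0 lee_fin leNgt t0.
  by rewrite lee_fin; apply: addr_ge0; [|apply: divr_ge0; [|exact: ltW]]; exact: expR_ge0.
apply: (@cell_prob n _ s0 eta) => //; last exact: hB.
by move=> s x [Fs _]; exact: hF Fs Fs0.
Qed.

(* The three conditions of the general theory: prior mass of a small neighbourhood,
   a sieve complement of negligible prior mass, and a cover of the sieve. *)
Definition contraction_sets (c1 c2 c3 c4 K : R) (n : nat) (eps : R) :=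
  exists A E : set S, exists F : nat -> set S, exists J : nat,
    [/\ measurable A, measurable E, forall j, measurable (F j) &
        ~` E `<=` \big[setU/set0]_(j < J) F j] /\
    [/\ ((expR (- (c1 * (n%:R * eps ^+ 2))))%:E <= Q A)%E,
        (Q E <= (K * expR (- ((c1 + 3 * c2 ^+ 2 + 1) * (n%:R * eps ^+ 2))))%:E)%E,
        J%:R <= K * expR (c3 * (n%:R * eps ^+ 2)),
        forall s x, A s -> `|r s x - 1| <= c2 * eps &
        forall j s s' x, F j s -> F j s' -> `|r s x - r s' x| <= c4 * eps * r s' x].

Lemma posterior_contraction (eps M : nat -> R) (Bad : nat -> set S) (c1 c2 c3 c4 K : R) :
  0 <= c1 -> 1 <= c2 -> 0 <= c3 -> 0 <= K ->
  eps n @[n --> \oo] --> 0 -> (forall n, 0 <= eps n) ->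
  n%:R * eps n ^+ 2 @[n --> \oo] --> +oo -> M n @[n --> \oo] --> +oo ->
  (forall n, measurable (Bad n)) ->
  (forall n s, Bad n s -> 0 <= M n -> (M n * eps n) ^+ 2 <= hell2 s) ->
  (\forall n \near \oo, contraction_sets c1 c2 c3 c4 K n (eps n)) ->
  cvg_in_probability P (fun n w => posterior Q (fun s => lik_prod X r n s w) (Bad n)) 0.
Proof.
move=> c10 c21 c30 K0 eps0 epsge0 Boo Moo mB hB sets delta d0.
have c20 : 0 < c2 by exact: lt_le_trans c21.
pose B n := n%:R * eps n ^+ 2.
pose K' := 1 + 2 * K / delta + (K + 2 * K * (K + 1) / delta).
have lim0 : (K' * expR (- B n))%:E @[n --> \oo] --> 0%E.
  apply: cvg_EFin; first by near=> n.
  rewrite -(mulr0 K'); apply: cvgM; first exact: cvg_cst.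
  exact: (cvg_comp _ _ Boo (@cvgr_expR R)).
apply: (squeeze_cvge (f := fun=> 0%E) (h := fun n => (K' * expR (- B n))%:E)) => //; last first.
  exact: cvg_cst.
near=> n; apply/andP; split => //.
have [A [E [F [J [[mA mE mF cov] [QA QE hJ hA hF]]]]]] : contraction_sets c1 c2 c3 c4 K n (eps n).
  by near: n.
have eps_half : eps n <= (2 * c2)^-1.
  by near: n; apply: (cvgr_le 0) => //; rewrite invr_gt0 mulr_gt0.
(* [c3] is doubled because the number of cells enters both as a factor and through the threshold of
   each cell; c1 + 3 c2^2 compensates [u], the 1 leaves a factor e^(-B n), and 16 c4^2 is the size
   condition of [cell_prob]. *)
pose k := 4 * (2 * c3 + c1 + 3 * c2 ^+ 2 + 1 + 16 * c4 ^+ 2).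
have Mk : k + 1 <= M n by near: n; move/cvgryPge : Moo; apply.
have k1 : 4 <= k.
  have := sqr_ge0 c4; have : 1 <= c2 ^+ 2 by rewrite exprn_ege1.
  by rewrite /k; lra.
have M0 : 0 <= M n by lra.
have M2 : k <= M n ^+ 2 by nra.
have B0 : 0 <= B n by rewrite mulr_ge0 ?sqr_ge0.
have e2 := sqr_ge0 (eps n).
have ep : c2 * eps n <= 1 / 2.
  have := ler_wpM2l (ltW c20) eps_half.
  by rewrite invfM mulrCA divff ?gt_eqF// mulr1 div1r.
have e01 : 0 <= c2 * eps n <= 1 / 2 by rewrite mulr_ge0// ltW.
apply: le_trans (posterior_prob n (h := M n * eps n) (mB n) mA mE mF _ e01 (expR_gt0 _) QA hA QE d0 _ hF _) _.
- move=> s _; have [Es|nEs] := pselect (E s); [by left|right; exact: cov].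
- rewrite !exprMn mulrA ler_wpM2r//; apply: le_trans M2.
  by rewrite /k; have := sqr_ge0 c2; have := sqr_ge0 c4; lra.
- by move=> s Bs; exact: hB.
rewrite lee_fin.
have BE : n%:R * (c2 * eps n) ^+ 2 = c2 ^+ 2 * B n by rewrite exprMn /B; ring.
have ME : n%:R * (M n * eps n) ^+ 2 = M n ^+ 2 * B n by rewrite exprMn /B; ring.
rewrite BE ME -expRD.
set u := delta * _ / 2.
have uE : u = delta / 2 * expR (- ((c1 + 3 * c2 ^+ 2) * B n)).
  by rewrite /u /B mulrAC; congr (_ * expR _); ring.
have u0 : 0 < u by rewrite uE; apply: mulr_gt0; [exact: divr_gt0|exact: expR_gt0].
have b1 : expR (- (c2 ^+ 2 * B n)) <= expR (- B n).
  rewrite ler_expR lerN2 ler_peMl//.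
  by rewrite exprn_ege1.
have b2 : K * expR (- ((c1 + 3 * c2 ^+ 2 + 1) * B n)) / u = 2 * K / delta * expR (- B n).
  rewrite uE (_ : - ((c1 + 3 * c2 ^+ 2 + 1) * B n) = - ((c1 + 3 * c2 ^+ 2) * B n) + - B n); last by ring.
  rewrite expRD; field; rewrite !gt_eqF ?expR_gt0//.
rewrite -/(B n) in hJ.
have key : (2 * c3 + c1 + 3 * c2 ^+ 2 + 1) * B n <= M n ^+ 2 * B n / 4.
  rewrite [leRHS]mulrAC ler_wpM2r//; move: M2; rewrite /k; have := sqr_ge0 c4; lra.
have h1 : 0 <= c1 * B n by apply: mulr_ge0.
have h2 : 0 <= c2 ^+ 2 * B n by apply: mulr_ge0 => //; exact: sqr_ge0.
have h3 : 0 <= c3 * B n by apply: mulr_ge0.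
have b3 : J%:R * expR (- (M n ^+ 2 * B n / 2)) <= K * expR (- B n).
  apply: le_trans (ler_wpM2r (expR_ge0 _) hJ) _.
  rewrite -[leLHS]mulrA -expRD ler_wpM2l// ler_expR.
  by move: (B n) (M n ^+ 2) key h1 h2 h3 B0 => b y; lra.
have J1 : J.+1%:R <= (K + 1) * expR (c3 * B n).
  rewrite -natr1 mulrDl mul1r lerD//.
  by apply: le_trans (expR_ge1Dx _); rewrite lerDl mulr_ge0.
have b4 : J%:R * (expR (- (M n ^+ 2 * B n / 4)) / (u / J.+1%:R)) <=
    2 * K * (K + 1) / delta * expR (- B n).
  rewrite invf_div mulrCA mulrA.
  apply: (@le_trans _ _ (expR (- (M n ^+ 2 * B n / 4)) *
      (K * expR (c3 * B n) * ((K + 1) * expR (c3 * B n) / u)))).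
    rewrite -[leLHS]mulrA; apply: ler_wpM2l; first exact: expR_ge0.
    apply: ler_pM => //; first by apply: divr_ge0 => //; exact: ltW.
    by rewrite ler_wpM2r// invr_ge0 ltW.
  rewrite uE invfM -expRN opprK (_ : _ * _ = 2 * K * (K + 1) / delta *
    (expR (- (M n ^+ 2 * B n / 4)) * expR (c3 * B n) * expR (c3 * B n) *
     expR ((c1 + 3 * c2 ^+ 2) * B n))); last by field; rewrite gt_eqF.
  rewrite ler_wpM2l ?divr_ge0 ?mulr_ge0 ?addr_ge0 ?(ltW d0)// -!expRD ler_expR.
  by move: (B n) (M n ^+ 2) key h1 h2 h3 B0 => b y; lra.
rewrite -/(B n) b2 [J%:R * (_ + _)]mulrDr.
rewrite (_ : K' * _ = expR (- B n) + 2 * K / delta * expR (- B n) +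
  (K * expR (- B n) + 2 * K * (K + 1) / delta * expR (- B n))); last by rewrite /K'; ring.
by apply: lerD; apply: lerD.
Unshelve. all: end_near.
Qed.

End posterior_bound.

(** * Smoothing of Hoelder functions *)

Section ball_derivative.
Context {R : realType}.
Implicit Types (f g : R -> R) (t q : R).

Lemma is_derive_of_bound f t q :
  (forall eps, 0 < eps -> exists2 eta : R, 0 < eta & forall s, `|s - t| < eta ->
     `|f s - f t - q * (s - t)| <= eps * `|s - t|) -> is_derive t 1 f q.
Proof.
move=> h; have c : (fun x : R => x^-1 *: (f (x *: 1 + t) - f t)) x @[x --> 0^'] --> q.
  apply/cvgrPdist_le => eps e0; have [eta eta0 he] := h _ e0.
  exists eta => //= x /=; rewrite distrC subr0 => xe x0.
  have := he (x *: 1 + t); rewrite addrK /GRing.scale/= mulr1 => /(_ xe) hx.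
  rewrite distrC -(ler_pM2r (_ : 0 < `|x|)) ?normr_gt0//.
  apply: le_trans hx; rewrite -normrM mulrBl mulrAC mulVf// mul1r.
  by rewrite mulrC.
split; first exact: (cvgP q).
by apply: cvg_lim.
Qed.

Lemma deriv_on_bound f t : has_deriv f -> unit_ball t -> forall eps, 0 < eps ->
  exists2 eta : R, 0 < eta & forall s, unit_ball s -> `|s - t| < eta ->
    `|f s - f t - deriv_on f t * (s - t)| <= eps * `|s - t|.
Proof.
move=> df bt eps e0; have := df t bt; rewrite /deriv_on => c.
have /cvgrPdist_le/(_ eps e0) := c.
move=> [eta /= eta0 h]; exists eta => // s bs st.
have [->|sNt] := eqVneq s t; first by rewrite !subrr mulr0 subr0 normr0 mulr0.
have := h s; rewrite /= distrC => /(_ st sNt bs); rewrite distrC.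
rewrite -(ler_pM2r (_ : 0 < `|s - t|)) ?normr_gt0 ?subr_eq0//.
by apply: le_trans; rewrite -normrM mulrBl /diff_quot divfK// subr_eq0.
Qed.

Lemma has_deriv_interior f t : has_deriv f -> -1 < t < 1 -> is_derive t 1 f (deriv_on f t).
Proof.
move=> df /andP[t1 t2]; apply: is_derive_of_bound => eps e0.
have bt : unit_ball t by rewrite /unit_ball/= in_itv/= !ltW.
have [eta eta0 h] := deriv_on_bound df bt e0.
exists (Num.min eta (Num.min (t + 1) (1 - t))).
  by rewrite !lt_min eta0 subr_gt0 t2 -(opprK 1) subr_gt0 t1.
move=> s; rewrite !lt_min => /andP[se /andP[]]; rewrite !ltr_norml => /andP[s1 _] /andP[_ s2].
by apply: h => //; rewrite /unit_ball/= in_itv/=; apply/andP; split; lra.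
Qed.

Lemma has_deriv_continuous f : has_deriv f -> {within unit_ball, continuous f}.
Proof.
move=> df; apply/subspace_continuousP => t bt.
have [eta eta0 h] := deriv_on_bound df bt ltr01.
apply/cvgrPdist_le => eps e0.
have k0 : 0 < `|deriv_on f t| + 1 by rewrite ltr_wpDl.
exists (Num.min eta (eps / (`|deriv_on f t| + 1))) => /=.
  by rewrite lt_min eta0 divr_gt0.
move=> s /=; rewrite lt_min distrC => /andP[se s2] bs; rewrite distrC.
have h1 := h s bs se; rewrite mul1r in h1.
have -> : f s - f t = (f s - f t - deriv_on f t * (s - t)) + deriv_on f t * (s - t) by ring.
apply: le_trans (ler_normD _ _) _; rewrite normrM.
apply: (@le_trans _ _ ((`|deriv_on f t| + 1) * `|s - t|)).
  by rewrite mulrDl mul1r addrC lerD2l.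
by rewrite mulrC -ler_pdivlMr// ltW.
Qed.

Lemma ball_MVT (f df : R -> R) (s t : R) : s <= t -> unit_ball s -> unit_ball t ->
  {within unit_ball, continuous f} ->
  (forall x : R, -1 < x < 1 -> is_derive x 1 f (df x)) ->
  exists2 c, s <= c <= t & f t - f s = df c * (t - s).
Proof.
rewrite /unit_ball/= !in_itv/= => st /andP[s1 s2] /andP[t1 t2] cf dff.
have [| |c cst ->] := @MVT_segment R f df s t st.
- move=> x; rewrite in_itv/= => /andP[x1 x2]; apply: dff.
  by rewrite (le_lt_trans s1)//= (lt_le_trans x2).
- apply: continuous_subspaceW cf => x; rewrite /= !in_itv/= => /andP[x1 x2].
  by rewrite (le_trans s1)//= (le_trans x2).
by exists c => //; move: cst; rewrite in_itv.
Qed.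

(* Convexity of the ball makes the mean value bound insensitive to the order of s and t. *)
Lemma ball_MVT_bound (f df : R -> R) (s t K : R) : unit_ball s -> unit_ball t ->
  {within unit_ball, continuous f} ->
  (forall x : R, -1 < x < 1 -> is_derive x 1 f (df x)) ->
  (forall x, Num.min s t <= x <= Num.max s t -> `|df x| <= K) ->
  `|f t - f s| <= K * `|t - s|.
Proof.
move=> bs bt cf dff; have [st|/ltW ts] := leP s t => hK.
  have [c cst ->] := ball_MVT st bs bt cf dff.
  by rewrite normrM ler_wpM2r// hK.
have [c cst e] := ball_MVT ts bt bs cf dff.
by rewrite distrC e normrM (distrC t s) ler_wpM2r// hK.
Qed.

End ball_derivative.

(** * Spline steps and the Leibniz rule *)

Section smooth_step.
Context {R : realType}.
Implicit Types (f g : R -> R) (x : R) (c h : nat -> R).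

Definition trunc_pow n x : R := Num.max 0 x ^+ n / n`!%:R.

Definition backward f x : R := f x - f (x - 1).

Lemma iter_backward_derive (f g : R -> R) n : (forall x : R, is_derive x 1 f (g x)) ->
  forall x : R, is_derive x 1 (iter n backward f) (iter n backward g x).
Proof.
move=> fg; elim: n => //= n ih x; apply: deriv_sub => //.
have hs : is_derive x 1 (fun y : R => y - 1) 1.
  by apply: (is_derive_eq (deriv_sub (deriv_id x) (deriv_cst 1 x))); rewrite subr0.
have h := @deriv_compose R (iter n backward f) (fun y => y - 1) x _ _ (ih (x - 1)) hs.
by apply: (is_derive_eq h); rewrite mulr1.
Qed.

Lemma iter_backward_local (f g : R -> R) n (a x : R) : (forall y, a <= y -> f y = g y) ->
  a + n%:R <= x -> iter n backward f x = iter n backward g x.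
Proof.
move=> fg; elim: n x => [|n ih] x /=; first by rewrite addr0; exact: fg.
rewrite -[in X in X -> _]natr1 => ax; rewrite /backward !ih//; lra.
Qed.

Lemma iter_backward_zero (f : R -> R) n (a x : R) : (forall y, y <= a -> f y = 0) ->
  x <= a -> iter n backward f x = 0.
Proof.
move=> f0; elim: n x => [|n ih] x xa /=; first exact: f0.
by rewrite /backward !ih ?subrr//; lra.
Qed.

Lemma iter_backward_bound (f : R -> R) n (K x : R) : (forall y, y <= x -> `|f y| <= K) ->
  `|iter n backward f x| <= 2 ^+ n * K.
Proof.
elim: n x => [|n ih] x fK /=; first by rewrite mul1r; apply: fK.
apply: le_trans (ler_normB _ _) _; rewrite exprS -mulrA mulr_natl mulr2n.
by apply: lerD; apply: ih => // y yx; apply: fK; lra.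
Qed.

(** The order starts at 2, since the truncated power of order 1 has a corner at 0; at 0 the
    derivative is checked from the definition. *)
Lemma trunc_pow_derive n x : is_derive x 1 (trunc_pow n.+2) (trunc_pow n.+1 x).
Proof.
have fE : (n.+2`!)%:R = (n.+2)%:R * (n.+1`!)%:R :> R by rewrite factS natrM.
have f0 : (n.+1`!)%:R != 0 :> R by rewrite pnatr_eq0 -lt0n fact_gt0.
have n0 : (n.+2)%:R != 0 :> R by rewrite pnatr_eq0.
have key (g : R -> R) : (\forall y \near x, trunc_pow n.+2 y = g y) ->
    is_derive x 1 g (trunc_pow n.+1 x) -> is_derive x 1 (trunc_pow n.+2) (trunc_pow n.+1 x).
  by move=> e dg; apply: (near_eq_is_derive (f := g)) => //; apply: filterS e.
have [x0|x0|->] := ltgtP x 0.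
- apply: (key (fun=> 0)).
    near=> y; rewrite /trunc_pow max_l ?expr0n ?mul0r//; apply: ltW; near: y.
    exact: lt_nbhsl.
  rewrite /trunc_pow max_l ?expr0n ?mul0r ?ltW//; exact: deriv_cst.
- apply: (key (fun y => n.+2`!%:R^-1 * y ^+ n.+2)).
    near=> y; rewrite /trunc_pow max_r 1?mulrC//; apply: ltW; near: y.
    exact: lt_nbhsr.
  apply: (is_derive_eq (deriv_scale _ (deriv_pow n.+1 x))).
  rewrite /trunc_pow max_r ?ltW// fE; field.
  by rewrite f0 (_ : 2 + n%:R = n.+2%:R)// addrC -natrD addn2.
- apply: is_derive_of_bound => eps e0; rewrite /trunc_pow !maxxx.
  exists (Num.min 1 eps); first by rewrite lt_min ltr01.
  move=> s; rewrite !subr0 lt_min !expr0n !mul0r !subr0 => /andP[s1 se].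
  have m0 : 0 <= Num.max 0 s by rewrite le_max lexx.
  have ms : Num.max 0 s <= `|s| by rewrite ge_max normr_ge0 ler_norm.
  rewrite normrM normrX (ger0_norm m0) normfV (ger0_norm (ler0n _ _)).
  apply: (@le_trans _ _ (Num.max 0 s ^+ n.+2)).
    by rewrite ler_piMr ?exprn_ge0// invf_le1 ?ltr0n ?fact_gt0// ler1n fact_gt0.
  rewrite exprSr; apply: ler_pM => //; first exact: exprn_ge0.
  rewrite exprSr; apply: (@le_trans _ _ (1 * `|s|)); last by rewrite mul1r ltW.
  by apply: ler_pM => //; [exact: exprn_ge0|rewrite exprn_ile1// (le_trans ms)// ltW].
Unshelve. all: end_near.
Qed.

(** By induction the n-th difference of x^(n+1) / (n+1)! has derivative 1, and one more difference
    of such a function is 1. *)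
Lemma iter_backward_pow n x : iter n backward (fun y => y ^+ n / n`!%:R) x = 1.
Proof.
elim: n x => [|n ih] x; first by rewrite /= expr0 fact0 divr1.
rewrite iterS /backward.
pose f := iter n backward (fun y : R => y ^+ n.+1 / n.+1`!%:R).
have df (y : R) : is_derive y 1 f 1.
  suff h (z : R) : is_derive z 1 (fun y : R => y ^+ n.+1 / n.+1`!%:R) (z ^+ n / n`!%:R).
    by apply: (is_derive_eq (iter_backward_derive n h y)); exact: ih.
  have h := deriv_mul (deriv_pow n z) (deriv_cst (n.+1`!%:R^-1) z).
  apply: (is_derive_eq h); rewrite mulr0 addr0 factS natrM.
  have f0 : (n`!)%:R != 0 :> R by rewrite pnatr_eq0 -lt0n fact_gt0.
  have n0 : 1 + n%:R != 0 :> R by rewrite addrC natr1 pnatr_eq0.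
  by rewrite -[n.+1%:R]natr1; field; rewrite f0 addrC n0.
have [||c _ ->] := @MVT_segment R f (fun=> 1) (x - 1) x _ (fun y _ => df y).
- by rewrite gerBl.
- apply: continuous_subspaceT => y; apply: differentiable_continuous.
  by apply/derivable1_diffP; have [] := df y.
by rewrite mul1r opprB addrCA subrr addr0.
Qed.

(* The cumulative distribution function of a cardinal B-spline of order M. *)
Definition smooth_step M l : R -> R := iter M backward (trunc_pow (M - l)).

Lemma smooth_step_derive M l x : (l.+1 < M)%N ->
  is_derive x 1 (smooth_step M l) (smooth_step M l.+1 x).
Proof.
move=> lM; apply: iter_backward_derive => y.
have -> : (M - l = (M - l.+2).+2)%N by lia.
have -> : (M - l.+1 = (M - l.+2).+1)%N by lia.
exact: trunc_pow_derive.
Qed.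

Lemma smooth_step_le0 M l x : (l < M)%N -> x <= 0 -> smooth_step M l x = 0.
Proof.
move=> lM; apply: iter_backward_zero => y y0.
by rewrite /trunc_pow max_l// expr0n/= subn_eq0 leqNgt lM mul0r.
Qed.

(** To the right of [M] every truncated power in the difference is a plain power of degree M - l;
    taking M differences gives 1 if l = 0 and annihilates it otherwise. *)
Lemma smooth_step_ge M l x : (l <= M)%N -> M%:R <= x -> smooth_step M l x = (l == 0)%:R.
Proof.
move=> lM Mx.
rewrite /smooth_step (@iter_backward_local _ (fun y => y ^+ (M - l) / (M - l)`!%:R) _ 0) ?add0r//; last first.
  by move=> y y0; rewrite /trunc_pow max_r.
rewrite -{1}(subnKC lM) iterD.
have -> : iter (M - l) backward (fun y => y ^+ (M - l) / (M - l)`!%:R) = fun=> 1.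
  by apply/funext => y; exact: iter_backward_pow.
case: l lM => [//|l] _; rewrite iterSr.
have -> : backward (fun=> 1) = fun=> 0 by apply/funext => y; rewrite /backward subrr.
by rewrite (@iter_backward_zero _ _ x).
Qed.

Lemma smooth_step_bound M l x : (l < M)%N -> `|smooth_step M l x| <= 2 ^+ M * M%:R ^+ M + 1.
Proof.
move=> lM; have [Mx|xM] := leP M%:R x.
  rewrite smooth_step_ge//; last exact: ltnW.
  rewrite normr_nat; apply: (@le_trans _ _ 1); first by case: (_ == _).
  by rewrite lerDr mulr_ge0// exprn_ge0.
apply: (@le_trans _ _ (2 ^+ M * M%:R ^+ M)); last by rewrite lerDl.
apply: iter_backward_bound => y yx; rewrite /trunc_pow.
have m0 : 0 <= Num.max 0 y by rewrite le_max lexx.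
have mM : Num.max 0 y <= M%:R by rewrite ge_max ler0n/=; lra.
rewrite normrM normrX (ger0_norm m0) normfV (ger0_norm (ler0n _ _)).
apply: (@le_trans _ _ (Num.max 0 y ^+ (M - l))).
  by rewrite ler_piMr ?exprn_ge0// invf_le1 ?ltr0n ?fact_gt0// ler1n fact_gt0.
apply: (@le_trans _ _ (M%:R ^+ (M - l))); first by rewrite lerXn2r// nnegrE.
by rewrite ler_weXn2l ?leq_subr// ler1n; apply: leq_trans lM.
Qed.

(* c and h stand for the sequences of successive derivatives of the factors at a point. *)
Fixpoint leibniz l c h : R :=
  if l is l'.+1 then leibniz l' (c \o succn) h + leibniz l' c (h \o succn)
  else c 0%N * h 0%N.

Lemma leibniz_derive l (f g : nat -> R -> R) x :
  (forall i, (i <= l)%N -> is_derive x 1 (f i) (f i.+1 x)) ->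
  (forall i, (i <= l)%N -> is_derive x 1 (g i) (g i.+1 x)) ->
  is_derive x 1 (fun y => leibniz l (f ^~ y) (g ^~ y)) (leibniz l.+1 (f ^~ x) (g ^~ x)).
Proof.
elim: l f g => [|l ih] f g df dg.
  by apply: (is_derive_eq (deriv_mul (df 0%N isT) (dg 0%N isT))).
apply: deriv_add.
  by apply: (ih (fun i => f i.+1) g) => i il; [exact: df|apply: dg; exact: leqW].
by apply: (ih f (fun i => g i.+1)) => i il; [apply: df; exact: leqW|exact: dg].
Qed.

Lemma leibniz_bound l c h (A B r : R) : 0 <= A -> 0 <= B -> 0 <= r ->
  (forall i, (i <= l)%N -> `|c i| <= A * r ^+ i) ->
  (forall i, (i <= l)%N -> `|h i| <= B * r ^+ i) ->
  `|leibniz l c h| <= 2 ^+ l * (A * B) * r ^+ l.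
Proof.
move=> A0 B0 r0; elim: l A B A0 B0 c h => [|l ih] A B A0 B0 c h cA hB /=.
  rewrite expr0 mul1r mulr1 normrM; apply: ler_pM => //.
    by have := cA 0%N isT; rewrite mulr1.
  by have := hB 0%N isT; rewrite mulr1.
apply: le_trans (ler_normD _ _) _.
have -> : 2 ^+ l.+1 * (A * B) * r ^+ l.+1 =
    2 ^+ l * ((A * r) * B) * r ^+ l + 2 ^+ l * (A * (B * r)) * r ^+ l by rewrite !exprS; ring.
apply: lerD; apply: ih => //; rewrite ?mulr_ge0// => i il /=.
- by rewrite -mulrA -exprS; exact: cA.
- by apply: hB; exact: leqW.
- by apply: cA; exact: leqW.
- by rewrite -mulrA -exprS; exact: hB.
Qed.

Lemma leibniz0 l c h : (forall i, (i <= l)%N -> c i = 0) -> leibniz l c h = 0.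
Proof.
elim: l c h => [|l ih] c h c0 /=; first by rewrite c0 ?mul0r.
rewrite !ih ?addr0// => i il; apply: c0 => //; exact: leqW.
Qed.

Lemma leibniz1 l c h : (forall i, (i <= l)%N -> c i = (i == 0)%:R) -> leibniz l c h = h l.
Proof.
elim: l c h => [|l ih] c h c1 /=; first by rewrite c1 ?mul1r.
rewrite leibniz0 ?add0r; last by move=> i il /=; rewrite c1.
by rewrite ih// => i il; apply: c1; exact: leqW.
Qed.

End smooth_step.

(** * Gluing Taylor polynomials *)

Section hoelder_smoothing.
Context {R : realType}.
Variables (g : R -> R) (beta : R) (k : nat) (L : R).
Hypotheses (kb : k%:R < beta) (L0 : 0 <= L).
Let G j := iter j deriv_on g.
Hypothesis dG : forall j, (j < k)%N -> has_deriv (G j).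
Hypothesis hG : forall s t, unit_ball s -> unit_ball t ->
  `|G k s - G k t| <= L * `|s - t| `^ (beta - k%:R).

(** Derivative of order [l] of the Taylor polynomial of degree [k] at [t]; the sum is empty beyond
    order [k]. *)
Definition taylor (t : R) l (x : R) : R :=
  \sum_(i < k.+1 - l) G (l + i)%N t * ((x - t) ^+ i / i`!%:R).

Lemma taylor_derive t l (x : R) : is_derive x 1 (taylor t l) (taylor t l.+1 x).
Proof.
rewrite /taylor; have [lk|kl] := leqP l k; last first.
  rewrite (_ : k.+1 - l = 0)%N; last by lia.
  rewrite (_ : k.+1 - l.+1 = 0)%N; last by lia.
  by under eq_fun do rewrite big_ord0; rewrite big_ord0; exact: deriv_cst.
rewrite (_ : k.+1 - l = (k - l).+1)%N; last by lia.
rewrite (_ : k.+1 - l.+1 = k - l)%N; last by lia.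
have hs : is_derive x 1 (fun y : R => y - t) 1.
  by apply: (is_derive_eq (deriv_sub (deriv_id x) (deriv_cst t x))); rewrite subr0.
have h := @deriv_compose R _ (fun y => y - t) x _ _
  (taylor_sum_derive (fun i => G (l + i)%N t) (k - l) (x - t)) hs.
by apply: (is_derive_eq h); rewrite mulr1; apply: eq_bigr => i _; rewrite addnS addSn.
Qed.

Lemma taylor_center t l : (l <= k)%N -> taylor t l t = G l t.
Proof.
move=> lk; rewrite /taylor (_ : k.+1 - l = (k - l).+1)%N; last by lia.
rewrite big_ord_recl /= addn0 expr0 fact0 divr1 mulr1 big1 ?addr0// => i _.
by rewrite subrr expr0n/= mul0r mulr0.
Qed.

Lemma taylor_high t l x : (k < l)%N -> taylor t l x = 0.
Proof. by move=> kl; rewrite /taylor (_ : k.+1 - l = 0)%N ?big_ord0//; lia. Qed.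

(** Descent from order [k], where it is the Hoelder condition; each lower order is one application
    of the mean value theorem and gains a factor [del]. *)
Lemma taylor_remainder t x (del : R) l : 0 < del -> unit_ball t -> unit_ball x ->
  `|x - t| <= del -> (l <= k)%N ->
  `|G l x - taylor t l x| <= L * del `^ (beta - k%:R) * del ^+ (k - l).
Proof.
move=> d0 bt + + lk; rewrite -{1 2}(subKn lk).
elim: (k - l)%N (leq_subr l k) x => [|i ih] ik x bx xt.
  rewrite subn0 expr0 mulr1 /taylor subSnn big_ord1 addn0 expr0 fact0 divr1 mulr1.
  apply: le_trans (hG bx bt) _; apply: ler_wpM2l => //.
  by apply: ge0_ler_powR; rewrite ?nnegrE ?subr_ge0 ?(ltW kb) ?(ltW d0).
have kE : (k - i = (k - i.+1).+1)%N by lia.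
have dk : (k - i.+1 < k)%N by lia.
pose f y := G (k - i.+1) y - taylor t (k - i.+1) y.
have -> : G (k - i.+1) x - taylor t (k - i.+1) x = f x - f t.
  by rewrite /f taylor_center ?subrr ?subr0//; lia.
apply: le_trans (_ : _ <= L * del `^ (beta - k%:R) * del ^+ i * `|x - t|) _; last first.
  by rewrite exprSr mulrA ler_wpM2l// !mulr_ge0 ?powR_ge0// exprn_ge0// ltW.
apply: (ball_MVT_bound (f := f) (df := fun y => G (k - i) y - taylor t (k - i) y)) => //.
- move=> y; apply: cvgB; first exact: (has_deriv_continuous (dG dk)).
  apply: continuous_subspaceT => z; apply: differentiable_continuous.
  by apply/derivable1_diffP; have [] := taylor_derive t (k - i.+1) z.
- move=> y y1; apply: deriv_sub; last by rewrite kE; exact: taylor_derive.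
  by rewrite kE; exact: has_deriv_interior (dG dk) y1.
- move=> y ytx; have [yb yt] : unit_ball y /\ `|y - t| <= del.
    move: bt bx ytx xt; rewrite /unit_ball/= !in_itv/= => /andP[a1 a2] /andP[b1 b2].
    rewrite !ler_norml; have [_|_] := leP t x => /andP[c1 c2] /andP[e1 e2];
      by split; apply/andP; split; lra.
  by apply: ih => //; exact: ltnW.
Qed.

Lemma deriv_sum n (f f' : nat -> R -> R) (x : R) :
  (forall i, (i < n)%N -> is_derive x 1 (f i) (f' i x)) ->
  is_derive x 1 (fun y => \sum_(i < n) f i y) (\sum_(i < n) f' i x).
Proof.
elim: n => [|n ih] h.
  by under eq_fun do rewrite big_ord0; rewrite big_ord0; exact: deriv_cst.
under eq_fun do rewrite big_ord_recr/=; rewrite big_ord_recr/=.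
by apply: deriv_add; [apply: ih => i il; apply: h; exact: ltnW|exact: h].
Qed.

Lemma grid_cell n (t : nat -> R) x : t 0%N <= x <= t n.+1 ->
  exists2 i, (i < n.+1)%N & t i <= x <= t i.+1.
Proof.
elim: n => [|n ih] /andP[x0 xn]; first by exists 0%N => //; rewrite x0.
have [xl|xr] := leP x (t n.+1); last by exists n.+1 => //; rewrite (ltW xr).
have [|i il ix] := ih; first by rewrite x0.
by exists i => //; exact: leqW.
Qed.

(** When the steps before cell [i] are complete and those after it have not begun, the glued
    function is the local polynomial plus a single transition. *)
Lemma telescoping_cell n i (T X : nat -> R) : (i < n)%N ->
  (forall j, (j < i)%N -> X j = T j.+1 - T j) ->
  (forall j, (i < j)%N -> X j = 0) -> T 0%N + \sum_(j < n) X j = T i + X i.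
Proof.
move=> inn h1 h2.
have lo p : (p <= i)%N -> T 0%N + \sum_(j < p) X j = T p.
  elim: p => [|p ih] pi; first by rewrite big_ord0 addr0.
  by rewrite big_ord_recr /= addrA ih ?h1// 1?ltnW//; ring.
have hi p : T 0%N + \sum_(j < i.+1 + p) X j = T i + X i.
  elim: p => [|p ih]; first by rewrite addn0 big_ord_recr/= addrA lo.
  by rewrite addnS big_ord_recr /= addrA ih (h2 (i + p).+1) ?addr0// ltnS leq_addr.
by rewrite -(subnKC inn) hi.
Qed.

Variable N : nat.
Hypothesis kN : (k <= N)%N.
Let M := N.+2.
Let Cs : R := 2 ^+ M * M%:R ^+ M + 1.

(** On a common cell the polynomials of neighbouring nodes differ, in their derivatives of order l,
    by O(del^(beta - l)), and those of the step are O(del^(-l)); the Leibniz rule keeps the product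
    at this order. At order N + 1 > k the local polynomial vanishes and only the transition
    remains. *)
Lemma smoothing_grid (m : nat) : (0 < m)%N -> let del : R := m%:R^-1 in
  exists a : nat -> R -> R,
  [/\ forall l (x : R), (l <= N)%N -> is_derive x 1 (a l) (a l.+1 x),
      forall x, unit_ball x ->
        `|a N.+1 x| <= 2 ^+ N.+1 * (Cs * (2 * L * del `^ beta)) * (M%:R / del) ^+ N.+1,
      forall x, unit_ball x -> `|a 0%N x - g x| <= (L + Cs * (2 * L)) * del `^ beta &
      forall l, (l <= N)%N -> a l (-1) = if (l <= k)%N then G l (-1) else 0].
Proof.
move=> m0 del.
have mr0 : 0 < m%:R :> R by rewrite ltr0n.
have d0 : 0 < del by rewrite invr_gt0.
have M1 : 1 <= M%:R :> R by rewrite ler1n.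
have M0 : 0 < M%:R :> R by rewrite ltr0n.
have Cs0 : 0 <= Cs by rewrite addr_ge0// mulr_ge0// exprn_ge0.
(* The spline step takes a length [M] to rise from 0 to 1; the dilation [r] fits it into one
   cell. *)
pose r := M%:R / del.
have r0 : 0 < r by rewrite divr_gt0.
pose t i : R := -1 + i%:R * del.
pose s i l x := r ^+ l * smooth_step M l (r * (x - t i)).
pose D i l x := taylor (t i.+1) l x - taylor (t i) l x.
pose a l x := taylor (t 0%N) l x + \sum_(i < m.*2) leibniz l (s i ^~ x) (D i ^~ x).
have ds i l (x : R) : (l <= N)%N -> is_derive x 1 (s i l) (s i l.+1 x).
  move=> lN; rewrite /s.
  have hs : is_derive x 1 (fun y : R => r * (y - t i)) r.
    have := deriv_scale r (deriv_sub (deriv_id x) (deriv_cst (t i) x)).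
    by rewrite subr0 mulr1.
  have h := @deriv_compose R (smooth_step M l) _ x _ _ (@smooth_step_derive R M l _ lN) hs.
  by apply: (is_derive_eq (deriv_scale (r ^+ l) h)); rewrite exprSr; ring.
have dD i l (x : R) : is_derive x 1 (D i l) (D i l.+1 x).
  by apply: deriv_sub; exact: taylor_derive.
have tb i : (i <= m.*2)%N -> unit_ball (t i).
  move=> im; rewrite /unit_ball/= in_itv/= /t lerDl mulr_ge0 ?(ltW d0)//=.
  have : i%:R * del <= m.*2%:R * del by rewrite ler_wpM2r ?ler_nat// ltW.
  rewrite -muln2 natrM mulrAC /del divff ?gt_eqF// mul1r; lra.
have tS i : t i.+1 = t i + del by rewrite /t -natr1; ring.
have cell x : unit_ball x -> exists2 i, (i < m.*2)%N & t i <= x <= t i.+1.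
  rewrite /unit_ball/= in_itv/= => /andP[x1 x2].
  have mE : (m.*2 = (m.*2.-1).+1)%N by rewrite prednK// double_gt0.
  rewrite mE; apply: grid_cell; rewrite -mE /t mul0r addr0 x1/=.
  by rewrite -muln2 natrM mulrAC /del divff ?gt_eqF// mul1r; lra.
have Dbound i l x : (i < m.*2)%N -> t i <= x <= t i.+1 -> unit_ball x ->
    `|D i l x| <= 2 * L * del `^ beta * r ^+ l.
  move=> im /andP[x1 x2] bx.
  have [lk|kl] := leqP l k; last first.
    by rewrite /D !taylor_high// subrr normr0 !mulr_ge0 ?powR_ge0// exprn_ge0// ltW.
  have e1 : `|x - t i| <= del by rewrite ger0_norm ?subr_ge0//; move: x2; rewrite tS; lra.
  have e2 : `|x - t i.+1| <= del by rewrite ler0_norm ?subr_le0//; move: x1; rewrite tS; lra.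
  have h1 := taylor_remainder d0 (tb i (ltnW im)) bx e1 lk.
  have h2 := taylor_remainder d0 (tb i.+1 im) bx e2 lk.
  have -> : D i l x = (G l x - taylor (t i) l x) - (G l x - taylor (t i.+1) l x).
    by rewrite /D; ring.
  apply: le_trans (ler_normB _ _) _.
  apply: le_trans (lerD h1 h2) _.
  have -> : L * del `^ (beta - k%:R) * del ^+ (k - l) = L * del `^ beta * del ^- l.
    rewrite (_ : del `^ beta = del `^ (beta - k%:R) * del ^+ k); last first.
      by rewrite -powR_mulrn ?(ltW d0)// -powRD ?subrK// (gt_eqF d0) implybT.
    have -> : del ^+ k = del ^+ (k - l) * del ^+ l by rewrite -exprD subnK.
    by field; rewrite expf_neq0// gt_eqF.
  have : del ^- l <= r ^+ l.
    by rewrite -exprVn lerXn2r ?nnegrE ?invr_ge0 ?(ltW d0) ?(ltW r0)// /r ler_peMl// invr_ge0 ltW.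
  have : 0 <= L * del `^ beta by rewrite mulr_ge0// powR_ge0.
  set A := L * _; set B := _ ^- l; set E := r ^+ l => A0 BE.
  have : A * B <= A * E by rewrite ler_wpM2l.
  have -> : 2 * L * del `^ beta * E = A * E + A * E by rewrite /A; ring.
  by move=> h; exact: lerD.
have sbound i l x : (l <= N.+1)%N -> `|s i l x| <= Cs * r ^+ l.
  move=> lN; rewrite /s normrM normrX (gtr0_norm r0) mulrC ler_wpM2r ?exprn_ge0 ?(ltW r0)//.
  exact: smooth_step_bound.
have aE l x i : (l <= N.+1)%N -> (i < m.*2)%N -> t i <= x <= t i.+1 ->
    a l x = taylor (t i) l x + leibniz l (s i ^~ x) (D i ^~ x).
  move=> lN im /andP[x1 x2]; rewrite /a.
  apply: (@telescoping_cell m.*2 i (fun j => taylor (t j) l x)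
    (fun j => leibniz l (s j ^~ x) (D j ^~ x))) => // j ji.
  - rewrite leibniz1// => q ql; rewrite /s smooth_step_ge ?(leq_trans ql) ?(leq_trans lN)//.
      by case: q {ql} => [|q]; rewrite ?expr0 ?mul1r//= mulr0.
    have : t j.+1 <= t i by rewrite /t lerD2l ler_wpM2r ?ler_nat// ltW.
    rewrite tS => tij; have h : 1 <= del^-1 * (x - t j).
      by rewrite mulrC ler_pdivlMr// mul1r; move: tij x1; lra.
    by rewrite /r -mulrA ler_peMr.
  - rewrite leibniz0// => q ql; rewrite /s smooth_step_le0 ?mulr0//.
      by apply: leq_ltn_trans ql _.
    have : t i.+1 <= t j by rewrite /t lerD2l ler_wpM2r ?ler_nat// ltW.
    by move=> tij; rewrite pmulr_rle0//; lra.
have A0 : 0 <= 2 * L * del `^ beta by rewrite !mulr_ge0 ?powR_ge0.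
have lbound l x i : (l <= N.+1)%N -> (i < m.*2)%N -> t i <= x <= t i.+1 -> unit_ball x ->
    `|leibniz l (s i ^~ x) (D i ^~ x)| <= 2 ^+ l * (Cs * (2 * L * del `^ beta)) * r ^+ l.
  move=> lN im xt bx; apply: leibniz_bound => //; first exact: ltW.
    by move=> q ql; apply: sbound; exact: leq_trans ql lN.
  by move=> q ql; apply: Dbound.
exists a; split.
- move=> l x lN; apply: deriv_add; first exact: taylor_derive.
  apply: (@deriv_sum m.*2 (fun i y => leibniz l (s i ^~ y) (D i ^~ y))
    (fun i y => leibniz l.+1 (s i ^~ y) (D i ^~ y))) => i im; apply: (@leibniz_derive R l (s i) (D i)) => q ql.
  by apply: ds; exact: leq_trans ql lN.
- move=> x bx; have [i im xt] := cell x bx.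
  by rewrite (aE _ _ i)// taylor_high ?ltnS// add0r; exact: lbound.
- move=> x bx; have [i im xt] := cell x bx; have /andP[x1 x2] := xt.
  rewrite (aE _ _ i)//.
  have e1 : `|x - t i| <= del by rewrite ger0_norm ?subr_ge0//; move: x2; rewrite tS; lra.
  have h1 := taylor_remainder d0 (tb i (ltnW im)) bx e1 (leq0n k).
  have h2 := lbound 0%N x i isT im xt bx.
  rewrite addrAC; apply: le_trans (ler_normD _ _) _; rewrite mulrDl; apply: lerD.
    rewrite distrC; apply: le_trans h1 _.
    rewrite subn0 -mulrA -powR_mulrn ?(ltW d0)// -powRD ?subrK// (gt_eqF d0) implybT//.
  by apply: le_trans h2 _; rewrite !expr0 mul1r mulr1 mulrA.
(* At the left endpoint no step has begun, so the initial derivatives are those of the Taylor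
   polynomial at -1, whatever [m] is. *)
- move=> l lN; have t0 : t 0%N = -1 by rewrite /t mul0r addr0.
  rewrite (aE l _ 0%N) ?double_gt0// ?(leqW lN)//; last by rewrite tS t0 lexx/= lerDl ltW.
  rewrite leibniz0 ?addr0; last first.
    move=> i il; rewrite /s t0 subrr mulr0 smooth_step_le0 ?mulr0//.
    by apply: leq_ltn_trans il _; apply: leq_trans lN _.
  by rewrite t0; case: leqP => lk; [rewrite taylor_center|rewrite taylor_high].
Qed.

End hoelder_smoothing.

Lemma hoelder_smoothing {R : realType} (beta : R) (N : nat) (g : R -> R) :
  beta <= N%:R + 1 / 2 -> hoelder_space beta g ->
  exists2 C : R, 0 < C & forall m, (0 < m)%N -> let del : R := m%:R^-1 in
  exists a : nat -> R -> R,
  [/\ forall l (x : R), (l <= N)%N -> is_derive x 1 (a l) (a l.+1 x),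
      forall x, unit_ball x -> `|a N.+1 x| <= C * (del `^ beta / del ^+ N.+1),
      forall x, unit_ball x -> `|a 0%N x - g x| <= C * del `^ beta &
      forall l, (l <= N)%N -> `|a l (-1)| <= C].
Proof.
move=> bN [k [kb bk dG [L hG]]].
have kN : (k <= N)%N by rewrite -ltnS -(ltr_nat R) -natr1; lra.
have hG' s t : unit_ball s -> unit_ball t ->
    `|iter k deriv_on g s - iter k deriv_on g t| <= `|L| * `|s - t| `^ (beta - k%:R).
  move=> bs bt; apply: le_trans (hG _ _ bs bt) _.
  by rewrite ler_wpM2r ?powR_ge0// ler_norm.
have H := smoothing_grid kb (normr_ge0 L) dG hG' kN.
set Cs := 2 ^+ N.+2 * N.+2%:R ^+ N.+2 + 1 in H.
have Cs0 : 0 <= Cs by rewrite addr_ge0// mulr_ge0// exprn_ge0.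
pose C1 := 2 ^+ N.+1 * (Cs * (2 * `|L|)) * N.+2%:R ^+ N.+1.
pose C2 := `|L| + Cs * (2 * `|L|).
pose C3 := \sum_(l < k.+1) `|iter l deriv_on g (-1)|.
have C10 : 0 <= C1 by rewrite !mulr_ge0// exprn_ge0.
have C20 : 0 <= C2 by rewrite addr_ge0// !mulr_ge0.
have C30 : 0 <= C3 by apply: sumr_ge0.
exists (1 + C1 + C2 + C3); first lra.
move=> m m0 del; have [a [a1 a2 a3 a4]] := H m m0.
have p0 : 0 <= del `^ beta by exact: powR_ge0.
exists a; split => //.
- move=> x bx; apply: le_trans (a2 x bx) _; rewrite -/del.
  rewrite expr_div_n (_ : _ * (_ / _) = C1 * (del `^ beta / del ^+ N.+1)).
    by rewrite ler_wpM2r ?divr_ge0 ?exprn_ge0 ?invr_ge0//; lra.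
  by rewrite /C1; ring.
- move=> x bx; apply: le_trans (a3 x bx) _; rewrite -/del ler_wpM2r//.
  by rewrite -/C2; lra.
- move=> l lN; rewrite a4//; case: leqP => lk; last by rewrite normr0; lra.
  apply: (@le_trans _ _ C3); last lra.
  rewrite /C3 (bigD1 (Ordinal (lk : l < k.+1)%N))//= lerDl.
  by apply: sumr_ge0.
Qed.

Section exponential_bounds.
Context {R : realType}.
Implicit Types x y A : R.

Lemma expR_ge_id x : x <= expR x.
Proof. by apply: le_trans (expR_ge1Dx x); rewrite lerDr. Qed.

(** Used to absorb constants: a fixed positive number is bounded below by some e^(-cA), uniformly in
    A >= 1. *)
Lemma ge_expRN x A : 0 < x -> 1 <= A -> expR (- (`|ln x| * A)) <= x.
Proof.
move=> x0 A1; rewrite -{2}(lnK x0) ler_expR.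
have h := ler_norm (- ln x); rewrite normrN in h.
have : `|ln x| <= `|ln x| * A by rewrite ler_peMr.
lra.
Qed.

Lemma invr_ge_expRN x A : 0 < x -> x <= A -> expR (- A) <= x^-1.
Proof.
move=> x0 xA; rewrite expRN lef_pV2 ?posrE ?expR_gt0//.
exact: le_trans (expR_ge_id _).
Qed.

Lemma truncn_succ_bounds x : 0 <= x -> x < (Num.truncn x).+1%:R <= x + 1.
Proof. by move=> x0; have /andP[h1 h2] := truncn_itv x0; rewrite h2 -natr1 lerD2r. Qed.

End exponential_bounds.

(** * Small balls and sieves for one integrated Brownian motion *)

Section one_process.
Context {R : realType} {d : measure_display} {T : measurableType d}.
Variables (P : probability T R) (B : T -> R -> R) (X : nat -> T -> R) (N : nat).
Hypothesis Bm : brownian P B.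
Hypothesis lawX : forall l, (l <= N)%N -> has_law (U := R) P (X l) (normal_prob 0 1).
Hypothesis indX : independent P [set l | (l <= N)%N] (fun l => sigma_of (X l)).
Hypothesis indXB : independent2 P
  <<s \bigcup_(l in [set l | (l <= N)%N]) sigma_of (X l)>> (sigma_path `[0, +oo[ B).

Let zero_start := [set w | B w 0 = 0].

Let measurable_zero_start : measurable zero_start.
Proof.
rewrite (_ : zero_start = (B ^~ 0) @^-1` [set 0])//.
by rewrite -[X in measurable X]setTI; apply: (brownian_measurable Bm).
Qed.

Let zero_start_prob : P (~` zero_start) = 0%E.
Proof.
case: Bm => _ _ [A [mA PA h]] _ _; apply/eqP; rewrite eq_le measure_ge0 andbT -PA.
by apply: le_measure; rewrite ?inE//; exact: measurableC.
Qed.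

Let prob_zero_start E : measurable E -> P (E `&` zero_start) = P E.
Proof.
move=> mE; apply/eqP; rewrite eq_le; apply/andP; split.
  by apply: le_measure; rewrite ?inE//; exact: measurableI.
rewrite (measureDI P mE measurable_zero_start).
have : (P (E `\` zero_start) <= P (~` zero_start))%E.
  apply: le_measure; rewrite ?inE; [exact: measurableD|exact: measurableC|].
  by move=> w [].
by rewrite zero_start_prob => h; rewrite -[leRHS]add0e; exact: leeD2r.
Qed.

Lemma ibm_small_ball (A0 La0 rho : R) : 0 < rho -> 0 <= La0 ->
  exists2 c : R, 0 < c & forall (m : nat) (A Lam : R) (a : nat -> R -> R),
  (0 < m)%N -> m%:R <= A -> let del : R := m%:R^-1 in
  (forall l, (l < N)%N -> forall t : R, 0 < t < 2 -> is_derive t 1 (a l) (a l.+1 t)) ->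
  (forall l, (l <= N)%N -> {within `[0, 2], continuous a l}) ->
  (forall l, (l <= N)%N -> `|a l 0| <= A0) ->
  0 <= Lam -> Lam ^+ 2 <= La0 * A ->
  (forall s t, 0 <= s <= 2 -> 0 <= t <= 2 -> `|a N t - a N s| <= Lam * `|t - s|) ->
  exists E : set T, [/\ measurable E, ((expR (- (c * A)))%:E <= P E)%E &
    forall w, E w -> forall l t, (l <= N)%N -> 0 <= t <= 2 ->
      `|jet N (B w) (fun l => X l w) l t - a l t| <= rho / Num.sqrt A * del ^+ (N - l)].
Proof.
move=> rho0 La00.
have [L [p [L0 p0 kickp]]] := kick_prob_gt0 R.
(* With [tau] at most 2 / (k A), the four terms of [k] ensure, in this order: tau <= 1, [tau] small
   against [del], Lam^2 tau <= 1/4, and 2^N (5 + L) sqrt(tau) <= rho / sqrt(A). *)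
have [k kE] : exists k : R,
    k = 2 + 8 * (4 ^+ N * (5 + L)) + 8 * La0 + 2 * (4 ^+ N * (5 + L) ^+ 2) / rho ^+ 2 by eexists.
have N40 : 0 < 4 ^+ N :> R by rewrite exprn_gt0.
have k2 : 0 <= 8 * (4 ^+ N * (5 + L)) by rewrite !mulr_ge0// ?(ltW N40)// addr_ge0// ltW.
have k3 : 0 <= 2 * (4 ^+ N * (5 + L) ^+ 2) / rho ^+ 2.
  apply: divr_ge0; last exact: sqr_ge0.
  by apply: mulr_ge0 => //; apply: mulr_ge0; [exact: ltW|exact: sqr_ge0].
have k0 : 2 <= k by rewrite kE; lra.
pose s0 := expR (- ((A0 + 1) ^+ 2 / 2)) / Num.sqrt (2 * pi) : R.
have s00 : 0 < s0 by rewrite divr_gt0 ?expR_gt0// sqrtr_gt0 mulr_gt0// pi_gt0.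
pose s1 := 2 * (s0 / 2 ^+ N).
have s10 : 0 < s1 by rewrite mulr_gt0// divr_gt0// exprn_gt0.
(* The first term pays for the kicks, at most (k + 1) A in number. The second pays for the [N.+1]
   coefficients, each confined to an interval of half-length [eta], whose factors s1, del^N and
   sqrt(tau) are bounded below by exponentials in A. *)
pose c := `|ln p| * (k + 1) + (`|ln s1| + N%:R + (k + 1)) * N.+1%:R.
exists c.
  rewrite /c; apply: ltr_wpDl; first by rewrite mulr_ge0//; lra.
  by rewrite mulr_gt0// ltr_wpDl ?addr_ge0//; lra.
move=> m A Lam a m0 mA del da ca a0 Lam0 LamA aL.
have m1 : 1 <= m%:R :> R by rewrite ler1n.
have A1 : 1 <= A by exact: le_trans mA.
have A00 : 0 < A by exact: lt_le_trans A1.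
have mr0 : 0 < m%:R :> R by exact: lt_le_trans m1.
have d0 : 0 < del by rewrite invr_gt0.
have d1 : del <= 1 by rewrite invf_le1.
have Ad : A^-1 <= del by rewrite lef_pV2.
have kA0 : 0 <= k * A by rewrite mulr_ge0 ?(ltW A00)//; lra.
pose J := (Num.truncn (k * A)).+1.
have /andP[J1 J2] := truncn_succ_bounds kA0; rewrite -/J in J1 J2.
have J0 : 0 < J%:R :> R by rewrite ltr0n.
pose tau := 2 / J%:R : R.
have tau0 : 0 < tau by rewrite divr_gt0.
have JA : J%:R <= (k + 1) * A by apply: le_trans J2 _; rewrite [leRHS](mulrDl k 1 A) mul1r lerD2l.
have kp : 0 < k by lra.
have tauk : tau <= 2 / k / A.
  rewrite /tau -mulrA -invfM ler_pM2l// lef_pV2 ?posrE ?mulr_gt0//; exact: ltW.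
have tau1 : tau <= 1.
  rewrite /tau ler_pdivrMr// mul1r; apply: le_trans (ltW J1).
  by rewrite -[2]mulr1; apply: ler_pM => //.
have taud : tau <= 2 / k * del by apply: le_trans tauk _; rewrite ler_wpM2l// divr_ge0// ltW.
pose eta := del ^+ N * Num.sqrt tau / 2 ^+ N.
have st1 : Num.sqrt tau <= 1 by rewrite -sqrtr1 ler_sqrt.
have st0 : 0 < Num.sqrt tau by rewrite sqrtr_gt0.
have p20 : 0 < 2 ^+ N :> R by rewrite exprn_gt0.
have dN0 : 0 < del ^+ N by rewrite exprn_gt0.
have eta0 : 0 < eta by rewrite divr_gt0// mulr_gt0.
have eta1 : eta <= 1.
  rewrite ler_pdivrMr// mul1r; apply: (@le_trans _ _ 1); last by rewrite exprn_ege1// ler1n.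
  by rewrite -[1]mulr1; apply: ler_pM => //; rewrite ?exprn_ile1 ?(ltW d0) ?(ltW dN0) ?(ltW st0).
have kp' t sgn : 0 <= t -> (p%:E <= P (kick B t tau L sgn))%E.
  by move=> t0; exact: (kickp _ _ _ _ Bm).
pose E := steered B X N a del tau eta L J.
have mE : measurable E by exact: (measurable_steered Bm).
exists (E `&` zero_start); split; first exact: measurableI.
  rewrite prob_zero_start//.
  apply: (le_trans _ (steered_prob_ge Bm lawX indXB a del eta tau0 p0 kp' J)).
  have hs := start_prob lawX indX (a := a) (eta := eta) (A0 := A0) _ a0.
  apply: le_trans (lee_wpmul2l _ (hs _)); rewrite ?lee_fin ?exprn_ge0 ?(ltW p0) ?(ltW eta0)//.
  have e1 : expR (- (`|ln p| * ((k + 1) * A))) <= p ^+ J.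
    rewrite -[p]lnK ?posrE// -expRM_natl ler_expR mulrC expRK.
    have h := ler_norm (- ln p); rewrite normrN in h.
    have : `|ln p| * J%:R <= `|ln p| * ((k + 1) * A) by rewrite ler_wpM2l.
    have : - ln p * J%:R <= `|ln p| * J%:R by rewrite ler_wpM2r.
    lra.
  have e2 : expR (- ((`|ln s1| + N%:R + (k + 1)) * A)) <= 2 * eta * s0.
    have -> : 2 * eta * s0 = s1 * (del ^+ N * Num.sqrt tau) by rewrite /eta /s1; ring.
    rewrite (_ : - (_ * A) = - (`|ln s1| * A) + - (N%:R * A) + - ((k + 1) * A)); last by ring.
    rewrite 2!expRD -mulrA.
    apply: ler_pM; rewrite ?mulr_ge0 ?expR_ge0//; first exact: ge_expRN.
    apply: ler_pM; rewrite ?mulr_ge0 ?expR_ge0//.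
      rewrite -mulrN expRM_natl; apply: lerXn2r; rewrite ?nnegrE ?expR_ge0 ?(ltW d0)//.
      exact: invr_ge_expRN.
    apply: (@le_trans _ _ tau).
      apply: (@le_trans _ _ J%:R^-1); first exact: invr_ge_expRN.
      by rewrite /tau ler_peMl// ?invr_ge0 ?ler1n// ltW.
    by rewrite -{1}(sqr_sqrtr (ltW tau0)) expr2 ler_piMl// ltW.
  have -> : c * A = `|ln p| * ((k + 1) * A) + N.+1%:R * ((`|ln s1| + N%:R + (k + 1)) * A).
    by rewrite /c; ring.
  rewrite opprD expRD; apply: ler_pM; rewrite ?expR_ge0//.
  rewrite -mulrN expRM_natl; apply: lerXn2r e2; rewrite nnegrE; first exact: expR_ge0.
  by apply: mulr_ge0; [apply: mulr_ge0 => //; exact: ltW|exact: ltW].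
move=> w [Ew Bw0] l t lN tS.
have JS : J%:R * tau = 2 by rewrite /tau mulrC divfK// gt_eqF.
have := @steered_error R d T P B X N Bm a del tau eta L d0 tau0 L0 Lam J d1.
rewrite JS => H.
apply: le_trans (H (ltr0Sn _ 1) Lam0 da ca aL _ _ _ w Ew Bw0 l t lN tS) _ => //.
- apply: le_trans (ler_wpM2l _ taud) _; first by rewrite !mulr_ge0// ?(ltW N40)//; lra.
  rewrite [leLHS](_ : _ = (4 ^+ N * (4 * (5 + L)) * 2) / k * del); last by ring.
  by apply: ler_piMl; [exact: ltW|rewrite ler_pdivrMr// mul1r; rewrite kE; lra].
- rewrite -(@ler_sqr _ (_ * _)) ?nnegrE ?mulr_ge0 ?(ltW st0)//.
  rewrite exprMn sqr_sqrtr ?(ltW tau0)//.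
  apply: le_trans (ler_pM (sqr_ge0 _) (ltW tau0) LamA tauk) _.
  rewrite mulrACA divff ?gt_eqF// mulr1 mulrA ler_pdivrMr// kE; lra.
- rewrite /eta divfK ?gt_eqF// ler_peMl ?ler1n// ltW// mulr_gt0//.
- apply: ler_wpM2r; first by rewrite exprn_ge0// ltW.
  have sA0 : 0 < Num.sqrt A by rewrite sqrtr_gt0.
  rewrite ler_pdivlMr// -(@ler_sqr _ (_ * _)) ?nnegrE ?mulr_ge0 ?(ltW st0) ?(ltW sA0) ?(ltW rho0) ?(ltW p20)//; last by lra.
  rewrite !exprMn !sqr_sqrtr ?(ltW tau0) ?(ltW A00)//.
  have -> : (2 ^+ N) ^+ 2 = 4 ^+ N :> R by rewrite exprAC -natrX.
  rewrite -mulrA; apply: (@le_trans _ _ (4 ^+ N * (5 + L) ^+ 2 * (2 / k))).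
    apply: ler_wpM2l; first by rewrite mulr_ge0 ?sqr_ge0// ltW.
    by rewrite -ler_pdivlMr.
  rewrite mulrA ler_pdivrMr//.
  have -> : 4 ^+ N * (5 + L) ^+ 2 * 2 = rho ^+ 2 * (2 * (4 ^+ N * (5 + L) ^+ 2) / rho ^+ 2).
    by field; rewrite gt_eqF.
  by rewrite ler_wpM2l ?sqr_ge0// kE; lra.
Qed.

Lemma ibm_sieve (c : R) : 0 < c -> exists c' K : R, [/\ 0 < c', 0 < K &
  forall (m : nat) (A : R), (0 < m)%N -> m%:R <= A -> let del : R := m%:R^-1 in
  exists (E : set T) (n : nat), [/\ measurable E, (P E <= (K * expR (- (c * A)))%:E)%E,
    n%:R <= K * expR (c' * A) &
    pieces (~` E) n (fun V => forall w w', V w -> V w' -> forall t, 0 <= t <= 2 ->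
      `|jet N (B w) (fun l => X l w) 0 t - jet N (B w') (fun l => X l w') 0 t|
      <= (65 + N)%:R * (del ^+ N * Num.sqrt del))]].
Proof.
move=> c0.
(* A budget of q A parts for the 2m cells fails with probability at most 5^(2m) 2^(-q A) <= e^(8A)
   e^(-q A / 2) = e^(-c A). *)
have [q qE] : exists q : R, q = 2 * (c + 8) by eexists.
have q0 : 0 < q by lra.
pose b : R := ((branching N).*2)%:R.
have b1 : 1 <= b by rewrite ler1n double_gt0 expn_gt0.
pose k : R := (4 * (1 + 4 * c) + 3) ^+ N.+1.
have k1 : 1 <= k by rewrite exprn_ege1//; lra.
exists ((N%:R + 2) * N.+1%:R + b * (q + 1)), (1 + 2 * N.+1%:R + k); split.
- by rewrite ltr_pwDl ?mulr_gt0 ?mulr_ge0//; lra.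
- by have := ler0n R N.+1; lra.
move=> m A m0 mA del.
have m1 : 1 <= m%:R :> R by rewrite ler1n.
have A1 : 1 <= A by exact: le_trans mA.
have A00 : 0 < A by exact: lt_le_trans A1.
have mr0 : 0 < m%:R :> R by exact: lt_le_trans m1.
have d0 : 0 < del by rewrite invr_gt0.
have d1 : del <= 1 by rewrite invf_le1.
have qA0 : 0 <= q * A by rewrite mulr_ge0// ltW.
pose r := (Num.truncn (q * A)).+1.
have /andP[r1 r2] := truncn_succ_bounds qA0; rewrite -/r in r1 r2.
(* At this level the Gaussian tail bound e^(-H0^2 / 4) is e^(-c A). *)
pose H0 : R := Num.sqrt (4 * c * A).
have cA0 : 0 <= 4 * c * A by rewrite !mulr_ge0// ltW.
pose D := del ^+ N * Num.sqrt del.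
have D0 : 0 < D by rewrite mulr_gt0 ?exprn_gt0 ?sqrtr_gt0.
have HD0 : 0 <= 2 * H0 / D by rewrite divr_ge0 ?(ltW D0)// mulr_ge0 ?sqrtr_ge0.
pose c0n := (Num.truncn (2 * H0 / D)).+1.
have /andP[h1 h2] := truncn_succ_bounds HD0; rewrite -/c0n in h1 h2.
pose V := tame B del m.*2 r.
pose W := bounded_start X N H0.
have mV : measurable V by exact: (measurable_tame Bm lawX indXB d0).
have mW : measurable W by exact: (measurable_bounded_start lawX).
(* Removing the null event that the Brownian path does not start at 0 makes the recentred jets equal
   to the actual ones. *)
exists (~` (W `&` V `&` zero_start)), ((c0n.*2.+1 ^ N.+1) * (branching N).*2 ^ r)%N; split.
- by apply: measurableC; apply: measurableI => //; exact: measurableI.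
- rewrite !setCI.
  have u1 : (P (~` W `|` ~` V `|` ~` zero_start) <= P (~` W `|` ~` V) + P (~` zero_start))%E.
    by apply: measureU2; [apply: measurableU|]; exact: measurableC.
  have u2 : (P (~` W `|` ~` V) <= P (~` W) + P (~` V))%E.
    by apply: measureU2; exact: measurableC.
  rewrite zero_start_prob adde0 in u1; apply: le_trans u1 _; apply: le_trans u2 _.
  apply: le_trans (leeD (bounded_start_prob lawX (sqrtr_ge0 _)) (tame_prob Bm lawX indXB d0 _ _)) _.
  rewrite -EFinD lee_fin sqr_sqrtr//.
  have e0 := expR_ge0 (- (c * A)).
  have -> : 4 * c * A / 4 = c * A by field.
  suff hV : 5 ^+ m.*2 * 2^-1 ^+ r <= expR (- (c * A)).
    apply: (@le_trans _ _ ((1 + 2 * N.+1%:R) * expR (- (c * A)))).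
      move: hV; move: (expR _) (5 ^+ _ * _) (N.+1%:R) => x y z; lra.
    by rewrite ler_wpM2r// lerDl; lra.
  have h5 : 5 ^+ m.*2 <= expR (8 * A).
    apply: (@le_trans _ _ (expR 4 ^+ m.*2)).
      by apply: lerXn2r; rewrite ?nnegrE ?expR_ge0//; have := expR_ge1Dx (4 : R); lra.
    by rewrite -expRM_natl ler_expR -muln2 natrM; lra.
  have h2' : 2^-1 ^+ r <= expR (- (q * A / 2)).
    apply: (@le_trans _ _ (expR (- (1 / 2)) ^+ r)).
      by apply: lerXn2r; rewrite ?nnegrE ?expR_ge0//; have := expR_ge1Dx (- (1 / 2) : R); lra.
    by rewrite -expRM_natl ler_expR; lra.
  apply: le_trans (ler_pM _ _ h5 h2') _; rewrite ?exprn_ge0//.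
  by rewrite -expRD ler_expR qE; lra.
- rewrite natrM !natrX.
  have Dm : D^-1 <= expR ((N%:R + 1) * A).
    rewrite -[leRHS]invrK -expRN lef_pV2 ?posrE ?expR_gt0//.
    rewrite mulrDl mul1r opprD expRD; apply: ler_pM; rewrite ?expR_ge0//.
      rewrite -mulrN expRM_natl; apply: lerXn2r; rewrite ?nnegrE ?expR_ge0 ?(ltW d0)//.
      exact: invr_ge_expRN.
    apply: (@le_trans _ _ del); first exact: invr_ge_expRN.
    rewrite -{1}(sqr_sqrtr (ltW d0)) expr2 ler_piMl ?sqrtr_ge0//.
    by rewrite -sqrtr1 ler_sqrt.
  have HA : H0 <= (1 + 4 * c) * expR A.
    apply: (@le_trans _ _ (1 + 4 * c * A)).
      rewrite -(@ler_sqr _ H0) ?nnegrE ?sqrtr_ge0//; last lra.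
      by rewrite sqr_sqrtr//; nra.
    have := expR_ge1Dx A.
    by have := expR_ge_id A; nra.
  have hc : (c0n.*2.+1)%:R <= (4 * (1 + 4 * c) + 3) * expR ((N%:R + 2) * A).
    apply: (@le_trans _ _ (4 * H0 / D + 3)).
      by rewrite -natr1 -muln2 natrM; lra.
    rewrite [leRHS]mulrDl; apply: lerD; last first.
      rewrite ler_peMr//; apply: le_trans (expR_ge1Dx _).
      by rewrite lerDl mulr_ge0// ltW.
    apply: (@le_trans _ _ (4 * ((1 + 4 * c) * expR A) * expR ((N%:R + 1) * A))).
      apply: ler_pM; [by rewrite mulr_ge0 ?sqrtr_ge0|by rewrite invr_ge0 ltW| |exact: Dm].
      by rewrite ler_pM2l.
    rewrite -!mulrA -expRD !ler_wpM2l//; first lra.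
    by rewrite ler_expR; lra.
  have hb : b ^+ r <= expR (b * (q + 1) * A).
    apply: (@le_trans _ _ (expR b ^+ r)).
      by apply: lerXn2r; rewrite ?nnegrE ?expR_ge0 ?expR_ge_id//; lra.
    rewrite -expRM_natl ler_expR [leLHS]mulrC -[leRHS]mulrA; apply: ler_wpM2l; first lra.
    by move: r2 A1; lra.
  rewrite -/b [((N%:R + 2) * _ + _) * A]mulrDl expRD mulrA.
  apply: ler_pM; [exact: exprn_ge0|by rewrite exprn_ge0//; lra| |exact: hb].
  apply: (@le_trans _ _ (k * expR ((N%:R + 2) * N.+1%:R * A))); last first.
    by rewrite ler_wpM2r ?expR_ge0// lerDr addr_ge0// mulr_ge0.
  rewrite (_ : (N%:R + 2) * N.+1%:R * A = N.+1%:R * ((N%:R + 2) * A)); last by ring.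
  rewrite expRM_natl -exprMn; apply: lerXn2r hc.
    by rewrite nnegrE.
  by rewrite nnegrE mulr_ge0 ?expR_ge0//; lra.
- rewrite setCK.
  have hs : 2 * H0 <= c0n%:R * D by rewrite -ler_pdivrMr// ltW.
  have s0 := bounded_start_small B X d0 d1 hs.
  have sV : pieces (W `&` V) (c0n.*2.+1 ^ N.+1)%N (fun F => small B X N del 0 F /\ F `<=` V).
    have [F [WF sF]] := s0; exists (fun j => F j `&` V); split.
      by move=> w [Ww Vw]; have [j jn Fw] := WF w Ww; exists j.
    by move=> j jn; split => [w w' [Fw _] [Fw' _]|w []//]; exact: sF jn _ _ Fw Fw'.
  have [|F [WF sF]] := pieces_refine sV (m := ((branching N).*2 ^ r)%N)
      (Q' := small B X N del (m.*2%:R * del)).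
    move=> F [sF FV]; have := tame_pieces Bm d0 m.*2 r sF.
    by rewrite -/V setIidl.
  exists (fun j => F j `&` zero_start); split.
    by move=> w [WVw zw]; have [j jn Fw] := WF w WVw; exists j.
  move=> j jn w w' [Fw zw] [Fw' zw'] t t2.
  have [h _] := sF j jn w w' Fw Fw'.
  have jE u : zero_start u -> jet N (B u) (fun l => X l u) 0 t = wjet B X N u 0 t.
    rewrite /zero_start/= => u0; rewrite /wjet; congr (jet N _ _ _ _).
    by apply/funext => s; rewrite u0 subr0.
  rewrite !jE//; apply: h; move: t2.
  by rewrite -muln2 natrM mulrAC /del divff ?gt_eqF// mul1r.
Qed.

End one_process.

(** * Conditioned paths and their compositions *)

Section path_sets.
Context {R : realType}.
Implicit Types (f z zeta : R -> R) (K eps : R).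

(** Clamped rationals: a countable dense family of points of [-1, 1], indexed by all of [rat]. *)
Definition ball_point (q : rat) : R := clamp (-1) 1 (ratr q).

Lemma ball_pointP q : unit_ball (ball_point q).
Proof. by apply: clamp_itv; lra. Qed.

Lemma unit_ballE (t : R) : unit_ball t = (-1 <= t <= 1) :> Prop.
Proof. by rewrite /unit_ball/= in_itv. Qed.

Lemma ball_dense f (c : R) : {within unit_ball, continuous f} ->
  (forall q, f (ball_point q) <= c) -> forall t, unit_ball t -> f t <= c.
Proof.
move=> cf fc t bt; rewrite leNgt; apply/negP => ct.
have /subspace_continuousP/(_ t bt)/cvgrPdist_lt/(_ (f t - c)) := cf.
rewrite subr_gt0 => /(_ ct)[eta /= eta0 h].
have [|q] := @rat_in_itvoo R (t - eta) (t + eta); first by lra.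
rewrite in_itv/= => /andP[q1 q2].
have st : `|t - ball_point q| < eta.
  move: bt q1 q2; rewrite unit_ballE /ball_point /clamp => /andP[t1 t2].
  rewrite ltr_norml; move: (ratr q : R) => x.
  have [a1|a1] := leP 1 x; have [a2|a2] := leP (-1) _; move=> *; apply/andP; split; lra.
have := h _ st (ball_pointP q).
by have := fc q; have := ler_norm (f t - f (ball_point q)); lra.
Qed.

(** Countably many evaluations put the set in the cylinder sigma-algebra; among continuous functions
    it is a closed uniform ball. *)
Definition tube zeta eps : set (R -> R) :=
  [set z | forall q, `|z (ball_point q) - zeta (ball_point q)| <= eps].

Definition lip_paths K : set (R -> R) :=
  [set z | forall q q', `|z (ball_point q) - z (ball_point q')| <=
                        K * `|ball_point q - ball_point q'|].

Lemma tubeP zeta eps z : {within unit_ball, continuous z} ->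
  {within unit_ball, continuous zeta} ->
  tube zeta eps z <-> forall t, unit_ball t -> `|z t - zeta t| <= eps.
Proof.
move=> cz cze; split => [h|h q]; last by apply: h; exact: ball_pointP.
apply: (@ball_dense (fun t => `|z t - zeta t|)) => // t.
by apply: cvg_norm; apply: cvgB; [exact: cz|exact: cze].
Qed.

Lemma lip_pathsP K z : {within unit_ball, continuous z} ->
  lip_paths K z <-> forall s t, unit_ball s -> unit_ball t -> `|z s - z t| <= K * `|s - t|.
Proof.
move=> cz; split => [h s t bs bt|h q q']; last by apply: h; exact: ball_pointP.
have ct (a : R) : {within unit_ball, continuous (fun t : R => `|a - t|)}.
  apply: continuous_subspaceT => u; apply: cvg_norm.
  by apply: cvgB; [exact: cvg_cst|exact: cvg_id].
have h1 q : `|z t - z (ball_point q)| <= K * `|t - ball_point q|.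
  rewrite distrC (distrC t) -subr_le0.
  apply: (@ball_dense (fun u => `|z (ball_point q) - z u| - K * `|ball_point q - u|)) => //.
    move=> u; apply: cvgB; last by apply: cvgM; [exact: cvg_cst|exact: ct].
    by apply: cvg_norm; apply: cvgB; [exact: cvg_cst|exact: cz].
  by move=> q'; rewrite subr_le0; exact: h.
rewrite distrC (distrC s) -subr_le0.
apply: (@ball_dense (fun u => `|z t - z u| - K * `|t - u|)) => //.
  move=> u; apply: cvgB; last by apply: cvgM; [exact: cvg_cst|exact: ct].
  by apply: cvg_norm; apply: cvgB; [exact: cvg_cst|exact: cz].
by move=> q; rewrite subr_le0.
Qed.

Let cyl := g_sigma_algebraType (\bigcup_(t in (@unit_ball R))
    preimage_set_system setT (fun z : R -> R => z t) measurable).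

Lemma cylinder_forall (phi : rat -> (R -> R) -> R) (c : R) :
  (forall q, @measurable_fun _ _ cyl R setT (phi q)) ->
  cylinder unit_ball [set z | forall q, phi q z <= c].
Proof.
move=> mphi; rewrite (_ : [set z | _] = ~` \bigcup_q ~` [set z | phi q z <= c]).
  apply: (@measurableC _ cyl); apply: (@bigcupT_measurable_rat _ cyl) => q.
  by apply: (@measurableC _ cyl); apply: (@measurable_set_le _ _ cyl).
rewrite setC_bigcup; apply/seteqP; split => z h.
  by move=> q _; rewrite setCK; exact: h.
by move=> q; have := h q I; rewrite setCK.
Qed.

Lemma cylinder_tube zeta eps : cylinder unit_ball (tube zeta eps).
Proof.
apply: cylinder_forall => q; apply: (@measurable_fun_norm _ _ cyl).
apply: (@measurable_funB _ cyl); last exact: measurable_cst.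
by apply: cylinder_eval; exact: ball_pointP.
Qed.

Lemma cylinderI (A A' : set (R -> R)) : cylinder unit_ball A -> cylinder unit_ball A' ->
  cylinder unit_ball (A `&` A').
Proof. by move=> hA hA'; exact: (@measurableI _ cyl A A'). Qed.

Lemma cylinder_lip K : cylinder unit_ball (lip_paths K).
Proof.
have h (q q' : rat) : @measurable_fun _ _ cyl R setT
    (fun z : R -> R => `|z (ball_point q) - z (ball_point q')|).
  apply: (@measurable_fun_norm _ _ cyl); apply: (@measurable_funB _ cyl);
  by apply: cylinder_eval; exact: ball_pointP.
rewrite (_ : lip_paths K = [set z | forall q, [set z | forall q', 
  `|z (ball_point q) - z (ball_point q')| - K * `|ball_point q - ball_point q'| <= 0] z]).
  rewrite (_ : [set z | _] = ~` \bigcup_q ~` [set z | forall q', 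
  `|z (ball_point q) - z (ball_point q')| - K * `|ball_point q - ball_point q'| <= 0]).
    apply: (@measurableC _ cyl); apply: (@bigcupT_measurable_rat _ cyl) => q.
    apply: (@measurableC _ cyl).
    apply: (@cylinder_forall (fun q' z => `|z (ball_point q) - z (ball_point q')| -
       K * `|ball_point q - ball_point q'|)) => q'.
    by apply: (@measurable_funB _ cyl); [exact: h|exact: measurable_cst].
  rewrite setC_bigcup; apply/seteqP; split => z hz.
    by move=> q _; rewrite setCK; exact: hz.
  by move=> q; have := hz q I; rewrite setCK.
by apply/seteqP; split => z hz q q'; have := hz q q'; rewrite subr_le0.
Qed.

(** By the mean value theorem difference quotients are values of [df] at intermediate points, so its
    continuity also yields the one-sided derivatives at the endpoints. *)
Lemma ball_C1 f (df : R -> R) : {within unit_ball, continuous f} ->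
  {within unit_ball, continuous df} ->
  (forall x : R, -1 < x < 1 -> is_derive x 1 f (df x)) -> has_deriv f.
Proof.
move=> cf cdf dff t bt; apply: (cvgP (df t)).
have /subspace_continuousP/(_ t bt)/cvgrPdist_le h := cdf.
apply/cvgrPdist_le => eps e0; have [eta /= eta0 he] := h _ e0.
exists eta => // s /= st sNt bs.
have [c ct ->] : exists2 c, `|t - c| <= `|t - s| /\ unit_ball c & diff_quot f t s = df c.
  rewrite /diff_quot; have := bt; have := bs; rewrite !unit_ballE => bs' bt'.
  have [ts|/ltW ts] := leP t s.
    have [c /andP[c1 c2] ->] := ball_MVT ts bt bs cf dff.
    exists c; last by rewrite mulfK// subr_eq0.
    rewrite unit_ballE; split; last by apply/andP; split; lra.
    by rewrite ler0_norm ?ler0_norm; lra.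
  have [c /andP[c1 c2] e] := ball_MVT ts bs bt cf dff.
  exists c; last by rewrite -opprB e -mulrN opprB mulfK// subr_eq0.
  rewrite unit_ballE; split; last by apply/andP; split; lra.
  by rewrite ger0_norm ?ger0_norm; lra.
have [c1 c2] := ct.
by apply: he c2 => /=; exact: le_lt_trans c1 st.
Qed.

(** Trades a bound on the derivative for a condition on evaluations, which the cylinder
    sigma-algebra can express. *)
Lemma lipschitz_deriv_on f K : has_deriv f ->
  (forall s t, unit_ball s -> unit_ball t -> `|f s - f t| <= K * `|s - t|) <->
  (forall t, unit_ball t -> `|deriv_on f t| <= K).
Proof.
move=> df; split => [h t bt|h s t bs bt].
  apply/ler_addgt0Pr => eps e0.
  have [eta eta0 he] := deriv_on_bound df bt e0.
  have [s [sNt bs st]] : exists s : R, [/\ s != t, unit_ball s & `|s - t| < eta].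
    have m0 : 0 < Num.min (1/2) (eta / 2) by rewrite lt_min !divr_gt0.
    have m1 : Num.min (1/2) (eta / 2) <= 1/2 by rewrite ge_min lexx.
    have m2 : Num.min (1/2) (eta / 2) <= eta/2 by rewrite ge_min lexx orbT.
    move: m0 m1 m2; move: (Num.min _ _) => u u0 u1 u2.
    move: bt; rewrite unit_ballE => bt.
    have [t0|t0] := leP t 0.
      exists (t + u); rewrite unit_ballE; split; [|lra|].
        by rewrite gt_eqF// ltrDl.
      by rewrite addrAC subrr add0r gtr0_norm//; lra.
    exists (t - u); rewrite unit_ballE; split; [|lra|].
      by rewrite lt_eqF// gtrBl.
    by rewrite addrAC subrr add0r normrN gtr0_norm//; lra.
  have s0 : 0 < `|s - t| by rewrite normr_gt0 subr_eq0.
  rewrite -(ler_pM2r s0) -normrM mulrDl.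
  have h1 := he s bs st; have h2 := h s t bs bt.
  have -> : deriv_on f t * (s - t) = (f s - f t) - (f s - f t - deriv_on f t * (s - t)) by ring.
  by apply: le_trans (ler_normB _ _) _; exact: lerD.
apply: (ball_MVT_bound (df := deriv_on f)) => //.
- exact: has_deriv_continuous.
- by move=> x x1; exact: has_deriv_interior.
- move=> x; move: bs bt; rewrite !unit_ballE => bs bt xst; apply: h; rewrite unit_ballE.
  by move: xst; have [_|_] := leP t s => ?; lra.
Qed.

Lemma sup_norm_le f (c : R) : (sup_norm f <= c%:E)%E <-> forall t, unit_ball t -> `|f t| <= c.
Proof.
split => [h t bt|h].
  by rewrite -lee_fin; apply: le_trans h; apply: ereal_sup_ubound; exists t.
by apply: ge_ereal_sup => _ [t bt <-]; rewrite lee_fin; exact: h.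
Qed.

(** The event [constraint] rewritten with countably many evaluations; both agree on paths that are
    continuous and, beyond the first layer, differentiable. *)
Definition constraint_cyl (H : nat) (K : nat -> R) (h : nat) : set (R -> R) :=
  if h == 1%N then tube (fun=> 0) 1
  else if (h < H)%N then tube (fun=> 0) 1 `&` lip_paths (K h) else lip_paths (K h).

Lemma constraint_cylP H (K : nat -> R) (h : nat) z : {within unit_ball, continuous z} ->
  (h != 1%N -> has_deriv z) -> constraint H K h z <-> constraint_cyl H K h z.
Proof.
move=> cz dz; rewrite /constraint /constraint_cyl.
have c0 : {within unit_ball, continuous (fun _ : R => 0 : R)} by move=> t; exact: cvg_cst.
have e1 : (sup_norm z <= 1)%E <-> tube (fun=> 0) 1 z.
  rewrite sup_norm_le tubeP//; split => h' t bt; first by rewrite subr0; exact: h'.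
  by have := h' t bt; rewrite subr0.
have e2 : h != 1%N -> (sup_norm (deriv_on z) <= (K h)%:E)%E <-> lip_paths (K h) z.
  by move=> /dz dz'; rewrite sup_norm_le lip_pathsP// lipschitz_deriv_on.
case: (eqVneq h 1%N) => [//|h1]; case: ifP => _ /=; last exact: e2.
by split => -[/e1 a /(e2 h1) b].
Qed.

Lemma cylinder_constraint H (K : nat -> R) (h : nat) : cylinder unit_ball (constraint_cyl H K h).
Proof.
rewrite /constraint_cyl; case: ifP => _; first exact: cylinder_tube.
by case: ifP => _; [apply: cylinderI; [exact: cylinder_tube|]|]; exact: cylinder_lip.
Qed.

End path_sets.

(** * Transfer to conditioned laws *)

Section conditioned_law.
Context {R : realType} {d e : measure_display} {T : measurableType d} {S : measurableType e}.
Variables (P : probability T R) (Q : probability S R) (Z : T -> R -> R) (Zc : S -> R -> R).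
Variables (C D : set (R -> R)).
Hypothesis mZ : forall t, unit_ball t -> measurable_fun setT (Z ^~ t).
Hypothesis cZ : forall w, {within unit_ball, continuous Z w}.
Hypothesis mZc : forall t, unit_ball t -> measurable_fun setT (Zc ^~ t).
Hypothesis cZc : forall s, {within unit_ball, continuous Zc s}.
Hypothesis cylD : cylinder unit_ball D.
Hypothesis CD : forall w, C (Z w) <-> D (Z w).
Hypothesis lawZc : forall A, cylinder unit_ball A -> Q (Zc @^-1` A) =
  (fine (P (Z @^-1` (A `&` C))) / fine (P (Z @^-1` C)))%:E.

Lemma cylinder_preimage {d'} {T' : measurableType d'} (Y : T' -> R -> R) A :
  (forall t, unit_ball t -> measurable_fun setT (Y ^~ t)) ->
  cylinder unit_ball A -> measurable (Y @^-1` A).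
Proof.
move=> mY cA; apply: (sigma_path_measurable mY).
by exists A => //; rewrite setTI.
Qed.

Let p := fine (P (Z @^-1` D)).

Let law' A : cylinder unit_ball A ->
  Q (Zc @^-1` A) = (fine (P (Z @^-1` (A `&` D))) / p)%:E.
Proof.
move=> cA; rewrite lawZc// /p; congr (fine (P _) / fine (P _))%:E.
  by apply/seteqP; split => w [h1 /CD h2].
by apply/seteqP; split => w /CD.
Qed.

Let cylT : cylinder unit_ball (@setT (R -> R)).
Proof.
exact: (@measurableT _ (g_sigma_algebraType (\bigcup_(t in (@unit_ball R))
    preimage_set_system setT (fun z : R -> R => z t) measurable))).
Qed.

(** Were the conditioning probability 0, division by 0 would give the whole space mass 0 under
    [Q]. *)
Lemma conditioning_gt0 : 0 < p.
Proof.
have p0 : 0 <= p by apply: fine_ge0.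
rewrite lt_neqAle p0 andbT; apply/eqP => pE.
have := law' cylT; rewrite -pE invr0 mulr0 preimage_setT probability_setT => /eqP.
by rewrite eqe oner_eq0.
Qed.

(** Dividing by a probability can only enlarge the mass of an event that already implies the
    constraint. *)
Lemma conditioned_lower A E : cylinder unit_ball A -> measurable E ->
  (forall w, E w -> A (Z w) /\ D (Z w)) -> (P E <= Q (Zc @^-1` A))%E.
Proof.
move=> cA mE EA; have p0 := conditioning_gt0.
have mAD : measurable (Z @^-1` (A `&` D)) by apply: cylinder_preimage => //; exact: cylinderI.
rewrite law'//; apply: (@le_trans _ _ (P (Z @^-1` (A `&` D)))).
  by apply: le_measure; rewrite ?inE.
rewrite -[leLHS]fineK ?fin_num_measure// lee_fin ler_pdivlMr//.
rewrite ler_piMr ?fine_ge0// -lee_fin /p fineK ?fin_num_measure//; last exact: cylinder_preimage.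
by apply: probability_le1; exact: cylinder_preimage.
Qed.

Lemma conditioned_upper A E : cylinder unit_ball A -> measurable E ->
  Z @^-1` A `<=` E -> (Q (Zc @^-1` A) <= (p^-1)%:E * P E)%E.
Proof.
move=> cA mE AE; have p0 := conditioning_gt0.
have mAD : measurable (Z @^-1` (A `&` D)) by apply: cylinder_preimage => //; exact: cylinderI.
rewrite law'// -[P E]fineK ?fin_num_measure// -EFinM lee_fin mulrC.
rewrite ler_wpM2l ?invr_ge0 ?(ltW p0)//; apply: fine_le; rewrite ?fin_num_measure//.
by apply: le_measure; rewrite ?inE// => w [/AE].
Qed.

Lemma conditioned_full A : cylinder unit_ball A -> D `<=` A -> Q (Zc @^-1` A) = 1%E.
Proof.
move=> cA DA; rewrite law'// (_ : A `&` D = D); last exact: setIidr.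
by rewrite divff// gt_eqF// conditioning_gt0.
Qed.

(** The pieces live on the sample space of [Z], not on that of [Zc]. Each is replaced by the tube
    around one of its paths, a cylinder set that makes sense for both processes; this doubles the
    diameter. *)
Lemma conditioned_pieces E n (rho : R) : measurable E ->
  pieces (~` E) n (fun V => forall w w', V w -> V w' ->
    forall t, unit_ball t -> `|Z w t - Z w' t| <= rho) ->
  exists E' : set S, [/\ measurable E', (Q E' <= (p^-1)%:E * P E)%E &
    pieces (~` E') n (fun V => measurable V /\ forall s s', V s -> V s' ->
      forall t, unit_ball t -> `|Zc s t - Zc s' t| <= 2 * rho)].
Proof.
move=> mE [F [EF hF]].
pose A j : set (R -> R) := if pselect (F j !=set0) is left h then
  tube (Z (projT1 (cid h))) rho else set0.
have cA j : cylinder unit_ball (A j).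
  rewrite /A; case: pselect => h; first exact: cylinder_tube.
  exact: (@measurable0 _ (g_sigma_algebraType (\bigcup_(t in (@unit_ball R))
    preimage_set_system setT (fun z : R -> R => z t) measurable))).
pose U := \bigcup_(j in [set j | (j < n)%N]) A j.
have cU : cylinder unit_ball (~` U).
  apply: (@measurableC _ (g_sigma_algebraType (\bigcup_(t in (@unit_ball R))
    preimage_set_system setT (fun z : R -> R => z t) measurable))).
  apply: (@bigcup_measurable _ (g_sigma_algebraType (\bigcup_(t in (@unit_ball R))
    preimage_set_system setT (fun z : R -> R => z t) measurable))) => j _.
  exact: cA.
exists (Zc @^-1` (~` U)); split.
- exact: cylinder_preimage.
- apply: conditioned_upper => // w /= nU; apply: contrapT => nE.
  have [j /= jn Fw] := EF w nE; apply: nU; exists j => //.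
  rewrite /A; case: pselect => h; last by exfalso; apply: h; exists w.
  case: cid => w' /= Fw' q.
  by apply: (hF j jn w w') => //; exact: ball_pointP.
- exists (fun j => Zc @^-1` (A j)); split.
    move=> s ns; have : U (Zc s) by apply: contrapT.
    by case=> j jn As; exists j.
  move=> j jn; split; first exact: cylinder_preimage.
  move=> s s'; rewrite /= /A; case: pselect => [h|//]; move: (projT1 _) => w h1 h2 t bt.
  have {}h1 := (tubeP rho (@cZc s) (@cZ w)).1 h1 t bt.
  have {}h2 := (tubeP rho (@cZc s') (@cZ w)).1 h2 t bt.
  have -> : Zc s t - Zc s' t = (Zc s t - Z w t) - (Zc s' t - Z w t) by ring.
  by apply: le_trans (ler_normB _ _) _; lra.
Qed.

End conditioned_law.

(** * Differentiability of the layers on [-1, 1] *)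

Section integrated_path.
Context {R : realType}.
Variables (N : nat) (b : R -> R) (x : nat -> R).
Hypothesis cb : {within `[0, +oo[, continuous b}.

Let cb2 : {within `[0, 2], continuous b}.
Proof.
by apply: continuous_subspaceW cb => s /=; rewrite !in_itv/= andbT => /andP[].
Qed.

Let shift_continuous (f : R -> R) : {within `[0, 2], continuous f} ->
  {within unit_ball, continuous (fun t => f (t + 1))}.
Proof.
move=> cf; have c2 := @continuous_clamp_comp R 0 2 f (ler0n _ _) cf.
have : {within unit_ball, continuous (fun t => f (clamp 0 2 (t + 1)))}.
  apply: continuous_subspaceT => t.
  have hs : (u + 1 : R) @[u --> t] --> (t + 1 : R) by apply: cvgD; [exact: cvg_id|exact: cvg_cst].
  exact: (cvg_comp _ _ hs (c2 (t + 1))).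
apply: subspace_eq_continuous => t; rewrite inE unit_ballE => bt.
by rewrite /from_subspace clamp_id//; lra.
Qed.

Lemma ibm_path_continuous : {within unit_ball, continuous (ibm_path N b x)}.
Proof.
have [c _] := jet_regular N x (ltr0Sn _ 1) cb2.
have -> : ibm_path N b x = fun t => jet N b x 0 (t + 1).
  by apply/funext => t; exact: ibm_path_jet.
exact: shift_continuous.
Qed.

Lemma ibm_path_derive (t : R) : (0 < N)%N -> -1 < t < 1 ->
  is_derive t 1 (ibm_path N b x) (jet N b x 1 (t + 1)).
Proof.
move=> N0 t1; have [_ dj] := jet_regular N x (ltr0Sn _ 1) cb2.
have -> : ibm_path N b x = fun t => jet N b x 0 (t + 1).
  by apply/funext => s; exact: ibm_path_jet.
have hs : is_derive t 1 (fun y : R => y + 1) 1.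
  by apply: (is_derive_eq (deriv_add (deriv_id t) (deriv_cst 1 t))); rewrite addr0.
have t2 : 0 < t + 1 < 2 by lra.
have h := @deriv_compose R (jet N b x 0) (fun y => y + 1) t _ _ (dj 0%N (t + 1) N0 t2) hs.
by apply: (is_derive_eq h); rewrite mulr1.
Qed.

Lemma ibm_path_has_deriv : (0 < N)%N -> has_deriv (ibm_path N b x).
Proof.
move=> N0; apply: (@ball_C1 _ _ (fun t => jet N b x 1 (t + 1))).
- exact: ibm_path_continuous.
- by apply: shift_continuous; have [c _] := jet_regular N x (ltr0Sn _ 1) cb2.
- by move=> t t1; exact: ibm_path_derive.
Qed.

Lemma ibm_path_lipschitz (K : R) : (0 < N)%N ->
  (forall t, 0 <= t <= 2 -> `|jet N b x 1 t| <= K) ->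
  forall s t, unit_ball s -> unit_ball t ->
  `|ibm_path N b x s - ibm_path N b x t| <= K * `|s - t|.
Proof.
move=> N0 hK s t bs bt.
apply: (ball_MVT_bound (df := fun t => jet N b x 1 (t + 1))) => //.
- exact: ibm_path_continuous.
- by move=> u u1; exact: ibm_path_derive.
- move=> u us; apply: hK; move: bs bt us; rewrite !unit_ballE.
  by have [_|_] := leP t s => *; lra.
Qed.

End integrated_path.

(** * Powers of the mesh *)

Section scales.
Context {R : realType}.
Variables (N1 : nat) (beta : R).
Hypotheses (beta_gt0 : 0 < beta) (hbeta1 : beta <= N1%:R + 1 / 2).

(** Up to a constant, the square of the Lipschitz constant that smoothing leaves on the derivative
    of order [N1]; see [smoothing_scale]. *)
Definition effort (m : nat) : R := m%:R `^ (2 * N1%:R + 2 - 2 * beta).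
Definition precision (m : nat) : R := m%:R^-1 `^ beta.

Variable m : nat.
Hypothesis m0 : (0 < m)%N.

Let m1 : 1 <= m%:R :> R. Proof. by rewrite ler1n. Qed.
Let mp : 0 < m%:R :> R. Proof. by rewrite ltr0n. Qed.
Let mN : m%:R != 0 :> R. Proof. by rewrite gt_eqF. Qed.
Let mD (x y : R) : m%:R `^ (x + y) = m%:R `^ x * m%:R `^ y.
Proof. by rewrite powRD// mN implybT. Qed.

Lemma precisionE : precision m = m%:R `^ (- beta).
Proof. by rewrite /precision -powR_inv1 ?(ltW mp)// -powRrM mulN1r. Qed.

Lemma precision_gt0 : 0 < precision m.
Proof. by rewrite precisionE powR_gt0. Qed.

Lemma precision_le1 : precision m <= 1.
Proof. by rewrite precisionE -[leRHS](powRr0 m%:R) ler_powR// oppr_le0 ltW. Qed.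

Lemma effort_ge : m%:R <= effort m.
Proof. by rewrite /effort -[leLHS]powRr1 ?(ltW mp)// ler_powR//; have := hbeta1; lra. Qed.

Lemma effort_ge1 : 1 <= effort m.
Proof. exact: le_trans effort_ge. Qed.

Lemma sqrt_effort : Num.sqrt (effort m) = m%:R `^ (N1%:R + 1 - beta).
Proof.
rewrite -powR12_sqrt ?powR_ge0// -powRrM; congr (_ `^ _).
by field.
Qed.

Lemma inv_pow (n : nat) : m%:R^-1 ^+ n = m%:R `^ (- n%:R) :> R.
Proof. by rewrite powR_invn ?(ltW mp)// exprVn. Qed.

(** The exponents compare as -(2 N1 + 1 - beta) <= -beta, that is, beta <= N1 + 1/2. *)
Lemma first_scale : m%:R^-1 ^+ N1 / Num.sqrt (effort m) <= precision m.
Proof.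
rewrite sqrt_effort precisionE inv_pow -powRN -mD ler_powR//; have := hbeta1; lra.
Qed.

Lemma next_scale (n : nat) : beta <= n%:R -> m%:R^-1 ^+ n / Num.sqrt (effort m) <= precision m.
Proof.
move=> bn; apply: (@le_trans _ _ (m%:R^-1 ^+ n)).
  rewrite ler_piMr ?exprn_ge0 ?invr_ge0 ?(ltW mp)// invf_le1 ?sqrtr_gt0; last first.
    by apply: lt_le_trans effort_ge1.
  by rewrite -sqrtr1 ler_sqrt// ?effort_ge1// (le_trans _ effort_ge1).
by rewrite precisionE inv_pow ler_powR//; lra.
Qed.

Lemma sieve_scale (n : nat) : beta <= n%:R + 1 / 2 ->
  m%:R^-1 ^+ n * Num.sqrt m%:R^-1 <= precision m.
Proof.
move=> bn; rewrite precisionE inv_pow -powR12_sqrt ?invr_ge0 ?(ltW mp)//.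
rewrite -(powR_inv1 (ltW mp)) -powRrM -mD ler_powR//; lra.
Qed.

Lemma smoothing_scale : (precision m / m%:R^-1 ^+ N1.+1) ^+ 2 = effort m.
Proof.
rewrite precisionE inv_pow -powRN -mD -powR_mulrn ?powR_ge0// -powRrM /effort; congr (_ `^ _).
by rewrite -natr1; ring.
Qed.

End scales.

Section composition.
Context {R : realType}.

Lemma compose_ball (z : nat -> R -> R) n t :
  (forall h, (1 <= h <= n)%N -> forall t, unit_ball t -> unit_ball (z h t)) ->
  unit_ball t -> unit_ball (compose z n t).
Proof.
elim: n => [//|n ih] hz bt /=; apply: (hz); first by rewrite ltnS leqnn.
by apply: ih => // h /andP[h1 hn]; apply: hz; rewrite h1 leqW.
Qed.

(** Stability constant of a composition. Starting from 0 gives the constant 1 after the first layer,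
    which enters through uniform closeness alone, its paths being possibly as rough as Brownian
    motion. *)
Fixpoint compose_lip (K : nat -> R) n : R :=
  if n is n'.+1 then K n * compose_lip K n' + 1 else 0.

Lemma compose_lip_ge0 (K : nat -> R) n : (forall h, (2 <= h <= n)%N -> 0 <= K h) ->
  0 <= compose_lip K n.
Proof.
elim: n => [//|n ih] hK /=; apply: addr_ge0 => //.
case: n ih hK => [|n] ih hK; first by rewrite mulr0.
apply: mulr_ge0; first by apply: hK; rewrite leqnn.
by apply: ih => h /andP[h2 hn]; apply: hK; rewrite h2 leqW.
Qed.

(** The inner argument is changed first, at the price of the Lipschitz constant of [z]; then [z] is
    replaced by [z'] at a common point of the ball. *)
Lemma compose_stability (K : nat -> R) (z z' : nat -> R -> R) n (eps : R) :
  0 <= eps ->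
  (forall h, (2 <= h <= n)%N -> 0 <= K h) ->
  (forall h, (1 <= h < n)%N -> forall t, unit_ball t -> unit_ball (z h t)) ->
  (forall h, (1 <= h < n)%N -> forall t, unit_ball t -> unit_ball (z' h t)) ->
  (forall h, (2 <= h <= n)%N -> forall s t, unit_ball s -> unit_ball t ->
     `|z h s - z h t| <= K h * `|s - t|) ->
  (forall h, (1 <= h <= n)%N -> forall t, unit_ball t -> `|z h t - z' h t| <= eps) ->
  forall t, unit_ball t -> `|compose z n t - compose z' n t| <= compose_lip K n * eps.
Proof.
move=> e0; elim: n => [|n ih] hK bz bz' lz zz' t bt /=; first by rewrite subrr normr0 mul0r.
have bc (y : nat -> R -> R) : (forall h, (1 <= h < n.+1)%N -> forall t, unit_ball t -> unit_ball (y h t)) ->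
    unit_ball (compose y n t) by move=> hy; apply: compose_ball.
have b1 := bc _ bz; have b2 := bc _ bz'.
have -> : z n.+1 (compose z n t) - z' n.+1 (compose z' n t) =
  (z n.+1 (compose z n t) - z n.+1 (compose z' n t)) +
  (z n.+1 (compose z' n t) - z' n.+1 (compose z' n t)) by ring.
apply: le_trans (ler_normD _ _) _; rewrite mulrDl mul1r; apply: lerD; last first.
  by apply: zz' => //; rewrite ltnS leqnn.
case: n ih hK bz bz' lz zz' b1 b2 {bc} => [|n] ih hK bz bz' lz zz' b1 b2.
  by rewrite /= subrr normr0 mulr0 mul0r.
apply: le_trans (lz _ _ _ _ b1 b2) _; first by rewrite leqnn.
rewrite -mulrA; apply: ler_wpM2l; first by apply: hK; rewrite leqnn.
have up h : (1 <= h < n.+1)%N -> (1 <= h < n.+2)%N by case/andP => -> /=; apply: leqW.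
have up2 h k : (k <= h <= n.+1)%N -> (k <= h <= n.+2)%N by case/andP => -> /=; apply: leqW.
apply: ih => //.
- by move=> h /up2; exact: hK.
- by move=> h /up; exact: bz.
- by move=> h /up; exact: bz'.
- by move=> h /up2; exact: lz.
- by move=> h /up2; exact: zz'.
Qed.

End composition.

(** * Small balls and sieves for the composed prior *)

Section prior.
Context {R : realType}.
Variables (H : nat) (N : nat -> nat).
Hypotheses (hH : (2 <= H)%N) (hN : forall h, (2 <= h <= H)%N -> (1 <= N h)%N).
Context {d : measure_display} {T : measurableType d}.
Variables (P : probability T R) (B : nat -> T -> R -> R) (G : nat -> nat -> T -> R).
Hypothesis hZ : ibm_family P H N B G.
Variable beta : R.
Hypotheses (beta_gt0 : 0 < beta) (hbeta1 : beta <= (N 1%N)%:R + 1 / 2).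
Hypothesis hbeta : forall h, (2 <= h <= H)%N -> beta <= (N h)%:R.
Variable K : nat -> R.
Hypothesis K0 : forall h, (2 <= h <= H)%N -> 0 <= K h.
Context {e : measure_display} {S : measurableType e}.
Variables (Q : probability S R) (Zc : nat -> S -> R -> R).
Hypothesis hZc : constrained_family H K P (ibm N B G) Q Zc.

Let Z := ibm N B G.
Let D h := constraint_cyl H K h.
Local Notation A := (effort (N 1%N) beta).
Local Notation eps := (precision beta).

Let range2 h : (1 <= h <= H)%N -> h != 1%N -> (2 <= h <= H)%N.
Proof. by move=> /andP[h1 h2] hn1; rewrite h2 andbT ltn_neqAle eq_sym hn1. Qed.

Let cB h w : (1 <= h <= H)%N -> {within `[0, +oo[, continuous B h w}.
Proof. by move=> /(hZ.1)[[]]. Qed.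

Let cZ h w : (1 <= h <= H)%N -> {within unit_ball, continuous Z h w}.
Proof. by move=> hr; apply: ibm_path_continuous; exact: cB. Qed.

Let mZ h t : (1 <= h <= H)%N -> unit_ball t -> measurable_fun setT (Z h ^~ t).
Proof.
move=> hr; rewrite unit_ballE => bt; have [bm lw _ _] := hZ.1 h hr.
rewrite (_ : (fun w => _) = fun w => jet (N h) (B h w) (fun l => G h l w) 0 (t + 1)).
  apply: measurable_jet => //; first lra.
  - by move=> s /andP[s0 _]; exact: (brownian_measurable bm).
  - by move=> w; exact: cB.
  - by move=> l lN; have [] := lw l lN.
by apply/funext => w; exact: ibm_path_jet.
Qed.

Let CD h w : (1 <= h <= H)%N -> constraint H K h (Z h w) <-> D h (Z h w).
Proof.
move=> hr; apply: constraint_cylP; first exact: cZ.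
move=> h1; apply: ibm_path_has_deriv; first exact: cB.
exact: hN (range2 hr h1).
Qed.

Let mZc h t : (1 <= h <= H)%N -> unit_ball t -> measurable_fun setT (Zc h ^~ t).
Proof. by move=> hr bt; case: hZc => /(_ h hr)[+ _] _ _ _; apply. Qed.

Let cZc h s : (1 <= h <= H)%N -> {within unit_ball, continuous Zc h s}.
Proof. by move=> hr; case: hZc => /(_ h hr)[_ +] _ _ _; apply. Qed.

Let lawZc h : (1 <= h <= H)%N -> forall A, cylinder unit_ball A -> Q (Zc h @^-1` A) =
  (fine (P (Z h @^-1` (A `&` constraint H K h))) / fine (P (Z h @^-1` constraint H K h)))%:E.
Proof. by move=> hr; case: hZc => _ _ _ /(_ h hr). Qed.

(** The target stays inside the constraints with a margin [rho] that absorbs the steering error, so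
    the steered event implies the constraint and survives conditioning. *)
Lemma small_ball_mass h (g : R -> R) (A0 La0 rho Cg : R) (m0 : nat) :
  (1 <= h <= H)%N -> {within unit_ball, continuous g} -> 0 < rho -> 0 <= La0 -> 0 <= Cg ->
  (forall m, (0 < m)%N -> (m0 <= m)%N -> exists (Lam : R) (a : nat -> R -> R),
    [/\ forall l, (l < N h)%N -> forall t : R, 0 < t < 2 -> is_derive t 1 (a l) (a l.+1 t),
        forall l, (l <= N h)%N -> {within `[0, 2], continuous a l},
        forall l, (l <= N h)%N -> `|a l 0| <= A0,
        [/\ 0 <= Lam, Lam ^+ 2 <= La0 * A m & forall s t, 0 <= s <= 2 -> 0 <= t <= 2 ->
          `|a (N h) t - a (N h) s| <= Lam * `|t - s|] &
        [/\ (h < H)%N -> forall t, 0 <= t <= 2 -> `|a 0%N t| <= 1 - rho,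
            h != 1%N -> forall t, 0 <= t <= 2 -> `|a 1%N t| <= K h - rho &
            forall t, unit_ball t -> `|a 0%N (t + 1) - g t| <= Cg * eps m]]) ->
  exists2 c : R, 0 < c & forall m, (0 < m)%N -> (m0 <= m)%N ->
    ((expR (- (c * A m)))%:E <= Q (Zc h @^-1` tube g ((Cg + rho) * eps m)))%E.
Proof.
move=> hr cg rho0 La00 Cg0 htarget.
have [bm lw iX iXB] := hZ.1 h hr.
have [c c0 hc] := ibm_small_ball bm lw iX iXB A0 rho0 La00.
exists c => // m m0' mm.
have [Lam [a [da ca a0 [Lam0 LamA aL] [h1 h2 h3]]]] := htarget m m0' mm.
have [E [mE PE hE]] := hc m (A m) Lam a m0' (effort_ge hbeta1 m0') da ca a0 Lam0 LamA aL.
apply: le_trans PE _.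
apply: (conditioned_lower (D := D h) (fun t => @mZ h t hr) (cylinder_constraint H K h)
  (fun w => CD w hr) (lawZc hr)) => //; first exact: cylinder_tube.
move=> w Ew; have jE t : Z h w t = jet (N h) (B h w) (fun l => G h l w) 0 (t + 1).
  exact: ibm_path_jet.
have e0 := precision_gt0 beta m0'; have e1 := precision_le1 beta_gt0 m0'.
(* The relation between beta and the number of integrations enters here: beta <= N_1 + 1/2 for the
   first layer, beta <= N_h for the others. *)
have sc : m%:R^-1 ^+ N h / Num.sqrt (A m) <= eps m.
  have [h1'|hn1] := eqVneq h 1%N; first by rewrite h1'; exact: first_scale.
  by apply: next_scale => //; apply: hbeta; exact: range2.
have close t : unit_ball t -> `|Z h w t - a 0%N (t + 1)| <= rho * eps m.
  rewrite unit_ballE => bt; rewrite jE; apply: le_trans (hE w Ew 0%N (t + 1) _ _) _ => //; first lra.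
  by rewrite subn0 mulrAC -mulrA ler_wpM2l// ltW.
have Zin : (h < H)%N -> tube (fun=> 0) 1 (Z h w).
  move=> hlt q; rewrite subr0; have bq := ball_pointP (R := R) q.
  have hq := close _ bq; have := h1 hlt (ball_point q + 1).
  rewrite unit_ballE in bq => /(_ _)/le_trans hh.
  rewrite -[Z h w _](subrK (a 0%N (ball_point q + 1))).
  apply: le_trans (ler_normD _ _) _.
  have : `|a 0%N (ball_point q + 1)| <= 1 - rho by apply: h1 => //; lra.
  have : rho * eps m <= rho by rewrite ler_piMr// ltW.
  by move: hq; lra.
have Zlip : h != 1%N -> lip_paths (K h) (Z h w).
  move=> hn1 q q'; apply: (@ibm_path_lipschitz _ _ _ _ (@cB h w hr)); try exact: ball_pointP.
    exact: hN (range2 hr hn1).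
  move=> t t2; rewrite -[jet _ _ _ _ _](subrK (a 1%N t)).
  apply: le_trans (ler_normD _ _) _.
  have hN1 := hN (range2 hr hn1).
  have := hE w Ew 1%N t hN1 t2; have := h2 hn1 t t2.
  have : rho / Num.sqrt (A m) * m%:R^-1 ^+ (N h - 1) <= rho.
    rewrite -mulrA ler_piMr ?(ltW rho0)//.
    have m1 : 1 <= m%:R :> R by rewrite ler1n.
    apply: (@le_trans _ _ (1 * 1)); last by rewrite mul1r.
    apply: ler_pM; rewrite ?invr_ge0 ?sqrtr_ge0 ?exprn_ge0 ?invr_ge0//.
      rewrite invf_le1 ?sqrtr_gt0; last by apply: lt_le_trans (effort_ge1 hbeta1 m0').
      rewrite -sqrtr1 ler_sqrt// ?(effort_ge1 hbeta1 m0')//.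
      exact: le_trans (effort_ge1 hbeta1 m0').
    by rewrite exprn_ile1// ?invr_ge0// invf_le1// (lt_le_trans ltr01).
  lra.
split; last first.
  rewrite /D /constraint_cyl; case: (eqVneq h 1%N) => [h1'|hn1].
    by apply: Zin; rewrite h1'.
  by case: ifP => [hlt|_]; [split; [exact: Zin|exact: Zlip]|exact: Zlip].
apply/(tubeP _ (@cZ h w hr) cg) => t bt.
rewrite -[Z h w t](subrK (a 0%N (t + 1))) -addrA mulrDl addrC.
by apply: le_trans (ler_normD _ _) _; apply: lerD; [exact: h3|exact: close].
Qed.

Let Cs h : R := 2 * (65 + N h)%:R.

Let sieve_one h (c : R) : (1 <= h <= H)%N -> 0 < c -> exists c' K' : R, [/\ 0 < c', 0 < K' &
  forall m, (0 < m)%N -> exists (E : set S) (n : nat), [/\ measurable E,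
    (Q E <= (K' * expR (- (c * A m)))%:E)%E, n%:R <= K' * expR (c' * A m) &
    pieces (~` E) n (fun V => measurable V /\ forall s s', V s -> V s' ->
      forall t, unit_ball t -> `|Zc h s t - Zc h s' t| <= Cs h * eps m)]].
Proof.
move=> hr c0; have [bm lw iX iXB] := hZ.1 h hr.
have [c' [K' [c'0 K'0 hc]]] := ibm_sieve bm lw iXB c0.
have p0 := conditioning_gt0 (D := D h) (fun w => CD w hr) (lawZc hr).
pose p : R := fine (P (Z h @^-1` D h)); rewrite -/p in p0.
exists c', (K' + p^-1 * K'); split => //; first by rewrite addr_gt0 ?mulr_gt0 ?invr_gt0.
move=> m m0; have [E [n [mE PE nn pE]]] := hc m (A m) m0 (effort_ge hbeta1 m0).
have pE' : pieces (~` E) n (fun V => forall w w', V w -> V w' -> forall t, unit_ball t ->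
    `|Z h w t - Z h w' t| <= (65 + N h)%:R * eps m).
  apply: pieces_weaken pE => // V hV w w' Vw Vw' t; rewrite unit_ballE => bt.
  rewrite /Z /ibm !ibm_path_jet; apply: le_trans (hV w w' Vw Vw' (t + 1) _) _; first lra.
  rewrite ler_wpM2l//; apply: sieve_scale => //.
  have [->//|hn1] := eqVneq h 1%N.
  by have := hbeta (range2 hr hn1); lra.
have [E' [mE' QE' pE'']] := conditioned_pieces (fun t => @mZ h t hr) (fun w => @cZ h w hr)
  (fun t => @mZc h t hr) (fun s => @cZc h s hr) (cylinder_constraint H K h)
  (fun w => CD w hr) (lawZc hr) mE pE'.
have e0 := precision_gt0 beta m0.
exists E', n; split => //.
- apply: le_trans QE' _; apply: (@le_trans _ _ ((p^-1)%:E * (K' * expR (- (c * A m)))%:E)%E).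
    by apply: lee_wpmul2l => //; rewrite lee_fin invr_ge0 ltW.
  by rewrite -EFinM lee_fin mulrA ler_wpM2r ?expR_ge0// lerDr ltW.
- by apply: le_trans nn _; rewrite ler_wpM2r ?expR_ge0// lerDl mulr_ge0 ?invr_ge0 ?ltW.
- apply: pieces_weaken pE'' => // V [mV hV]; split => // s s' Vs Vs' t bt.
  by rewrite /Cs -mulrA; exact: hV.
Qed.

Lemma pieces_inter {U : Type} (E1 E2 : set U) n1 n2 (Q1 Q2 Q3 : set U -> Prop) :
  (forall A1 A2, Q1 A1 -> Q2 A2 -> Q3 (A1 `&` A2)) ->
  pieces E1 n1 Q1 -> pieces E2 n2 Q2 -> pieces (E1 `&` E2) (n1 * n2) Q3.
Proof.
move=> h12 [F1 [EF1 hF1]] p2; apply: (@pieces_refine _ _ n1 n2 (fun V => exists2 F, Q1 F & V = F `&` E2)).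
  exists (fun j => F1 j `&` E2); split.
    by move=> w [/EF1[j jn Fw] E2w]; exists j.
  by move=> j jn; exists (F1 j) => //; exact: hF1.
move=> V [F QF ->]; have [F2 [EF2 hF2]] := p2.
exists (fun j => F `&` F2 j); split.
  by move=> w [Fw /EF2[j jn F2w]]; exists j.
by move=> j jn; apply: h12 => //; exact: hF2.
Qed.

(** Layer after layer, exceptional sets are united and pieces intersected; the constants depend on
    the number of layers but not on [m]. *)
Lemma sieve_all (c : R) : 0 < c -> forall k, (k <= H)%N ->
  exists c' K' C' : R, [/\ 0 < c', 0 < K', 0 <= C' &
  forall m, (0 < m)%N -> exists (E : set S) (n : nat), [/\ measurable E,
    (Q E <= (K' * expR (- (c * A m)))%:E)%E, n%:R <= K' * expR (c' * A m) &
    pieces (~` E) n (fun V => measurable V /\ forall h, (1 <= h <= k)%N ->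
      forall s s', V s -> V s' -> forall t, unit_ball t ->
        `|Zc h s t - Zc h s' t| <= C' * eps m)]].
Proof.
move=> c0; elim=> [_|k ih kH].
  exists 1, 1, 0; split => // m m0; exists set0, 1%N; split => //.
  - by rewrite measure0 lee_fin mulr_ge0// expR_ge0.
  - rewrite mul1r; apply: le_trans (expR_ge1Dx _); rewrite mul1r lerDl.
    by apply: le_trans (effort_ge1 hbeta1 m0).
  - exists (fun=> setT); split; first by move=> s _; exists 0%N.
    by move=> j _; split => // h /andP[h1 h2]; move: (leq_trans h1 h2).
have [c1 [K1 [C1 [c10 K10 C10 h1]]]] := ih (ltnW kH).
have hr : (1 <= k.+1 <= H)%N by [].
have [c2 [K2 [c20 K20 h2]]] := sieve_one hr c0.
have C20 : 0 <= Cs k.+1 by rewrite mulr_ge0.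
exists (c1 + c2), (K1 + K2 + K1 * K2), (C1 + Cs k.+1); split.
- exact: addr_gt0.
- by rewrite !addr_gt0 ?mulr_gt0.
- exact: addr_ge0.
move=> m m0; have e0 := precision_gt0 beta m0.
have [E1 [n1 [mE1 QE1 nn1 p1]]] := h1 m m0.
have [E2 [n2 [mE2 QE2 nn2 p2]]] := h2 m m0.
exists (E1 `|` E2), (n1 * n2)%N; split.
- exact: measurableU.
- apply: le_trans (measureU2 _ mE1 mE2) _.
  apply: le_trans (leeD QE1 QE2) _; rewrite -EFinD lee_fin -mulrDl ler_wpM2r ?expR_ge0//.
  by rewrite lerDl mulr_ge0// ltW.
- rewrite natrM [(c1 + c2) * A m]mulrDl expRD.
  apply: le_trans (ler_pM _ _ nn1 nn2) _ => //.
  by rewrite mulrACA ler_wpM2r ?mulr_ge0 ?expR_ge0// lerDr addr_ge0// ltW.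
- rewrite setCU; apply: pieces_inter p1 p2 => V1 V2 [mV1 hV1] [mV2 hV2].
  split; first exact: measurableI.
  move=> h /andP[h1' hk] s s' [V1s V2s] [V1s' V2s'] t bt.
  have a1 : 0 <= C1 * eps m by rewrite mulr_ge0// ltW.
  have a2 : 0 <= Cs k.+1 * eps m by rewrite mulr_ge0// ltW.
  move: hk; rewrite mulrDl leq_eqVlt => /predU1P[->|].
    by apply: le_trans (hV2 _ _ V2s V2s' t bt) _; rewrite lerDr.
  rewrite ltnS => hk; apply: le_trans (hV1 h _ _ _ V1s V1s' t bt) _; first by rewrite h1'.
  by rewrite lerDl.
Qed.

(** The Lipschitz bounds hold almost surely under [Q]; pathwise estimates are confined to this event
    of full mass. *)
Let S0 := \bigcap_(h in [set h | (2 <= h <= H)%N]) (Zc h @^-1` lip_paths (K h)).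

Let range1 h : (2 <= h <= H)%N -> (1 <= h <= H)%N.
Proof. by case/andP => /ltnW -> ->. Qed.

Let mlip h : (2 <= h <= H)%N -> measurable (Zc h @^-1` lip_paths (K h)).
Proof.
move=> h2; apply: cylinder_preimage; last exact: cylinder_lip.
by move=> t bt; apply: mZc => //; exact: range1.
Qed.

Let lip_full h : (2 <= h <= H)%N -> Q (~` (Zc h @^-1` lip_paths (K h))) = 0%E.
Proof.
move=> h2; rewrite probability_setC; last exact: mlip.
have hr := range1 h2.
rewrite (conditioned_full (D := D h) (fun w => CD w hr) (lawZc hr) (cylinder_lip (K h))) ?subee//.
move=> z; rewrite /D /constraint_cyl; case: eqVneq => [h1|_].
  by move: h2; rewrite h1.
by case: ifP => // _ [].
Qed.

Let mS0 : measurable S0.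
Proof. by apply: bigcap_measurable; [by exists 2%N; rewrite /= hH|exact: mlip]. Qed.

Let QS0 : Q (~` S0) = 0%E.
Proof.
rewrite setC_bigcap; apply/eqP; rewrite eq_le measure_ge0 andbT.
have mF h : measurable (if (2 <= h <= H)%N then ~` (Zc h @^-1` lip_paths (K h)) else set0).
  by case: ifP => // h2; apply: measurableC; exact: mlip.
have -> : \bigcup_(h in [set h | (2 <= h <= H)%N]) ~` (Zc h @^-1` lip_paths (K h)) =
    \bigcup_h (if (2 <= h <= H)%N then ~` (Zc h @^-1` lip_paths (K h)) else set0).
  apply/seteqP; split => s [h]; first by move=> /= h2 hs; exists h => //; rewrite h2.
  by move=> _; case: ifP => // h2 hs; exists h.
apply: le_trans (generalized_Boole_inequality Q mF (bigcupT_measurable _ mF)) _.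
rewrite eseries0// => h _ _; case: ifP => h2; last exact: measure0.
exact: lip_full.
Qed.

Lemma lip_S0 s h : S0 s -> (2 <= h <= H)%N -> forall u v, unit_ball u -> unit_ball v ->
  `|Zc h s u - Zc h s v| <= K h * `|u - v|.
Proof.
by move=> hs h2; apply/(lip_pathsP _ (@cZc h s (range1 h2))); exact: hs h h2.
Qed.

(** Independence of the layers multiplies the lower bounds; common constants come from a sum over
    the layers and a common threshold from a maximum. *)
Lemma tube_mass (g : nat -> R -> R) :
  (forall h, (1 <= h <= H)%N -> exists c C : R, exists m0 : nat, [/\ 0 < c, 0 <= C &
    forall m, (0 < m)%N -> (m0 <= m)%N ->
    ((expR (- (c * A m)))%:E <= Q (Zc h @^-1` tube (g h) (C * eps m)))%E]) ->
  exists c C : R, exists m0 : nat, [/\ 0 < c, 0 <= C &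
    forall m, (0 < m)%N -> (m0 <= m)%N -> ((expR (- (c * A m)))%:E <=
      Q (\bigcap_(h in [set h | (1 <= h <= H)%N]) Zc h @^-1` tube (g h) (C * eps m)))%E].
Proof.
move=> hg.
have hg' h : exists cC : R * R * nat, [/\ 0 < cC.1.1, 0 <= cC.1.2 & (1 <= h <= H)%N ->
    forall m, (0 < m)%N -> (cC.2 <= m)%N ->
    ((expR (- (cC.1.1 * A m)))%:E <= Q (Zc h @^-1` tube (g h) (cC.1.2 * eps m)))%E].
  have [hr|_] := boolP (1 <= h <= H)%N; last by exists (1, 0, 0%N).
  by have [c [C [m0 [c0 C0 hc]]]] := hg h hr; exists (c, C, m0).
have [f hf] := choice hg'.
pose c := \sum_(h < H.+1) (f h).1.1; pose C := \sum_(h < H.+1) (f h).1.2.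
pose m0 := \max_(h < H.+1) (f h).2.
have fc h : (h <= H)%N -> (f h).1.1 <= c.
  move=> hl; rewrite /c (bigD1 (Ordinal (hl : h < H.+1)%N))//= lerDl.
  by apply: sumr_ge0 => i _; have [+ _ _] := hf i; exact: ltW.
have fC h : (h <= H)%N -> (f h).1.2 <= C.
  move=> hl; rewrite /C (bigD1 (Ordinal (hl : h < H.+1)%N))//= lerDl.
  by apply: sumr_ge0 => i _; have [] := hf i.
have c0 : 0 < c by apply: lt_le_trans (fc 0%N isT); have [] := hf 0%N.
exists (H%:R * c), C, m0; split.
- by rewrite mulr_gt0// ltr0n; apply: leq_trans hH.
- by apply: le_trans (fC 0%N isT); have [] := hf 0%N.
move=> m mp mm; have e0 := precision_gt0 beta mp.
have A0 : 0 <= A m by apply: le_trans (effort_ge1 hbeta1 mp).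
pose J := seq_fset tt (iota 1 H).
have JE h : (h \in J) = (1 <= h <= H)%N by rewrite seq_fsetE mem_iota add1n ltnS.
have setJ : [set` J] = [set h | (1 <= h <= H)%N].
  by apply/seteqP; split => h /=; rewrite JE.
rewrite -setJ; case: hZc => _ _ indZ _.
rewrite indZ; last 2 first.
- by move=> h /=; rewrite JE.
- move=> h hJ; exists (tube (g h) (C * eps m)); first exact: cylinder_tube.
  by rewrite setTI.
have sJ : size J = H by rewrite size_seq_fset undup_id ?iota_uniq// size_iota.
have -> : expR (- (H%:R * c * A m)) = expR (- (c * A m)) ^+ size J.
  by rewrite sJ -expRM_natl; congr expR; ring.
apply: prode_ge_expr; first exact: expR_ge0.
move=> h; rewrite JE => hr; have hl : (h <= H)%N by case/andP: hr.
have [_ _ hfh] := hf h.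
apply: (@le_trans _ _ (expR (- ((f h).1.1 * A m)))%:E).
  by rewrite lee_fin ler_expR lerN2 ler_wpM2r// fc.
apply: le_trans (hfh hr m mp _) _.
  apply: leq_trans mm; rewrite /m0.
  exact: (leq_bigmax (F := fun h : 'I_H.+1 => (f h).2) (Ordinal (hl : h < H.+1)%N)).
apply: le_measure; rewrite ?inE; try (apply: cylinder_preimage; [|exact: cylinder_tube]).
- by move=> t bt; exact: mZc.
- by move=> t bt; exact: mZc.
by move=> s hs q; apply: le_trans (hs q) _; rewrite ler_wpM2r ?fC// ltW.
Qed.

Local Notation Y s := (compose (Zc ^~ s) H).

Let ballZc h s : (1 <= h < H)%N -> forall t, unit_ball t -> unit_ball (Zc h s t).
Proof. by move=> hr t; case: hZc => _ /(_ h hr) + _ _; apply. Qed.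

Lemma composed_mass (g : nat -> R -> R) :
  (forall h, (1 <= h <= H)%N -> {within unit_ball, continuous g h}) ->
  (forall h, (1 <= h < H)%N -> forall t, unit_ball t -> unit_ball (g h t)) ->
  (forall h, (1 <= h <= H)%N -> exists c C : R, exists m0 : nat, [/\ 0 < c, 0 <= C &
    forall m, (0 < m)%N -> (m0 <= m)%N ->
    ((expR (- (c * A m)))%:E <= Q (Zc h @^-1` tube (g h) (C * eps m)))%E]) ->
  exists c C : R, exists m0 : nat, [/\ 0 < c, 0 <= C &
    forall m, (0 < m)%N -> (m0 <= m)%N -> exists V : set S,
      [/\ measurable V, ((expR (- (c * A m)))%:E <= Q V)%E &
       forall s, V s -> forall t, unit_ball t -> `|Y s t - compose g H t| <= C * eps m]].
Proof.
move=> cg bg /tube_mass[c [C [m0 [c0 C0 hc]]]].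
have L0 : 0 <= compose_lip K H by apply: compose_lip_ge0; exact: K0.
exists c, (compose_lip K H * C), m0; split => //; first exact: mulr_ge0.
move=> m mp mm; have e0 := precision_gt0 beta mp.
pose V := \bigcap_(h in [set h | (1 <= h <= H)%N]) Zc h @^-1` tube (g h) (C * eps m).
have mV : measurable V.
  apply: bigcap_measurable; first by exists 1%N => /=; apply: leq_trans hH.
  move=> h hr; apply: cylinder_preimage; last exact: cylinder_tube.
  by move=> t bt; exact: mZc.
exists (V `&` S0); split; first exact: measurableI.
- have -> : Q (V `&` S0) = Q V; last exact: hc.
  apply/eqP; rewrite eq_le; apply/andP; split.
    by apply: le_measure; rewrite ?inE//; exact: measurableI.
  apply: (@le_trans _ _ (Q (V `&` S0) + Q (~` S0))%E); last by rewrite QS0 adde0.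
  apply: le_trans (measureU2 _ (measurableI _ _ mV mS0) (measurableC mS0)).
  apply: le_measure; rewrite ?inE//.
    by apply: measurableU; [exact: measurableI|exact: measurableC].
  by move=> s Vs; have [S0s|nS0] := pselect (S0 s); [left|right].
move=> s [Vs S0s] t bt; rewrite -mulrA.
apply: compose_stability bt => //.
- by rewrite mulr_ge0// ltW.
- by move=> h hr; exact: ballZc.
- by move=> h hr; exact: lip_S0.
- move=> h hr; have := Vs h hr => /= /(tubeP _ (@cZc h s hr) (@cg h hr)); exact.
Qed.

Lemma composed_sieve (c : R) : 0 < c -> exists c' K' C' : R, [/\ 0 < c', 0 < K', 0 <= C' &
  forall m, (0 < m)%N -> exists (E : set S) (n : nat), [/\ measurable E,
    (Q E <= (K' * expR (- (c * A m)))%:E)%E, n%:R <= K' * expR (c' * A m) &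
    pieces (~` E) n (fun V => measurable V /\ forall s s', V s -> V s' ->
      forall t, unit_ball t -> `|Y s t - Y s' t| <= C' * eps m)]].
Proof.
move=> c0; have [c' [K' [C' [c'0 K'0 C'0 hc]]]] := sieve_all c0 (leqnn H).
have L0 : 0 <= compose_lip K H by apply: compose_lip_ge0; exact: K0.
exists c', K', (compose_lip K H * C'); split => //; first exact: mulr_ge0.
move=> m mp; have [E [n [mE QE nn pE]]] := hc m mp; have e0 := precision_gt0 beta mp.
exists (E `|` ~` S0), n; split => //.
- by apply: measurableU => //; exact: measurableC.
- apply: le_trans (measureU2 _ mE (measurableC mS0)) _.
  rewrite [X in (_ + X)%E](_ : _ = 0%E) ?adde0//; exact: QS0.
- have [F [EF hF]] := pE; exists (fun j => F j `&` S0); split.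
    by rewrite setCU setCK => s [/EF[j jn Fs] S0s]; exists j.
  move=> j jn; have [mF hFj] := hF j jn; split; first exact: measurableI.
  move=> s s' [Fs S0s] [Fs' _] t bt; rewrite -mulrA.
  apply: compose_stability bt => //.
  + by rewrite mulr_ge0// ltW.
  + by move=> h hr; exact: ballZc.
  + by move=> h hr; exact: ballZc.
  + by move=> h hr; exact: lip_S0.
  + by move=> h hr u bu; exact: hFj.
Qed.

End prior.

(** * From the mesh to the sample size *)

Section sample_size.
Context {R : realType}.
Variables (N1 : nat) (beta : R).
Hypotheses (beta_gt0 : 0 < beta) (hbeta1 : beta <= N1%:R + 1 / 2).
Let p : R := 2 * N1%:R + 2.
Let p0 : 0 < p. Proof. by rewrite /p ltr_wpDl// mulr_ge0. Qed.
Let x n : R := n%:R `^ p^-1.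

Definition grid (n : nat) : nat := (Num.truncn (x n)).+1.

(** The value 0 at [n = 0] keeps it below [rate] there as well. *)
Definition sample_precision (n : nat) : R := if n == 0%N then 0 else precision beta (grid n).

Let x_grid n : x n < (grid n)%:R <= x n + 1.
Proof. by apply: truncn_succ_bounds; exact: powR_ge0. Qed.

Let xp n : x n `^ p = n%:R.
Proof. by rewrite /x -powRrM mulVf ?gt_eqF// powRr1. Qed.

Let x1 n : (0 < n)%N -> 1 <= x n.
Proof.
move=> n0; rewrite -[leLHS](powRr0 n%:R) ler_powR ?ler1n// invr_ge0 ltW//.
Qed.

Lemma sample_precision_ge0 n : 0 <= sample_precision n.
Proof. by rewrite /sample_precision; case: eqP => // _; exact: powR_ge0. Qed.

Let m2 n : (grid n)%:R `^ (2 * beta) = precision beta (grid n) ^- 2.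
Proof.
rewrite precisionE// -powR_mulrn ?powR_ge0// -powRrM -powRN; congr (_ `^ _); ring.
Qed.

Let effortE n : effort N1 beta (grid n) = (grid n)%:R `^ p * precision beta (grid n) ^+ 2.
Proof.
rewrite /effort -/p powRD; last by rewrite pnatr_eq0 implybT.
by rewrite powRN m2 invrK.
Qed.

Lemma sample_effort_le n : n%:R * sample_precision n ^+ 2 <= effort N1 beta (grid n).
Proof.
rewrite /sample_precision; case: (eqVneq n 0%N) => [->|n0]; first by rewrite mul0r powR_ge0.
have /andP[h1 _] := x_grid n.
rewrite effortE ler_wpM2r ?sqr_ge0// -xp.
apply: ge0_ler_powR; rewrite ?nnegrE ?powR_ge0 ?ler0n ?(ltW p0)//; exact: ltW.
Qed.

(** Rounding n^(1/p) up at most doubles it, so the effort and n eps^2 agree up to the factor 2^p. *)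
Lemma sample_effort_ge n : (0 < n)%N ->
  effort N1 beta (grid n) <= 2 `^ p * (n%:R * sample_precision n ^+ 2).
Proof.
move=> n0; rewrite /sample_precision (gtn_eqF n0) effortE mulrA ler_wpM2r ?sqr_ge0//.
have /andP[_ h2] := x_grid n; have x1n := x1 n0.
rewrite -(xp n) -powRM ?powR_ge0//.
apply: ge0_ler_powR; rewrite ?nnegrE ?mulr_ge0 ?powR_ge0 ?ler0n ?(ltW p0)//; lra.
Qed.

Lemma sample_precision_le n : sample_precision n <= rate 1 beta N1 n.
Proof.
rewrite /sample_precision /rate mul1r; case: (eqVneq n 0%N) => [->|n0]; first exact: powR_ge0.
have n1 : (0 < n)%N by rewrite lt0n.
rewrite precisionE// -/p (_ : - (beta / p) = p^-1 * - beta); last by rewrite mulrN mulrC.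
rewrite powRrM -/(x n) !powRN lef_pV2 ?posrE ?powR_gt0 ?(lt_le_trans ltr01 (x1 n1)) ?ltr0n//.
have /andP[h1 _] := x_grid n.
by apply: ge0_ler_powR; rewrite ?nnegrE ?powR_ge0 ?ler0n ?(ltW beta_gt0)//; exact: ltW.
Qed.

Lemma grid_large (b : R) : \forall n \near \oo, b <= (grid n)%:R.
Proof.
near=> n; have /andP[h1 _] := x_grid n; apply: le_trans (ltW h1).
have [b0|b0] := leP b 0; first by apply: le_trans b0 (powR_ge0 _ _).
have -> : b = (b `^ p) `^ p^-1 by rewrite -powRrM divff ?gt_eqF// powRr1// ltW.
apply: ge0_ler_powR; rewrite ?nnegrE ?powR_ge0 ?invr_ge0 ?(ltW p0)//.
by near: n; exact: nbhs_infty_ger.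
Unshelve. all: end_near.
Qed.

Lemma sample_precision_small (u : R) : 0 < u -> \forall n \near \oo, sample_precision n <= u.
Proof.
move=> u0; near=> n; rewrite /sample_precision; case: eqP => [_|_]; first exact: ltW.
have h : u `^ (- beta^-1) <= (grid n)%:R by near: n; exact: grid_large.
have [v vE] : exists v, v = u `^ (- beta^-1) by eexists.
have v0 : 0 < v by rewrite vE powR_gt0.
rewrite precisionE// (_ : u = v `^ (- beta)); last first.
  by rewrite vE -powRrM mulrNN mulVf ?gt_eqF// powRr1// ltW.
rewrite !powRN lef_pV2 ?posrE ?powR_gt0 ?ltr0n//.
by apply: ge0_ler_powR; rewrite ?nnegrE ?(ltW v0) ?ler0n ?(ltW beta_gt0)// vE.
Unshelve. all: end_near.
Qed.

Lemma sample_precision_cvg : sample_precision n @[n --> \oo] --> 0.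
Proof.
apply/cvgrPdist_le => u u0; have h := sample_precision_small u0.
near=> n; rewrite sub0r normrN ger0_norm ?sample_precision_ge0//.
by near: n.
Unshelve. all: end_near.
Qed.

Lemma sample_information_cvg : n%:R * sample_precision n ^+ 2 @[n --> \oo] --> +oo.
Proof.
apply/cvgryPge => b; near=> n.
have n0 : (0 < n)%N by near: n; exists 1%N.
have h1 := sample_effort_ge n0.
have h2 : b * 2 `^ p <= (grid n)%:R by near: n; exact: grid_large.
have h3 := effort_ge hbeta1 (ltn0Sn (Num.truncn (x n))); rewrite -/(grid n) in h3.
have q0 : 0 < 2 `^ p :> R by rewrite powR_gt0.
by rewrite -(ler_pM2r q0) [leRHS]mulrC; apply: le_trans h2 (le_trans h3 h1).
Unshelve. all: end_near.
Qed.

Context {du d e : measure_display} {U : measurableType du} {S : measurableType e}.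
Variables (Q : probability S R) (r : S -> U -> R) (Y : S -> R -> R) (y : R -> R) (Cr : R).
Hypothesis Cr0 : 0 <= Cr.
Hypothesis r_near : forall s (eta : R), 0 <= eta <= 1 ->
  (forall t, unit_ball t -> `|Y s t - y t| <= eta) -> forall x, `|r s x - 1| <= Cr * eta.
Hypothesis r_close : forall s s' (eta : R), 0 <= eta <= 1 ->
  (forall t, unit_ball t -> `|Y s t - Y s' t| <= eta) ->
  forall x, `|r s x - r s' x| <= Cr * eta * r s' x.
Local Notation A := (effort N1 beta).
Local Notation eps := (precision beta).
Hypothesis mass : exists c C : R, exists m0 : nat, [/\ 0 < c, 0 <= C &
    forall m, (0 < m)%N -> (m0 <= m)%N -> exists V : set S,
      [/\ measurable V, ((expR (- (c * A m)))%:E <= Q V)%E &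
       forall s, V s -> forall t, unit_ball t -> `|Y s t - y t| <= C * eps m]].
Hypothesis sieve : forall c : R, 0 < c -> exists c' K' C' : R, [/\ 0 < c', 0 < K', 0 <= C' &
  forall m, (0 < m)%N -> exists (E : set S) (n : nat), [/\ measurable E,
    (Q E <= (K' * expR (- (c * A m)))%:E)%E, n%:R <= K' * expR (c' * A m) &
    pieces (~` E) n (fun V => measurable V /\ forall s s', V s -> V s' ->
      forall t, unit_ball t -> `|Y s t - Y s' t| <= C' * eps m)]].

Lemma prior_contraction_sets : exists c1 c2 c3 c4 K' : R,
  [/\ 0 <= c1, 1 <= c2, 0 <= c3, 0 <= K' &
   \forall n \near \oo, contraction_sets Q r c1 c2 c3 c4 K' n (sample_precision n)].
Proof.
have [c [C [m0 [c0 C0 hmass]]]] := mass.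
have q0 : 0 < 2 `^ p :> R by rewrite powR_gt0.
pose c1 := c * 2 `^ p; pose c2 := 1 + Cr * C.
have c10 : 0 < c1 by rewrite mulr_gt0.
(* The mass left out by the sieve has to be negligible against the prior mass and the evidence
   bound, so the sieve is chosen once [c1] and [c2] are known. *)
have c5 : 0 < c1 + 3 * c2 ^+ 2 + 1 by have := sqr_ge0 c2; lra.
have [c' [K' [C' [c'0 K'0 C'0 hsieve]]]] := sieve c5.
exists c1, c2, (c' * 2 `^ p), (Cr * C'), K'; split.
- exact: ltW.
- by rewrite lerDl mulr_ge0.
- by rewrite mulr_ge0// ltW.
- exact: ltW.
near=> n.
have n0 : (0 < n)%N by near: n; exists 1%N.
have m0n : (m0 <= grid n)%N by rewrite -(ler_nat R); near: n; exact: grid_large.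
have e0 := sample_precision_ge0 n.
have h1 : sample_precision n <= (1 + C)^-1.
  by near: n; apply: sample_precision_small; rewrite invr_gt0; lra.
have h2 : sample_precision n <= (1 + C')^-1.
  by near: n; apply: sample_precision_small; rewrite invr_gt0; lra.
have small (b : R) : 0 <= b -> sample_precision n <= (1 + b)^-1 ->
    0 <= b * sample_precision n <= 1.
  move=> b0 hb; rewrite mulr_ge0//=; apply: le_trans (ler_wpM2l b0 hb) _.
  by rewrite ler_pdivrMr; lra.
have pE : eps (grid n) = sample_precision n by rewrite /sample_precision (gtn_eqF n0).
have [V [mV QV hV]] := hmass (grid n) isT m0n.
have [E [J [mE QE nJ [F [EF hF]]]]] := hsieve (grid n) isT.
rewrite pE in hV hF.
have le1 := sample_effort_le n; have le2 := sample_effort_ge n0.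
exists V, E, (fun j => if (j < J)%N then F j else set0), J; split; split => //.
- by move=> j; case: ifP => // jJ; have [] := hF j jJ.
- move=> s /EF[j /= jJ Fs]; 
  by apply: (bigsetU_sup (i := j) (F := fun j => if (j < J)%N then F j else set0)) => //=; rewrite jJ.
- apply: le_trans QV; rewrite lee_fin ler_expR lerN2 /c1 -mulrA ler_wpM2l//; exact: ltW.
- apply: le_trans QE _; rewrite lee_fin ler_wpM2l ?(ltW K'0)// ler_expR lerN2 ler_wpM2l//.
  exact: ltW.
- apply: le_trans nJ _; rewrite ler_wpM2l ?(ltW K'0)// ler_expR -mulrA ler_wpM2l//.
  exact: ltW.
- move=> s z Vs; apply: le_trans (r_near (small C C0 h1) (hV s Vs) z) _.
  by rewrite mulrA ler_wpM2r// lerDr.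
- move=> j s s' z; case: ifP => // jJ Fs Fs'; have [_ hFj] := hF j jJ.
  have := r_close (small C' C'0 h2) (hFj s s' Fs Fs') z.
  by rewrite !mulrA.
Unshelve. all: end_near.
Qed.

End sample_size.

Lemma indic_iff {R : realType} {T T' : Type} (A : set T) (A' : set T') x y :
  (A x <-> A' y) -> \1_A x = \1_A' y :> R.
Proof.
move=> h; rewrite !indicE; congr ((nat_of_bool _)%:R).
by apply/idP/idP => /set_mem/h/mem_set.
Qed.

(** * Integrals determined by weighted laws *)

Section weighted_integral.
Context {R : realType} {dv : measure_display} {V : measurableType dv} (f : V -> R).
Hypotheses (mf : measurable_fun setT f) (f0 : forall x, 0 <= f x).
Local Open Scope ereal_scope.

(* Both sides are double integrals over the region 0 <= t < f (X w). *)
Lemma weighted_layer_cake {d} {T : measurableType d}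
    (mu : {sigma_finite_measure set T -> \bar R}) (X : T -> V) (rho : T -> R) :
  measurable_fun setT X -> measurable_fun setT rho -> (forall w, 0 <= rho w)%R ->
  \int[mu]_w (f (X w) * rho w)%:E =
  \int[lebesgue_measure]_t \int[mu]_(w in X @^-1` [set x | 0 <= t < f x]%R) (rho w)%:E.
Proof.
move=> mX mrho rho0.
pose E : set (T * R) := [set p | 0 <= p.2 < f (X p.1)]%R.
have mfX : measurable_fun setT (fun p : T * R => f (X p.1)).
  exact: (measurableT_comp (measurableT_comp mf mX) measurable_fst).
have mE : measurable E.
  rewrite (_ : E = [set p | 0 <= p.2]%R `&` [set p | 0 < f (X p.1) - p.2]%R); last first.
    by apply/seteqP; split => -[x t] /=; rewrite subr_gt0; [case/andP|case=> h1 h2; apply/andP].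
  apply: measurableI; first by apply: measurable_set_ge; exact: measurable_snd.
  apply: measurable_set_gt; apply: measurable_funB => //; exact: measurable_snd.
have m1 : measurable_fun setT (fun q : T * R => (\1_E q)%:E : \bar R).
  by apply/measurable_EFinP; exact: measurable_indic.
have m2 : measurable_fun setT (fun q : T * R => (\1_E q * rho q.1)%:E : \bar R).
  apply/measurable_EFinP; apply: measurable_funM; first exact: measurable_indic.
  exact: (measurableT_comp mrho measurable_fst).
have fE x : (f (X x))%:E = \int[lebesgue_measure]_t (\1_E (x, t))%:E.
  rewrite (_ : (fun t => _) = fun t => (\1_(`[0%R, f (X x)[%classic : set R) t)%:E); last first.
    by apply/funext => t; congr (_%:E); apply: indic_iff; rewrite /E/= in_itv.
  rewrite integral_indic//; rewrite setIT.
  transitivity (lebesgue_measure (`[0%R, f (X x)[%classic : set R)); last by [].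
  rewrite lebesgue_measure_itv/= lte_fin.
  have := f0 (X x); rewrite le_eqVlt => /predU1P[<-|fx]; first by rewrite ltxx.
  by rewrite fx sube0.
have fE' x : (f (X x) * rho x)%:E = \int[lebesgue_measure]_t (\1_E (x, t) * rho x)%:E.
  under eq_integral do rewrite EFinM.
  rewrite ge0_integralZr ?lee_fin// -?fE ?EFinM//.
  by apply: (measurableT_comp m1); exact: pair1_measurable.
under eq_integral do rewrite fE'.
rewrite (fubini_tonelli (m1 := mu) (m2 := lebesgue_measure) _ m2); last first.
  by move=> q; rewrite lee_fin mulr_ge0.
apply: eq_integral => t _.
rewrite [RHS]integral_mkcond; apply: eq_integral => x _.
by rewrite restrict_EFin patch_indic/= mulrC.
Qed.

(** Serves to compute expectations of functions of the sample from what a model specifies: masses of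
    preimages, with a density as weight. *)
Lemma weighted_integral_eq {d d'} {T : measurableType d} {T' : measurableType d'}
    (mu : {sigma_finite_measure set T -> \bar R}) (mu' : {sigma_finite_measure set T' -> \bar R})
    (X : T -> V) (X' : T' -> V) (rho : T -> R) (rho' : T' -> R) :
  measurable_fun setT X -> measurable_fun setT X' ->
  measurable_fun setT rho -> measurable_fun setT rho' ->
  (forall w, 0 <= rho w)%R -> (forall w, 0 <= rho' w)%R ->
  (forall A, measurable A -> \int[mu]_(w in X @^-1` A) (rho w)%:E =
    \int[mu']_(w in X' @^-1` A) (rho' w)%:E) ->
  \int[mu]_w (f (X w) * rho w)%:E = \int[mu']_w (f (X' w) * rho' w)%:E.
Proof.
move=> mX mX' mr mr' r0 r0' h; rewrite !weighted_layer_cake//.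
apply: eq_integral => t _; apply: h.
rewrite (_ : [set x | _] = [set x | 0 <= t]%R `&` [set x | t < f x]%R); last first.
  by apply/seteqP; split => x /=; [case/andP|case=> h1 h2; apply/andP].
apply: measurableI; last exact: measurable_set_gt.
by have [t0|t0] := boolP (0 <= t)%R; [rewrite (_ : [set _ | _] = setT)//|rewrite (_ : [set _ | _] = set0)//];
  apply/seteqP; split => x //=.
Qed.

End weighted_integral.

(** * Smooth last layers and their derivatives *)

Section jets.
Context {R : realType}.
Implicit Types (f : R -> R) (gam : nat -> R -> R).

Definition jets gam := forall l (x : R), unit_ball x -> is_derive x 1 (gam l) (gam l.+1 x).

Lemma ball_continuous_bound f : {within unit_ball, continuous f} ->
  exists2 A, 0 <= A & forall x, unit_ball x -> `|f x| <= A.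
Proof.
move=> cf; have ab : -1 <= 1 :> R by lra.
have [c _ hc] := EVT_max ab cf; have [c' _ hc'] := EVT_min ab cf.
exists (`|f c| + `|f c'|); first by rewrite addr_ge0.
move=> x bx; have := hc x bx; have := hc' x bx.
have := ler_norm (f c); have := ler_norm (- f c'); rewrite normrN.
by rewrite ler_norml => *; apply/andP; split; have := normr_ge0 (f c);
  have := normr_ge0 (f c'); lra.
Qed.

Lemma hoelder_space_continuous (beta : R) f : hoelder_space beta f ->
  {within unit_ball, continuous f}.
Proof.
move=> [[|k] [kb _ df hf]]; last by apply: has_deriv_continuous; exact: (df 0%N).
have [L hL] := hf; rewrite subr0 /= in hL; rewrite mulr0n in kb.
apply/subspace_continuousP => t bt; apply/cvgrPdist_le => eps e0.
have L0 : 0 < `|L| + 1 by rewrite ltr_wpDl.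
have q0 : 0 < (eps / (`|L| + 1)) `^ beta^-1 by apply: powR_gt0; exact: divr_gt0.
exists ((eps / (`|L| + 1)) `^ beta^-1) => //= s /= st bs.
apply: le_trans (hL t s bt bs) _.
apply: (@le_trans _ _ ((`|L| + 1) * `|t - s| `^ beta)).
  by rewrite ler_wpM2r ?powR_ge0//; have := ler_norm L; lra.
rewrite mulrC -ler_pdivlMr//.
have -> : eps / (`|L| + 1) = ((eps / (`|L| + 1)) `^ beta^-1) `^ beta.
  by rewrite -powRrM mulVf ?gt_eqF// powRr1//; apply: divr_ge0; exact: ltW.
by apply: ge0_ler_powR; rewrite ?nnegrE ?powR_ge0//; apply: ltW.
Qed.

Lemma jets_continuous gam l : jets gam -> {within unit_ball, continuous gam l}.
Proof. by move=> hg; apply: derivable_within_continuous => x /(hg l)[]. Qed.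

Lemma jets_bounded gam n : jets gam ->
  exists2 A, 0 <= A & forall l x, (l <= n)%N -> unit_ball x -> `|gam l x| <= A.
Proof.
move=> hg; elim: n => [|n [A A0 hA]].
  have [A A0 hA] := ball_continuous_bound (@jets_continuous _ 0%N hg).
  by exists A => // l x; rewrite leqn0 => /eqP ->; exact: hA.
have [A' A'0 hA'] := ball_continuous_bound (@jets_continuous _ n.+1 hg).
exists (A + A') => [|l x]; first exact: addr_ge0.
rewrite leq_eqVlt => /predU1P[->|ln] bx; first by have := hA' x bx; lra.
by have := hA l x ln bx; lra.
Qed.

Definition affine_jet (a b : R) l x : R :=
  if l == 0%N then a * x + b else if l == 1%N then a else 0.

Lemma affine_jets a b : jets (affine_jet a b).
Proof.
move=> [|[|l]] x _ /=; rewrite /affine_jet/=; try exact: deriv_cst.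
by have := deriv_add (deriv_scale a (deriv_id x)) (deriv_cst b x); rewrite mulr1 addr0.
Qed.

(** Successive derivatives of x -> ln (v + mu x), the last layer in the case of densities. *)
Definition log_jet (v mu : R) l x : R :=
  if l is k.+1 then (-1) ^+ k * k`!%:R * mu ^+ k.+1 / (v + mu * x) ^+ k.+1 else ln (v + mu * x).

Lemma log_jets v mu : 0 <= mu < v -> jets (log_jet v mu).
Proof.
move=> /andP[mu0 muv] l x; rewrite unit_ballE => bx.
have u0 : 0 < v + mu * x by nra.
have du : is_derive x 1 (fun y : R => v + mu * y) mu.
  by have := deriv_add (deriv_cst v x) (deriv_scale mu (deriv_id x)); rewrite mulr1 add0r.
case: l => [|k] /=.
  have -> : (-1) ^+ 0 * 0`!%:R * mu ^+ 1 / (v + mu * x) ^+ 1 = (v + mu * x)^-1 * mu.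
    by rewrite expr0 fact0 !mul1r !expr1 mulrC.
  by apply: deriv_compose du; exact: is_derive1_ln.
pose c := (-1) ^+ k * k`!%:R * mu ^+ k.+1.
have dp : is_derive x 1 (fun y : R => (v + mu * y) ^+ k.+1) (k.+1%:R * (v + mu * x) ^+ k * mu).
  by apply: (deriv_compose (f := fun y => y ^+ k.+1)) du; exact: deriv_pow.
have dV : is_derive x 1 (fun y : R => ((v + mu * y) ^+ k.+1)^-1)
    (- ((v + mu * x) ^+ k.+1) ^- 2 *: (k.+1%:R * (v + mu * x) ^+ k * mu)).
  by apply: is_deriveV => //; rewrite expf_neq0// gt_eqF.
have := deriv_scale c dV; congr is_derive.
rewrite /c/= factS natrM [(-1) ^+ k.+1]exprS [mu ^+ k.+2]exprS.
have -> : (v + mu * x) ^+ k.+2 = (v + mu * x) ^+ k.+1 * (v + mu * x) by rewrite exprSr.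
have -> : (v + mu * x) ^+ k.+1 = (v + mu * x) ^+ k * (v + mu * x) by rewrite exprSr.
have uk : (v + mu * x) ^+ k != 0 by rewrite expf_neq0// gt_eqF.
have -> (a b : R) : a *: b = a * b by [].
move: uk u0; move: ((v + mu * x) ^+ k) (v + mu * x) (mu ^+ k.+1) ((-1) ^+ k) => q u w s q0 u0.
by field; rewrite gt_eqF.
Qed.

End jets.

(** * The truth as a composition of layers *)

Section target.
Context {R : realType}.
Variables (H : nat) (N : nat -> nat).
Hypotheses (hH : (2 <= H)%N) (hN : forall h, (2 <= h <= H)%N -> (1 <= N h)%N).
Context {d : measure_display} {T : measurableType d}.
Variables (P : probability T R) (B : nat -> T -> R -> R) (G : nat -> nat -> T -> R).
Hypothesis hZ : ibm_family P H N B G.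
Variable beta : R.
Hypotheses (beta_gt0 : 0 < beta) (hbeta1 : beta <= (N 1%N)%:R + 1 / 2).
Hypothesis hbeta : forall h, (2 <= h <= H)%N -> beta <= (N h)%:R.
Variables (kappa al b A0 : R) (f : R -> R) (gam : nat -> R -> R).
Hypotheses (kappa01 : 0 < kappa < 1) (hf : hoelder_space beta f).
Hypothesis f_kappa : forall t, unit_ball t -> `|al * f t + b| <= kappa.
Hypotheses (hgam : jets gam) (A00 : 0 <= A0).
Hypothesis gamA : forall l x, (l <= (N H).+1)%N -> unit_ball x -> `|gam l x| <= A0.
Variable K : nat -> R.
Hypothesis hK : forall h, (2 <= h <= H)%N -> A0 + 1 <= K h.
Context {e : measure_display} {S : measurableType e}.
Variables (Q : probability S R) (Zc : nat -> S -> R -> R).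
Hypothesis hZc : constrained_family H K P (ibm N B G) Q Zc.
Local Notation A := (effort (N 1%N) beta).
Local Notation eps := (precision beta).

Definition layers h : R -> R :=
  if h == 1%N then fun t => al * f t + b else if (h < H)%N then affine_jet kappa 0 0 else gam 0%N.

Let K_ge0 h : (2 <= h <= H)%N -> 0 <= K h.
Proof. by move=> /hK; have := A00; lra. Qed.

Lemma precision_small (u : R) : 0 < u -> exists m0 : nat, forall m, (0 < m)%N -> (m0 <= m)%N ->
  eps m <= u.
Proof.
move=> u0; have [v vE] : exists v, v = u `^ (- beta^-1) by eexists.
have v0 : 0 < v by rewrite vE powR_gt0.
exists (Num.truncn v).+1 => m mp mm; rewrite precisionE//.
rewrite (_ : u = v `^ (- beta)); last first.
  by rewrite vE -powRrM mulrNN mulVf ?gt_eqF// powRr1// ltW.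
rewrite !powRN lef_pV2 ?posrE ?powR_gt0 ?ltr0n//.
apply: ge0_ler_powR; rewrite ?nnegrE ?(ltW v0) ?ler0n ?(ltW beta_gt0)//.
have /andP[v1 _] := truncn_succ_bounds (ltW v0).
by apply: le_trans (ltW v1) _; rewrite ler_nat.
Qed.

(** A smooth target is its own approximation at every scale: the Lipschitz constant does not depend
    on [m] and the approximation error is 0. *)
Lemma smooth_layer_mass h (g : nat -> R -> R) A1 : (2 <= h <= H)%N -> jets g -> 0 <= A1 ->
  (forall l x, (l <= (N h).+1)%N -> unit_ball x -> `|g l x| <= A1) ->
  A1 + (1 - kappa) <= K h ->
  ((h < H)%N -> forall x, unit_ball x -> `|g 0%N x| <= kappa) ->
  exists c C : R, exists m0 : nat, [/\ 0 < c, 0 <= C &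
    forall m, (0 < m)%N -> (m0 <= m)%N ->
    ((expR (- (c * A m)))%:E <= Q (Zc h @^-1` tube (g 0%N) (C * eps m)))%E].
Proof.
move=> /andP[h2 hh] hg A10 hA1 hKh hkap.
have hr : (1 <= h <= H)%N by rewrite hh (leq_trans _ h2).
have rho0 : 0 < 1 - kappa by have := kappa01; lra.
have [] := @small_ball_mass R H N hH hN d T P B G hZ beta beta_gt0 hbeta1 hbeta K e S Q Zc hZc
  h (g 0%N) A1 (A1 ^+ 2) (1 - kappa) 0 0%N hr (@jets_continuous _ _ 0%N hg) rho0 (sqr_ge0 _) (lexx 0).
  move=> m mp _; exists A1, (fun l t => g l (t - 1)).
  have shift (t : R) : 0 <= t <= 2 -> unit_ball (t - 1) by rewrite unit_ballE; lra.
  have dg l (t : R) : 0 <= t <= 2 -> is_derive t 1 (fun y => g l (y - 1)) (g l.+1 (t - 1)).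
    move=> /shift bt; rewrite -[g l.+1 _]mulr1; apply: (deriv_compose (f := g l)); first exact: hg.
    by have := deriv_sub (deriv_id t) (deriv_cst 1 t); rewrite subr0.
  split.
  - by move=> l _ t t2; apply: dg; lra.
  - by move=> l _; apply: derivable_within_continuous => t; rewrite in_itv/= => /(dg l)[].
  - by move=> l lN; apply: hA1; [exact: leqW|apply: shift; lra].
  - split => //; first by rewrite ler_peMr ?sqr_ge0// (effort_ge1 hbeta1).
    move=> s t s2 t2; have -> : t - s = (t - 1) - (s - 1) by ring.
    apply: ball_MVT_bound (shift _ s2) (shift _ t2) (@jets_continuous _ _ _ hg) _ _.
      by move=> x x1; apply: hg; rewrite unit_ballE; lra.
    move=> x hx; apply: hA1 => //; rewrite unit_ballE; move: hx.
    by rewrite ge_min le_max => /andP[/orP[] ? /orP[] ?]; lra.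
  - split.
    + by move=> hlt t t2; rewrite opprB addrCA subrr addr0; apply: hkap => //; exact: shift.
    + move=> _ t t2; have := hA1 1%N (t - 1) isT (shift t t2); have := hKh; lra.
    + by move=> t bt; rewrite addrK subrr normr0 mul0r.
move=> c c0 hc; exists c, (0 + (1 - kappa)), 0%N; split => //.
by rewrite add0r ltW.
Qed.

Lemma first_layer_mass : exists c C : R, exists m0 : nat, [/\ 0 < c, 0 <= C &
    forall m, (0 < m)%N -> (m0 <= m)%N ->
    ((expR (- (c * A m)))%:E <= Q (Zc 1%N @^-1` tube (fun t : R => al * f t + b)%R (C * eps m)))%E].
Proof.
have /andP[k0 k1] := kappa01.
have [C C0 hC] := hoelder_smoothing hbeta1 hf.
pose C1 := `|al| * C; have C10 : 0 <= C1 by rewrite mulr_ge0// ltW.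
(* The margin 1 - kappa is shared equally between the smoothing error and the steering error. *)
have [rho [rho0 rhoE]] : exists rho : R, 0 < rho /\ rho = (1 - kappa) / 2.
  by exists ((1 - kappa) / 2); split => //; rewrite divr_gt0// subr_gt0.
have [m0 hm0] : exists m0 : nat, forall m, (0 < m)%N -> (m0 <= m)%N -> C1 * eps m <= rho.
  have [|m0 h0] := @precision_small (rho / (C1 + 1)); first by rewrite divr_gt0// ltr_wpDl.
  exists m0 => m mp mm; have := h0 m mp mm; rewrite ler_pdivlMr ?ltr_wpDl// => h1.
  have := precision_gt0 beta mp; lra.
have hr : (1 <= 1 <= H)%N by rewrite (leq_trans _ hH).
have cg : {within unit_ball, continuous (fun t => al * f t + b)}.
  move=> t; apply: cvgD; last exact: cvg_cst.
  by apply: cvgMr; exact: (hoelder_space_continuous hf).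
have [] := @small_ball_mass R H N hH hN d T P B G hZ beta beta_gt0 hbeta1 hbeta K e S Q Zc hZc
  1%N (fun t : R => al * f t + b) (C1 + `|b|) (C1 ^+ 2) rho C1 m0 hr cg rho0 (sqr_ge0 _) C10.
  move=> m mp mm; have [a [da aN a0 am1]] := hC m mp.
  have e0 := precision_gt0 beta mp.
  pose g l x := if l == 0%N then al * a 0%N x + b else al * a l x.
  have dg l (x : R) : (l <= N 1)%N -> is_derive x 1 (g l) (g l.+1 x).
    move=> lN; have ha := deriv_scale al (da l x lN).
    case: l lN ha => [|l] lN ha; rewrite /g//=.
    by rewrite -[al * a _ _]addr0; apply: deriv_add => //; exact: deriv_cst.
  have dgs l (t : R) : (l <= N 1)%N -> is_derive t 1 (fun y => g l (y - 1)) (g l.+1 (t - 1)).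
    move=> lN; rewrite -[g l.+1 _]mulr1; apply: (deriv_compose (f := g l)); first exact: dg.
    by have := deriv_sub (deriv_id t) (deriv_cst 1 t); rewrite subr0.
  have close x : unit_ball x -> `|g 0%N x - (al * f x + b)| <= C1 * eps m.
    move=> bx; rewrite /g/= (_ : _ - _ = al * (a 0%N x - f x)); last by ring.
    by rewrite normrM /C1 -mulrA ler_wpM2l// a0.
  have shift (t : R) : 0 <= t <= 2 -> unit_ball (t - 1) by rewrite unit_ballE; lra.
  exists (C1 * (eps m / m%:R^-1 ^+ (N 1%N).+1)), (fun l t => g l (t - 1)); split.
  - by move=> l lN t _; apply: dgs; exact: ltnW.
  - by move=> l lN; apply: derivable_within_continuous => t _; have [] := dgs l t lN.
  - move=> l lN; rewrite sub0r /g; case: ifP => [/eqP l0|_].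
      by apply: le_trans (ler_normD _ _) _; rewrite lerD2r normrM ler_wpM2l// am1.
    by rewrite normrM; apply: le_trans (ler_wpM2l _ (am1 l lN)) _; rewrite ?lerDl.
  - split.
    + by apply: mulr_ge0 => //; apply: divr_ge0; [exact: ltW|rewrite exprn_ge0// invr_ge0].
    + by rewrite exprMn (smoothing_scale (N 1%N) beta mp).
    move=> s t s2 t2; have -> : t - s = (t - 1) - (s - 1) by ring.
    apply: ball_MVT_bound (shift _ s2) (shift _ t2) _ _ _.
    + by apply: derivable_within_continuous => x _; have [] := dg (N 1%N) x (leqnn _).
    + by move=> x _; exact: dg.
    move=> x hx; rewrite /g/= normrM /C1 -mulrA ler_wpM2l//; apply: aN.
    have := s2; have := t2; rewrite unit_ballE; move: hx.
    by rewrite ge_min le_max => /andP[/orP[] ? /orP[] ?]; lra.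
  - split.
    + move=> _ t t2; have bt := shift t t2; have := close _ bt; have := f_kappa bt.
      have := hm0 m mp mm; move: (g _ _) (al * _ + b) => u w h1 h2 h3.
      by rewrite -[u](subrK w); apply: le_trans (ler_normD _ _) _; lra.
    + by [].
    + by move=> t bt; rewrite addrK; exact: close.
move=> c c0 hc; exists c, (C1 + rho), m0; split => //.
by apply: addr_ge0 => //; exact: ltW.
Qed.

Lemma layers_ball h : (1 <= h < H)%N -> forall t, unit_ball t -> unit_ball (layers h t).
Proof.
have /andP[k0 k1] := kappa01.
move=> /andP[h1 hlt] t bt; rewrite /layers; case: ifP => [_|_].
  by have := f_kappa bt; rewrite unit_ballE ler_norml; lra.
by rewrite hlt /affine_jet/= addr0; move: bt; rewrite !unit_ballE => /andP[t1 t2]; apply/andP; split; nra.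
Qed.

Lemma layers_continuous h : (1 <= h <= H)%N -> {within unit_ball, continuous layers h}.
Proof.
move=> hr; rewrite /layers; case: ifP => _.
  move=> t; apply: cvgD; last exact: cvg_cst.
  by apply: cvgMr; exact: (hoelder_space_continuous hf).
by case: ifP => _; apply: jets_continuous => //; exact: affine_jets.
Qed.

Lemma layers_mass h : (1 <= h <= H)%N -> exists c C : R, exists m0 : nat, [/\ 0 < c, 0 <= C &
    forall m, (0 < m)%N -> (m0 <= m)%N ->
    ((expR (- (c * A m)))%:E <= Q (Zc h @^-1` tube (layers h) (C * eps m)))%E].
Proof.
have /andP[k0 k1] := kappa01.
move=> /andP[h1 hh]; rewrite /layers; case: eqP => [->|/eqP hn1]; first exact: first_layer_mass.
have hr : (2 <= h <= H)%N by rewrite hh andbT ltn_neqAle eq_sym hn1.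
have aff x : unit_ball x -> `|kappa * x + 0| <= kappa.
  by rewrite addr0 unit_ballE normrM gtr0_norm// => bx; rewrite ler_piMr ?(ltW k0)// ler_norml; lra.
case: ifP => [hlt|/negbT]; last first.
  rewrite -leqNgt => Hh; have hE : h = H by apply/eqP; rewrite eqn_leq hh.
  rewrite hE; apply: (@smooth_layer_mass H gam A0) => //; first by rewrite hH leqnn.
    by have := @hK H; rewrite hH leqnn => /(_ isT); lra.
  by rewrite ltnn.
apply: (@smooth_layer_mass h (affine_jet kappa 0) kappa) => //.
- exact: affine_jets.
- exact: ltW.
- move=> l x _ bx; rewrite /affine_jet; case: ifP => _; first exact: aff.
  by case: ifP => _; rewrite ?normr0 ?gtr0_norm// ltW.
- by have := hK hr; have := A00; lra.
Qed.

Lemma compose_layers t : unit_ball t ->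
  compose layers H t = gam 0%N (kappa ^+ (H - 2) * (al * f t + b)).
Proof.
move=> bt; have mid n : (n.+1 < H)%N ->
    compose layers n.+1 t = kappa ^+ n * (al * f t + b).
  elim: n => [|n ih] nH; first by rewrite /= /layers/= expr0 mul1r.
  transitivity (layers n.+2 (compose layers n.+1 t)) => //.
  by rewrite ih 1?ltnW// /layers/= nH /affine_jet/= addr0 exprS mulrA.
have [k kE] : exists k, H = k.+2 by case: H hH => [//|[//|k]]; exists k.
rewrite {1}kE (_ : compose layers k.+2 t = layers k.+2 (compose layers k.+1 t))//.
rewrite mid ?kE// /layers /= -kE ltnn.
by rewrite kE /= subn2.
Qed.

Lemma target_mass : exists c C : R, exists m0 : nat, [/\ 0 < c, 0 <= C &
    forall m, (0 < m)%N -> (m0 <= m)%N -> exists V : set S,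
      [/\ measurable V, ((expR (- (c * A m)))%:E <= Q V)%E &
       forall s, V s -> forall t, unit_ball t ->
         `|compose (Zc ^~ s) H t - gam 0%N (kappa ^+ (H - 2) * (al * f t + b))| <= C * eps m]].
Proof.
have [c [C [m0 [c0 C0 h]]]] := composed_mass hH hN hZ hbeta1 K_ge0 hZc
  (fun h hr => @layers_continuous h hr) layers_ball layers_mass.
exists c, C, m0; split => // m mp mm; have [V [mV QV hV]] := h m mp mm.
by exists V; split => // s Vs t bt; rewrite -compose_layers//; exact: hV.
Qed.

Context {d' du : measure_display} {T' : measurableType d'} {U : measurableType du}.
Variables (P' : probability T' R) (X : nat -> T' -> U).
Hypothesis mX : forall k, measurable_fun setT (X k).
Hypothesis indX : independent P' setT (fun k => sigma_of (X k)).
Hypothesis lawX : forall k A, measurable A -> P' (X k @^-1` A) = P' (X 0%N @^-1` A).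
Variables (r : S -> U -> R) (Cr : R).
Hypothesis mr : measurable_fun setT (fun p : S * U => r p.1 p.2).
Hypothesis r_gt0 : forall s x, 0 < r s x.
Hypothesis r_density : forall s, (\int[P']_w (r s (X 0%N w))%:E = 1)%E.
Local Notation Y s := (compose (Zc ^~ s) H).
Hypothesis Cr0 : 0 <= Cr.
Hypothesis r_near : forall s (eta : R), 0 <= eta <= 1 ->
  (forall t, unit_ball t -> `|Y s t - gam 0%N (kappa ^+ (H - 2) * (al * f t + b))| <= eta) ->
  forall x, `|r s x - 1| <= Cr * eta.
Hypothesis r_close : forall s s' (eta : R), 0 <= eta <= 1 ->
  (forall t, unit_ball t -> `|Y s t - Y s' t| <= eta) ->
  forall x, `|r s x - r s' x| <= Cr * eta * r s' x.

Lemma target_contraction (M : nat -> R) (Bad : nat -> set S) : M n @[n --> \oo] --> +oo ->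
  (forall n, measurable (Bad n)) ->
  (forall n s, Bad n s -> 0 <= M n -> (M n * rate 1 beta (N 1%N) n) ^+ 2 <= hell2 P' X r s) ->
  cvg_in_probability P' (fun n w => posterior Q (fun s => lik_prod X r n s w) (Bad n)) 0.
Proof.
move=> Moo mBad hBad.
have sieve c (c0 : 0 < c) := composed_sieve hH hN hZ hbeta1 hbeta K_ge0 hZc c0.
have [c1 [c2 [c3 [c4 [K' [c10 c21 c30 K'0 hc]]]]]] :=
  prior_contraction_sets beta_gt0 Cr0 r_near r_close target_mass sieve.
apply: (posterior_contraction mX indX lawX mr r_gt0 r_density
  (eps := sample_precision (N 1%N) beta) (M := M) (c4 := c4) c10 c21 c30 K'0) => //.
- exact: sample_precision_cvg.
- by move=> n; exact: sample_precision_ge0.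
- exact: sample_information_cvg.
- move=> n s Bs Mn; apply: le_trans (hBad n s Bs Mn).
  have e0 := sample_precision_ge0 (N 1%N) beta n.
  have el := sample_precision_le (N 1%N) beta_gt0 n.
  by rewrite ler_sqr ?nnegrE; [rewrite ler_wpM2l| |]; rewrite ?mulr_ge0// (le_trans e0).
Qed.

End target.

(** * Measurability of compositions *)

Section path_measurability.
Context {R : realType} {e : measure_display} {S : measurableType e}.
Variables (H : nat) (Zc : nat -> S -> R -> R).
Hypothesis mZ : forall h, (1 <= h <= H)%N -> forall t, unit_ball t -> measurable_fun setT (Zc h ^~ t).
Hypothesis cZ : forall h, (1 <= h <= H)%N -> forall s, {within unit_ball, continuous (Zc h s)}.
Hypothesis bZ : forall h, (1 <= h < H)%N -> forall s t, unit_ball t -> unit_ball (Zc h s t).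

Lemma clamp_ball (t : R) : unit_ball (clamp (-1) 1 t).
Proof. by apply: clamp_itv; lra. Qed.

Lemma clamp_ball_id (t : R) : unit_ball t -> clamp (-1) 1 t = t.
Proof. by rewrite unit_ballE; exact: clamp_id. Qed.

(** The clamp makes each path continuous on the whole line, as joint measurability requires, and it
    is the identity at the values of the inner layers. *)
Lemma measurable_compose n : (n <= H)%N ->
  measurable_fun setT (fun p : S * R => compose (Zc ^~ p.1) n (clamp (-1) 1 p.2)).
Proof.
elim: n => [_|n ih nH].
  apply: (measurableT_comp (f := clamp (-1) 1)); last exact: measurable_snd.
  by apply: continuous_measurable_fun; exact: continuous_clamp.
have hn : (1 <= n.+1 <= H)%N by rewrite nH.
have m1 : measurable_fun setT (fun p : S * R => Zc n.+1 p.1 (clamp (-1) 1 p.2)).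
  apply: (@measurable_caratheodory_fun R _ S (fun s x => Zc n.+1 s (clamp (-1) 1 x))) => [t|s].
    by apply: mZ => //; exact: clamp_ball.
  by apply: continuous_clamp_comp; [lra|exact: cZ].
have m2 : measurable_fun setT (fun p : S * R => (p.1, compose (Zc ^~ p.1) n (clamp (-1) 1 p.2))).
  by apply: measurable_fun_pair; [exact: measurable_fst|apply: ih; exact: ltnW].
have := measurableT_comp m1 m2; congr measurable_fun; apply/funext => -[s t] /=.
rewrite clamp_ball_id//; apply: compose_ball (clamp_ball t) => h /andP[h1 hn'] u.
by apply: bZ; rewrite h1 (leq_ltn_trans hn').
Qed.

Lemma compose_clamp_continuous n s : (n <= H)%N ->
  continuous (fun t : R => compose (Zc ^~ s) n (clamp (-1) 1 t)).
Proof.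
elim: n => [_|n ih nH]; first exact: continuous_clamp.
have hn : (1 <= n.+1 <= H)%N by rewrite nH.
apply: (continuous_within_comp (@cZ n.+1 hn s) (ih (ltnW nH))) => t.
apply: compose_ball (clamp_ball t) => h /andP[h1 hn'] u.
by apply: bZ; rewrite h1 (leq_ltn_trans hn').
Qed.

End path_measurability.

(** * Density estimation *)


Section ratio.
Context {R : realType}.

Lemma exp_ratio_bound (a b x : R) : 0 < b -> 0 <= x ->
  a <= expR x * b -> b <= expR x * a -> `|a - b| <= x * expR x * b.
Proof.
move=> b0 x0 h1 h2.
have e1 := expR_ge1Dx (- x); have e2 := expR_ge1Dx x.
have eN : expR x * expR (- x) = 1 by rewrite expRN divff// gt_eqF// expR_gt0.
have E0 := expR_gt0 x; move: (expR x) (expR (- x)) e1 e2 eN E0 h1 h2 => u v e1 e2 uv u0 h1 h2.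
have uu : u - 1 <= x * u by nra.
have a0 : 0 < a by nra.
by rewrite ler_norml; apply/andP; split; nra.
Qed.

(** The factor stands for the likelihood of the truth, which depends on the sample alone and cancels
    in Bayes' rule. *)
Lemma posteriorZ {d : measure_display} {S : measurableType d} (Q : probability S R)
    (L : S -> R) (c : R) (A : set S) : 0 < c -> measurable A -> measurable_fun setT L ->
  (forall s, 0 <= L s) -> posterior Q (fun s => c * L s) A = posterior Q L A.
Proof.
move=> c0 mA mL L0.
have h B : measurable B -> \int[Q]_(s in B) (c * L s) = c * \int[Q]_(s in B) L s.
  move=> mB; rewrite /Rintegral.
  have -> : (\int[Q]_(s in B) (c * L s)%:E = c%:E * \int[Q]_(s in B) (L s)%:E)%E.
    rewrite -ge0_integralZl ?lee_fin ?(ltW c0)//; last by move=> s _; rewrite lee_fin.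
    by apply/measurable_EFinP; exact: measurable_funTS.
  have : (0 <= \int[Q]_(s in B) (L s)%:E)%E by apply: integral_ge0 => s _; rewrite lee_fin.
  (* An infinite integral is read as 0 on both sides. *)
  case: (integral _ _ _) => [x _ //|_|//].
  by rewrite gt0_muley ?lte_fin//= mulr0.
rewrite /posterior !h// invfM mulrACA divff ?mul1r//; exact: lt0r_neq0.
Qed.

Lemma sqrt_diff (p q : R) : 0 < q -> 0 <= p ->
  (Num.sqrt (p / q) - 1) ^+ 2 * q = (Num.sqrt p - Num.sqrt q) ^+ 2.
Proof.
move=> q0 p0; have -> : Num.sqrt p - Num.sqrt q = (Num.sqrt (p / q) - 1) * Num.sqrt q.
  by rewrite mulrBl mul1r -sqrtrM ?divr_ge0 ?(ltW q0)// divfK// gt_eqF.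
by rewrite exprMn sqr_sqrtr// ltW.
Qed.

End ratio.

(** * Stability of exponential densities *)

Section exp_density.
Context {R : realType}.
Implicit Types z : R -> R.
Local Notation mass z := (\int[lebesgue_measure]_(s in unit_ball) expR (z s)).

Lemma measurable_unit_ball : measurable (@unit_ball R).
Proof. exact: measurable_itv. Qed.

Lemma ball_integrable (f : R -> R) : {within unit_ball, continuous f} ->
  lebesgue_measure.-integrable unit_ball (EFin \o f).
Proof. by move=> cf; apply: continuous_compact_integrable => //; exact: segment_compact. Qed.

Lemma within_continuous_post (A : set R) (f g : R -> R) : {within A, continuous f} ->
  (forall t, A t -> {for f t, continuous g}) -> {within A, continuous (fun t => g (f t))}.
Proof.
move=> /subspace_continuousP cf cg; apply/subspace_continuousP => t At.
apply: (@cvg_comp _ _ _ f g (within A (nbhs t)) (nbhs (f t))); first exact: cf.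
exact: cg.
Qed.

Lemma expR_within z : {within unit_ball, continuous z} ->
  {within unit_ball, continuous (fun t => expR (z t))}.
Proof. by move=> cz; apply: within_continuous_post cz _ => t _; exact: continuous_expR. Qed.

Lemma exp_mass_gt0 z : {within unit_ball, continuous z} -> 0 < mass z.
Proof.
move=> cz; have [A A0 hA] := ball_continuous_bound cz.
have iA : lebesgue_measure.-integrable unit_ball (EFin \o (fun _ : R => expR (- A))).
  by apply: ball_integrable => t; exact: cvg_cst.
apply: (@lt_le_trans _ _ (\int[lebesgue_measure]_(s in unit_ball) expR (- A))); last first.
  apply: le_Rintegral => //; first exact: measurable_unit_ball.
    by apply: ball_integrable; exact: expR_within.
  by move=> t bt; rewrite ler_expR; have := hA t bt; rewrite ler_norml => /andP[].
rewrite Rintegral_cst//; last exact: measurable_unit_ball.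
have e2 : fine (lebesgue_measure (`[-1, 1]%classic : set R)) = 2.
  rewrite lebesgue_measure_itv/= lte_fin -EFinB ifT; last by lra.
  by rewrite /=; ring.
have : 0 < expR (- A) * fine (lebesgue_measure (`[-1, 1]%classic : set R)).
  by rewrite e2 mulr_gt0// expR_gt0.
exact.
Qed.

Lemma exp_mass_le z z' eta : {within unit_ball, continuous z} ->
  {within unit_ball, continuous z'} ->
  (forall t, unit_ball t -> `|z t - z' t| <= eta) -> mass z <= expR eta * mass z'.
Proof.
move=> cz cz' h; have i1 := ball_integrable (expR_within cz).
have i2 := ball_integrable (expR_within cz').
rewrite -RintegralZl//; last exact: measurable_unit_ball.
apply: le_Rintegral => //; first exact: measurable_unit_ball.
  by apply: ball_integrable => t; apply: cvgMr; exact: expR_within.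
move=> t bt; rewrite -expRD ler_expR; have := h t bt; rewrite ler_norml; lra.
Qed.

(** One [eta] comes from the exponential and the other from the normalising integral. *)
Lemma exp_density_le z z' eta t : {within unit_ball, continuous z} ->
  {within unit_ball, continuous z'} -> unit_ball t ->
  (forall t, unit_ball t -> `|z t - z' t| <= eta) ->
  exp_density z t <= expR (2 * eta) * exp_density z' t.
Proof.
move=> cz cz' bt h.
have h' u : unit_ball u -> `|z' u - z u| <= eta by move=> bu; rewrite distrC h.
have m0 := exp_mass_gt0 cz; have m0' := exp_mass_gt0 cz'.
have hm := exp_mass_le cz' cz h'.
have ez : expR (z t) <= expR eta * expR (z' t).
  by rewrite -expRD ler_expR; have := h t bt; rewrite ler_norml; lra.
rewrite /exp_density mulrA ler_pdivrMr// mulrAC ler_pdivlMr//.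
have -> : expR (2 * eta) = expR eta * expR eta by rewrite -expRD; congr expR; lra.
have E0 := expR_gt0 eta; have z0 := expR_gt0 (z' t); have z1 := expR_gt0 (z t).
apply: le_trans (ler_wpM2l (ltW z1) hm) _.
by rewrite mulrCA -!mulrA ler_wpM2l ?(ltW E0)// !mulrA ler_wpM2r ?(ltW m0).
Qed.

Lemma exp_density_gt0 z t : {within unit_ball, continuous z} -> 0 < exp_density z t.
Proof. by move=> cz; rewrite divr_gt0 ?expR_gt0 ?exp_mass_gt0. Qed.

Lemma exp_density_close z z' eta t : 0 <= eta <= 1 -> {within unit_ball, continuous z} ->
  {within unit_ball, continuous z'} -> unit_ball t ->
  (forall t, unit_ball t -> `|z t - z' t| <= eta) ->
  `|exp_density z t - exp_density z' t| <= 2 * expR 2 * eta * exp_density z' t.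
Proof.
move=> /andP[e0 e1] cz cz' bt h.
have h' u : unit_ball u -> `|z' u - z u| <= eta by move=> bu; rewrite distrC h.
have p0 := exp_density_gt0 t cz'.
have := exp_ratio_bound p0 (_ : 0 <= 2 * eta) (exp_density_le cz cz' bt h) (exp_density_le cz' cz bt h').
rewrite mulr_ge0// => /(_ isT)/le_trans; apply.
rewrite ler_wpM2r ?(ltW p0)// mulrAC ler_wpM2r// ler_wpM2l// ler_expR; lra.
Qed.

End exp_density.

Lemma clamp_within {R : realType} (f : R -> R) :
  continuous (fun t => f (clamp (-1) 1 t)) -> {within unit_ball, continuous f}.
Proof.
move=> cf; apply: (@subspace_eq_continuous _ _ _ (fun t => f (clamp (-1) 1 t))).
  by move=> t; rewrite inE => bt; rewrite /= clamp_ball_id.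
exact: continuous_subspaceT.
Qed.

(** * Likelihood ratios of the density model *)

Section density_model.
Context {R : realType} {d e : measure_display} {T : measurableType d} {S : measurableType e}.
Variables (P : probability T R) (X : nat -> T -> R) (Q : probability S R).
Variables (p0 : R -> R) (Y : S -> R -> R).
Hypotheses (hp0 : positive_density p0) (cp0 : {within unit_ball, continuous p0}).
Hypothesis hX : iid_density P p0 X.
Hypothesis mY : measurable_fun setT (fun p : S * R => Y p.1 (clamp (-1) 1 p.2)).
Hypothesis cY : forall s, {within unit_ball, continuous Y s}.
Local Notation clp := (clamp (-1) 1).

(** Relative to the truth a likelihood has expectation 1. Clamping makes the ratio positive on the
    whole line and changes nothing on the sample, which lies in [-1, 1]. *)
Definition density_ratio s x := exp_density (Y s) (clp x) / p0 (clp x).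

Let ballX k w : unit_ball (X k w). Proof. by case: hX. Qed.
Let mX k : measurable_fun setT (X k). Proof. by case: hX => _ /(_ k)[]. Qed.
Let p0_gt0 x : 0 < p0 (clp x). Proof. by apply: hp0.1; exact: clamp_ball. Qed.
Let mball := @measurable_unit_ball R.

Let mp0 : measurable_fun setT (fun x => p0 (clp x)).
Proof. by apply: continuous_measurable_fun; apply: continuous_clamp_comp => //; lra. Qed.

Lemma measurable_exp_density :
  measurable_fun setT (fun p : S * R => exp_density (Y p.1) (clp p.2)).
Proof.
have mE := measurableT_comp (@measurable_expR R) mY.
have mM : measurable_fun setT (fun s => \int[lebesgue_measure]_(u in unit_ball) expR (Y s u)).
  have := @measurable_param_integral R _ S _ _ lebesgue_measure unit_ball
    (fun s u => expR (Y s (clp u))) mball mE.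
  congr measurable_fun; apply/funext => s; apply: eq_Rintegral => u.
  by rewrite inE => bu; rewrite clamp_ball_id.
apply: measurable_funM => //; apply: measurable_funV_ge0.
  by move=> p; apply: Rintegral_ge0 => t _; exact: expR_ge0.
exact: (measurableT_comp mM measurable_fst).
Qed.

Lemma measurable_density_ratio : measurable_fun setT (fun p : S * R => density_ratio p.1 p.2).
Proof.
apply: measurable_funM; first exact: measurable_exp_density.
apply: measurable_funV_ge0; first by move=> p; exact: ltW.
exact: (measurableT_comp mp0 measurable_snd).
Qed.

Lemma density_ratio_gt0 s x : 0 < density_ratio s x.
Proof. by rewrite divr_gt0// exp_density_gt0. Qed.

Lemma density_sample_integral (f : R -> R) : measurable_fun setT f -> (forall x, 0 <= f x) ->
  (\int[P]_w (f (X 0%N w))%:E =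
   \int[lebesgue_measure]_(t in unit_ball) (f t * p0 t)%:E)%E.
Proof.
move=> mf f0.
pose rho' t : R := p0 (clp t) * \1_unit_ball t.
have rho'E (D : set R) : (\int[lebesgue_measure]_(t in D) (rho' t)%:E =
    \int[lebesgue_measure]_(t in D `&` unit_ball) (p0 t)%:E)%E.
  rewrite integral_mkcondr; apply: eq_integral => t _.
  rewrite restrict_EFin patch_indic/= /rho' indicE; congr (_%:E).
  by case: (boolP (t \in unit_ball)) => [/set_mem bt|_]; rewrite ?mulr0// clamp_ball_id.
have m1 : measurable_fun setT rho'.
  by apply: measurable_funM => //; exact: measurable_indic.
have r0 t : 0 <= rho' t by rewrite mulr_ge0// ltW.
have mc : measurable_fun setT (fun _ : T => 1 : R) by exact: measurable_cst.
have h := weighted_integral_eq mf f0 (mu := P) (mu' := lebesgue_measure) (X' := id)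
  (rho := fun=> 1) (mX 0%N) (@measurable_id _ _ setT) mc m1 (fun=> ler01) r0.
transitivity (\int[P]_w (f (X 0%N w) * 1)%:E)%E; first by under [RHS]eq_integral do rewrite mulr1.
rewrite h => [|A mA].
  rewrite [RHS]integral_mkcond; apply: eq_integral => t _.
  rewrite restrict_EFin patch_indic/= /rho' indicE; congr (_%:E).
  case: (boolP (t \in unit_ball)) => [/set_mem bt|_]; last by rewrite !mulr0.
  by rewrite clamp_ball_id// !mulr1.
rewrite rho'E integral_cst; last by rewrite -[_ @^-1` _]setTI; exact: mX.
by rewrite mul1e; case: hX => _ /(_ 0%N)[_ /(_ A mA)] + _; exact.
Qed.

Lemma density_ratio_integral s : (\int[P]_w (density_ratio s (X 0%N w))%:E = 1)%E.
Proof.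
have m1 := measurableT_comp measurable_density_ratio (measurable_pair1 s).
rewrite density_sample_integral => //; last by move=> x; rewrite ltW// density_ratio_gt0.
transitivity (\int[lebesgue_measure]_(t in unit_ball) (exp_density (Y s) t)%:E)%E.
  apply: eq_integral => t /set_mem bt.
  by rewrite /density_ratio clamp_ball_id// divfK// gt_eqF// hp0.1.
have i1 := ball_integrable (expR_within (@cY s)).
have c1 : {within unit_ball, continuous exp_density (Y s)}.
  by move=> t; apply: cvgMl; exact: expR_within.
have i2 := ball_integrable c1.
rewrite -[LHS]fineK; last exact: integrable_fin_num.
congr (_%:E); transitivity (\int[lebesgue_measure]_(t in unit_ball) exp_density (Y s) t) => //.
by rewrite RintegralZr// divff// gt_eqF// exp_mass_gt0.
Qed.

Lemma hell2_hellinger s : hell2 P X density_ratio s = hellinger (exp_density (Y s)) p0 ^+ 2.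
Proof.
have m1 := measurableT_comp measurable_density_ratio (measurable_pair1 s).
have m2 : measurable_fun setT (fun x => (Num.sqrt (density_ratio s x) - 1) ^+ 2).
  apply: measurable_funX; apply: measurable_funB => //.
  exact: (measurableT_comp (continuous_measurable_fun (@sqrt_continuous R)) m1).
rewrite /hellinger sqr_sqrtr; last by apply: Rintegral_ge0 => t _; exact: sqr_ge0.
rewrite /hell2 /Rintegral (density_sample_integral m2) => [|x]; last exact: sqr_ge0.
congr fine; apply: eq_integral => t /set_mem bt; congr (_%:E).
rewrite /density_ratio clamp_ball_id// sqrt_diff//; first exact: hp0.1.
by rewrite ltW// exp_density_gt0.
Qed.

Lemma likelihood_densityE s n w : likelihood_density (exp_density (Y s)) n (X ^~ w) =
  (\prod_(k < n) p0 (X k w)) * lik_prod X density_ratio n s w.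
Proof.
rewrite -big_split/=; apply: eq_bigr => k _.
rewrite /density_ratio clamp_ball_id// mulrC divfK// gt_eqF// hp0.1//; exact: ballX.
Qed.

Lemma posterior_densityE n w A : measurable A ->
  posterior Q (fun s => likelihood_density (exp_density (Y s)) n (X ^~ w)) A =
  posterior Q (fun s => lik_prod X density_ratio n s w) A.
Proof.
move=> mA; under [X in posterior _ X]funext do rewrite likelihood_densityE.
apply: posteriorZ => //.
- by apply: prodr_gt0 => k _; apply: hp0.1; exact: ballX.
- by apply: measurable_lik_prod1 => //; exact: measurable_density_ratio.
- by move=> s; apply: lik_prod_ge0 => s' x; rewrite ltW// density_ratio_gt0.
Qed.

Lemma measurable_hellinger : measurable_fun setT (fun s => hellinger (exp_density (Y s)) p0).
Proof.
apply: (measurableT_comp (continuous_measurable_fun (@sqrt_continuous R))).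
have msqrt := continuous_measurable_fun (@sqrt_continuous R).
have m1 : measurable_fun setT (fun p : S * R =>
    (Num.sqrt (exp_density (Y p.1) (clp p.2)) - Num.sqrt (p0 (clp p.2))) ^+ 2).
  apply: measurable_funX; apply: measurable_funB.
    exact: (measurableT_comp msqrt measurable_exp_density).
  exact: (measurableT_comp msqrt (measurableT_comp mp0 measurable_snd)).
have := @measurable_param_integral R _ S _ _ lebesgue_measure unit_ball
  (fun s t => (Num.sqrt (exp_density (Y s) (clp t)) - Num.sqrt (p0 (clp t))) ^+ 2) mball m1.
congr measurable_fun; apply/funext => s; apply: eq_Rintegral => t.
by rewrite inE => bt; rewrite clamp_ball_id.
Qed.

Lemma density_ratio_close s s' (eta : R) : 0 <= eta <= 1 ->
  (forall t, unit_ball t -> `|Y s t - Y s' t| <= eta) ->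
  forall x, `|density_ratio s x - density_ratio s' x| <= 2 * expR 2 * eta * density_ratio s' x.
Proof.
move=> he h x; rewrite /density_ratio -mulrBl normrM [ `|_^-1|]gtr0_norm ?invr_gt0//.
rewrite mulrA ler_pM2r ?invr_gt0//; apply: exp_density_close => //; exact: clamp_ball.
Qed.

Lemma density_ratio_near s (y : R -> R) (eta : R) : (forall t, unit_ball t -> y t = ln (p0 t)) ->
  0 <= eta <= 1 -> (forall t, unit_ball t -> `|Y s t - y t| <= eta) ->
  forall x, `|density_ratio s x - 1| <= 2 * expR 2 * eta.
Proof.
move=> yE he h x; pose z t := ln (p0 t).
have zp t : unit_ball t -> expR (z t) = p0 t by move=> bt; rewrite lnK// posrE hp0.1.
have cz : {within unit_ball, continuous (fun t => ln (p0 t))}.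
  by apply: within_continuous_post cp0 _ => t bt; apply: continuous_ln; exact: hp0.1.
(* Since [p0] integrates to 1, the normalisation is trivial at ln p0 and [exp_density] returns
   [p0]. *)
have m1 : \int[lebesgue_measure]_(t in unit_ball) expR (z t) = 1.
  transitivity (\int[lebesgue_measure]_(t in unit_ball) p0 t).
    by apply: eq_Rintegral => t /set_mem; exact: zp.
  by rewrite /Rintegral hp0.2.
have bx := clamp_ball x.
have := exp_density_close he (@cY s) cz bx (_ : forall t, unit_ball t -> `|Y s t - z t| <= eta).
have -> : exp_density z (clp x) = p0 (clp x) by rewrite /exp_density m1 divr1 zp.
move=> /(_ _)/le_trans h2.
have -> : density_ratio s x - 1 = (exp_density (Y s) (clp x) - p0 (clp x)) / p0 (clp x).
  by rewrite /density_ratio mulrBl divff// gt_eqF.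
rewrite normrM [ `|_^-1|]gtr0_norm ?invr_gt0//.
rewrite ler_pdivrMr//; apply: h2 => // t bt; rewrite /z -yE//; exact: h.
Qed.

End density_model.

Lemma shrink_factor {R : realType} (rho : R) n : 0 < rho < 1 ->
  exists2 kappa : R, 0 < kappa < 1 & rho < kappa ^+ n.
Proof.
move=> /andP[r0 r1]; pose k : R := rho `^ (n.+1%:R)^-1.
have k0 : 0 < k by exact: powR_gt0.
have kE : k ^+ n.+1 = rho by rewrite -powR_mulrn ?ltW// -powRrM mulVf// powRr1// ltW.
have k1 : k < 1.
  rewrite ltNge; apply/negP => h; have : 1 <= k ^+ n.+1 by rewrite exprn_ege1.
  by rewrite kE leNgt r1.
exists k; first by rewrite k0.
by rewrite -kE exprS gtr_pMl// exprn_gt0.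
Qed.

Section density.
Context {R : realType}.
Variables (H : nat) (N : nat -> nat).
Hypotheses (hH : (2 <= H)%N) (hN : forall h, (2 <= h <= H)%N -> (1 <= N h)%N).
Context {d : measure_display} {T : measurableType d}.
Variables (P : probability T R) (B : nat -> T -> R -> R) (G : nat -> nat -> T -> R).
Hypothesis hZ : ibm_family P H N B G.
Variable beta : R.
Hypotheses (beta_gt0 : 0 < beta) (hbeta1 : beta <= (N 1%N)%:R + 1 / 2).
Hypothesis hbeta : forall h, (2 <= h <= H)%N -> beta <= (N h)%:R.

(* The density is reached through the logarithm: the first layer carries an affine image of p0
   shrunk by kappa into the ball, the middle layers keep shrinking, and the last one is the
   smooth function x -> ln (v + mu x). *)
Lemma log_density_layers (p0 : R -> R) : positive_density p0 -> hoelder_space beta p0 ->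
  exists kappa al b v mu : R, [/\ 0 < kappa < 1, 0 <= mu < v,
    forall t, unit_ball t -> `|al * p0 t + b| <= kappa &
    forall t, v + mu * (kappa ^+ (H - 2) * (al * p0 t + b)) = p0 t].
Proof.
move=> [p0_gt0 _] hp; have cp := hoelder_space_continuous hp.
have ab : -1 <= 1 :> R by lra.
have [c cb hc] := EVT_min ab cp; have [A A0 hA] := ball_continuous_bound cp.
have bc : unit_ball c by [].
pose v := A + 1; pose a := p0 c; pose lam := v - a.
have a0 : 0 < a by exact: p0_gt0.
have aA : a <= A by have := hA c bc; rewrite ger0_norm// ltW.
have v0 : 0 < v by rewrite /v; lra.
have lam0 : 0 < lam by rewrite /lam /v; lra.
have rho01 : 0 < lam / v < 1 by rewrite divr_gt0//= ltr_pdivrMr// mul1r /lam; lra.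
(* After H - 1 shrinkings by [k] the last layer needs the slope mu = lam / k^(H - 1). It must stay
   below [v] for the logarithm to be smooth on [-1, 1], whence the condition lam / v < k^(H - 1). *)
have [k k01 hk] := shrink_factor (H - 1) rho01.
have /andP[k0 k1] := k01.
have kn n : 0 < k ^+ n by rewrite exprn_gt0.
exists k, (k / lam), (- (k * v / lam)), v, (lam / k ^+ (H - 1)); split => //.
- rewrite divr_ge0 ?ltW//= ltr_pdivrMr// mulrC -ltr_pdivrMr//.
- move=> t bt; have h1 := le_trans (ler_norm _) (hA t bt).
  have h2 : a <= p0 t by apply: hc.
  rewrite (_ : _ + _ = - (k * ((v - p0 t) / lam))); last by field; rewrite gt_eqF.
  rewrite normrN normrM gtr0_norm// ler_piMr ?(ltW k0)// ger0_norm; last first.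
    by rewrite divr_ge0 ?(ltW lam0)// /v; lra.
  by rewrite ler_pdivrMr// mul1r /lam; lra.
move=> t; have -> : k ^+ (H - 1) = k ^+ (H - 2) * k by rewrite -exprSr -subSn// subSS.
have := kn (H - 2)%N; move: (k ^+ (H - 2)) => u u0.
by field; rewrite !gt_eqF.
Qed.

Lemma density_contraction (p0 : R -> R) : positive_density p0 -> hoelder_space beta p0 ->
   forall (d' : measure_display) (T' : measurableType d') (P' : probability T' R)
     (X : nat -> T' -> R), iid_density P' p0 X ->
   exists K0 : nat -> R, (forall h, 0 < K0 h) /\
   forall K : nat -> R, (forall h, (2 <= h <= H)%N -> K0 h <= K h) ->
   forall (e : measure_display) (S : measurableType e) (Q : probability S R)
     (Zc : nat -> S -> R -> R), constrained_family H K P (ibm N B G) Q Zc ->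
   exists C : R, 0 < C /\
   forall M : nat -> R, M n @[n --> \oo] --> +oo ->
   let p := fun s : S => exp_density (compose (Zc ^~ s) H) in
   cvg_in_probability P'
     (fun n w => posterior Q
        (fun s => likelihood_density (p s) n (X ^~ w))
        [set s | hellinger (p s) p0 > M n * rate C beta (N 1%N) n])
     0.
Proof.
move=> hp0 hp d' T' P' X hX; have cp0 := hoelder_space_continuous hp.
have [kappa [al [b [v [mu [k01 muv fk hlog]]]]]] := log_density_layers hp0 hp.
have jg := log_jets muv.
have [A A0 hA] := jets_bounded (N H).+1 jg.
(* [A] bounds the derivatives of the last layer; the additional 1 leaves the margin required by the
   small balls and covers the contractions of the middle layers. *)
exists (fun=> A + 1); split => [_|K hK e S Q Zc hZc]; first by rewrite ltr_wpDl.
exists 1; split => // M Moo p.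
have [hreg hball _ _] := hZc.
have mY := measurable_compose (fun h hr => (hreg h hr).1) (fun h hr => (hreg h hr).2) hball (leqnn H).
have cY s : {within unit_ball, continuous compose (Zc ^~ s) H}.
  apply: clamp_within.
  exact: (compose_clamp_continuous (fun h hr => (hreg h hr).2) hball (leqnn H)).
pose r := density_ratio p0 (fun s => compose (Zc ^~ s) H).
have mr : measurable_fun setT (fun q : S * R => r q.1 q.2).
  exact: (measurable_density_ratio hp0 cp0 mY).
have mBad n : measurable [set s | M n * rate 1 beta (N 1%N) n < hellinger (p s) p0].
  by apply: measurable_set_gt; exact: (measurable_hellinger cp0 mY).
have [bX lX iX] := hX.
have lawX k D : measurable D -> P' (X k @^-1` D) = P' (X 0%N @^-1` D).
  by move=> mD; rewrite (lX k).2// (lX 0%N).2.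
have C0 : 0 <= 2 * expR 2 :> R by rewrite mulr_ge0// expR_ge0.
have r_near s (eta : R) : 0 <= eta <= 1 -> (forall t, unit_ball t ->
    `|compose (Zc ^~ s) H t - log_jet v mu 0 (kappa ^+ (H - 2) * (al * p0 t + b))| <= eta) ->
    forall x, `|r s x - 1| <= 2 * expR 2 * eta.
  apply: (density_ratio_near hp0 cp0 cY) => t bt.
  by rewrite /log_jet hlog.
have r_close s s' (eta : R) : 0 <= eta <= 1 -> (forall t, unit_ball t ->
    `|compose (Zc ^~ s) H t - compose (Zc ^~ s') H t| <= eta) ->
    forall x, `|r s x - r s' x| <= 2 * expR 2 * eta * r s' x.
  exact: (density_ratio_close hp0 cY).
have := target_contraction hH hN hZ beta_gt0 hbeta1 hbeta k01 hp fk jg A0 hA hK hZc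
  (fun k => (lX k).1) iX lawX mr (density_ratio_gt0 hp0 cY)
  (density_ratio_integral hp0 cp0 hX mY cY) C0 r_near r_close Moo mBad.
have rate0 n : 0 <= rate 1 beta (N 1%N) n by rewrite /rate mul1r powR_ge0.
rewrite (_ : (fun n w => posterior _ (fun s => lik_prod _ _ _ _ _) _) = (fun n w => posterior Q
    (fun s => likelihood_density (p s) n (X ^~ w))
    [set s | M n * rate 1 beta (N 1%N) n < hellinger (p s) p0])); last first.
  by apply/funext => n; apply/funext => w; rewrite -(posterior_densityE Q hp0 cp0 hX mY cY).
apply=> n s; rewrite /= => Bs Mn.
rewrite (hell2_hellinger hp0 cp0 hX mY cY) ler_sqr ?nnegrE ?mulr_ge0 ?sqrtr_ge0//.
exact: ltW.
Qed.

End density.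

(** * Classification *)


Lemma log_lipschitz {R : realType} (f df : R -> R) (c x y : R) :
  (forall z, 0 < f z) -> (forall z : R, is_derive z 1 f (df z)) ->
  (forall z, `|df z| <= c * f z) -> f x <= expR (c * `|x - y|) * f y.
Proof.
move=> f0 dff hc.
have dl (z : R) : is_derive z 1 (fun u => ln (f u)) ((f z)^-1 * df z).
  by apply: (deriv_compose (f := fun u => ln u)) => //; exact: is_derive1_ln.
have cl (i : interval R) : {within [set` i], continuous (fun u => ln (f u))}.
  by apply: derivable_within_continuous => z _; have [] := dl z.
have key u v : u <= v -> `|ln (f v) - ln (f u)| <= c * `|v - u|.
  move=> uv; have [z _ ->] := @MVT_segment R _ _ u v uv (fun z _ => dl z) (cl `[u, v]).
  rewrite normrM ler_wpM2r// normrM gtr0_norm ?invr_gt0// mulrC ler_pdivrMr//.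
have h : ln (f x) - ln (f y) <= c * `|x - y|.
  have [xy|/ltW yx] := leP x y; last by apply: le_trans (key _ _ yx); exact: ler_norm.
  by rewrite distrC; apply: le_trans (key _ _ xy); rewrite -[leRHS]normrN opprB; exact: ler_norm.
by rewrite -[leLHS]lnK ?posrE// -[X in _ * X]lnK ?posrE// -expRD ler_expR; lra.
Qed.

(** The derivatives of ln Psi and ln (1 - Psi) are Psi' / (Psi (1 - Psi)) times 1 - Psi and -Psi,
    hence bounded: uniform closeness of the latent functions controls the ratios of both label
    probabilities. *)
Lemma link_log_lipschitz {R : realType} (Psi : R -> R) : link_function Psi ->
  exists2 c : R, 0 <= c & forall x y : R, Psi x <= expR (c * `|x - y|) * Psi y /\
    1 - Psi x <= expR (c * `|x - y|) * (1 - Psi y).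
Proof.
move=> [h01 dP _ [c hc]].
have P0 x : 0 < Psi x by have /andP[] := h01 x.
have P1 x : 0 < 1 - Psi x by have /andP[_] := h01 x; rewrite subr_gt0.
have dPsi (x : R) : is_derive x 1 Psi (Psi^`()%classic x).
  by rewrite derive1E; apply: derivableP.
have dN (x : R) : is_derive x 1 (fun u => 1 - Psi u) (- Psi^`()%classic x).
  by have := deriv_sub (deriv_cst 1 x) (dPsi x); rewrite sub0r.
have c0 : 0 <= c by apply: le_trans (hc 0).
have bound x : `|Psi^`()%classic x| <= c * (Psi x * (1 - Psi x)).
  have q0 : 0 < Psi x * (1 - Psi x) by rewrite mulr_gt0.
  by have := hc x; rewrite normrM normfV (gtr0_norm q0) ler_pdivrMr.
exists c => // x y; split.
  apply: log_lipschitz => // z; apply: le_trans (bound z) _.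
  by rewrite ler_wpM2l// ler_piMr ?(ltW (P0 z))//; have := P0 z; lra.
apply: (log_lipschitz (f := fun u => 1 - Psi u) x y P1 dN) => z.
rewrite normrN; apply: le_trans (bound z) _.
by rewrite ler_wpM2l// ler_piMl ?(ltW (P1 z))//; have := P1 z; lra.
Qed.

(** * Likelihood ratios of the classification model *)

Section classification_model.
Context {R : realType} {d e : measure_display} {T : measurableType d} {S : measurableType e}.
Variables (P : probability T R) (Q : probability S R).
Variables (Psi g0 : R -> R) (U : T -> R) (V : T -> bool) (Us : nat -> T -> R) (Vs : nat -> T -> bool).
Variable Y : S -> R -> R.
Hypotheses (hPsi : link_function Psi) (cg0 : {within unit_ball, continuous g0}).
Hypothesis hUV : iid_classif P (Psi \o g0) U V Us Vs.
Hypothesis mY : measurable_fun setT (fun p : S * R => Y p.1 (clamp (-1) 1 p.2)).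
Local Notation clp := (clamp (-1) 1).

Definition classif_fit s u := Psi (Y s (clp u)).
Definition classif_truth u := Psi (g0 (clp u)).
Local Notation fit := classif_fit.
Local Notation truth := classif_truth.

Definition classif_ratio s (x : R * bool) :=
  if x.2 then fit s x.1 / truth x.1 else (1 - fit s x.1) / (1 - truth x.1).

Let X k w := (Us k w, Vs k w).
Let Psi_gt0 x : 0 < Psi x. Proof. by case: hPsi => /(_ x)/andP[]. Qed.
Let Psi_lt1 x : 0 < 1 - Psi x. Proof. by case: hPsi => /(_ x)/andP[]; rewrite subr_gt0. Qed.
Let truth_gt0 u : 0 < truth u. Proof. exact: Psi_gt0. Qed.
Let truth_lt1 u : 0 < 1 - truth u. Proof. exact: Psi_lt1. Qed.
Let fit_gt0 s u : 0 < fit s u. Proof. exact: Psi_gt0. Qed.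
Let fit_lt1 s u : 0 < 1 - fit s u. Proof. exact: Psi_lt1. Qed.
Let ballU w : unit_ball (U w). Proof. by case: hUV => -[]. Qed.
Let ballUs k w : unit_ball (Us k w). Proof. by case: hUV => -[]. Qed.
Let mU : measurable_fun setT U. Proof. by case: hUV => _ []. Qed.
Let mV : measurable_fun setT V. Proof. by case: hUV => _ []. Qed.
Let mX k : measurable_fun setT (X k). Proof. by case: hUV => _ _ _ /(_ k)[]. Qed.

Let mPsi : measurable_fun setT Psi.
Proof.
apply: continuous_measurable_fun => x; apply: differentiable_continuous.
by apply/derivable1_diffP; case: hPsi => _ /(_ x).
Qed.

Let mtruth : measurable_fun setT truth.
Proof.
apply: (measurableT_comp mPsi); apply: continuous_measurable_fun.
by apply: continuous_clamp_comp => //; lra.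
Qed.

Lemma measurable_fit : measurable_fun setT (fun p : S * R => fit p.1 p.2).
Proof. exact: (measurableT_comp mPsi mY). Qed.

Lemma classif_ratio_gt0 s x : 0 < classif_ratio s x.
Proof. by rewrite /classif_ratio; case: ifP => _; rewrite divr_gt0. Qed.

Lemma measurable_classif_ratio : measurable_fun setT (fun p : S * (R * bool) => classif_ratio p.1 p.2).
Proof.
have m1 : measurable_fun setT (fun p : S * (R * bool) => (p.1, p.2.1)).
  apply: measurable_fun_pair; first exact: measurable_fst.
  exact: (measurableT_comp measurable_fst measurable_snd).
have mf := measurableT_comp measurable_fit m1.
have mt : measurable_fun setT (fun p : S * (R * bool) => truth p.2.1).
  exact: (measurableT_comp mtruth (measurableT_comp measurable_fst measurable_snd)).
apply: measurable_fun_ifT.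
- exact: (measurableT_comp measurable_snd measurable_snd).
- apply: measurable_funM => //; apply: measurable_funV_ge0 => //.
  by move=> p; exact: ltW.
- apply: measurable_funM; first by apply: measurable_funB => //; exact: measurable_cst.
  apply: measurable_funV_ge0; first by move=> p; exact: ltW.
  by apply: measurable_funB => //; exact: measurable_cst.
Qed.

Let VP A : measurable A ->
  P (U @^-1` A `&` [set w | V w]) = (\int[P]_(w in U @^-1` A) (truth (U w))%:E)%E.
Proof.
move=> mA; case: hUV => _ _ /(_ A mA) -> _ _; apply: eq_integral => w _.
by rewrite /truth clamp_ball_id.
Qed.

Let mVset : measurable [set w | V w].
Proof. by have := mV measurableT (_ : measurable [set true]) => /(_ I); rewrite setTI. Qed.

Let mUinv A : measurable A -> measurable (U @^-1` A).
Proof. by move=> mA; rewrite -[X in measurable X]setTI; exact: mU. Qed.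

(** The model specifies the label true; the other label follows by complement. *)
Let label_prob (b : bool) A : measurable A ->
  (\int[P]_(w in U @^-1` A) (\1_[set w | V w == b] w)%:E =
   \int[P]_(w in U @^-1` A) (if b then truth (U w) else 1 - truth (U w))%:E)%E.
Proof.
move=> mA; have mUA := mUinv mA.
have mW : measurable (~` [set w | V w]) by exact: measurableC.
have ind D : measurable D -> (\int[P]_(w in U @^-1` A) (\1_D w)%:E = P (U @^-1` A `&` D))%E.
  by move=> mD; rewrite integral_indic// setIC.
case: b; last first.
  rewrite (_ : [set w | V w == false] = ~` [set w | V w]); last first.
    by apply/seteqP; split => w /=; case: (V w).
  rewrite ind//.
  have mtU : measurable_fun (U @^-1` A) (fun w => truth (U w)).
    by apply: measurable_funTS; exact: (measurableT_comp mtruth mU).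
  have e1 : (\int[P]_(w in U @^-1` A) (1 - truth (U w))%:E + P (U @^-1` A `&` [set w | V w]) =
      P (U @^-1` A))%E.
    rewrite VP// -ge0_integralD//.
    - under eq_integral do rewrite -EFinD subrK.
      by rewrite integral_cst// mul1e.
    - by move=> w _; rewrite lee_fin ltW.
    - by apply/measurable_EFinP; apply: measurable_funB => //; exact: measurable_cst.
    - by move=> w _; rewrite lee_fin ltW.
    - by apply/measurable_EFinP.
  have e2 : (P (U @^-1` A `&` ~` [set w | V w]) + P (U @^-1` A `&` [set w | V w]) = P (U @^-1` A))%E.
    rewrite -measureU; try exact: measurableI.
      by rewrite -setIUr setUC setUv setIT.
    by rewrite setIACA setIC [X in X `&` _]setIC setICr set0I.
  have fin : P (U @^-1` A `&` [set w | V w]) \is a fin_num.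
    by apply: fin_num_measure; exact: measurableI.
  by rewrite -[LHS](addeK _ fin) e2 -e1 addeK.
rewrite (_ : [set w | V w == true] = [set w | V w]); last first.
  by apply/seteqP; split => w /=; rewrite eqb_id.
by rewrite ind// VP.
Qed.

(** Conditioning on [U] replaces the label by its conditional law. *)
Lemma classif_sample_integral (h : R * bool -> R) : measurable_fun setT h -> (forall x, 0 <= h x) ->
  (\int[P]_w (h (X 0%N w))%:E = \int[P]_w (h (U w, true) * truth (U w) +
    h (U w, false) * (1 - truth (U w)))%:E)%E.
Proof.
move=> mh h0.
have mc : measurable_fun setT (fun _ : T => 1 : R) by exact: measurable_cst.
have mUV : measurable_fun setT (fun w => (U w, V w)) by exact: measurable_fun_pair.
have e1 : (\int[P]_w (h (X 0%N w))%:E = \int[P]_w (h (U w, V w))%:E)%E.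
  transitivity (\int[P]_w (h (X 0%N w) * 1)%:E)%E; first by under [RHS]eq_integral do rewrite mulr1.
  transitivity (\int[P]_w (h (U w, V w) * 1)%:E)%E; last by under eq_integral do rewrite mulr1.
  apply: weighted_integral_eq => // A mA.
  rewrite !integral_cst ?mul1e; last 2 first.
  - by rewrite -[_ @^-1` _]setTI; exact: mUV.
  - by rewrite -[_ @^-1` _]setTI; exact: mX.
  by case: hUV => _ _ _ /(_ 0%N)[_ /(_ A mA)] + _; exact.
have mhb b : measurable_fun setT (fun u => h (u, b)).
  by apply: (measurableT_comp mh); exact: measurable_fun_pair.
have mVb b : measurable [set w | V w == b].
  by have := mV measurableT (_ : measurable [set b]) => /(_ I); rewrite setTI;
    congr measurable; apply/seteqP; split => w /=; [move=> ->|move=> /eqP].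
have mtU := measurableT_comp mtruth mU.
have mt b : measurable_fun setT (fun w => if b then truth (U w) else 1 - truth (U w)).
  by case: b => //; apply: measurable_funB => //.
have t0 b w : 0 <= (if b then truth (U w) else 1 - truth (U w)) by case: b; exact: ltW.
have e2 b : (\int[P]_w (h (U w, b) * \1_[set w | V w == b] w)%:E =
    \int[P]_w (h (U w, b) * (if b then truth (U w) else 1 - truth (U w)))%:E)%E.
  have mi : measurable_fun setT (\1_[set w | V w == b] : T -> R) by exact: measurable_indic.
  have i0 w : 0 <= \1_[set w | V w == b] w :> R by rewrite indicE.
  exact: (weighted_integral_eq (mhb b) _ mU mU mi (mt b) i0 (t0 b) (@label_prob b)).
have mp b (r : T -> R) : measurable_fun setT r -> measurable_fun setT (fun w => (h (U w, b) * r w)%:E : \bar R).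
  by move=> mr; apply/measurable_EFinP; apply: measurable_funM => //; exact: (measurableT_comp (mhb b) mU).
rewrite e1; under [RHS]eq_integral do rewrite EFinD.
rewrite ge0_integralD//; last 4 first.
- by move=> w _; rewrite lee_fin mulr_ge0// ltW.
- exact: (mp true _ (mt true)).
- by move=> w _; rewrite lee_fin mulr_ge0// ltW.
- exact: (mp false _ (mt false)).
rewrite -(e2 true) -(e2 false) -ge0_integralD//; last 4 first.
- by move=> w _; rewrite lee_fin mulr_ge0.
- by apply: mp; exact: measurable_indic.
- by move=> w _; rewrite lee_fin mulr_ge0.
- by apply: mp; exact: measurable_indic.
apply: eq_integral => w _; rewrite -EFinD; congr (_%:E); rewrite !indicE.
have iE b : (w \in [set w | V w == b]) = (V w == b).
  by apply/idP/idP => [/set_mem//|hb]; apply/mem_set.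
by rewrite !iE; case: (V w); rewrite /= mulr1 mulr0 ?addr0 ?add0r.
Qed.

Lemma classif_ratio_integral s : (\int[P]_w (classif_ratio s (X 0%N w))%:E = 1)%E.
Proof.
have m1 := measurableT_comp measurable_classif_ratio (measurable_pair1 s).
rewrite classif_sample_integral => //; last by move=> x; rewrite ltW// classif_ratio_gt0.
transitivity (\int[P]_w 1%:E)%E.
  apply: eq_integral => w _; rewrite /classif_ratio/= !divfK ?gt_eqF//.
  by rewrite addrC subrK.
by rewrite integral_cst// mul1e; exact: (@probability_setT _ _ _ P).
Qed.

Let fitU s : measurable_fun setT (fun w => fit s (U w)).
Proof. exact: (measurableT_comp (measurableT_comp measurable_fit (measurable_pair1 s)) mU). Qed.

Let bounded_integrable (f : T -> R) (c : R) : measurable_fun setT f -> (forall w, `|f w| <= c) ->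
  P.-integrable setT (EFin \o f).
Proof.
move=> mf fc; have c0 : 0 <= c by apply: le_trans (fc point).
apply: (@le_integrable _ _ _ P setT _ _ (EFin \o (fun _ : T => c))) => //.
- by apply/measurable_EFinP.
- by move=> w _ /=; rewrite lee_fin (ger0_norm c0).
- exact: finite_measure_integrable_cst.
Qed.

(** From (x^2 - y^2)^2 = (x - y)^2 (x + y)^2 <= 4 (x - y)^2, where x and y are the square roots of
    the two probabilities of the label true. *)
Lemma norm2_hell2 s : norm2 P U (fun u => Psi (Y s u) - (Psi \o g0) u) ^+ 2 <=
  4 * hell2 P X classif_ratio s.
Proof.
have msqrt := continuous_measurable_fun (@sqrt_continuous R).
have m1 := measurableT_comp measurable_classif_ratio (measurable_pair1 s).
have m2 : measurable_fun setT (fun x => (Num.sqrt (classif_ratio s x) - 1) ^+ 2).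
  by apply: measurable_funX; apply: measurable_funB => //; exact: (measurableT_comp msqrt m1).
have mtU := measurableT_comp mtruth mU.
have mfU := fitU s.
have mfU' : measurable_fun setT (fun w => 1 - fit s (U w)).
  by apply: measurable_funB => //; exact: measurable_cst.
have mtU' : measurable_fun setT (fun w => 1 - truth (U w)).
  by apply: measurable_funB => //; exact: measurable_cst.
pose b w := (Num.sqrt (fit s (U w)) - Num.sqrt (truth (U w))) ^+ 2 +
  (Num.sqrt (1 - fit s (U w)) - Num.sqrt (1 - truth (U w))) ^+ 2.
have sq01 (x : R) : 0 < x -> 0 < 1 - x -> 0 <= Num.sqrt x <= 1.
  by move=> x0 x1; rewrite sqrtr_ge0 -[leRHS]sqrtr1 ler_sqrt//; lra.
have dsq (x y : R) : 0 <= x <= 1 -> 0 <= y <= 1 -> 0 <= (x - y) ^+ 2 <= 1.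
  move=> /andP[x0 x1] /andP[y0 y1]; rewrite sqr_ge0/= -subr_ge0.
  rewrite (_ : 1 - _ = (1 - (x - y)) * (1 + (x - y))); last by ring.
  by apply: mulr_ge0; lra.
have mb : measurable_fun setT b.
  by apply: measurable_funD; apply: measurable_funX; apply: measurable_funB;
    exact: (measurableT_comp msqrt).
have bb w : 0 <= b w <= 2.
  have /andP[h1 h2] := dsq _ _ (sq01 _ (fit_gt0 s (U w)) (fit_lt1 s (U w)))
    (sq01 _ (truth_gt0 (U w)) (truth_lt1 (U w))).
  have f1 : 0 < 1 - (1 - fit s (U w)) by have := fit_gt0 s (U w); lra.
  have t1 : 0 < 1 - (1 - truth (U w)) by have := truth_gt0 (U w); lra.
  have /andP[h3 h4] := dsq _ _ (sq01 _ (fit_lt1 s (U w)) f1) (sq01 _ (truth_lt1 (U w)) t1).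
  by rewrite /b; apply/andP; split; lra.
have ib : P.-integrable setT (EFin \o b).
  by apply: (bounded_integrable (c := 2)) => // w; have /andP[b0 b2] := bb w; rewrite ger0_norm.
have hE : hell2 P X classif_ratio s = \int[P]_w b w.
  rewrite /hell2 /Rintegral (classif_sample_integral m2) => [|x]; last exact: sqr_ge0.
  congr fine; apply: eq_integral => w _; congr (_%:E).
  by rewrite /classif_ratio/= !sqrt_diff// ltW.
rewrite /norm2 sqr_sqrtr; last by apply: Rintegral_ge0 => w _; exact: sqr_ge0.
have aE w : (Psi (Y s (U w)) - (Psi \o g0) (U w)) ^+ 2 = (fit s (U w) - truth (U w)) ^+ 2.
  by rewrite /fit /truth /classif_fit /classif_truth clamp_ball_id.
under eq_Rintegral do rewrite aE.
rewrite hE -RintegralZl//; apply: le_Rintegral => //.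
- apply: (bounded_integrable (c := 1)).
    by apply: measurable_funX; apply: measurable_funB.
  move=> w; rewrite ger0_norm ?sqr_ge0//.
  have := fit_gt0 s (U w); have := fit_lt1 s (U w); have := truth_gt0 (U w); have := truth_lt1 (U w).
  by move: (classif_fit _ _) (classif_truth _) => x y *; nra.
- exact: (integrableZl measurableT 4 ib).
move=> w _; rewrite /b.
have := sq01 _ (fit_gt0 s (U w)) (fit_lt1 s (U w)).
have := sq01 _ (truth_gt0 (U w)) (truth_lt1 (U w)).
have := sqr_sqrtr (ltW (fit_gt0 s (U w))); have := sqr_sqrtr (ltW (truth_gt0 (U w))).
have := sqr_ge0 (Num.sqrt (1 - fit s (U w)) - Num.sqrt (1 - truth (U w))).
move: ((Num.sqrt (1 - _) - _) ^+ 2) => z z0.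
move: (Num.sqrt (classif_fit _ _)) (Num.sqrt (classif_truth _)) => x y yE xE hy hx.
rewrite -xE -yE subr_sqr exprMn [leRHS]mulrC.
apply: (@le_trans _ _ ((x - y) ^+ 2 * 4)); last by rewrite ler_pM2r//; lra.
rewrite ler_wpM2l ?sqr_ge0//; nra.
Qed.

Lemma likelihood_classifE s n w :
  likelihood_classif (Psi \o Y s) n (Us ^~ w) (Vs ^~ w) =
  (\prod_(k < n) (if Vs k w then truth (Us k w) else 1 - truth (Us k w))) *
    lik_prod X classif_ratio n s w.
Proof.
rewrite -big_split/=; apply: eq_bigr => k _.
rewrite /classif_ratio/= /fit /classif_fit clamp_ball_id; last exact: ballUs.
have tn : truth (Us k w) != 0 by rewrite gt_eqF.
have tn' : 1 - truth (Us k w) != 0 by rewrite gt_eqF.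
by case: (Vs k w); rewrite /= ?expr1 ?expr0 ?mul1r ?mulr1 mulrC divfK.
Qed.

Lemma posterior_classifE n w A : measurable A ->
  posterior Q (fun s => likelihood_classif (Psi \o Y s) n (Us ^~ w) (Vs ^~ w)) A =
  posterior Q (fun s => lik_prod X classif_ratio n s w) A.
Proof.
move=> mA; under [X in posterior _ X]funext do rewrite likelihood_classifE.
apply: posteriorZ => //.
- by apply: prodr_gt0 => k _; case: ifP.
- by apply: measurable_lik_prod1 => //; exact: measurable_classif_ratio.
- by move=> s; apply: lik_prod_ge0 => s' x; rewrite ltW// classif_ratio_gt0.
Qed.

Lemma measurable_norm2 :
  measurable_fun setT (fun s => norm2 P U (fun u => Psi (Y s u) - (Psi \o g0) u)).
Proof.
apply: (measurableT_comp (continuous_measurable_fun (@sqrt_continuous R))).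
have m1 : measurable_fun setT (fun p : S * T => (p.1, U p.2)).
  apply: measurable_fun_pair; first exact: measurable_fst.
  exact: (measurableT_comp mU measurable_snd).
have m2 : measurable_fun setT (fun p : S * T => (fit p.1 (U p.2) - truth (U p.2)) ^+ 2).
  apply: measurable_funX; apply: measurable_funB; first exact: (measurableT_comp measurable_fit m1).
  exact: (measurableT_comp (measurableT_comp mtruth mU) measurable_snd).
have := @measurable_param_integral R _ S _ _ P setT
  (fun s w => (fit s (U w) - truth (U w)) ^+ 2) measurableT m2.
congr measurable_fun; apply/funext => s; apply: eq_Rintegral => w _.
by rewrite /classif_fit /classif_truth clamp_ball_id.
Qed.

Variable c : R.
Hypothesis c0 : 0 <= c.
Hypothesis hc : forall x y : R, Psi x <= expR (c * `|x - y|) * Psi y /\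
    1 - Psi x <= expR (c * `|x - y|) * (1 - Psi y).

Let Psi_close (x y eta : R) : 0 <= eta <= 1 -> `|x - y| <= eta ->
  `|Psi x - Psi y| <= c * expR c * eta * Psi y /\
  `|(1 - Psi x) - (1 - Psi y)| <= c * expR c * eta * (1 - Psi y).
Proof.
move=> /andP[e0 e1] xy; have [h1 h2] := hc x y; have := hc y x; rewrite distrC => -[h3 h4].
have q0 : 0 <= c * `|x - y| by rewrite mulr_ge0.
have ce : c * `|x - y| * expR (c * `|x - y|) <= c * expR c * eta.
  rewrite -mulrA -[leRHS]mulrA [expR c * eta]mulrC ler_wpM2l//.
  apply: ler_pM; rewrite ?expR_ge0//.
  by rewrite ler_expR ler_piMr//; exact: le_trans e1.
split.
  apply: le_trans (exp_ratio_bound (Psi_gt0 y) q0 h1 h3) _.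
  by rewrite ler_pM2r.
apply: le_trans (exp_ratio_bound (Psi_lt1 y) q0 h2 h4) _.
by rewrite ler_pM2r.
Qed.

Lemma classif_ratio_close s s' (eta : R) : 0 <= eta <= 1 ->
  (forall t, unit_ball t -> `|Y s t - Y s' t| <= eta) ->
  forall x, `|classif_ratio s x - classif_ratio s' x| <= c * expR c * eta * classif_ratio s' x.
Proof.
move=> he h [u v]; have [h1 h2] := Psi_close he (h _ (clamp_ball u)).
rewrite /classif_ratio/=; case: v; rewrite -mulrBl normrM mulrA.
  by rewrite [ `|_^-1|]gtr0_norm ?invr_gt0// ler_pM2r ?invr_gt0.
by rewrite [ `|_^-1|]gtr0_norm ?invr_gt0// ler_pM2r ?invr_gt0.
Qed.

Lemma classif_ratio_near s (eta : R) : 0 <= eta <= 1 ->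
  (forall t, unit_ball t -> `|Y s t - g0 t| <= eta) ->
  forall x, `|classif_ratio s x - 1| <= c * expR c * eta.
Proof.
move=> he h [u v]; have [h1 h2] := Psi_close he (h _ (clamp_ball u)).
have sub1 (p q : R) : 0 < q -> p / q - 1 = (p - q) / q by move=> q0; rewrite mulrBl divff ?gt_eqF.
rewrite /classif_ratio/=; case: v; rewrite sub1// normrM [ `|_^-1|]gtr0_norm ?invr_gt0//.
  by rewrite ler_pdivrMr.
by rewrite ler_pdivrMr.
Qed.

End classification_model.

Section classification.
Context {R : realType}.
Variables (H : nat) (N : nat -> nat).
Hypotheses (hH : (2 <= H)%N) (hN : forall h, (2 <= h <= H)%N -> (1 <= N h)%N).
Context {d : measure_display} {T : measurableType d}.
Variables (P : probability T R) (B : nat -> T -> R -> R) (G : nat -> nat -> T -> R).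
Hypothesis hZ : ibm_family P H N B G.
Variable beta : R.
Hypotheses (beta_gt0 : 0 < beta) (hbeta1 : beta <= (N 1%N)%:R + 1 / 2).
Hypothesis hbeta : forall h, (2 <= h <= H)%N -> beta <= (N h)%:R.

Lemma classification_contraction (Psi g0 : R -> R) : link_function Psi -> hoelder_space beta g0 ->
   let f0 := Psi \o g0 in
   forall (d' : measure_display) (T' : measurableType d') (P' : probability T' R)
     (U : T' -> R) (V : T' -> bool) (Us : nat -> T' -> R) (Vs : nat -> T' -> bool),
   iid_classif P' f0 U V Us Vs ->
   exists K0 : nat -> R, (forall h, 0 < K0 h) /\
   forall K : nat -> R, (forall h, (2 <= h <= H)%N -> K0 h <= K h) ->
   forall (e : measure_display) (S : measurableType e) (Q : probability S R)
     (Zc : nat -> S -> R -> R), constrained_family H K P (ibm N B G) Q Zc ->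
   exists C : R, 0 < C /\
   forall M : nat -> R, M n @[n --> \oo] --> +oo ->
   let f := fun s : S => Psi \o compose (Zc ^~ s) H in
   cvg_in_probability P'
     (fun n w => posterior Q
        (fun s => likelihood_classif (f s) n (Us ^~ w) (Vs ^~ w))
        [set s | norm2 P' U (fun u => f s u - f0 u) > M n * rate C beta (N 1%N) n])
     0.
Proof.
move=> hPsi hg f0 d' T' P' U V Us Vs hUV; have cg0 := hoelder_space_continuous hg.
have [c c0 hc] := link_log_lipschitz hPsi.
have [A1 A10 hA1] := ball_continuous_bound cg0.
(* The first layer is a multiple of [g0] fitting into the ball; no logarithm intervenes, and the
   last layer is linear and undoes the scalings. *)
pose kappa : R := 1 / 2; pose al : R := kappa / (A1 + 1).
have k0 : 0 < kappa by rewrite divr_gt0.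
have k01 : 0 < kappa < 1 by rewrite k0 /kappa; lra.
have al0 : 0 < al by rewrite divr_gt0// ltr_wpDl.
have fk t : unit_ball t -> `|al * g0 t + 0| <= kappa.
  move=> bt; rewrite addr0 normrM gtr0_norm// /al mulrAC ler_pdivrMr ?ltr_wpDl//.
  by rewrite ler_wpM2l ?(ltW k0)//; have := hA1 t bt; lra.
pose gam := affine_jet (kappa ^+ (H - 2) * al)^-1 0.
have jg : jets gam by exact: affine_jets.
have gamE t : gam 0%N (kappa ^+ (H - 2) * (al * g0 t + 0)) = g0 t.
  by rewrite /gam /affine_jet/= !addr0 [kappa ^+ _ * (_ * _)]mulrA mulKf// gt_eqF// mulr_gt0// exprn_gt0.
have [A A0 hA] := jets_bounded (N H).+1 jg.
exists (fun=> A + 1); split => [_|K hK e S Q Zc hZc]; first by rewrite ltr_wpDl.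
(* The factor 2 is the square root of the 4 in [norm2_hell2]. *)
exists 2; split => // M Moo f.
have [hreg hball _ _] := hZc.
pose Y s := compose (Zc ^~ s) H.
have mY : measurable_fun setT (fun q : S * R => Y q.1 (clamp (-1) 1 q.2)).
  exact: (measurable_compose (fun h hr => (hreg h hr).1) (fun h hr => (hreg h hr).2) hball (leqnn H)).
have mr := measurable_classif_ratio hPsi cg0 mY.
have mBad n : measurable [set s | M n * rate 2 beta (N 1%N) n < norm2 P' U (fun u => f s u - f0 u)].
  by apply: measurable_set_gt; exact: (measurable_norm2 hPsi cg0 hUV mY).
have [_ _ _ lX iX] := hUV.
pose X k w := (Us k w, Vs k w).
have lawX k D : measurable D -> P' (X k @^-1` D) = P' (X 0%N @^-1` D).
  by move=> mD; rewrite (lX k).2// (lX 0%N).2.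
have C0 : 0 <= c * expR c by rewrite mulr_ge0// expR_ge0.
have r_near s (eta : R) : 0 <= eta <= 1 -> (forall t, unit_ball t ->
    `|Y s t - gam 0%N (kappa ^+ (H - 2) * (al * g0 t + 0))| <= eta) ->
    forall x, `|classif_ratio Psi g0 Y s x - 1| <= c * expR c * eta.
  move=> he h; apply: (classif_ratio_near hPsi c0 hc he) => t bt.
  by have := h t bt; rewrite gamE.
have := target_contraction hH hN hZ beta_gt0 hbeta1 hbeta k01 hg fk jg A0 hA hK hZc
  (fun k => (lX k).1) iX lawX mr (classif_ratio_gt0 g0 Y hPsi)
  (classif_ratio_integral hPsi cg0 hUV mY) C0 r_near
  (classif_ratio_close g0 hPsi c0 hc) Moo mBad.
have rate0 n : 0 <= rate 1 beta (N 1%N) n by rewrite /rate mul1r powR_ge0.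
have rate2 n : rate 2 beta (N 1%N) n = 2 * rate 1 beta (N 1%N) n by rewrite /rate mul1r.
rewrite (_ : (fun n w => posterior _ (fun s => lik_prod _ _ _ _ _) _) = (fun n w => posterior Q
    (fun s => likelihood_classif (f s) n (Us ^~ w) (Vs ^~ w))
    [set s | M n * rate 2 beta (N 1%N) n < norm2 P' U (fun u => f s u - f0 u)])); last first.
  by apply/funext => n; apply/funext => w; rewrite -(posterior_classifE Q hPsi cg0 hUV mY).
apply=> n s; rewrite /= => Bs Mn.
have key := norm2_hell2 hPsi cg0 hUV mY s.
rewrite -(@ler_pM2l _ 4)//; apply: le_trans key.
rewrite rate2 mulrCA in Bs.
have q0 : 0 <= M n * rate 1 beta (N 1%N) n by rewrite mulr_ge0.
have -> : 4 * (M n * rate 1 beta (N 1%N) n) ^+ 2 = (2 * (M n * rate 1 beta (N 1%N) n)) ^+ 2 by ring.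
by rewrite ler_sqr ?nnegrE ?sqrtr_ge0 ?(mulr_ge0 _ q0)// ltW.
Qed.

End classification.

Theorem theorem4p1 (R : realType) (H : nat) (hH : (2 <= H)%N)
    (N : nat -> nat) (hN : forall h, (2 <= h <= H)%N -> (1 <= N h)%N)
    (d : measure_display) (T : measurableType d) (P : probability T R)
    (B : nat -> T -> R -> R) (G : nat -> nat -> T -> R)
    (hZ : ibm_family P H N B G)
    (beta : R) (beta_gt0 : 0 < beta) (hbeta1 : beta <= (N 1%N)%:R + 1 / 2)
    (hbeta : forall h, (2 <= h <= H)%N -> beta <= (N h)%:R) :
  (forall p0 : R -> R, positive_density p0 -> hoelder_space beta p0 ->
   forall (d' : measure_display) (T' : measurableType d') (P' : probability T' R)
     (X : nat -> T' -> R), iid_density P' p0 X ->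
   exists K0 : nat -> R, (forall h, 0 < K0 h) /\
   forall K : nat -> R, (forall h, (2 <= h <= H)%N -> K0 h <= K h) ->
   forall (e : measure_display) (S : measurableType e) (Q : probability S R)
     (Zc : nat -> S -> R -> R), constrained_family H K P (ibm N B G) Q Zc ->
   exists C : R, 0 < C /\
   forall M : nat -> R, M n @[n --> \oo] --> +oo ->
   let p := fun s : S => exp_density (compose (Zc ^~ s) H) in
   cvg_in_probability P'
     (fun n w => posterior Q
        (fun s => likelihood_density (p s) n (X ^~ w))
        [set s | hellinger (p s) p0 > M n * rate C beta (N 1%N) n])
     0) /\
  (forall (Psi g0 : R -> R), link_function Psi -> hoelder_space beta g0 ->
   let f0 := Psi \o g0 in
   forall (d' : measure_display) (T' : measurableType d') (P' : probability T' R)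
     (U : T' -> R) (V : T' -> bool) (Us : nat -> T' -> R) (Vs : nat -> T' -> bool),
   iid_classif P' f0 U V Us Vs ->
   exists K0 : nat -> R, (forall h, 0 < K0 h) /\
   forall K : nat -> R, (forall h, (2 <= h <= H)%N -> K0 h <= K h) ->
   forall (e : measure_display) (S : measurableType e) (Q : probability S R)
     (Zc : nat -> S -> R -> R), constrained_family H K P (ibm N B G) Q Zc ->
   exists C : R, 0 < C /\
   forall M : nat -> R, M n @[n --> \oo] --> +oo ->
   let f := fun s : S => Psi \o compose (Zc ^~ s) H in
   cvg_in_probability P'
     (fun n w => posterior Q
        (fun s => likelihood_classif (f s) n (Us ^~ w) (Vs ^~ w))
        [set s | norm2 P' U (fun u => f s u - f0 u) > M n * rate C beta (N 1%N) n])
     0).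
Proof.
split=> [p0 hp0 hp d' T' P' X hX|Psi g0 hPsi hg f0 d' T' P' U V Us Vs hUV].
  exact: (density_contraction hH hN hZ beta_gt0 hbeta1 hbeta hp0 hp hX).
exact: (classification_contraction hH hN hZ beta_gt0 hbeta1 hbeta hPsi hg hUV).
Qed.
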